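(* For $M>0$ let $\widetilde{\mathbb C}_M=\{z\in\widetilde{\mathbb C^*}:|z|>M\}$. Consider the differential equation $$\frac{d\psi(z)}{dz}=\left(-A\,p(z;\omega)+R(z;\omega)\right)\psi,$$ where: - $A\in\mathfrak{gl}(n,\mathbb C)$ is a constant diagonalisable matrix with eigenvectors $\psi_j$ (forming a basis) and corresponding eigenvalues $\nu_j$, $j=1,\dots,n$, not necessarily pairwise distinct; - $p(z;\omega)=z^{\beta_0}+\sum_{k=1}^Hc_k(\omega)z^{\beta_k}$, where the exponents are real with $\beta_0>\beta_1>\dots>\beta_H=-1$, and the $c_k(\omega)$ are bounded analytic functions of the parameter $\omega$, which belongs to a domain $\Omega\subset\mathbb C$; define $$P(z;\omega):=\frac{z^{\beta_0+1}}{\beta_0+1}+\sum_{k=1}^{H-1}c_k(\omega)\frac{z^{\beta_k+1}}{\beta_k+1}+c_H(\omega)\ln z;$$ - $R\in\mathscr O(\widetilde{\mathbb C}_M\times\Omega;\mathfrak{gl}(n,\mathbb C))$ with $|R(z;\omega)|=O(z^{-1-\delta})$ at infinity for some $\delta>0$, uniformly with respect to $\omega\in\Omega$, in any arbitrary closed sector of $\widetilde{\mathbb C}_M$. (1) Assume that for an interval $[a,b]$ the following holds: for all $\tau\in[a,b]$, $\operatorname{Re}\big((\nu_j-\nu_{j'})e^{\sqrt{-1}\tau}\big)=0$ if and only if $\nu_j=\nu_{j'}$. Then there exists a unique basis of solutions $\psi_j(z;\omega)$, $j=1,\dots,n$, analytic in $\widetilde{\mathbb C}_M\times\Omega$, with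 the asymptotic behaviour $$\psi_j(z;\omega)=\left(\psi_j+O(z^{-\delta})\right)e^{-\nu_jP(z;\omega)}\quad\text{when }z\to\infty\text{ in the sector }\frac{a}{\beta_0+1}\le\arg z\le\frac{b+\pi}{\beta_0+1},$$ uniformly with respect to $\omega\in\Omega$. (2) Assume that $j_0$ is a subdominant index for an interval $[a,b]$, namely $\operatorname{Re}\big((\nu_{j_0}-\nu_j)e^{\sqrt{-1}\tau}\big)>0$ for all $\tau\in[a,b]$ and all $j\ne j_0$. Then there exists a unique solution $\Psi(z;\omega)$ such that $$\Psi(z;\omega)=\left(\psi_{j_0}+O(z^{-\delta})\right)e^{-\nu_{j_0}P(z;\omega)}\quad\text{as }z\to\infty\text{ in the sector }\frac{a-\pi}{\beta_0+1}\le\arg z\le\frac{b+\pi}{\beta_0+1},$$ uniformly with respect to $\omega\in\Omega$. Moreover, $\Psi(\cdot,\cdot)$ is analytic in $\widetilde{\mathbb C}_M\times\Omega$.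
   Context: $\widetilde{\mathbb C^*}$ is the universal cover of $\mathbb C^*=\mathbb C\setminus\{0\}$; its points have modulus $|z|>0$ and argument $\arg z\in\mathbb R$; $z^s=|z|^se^{\sqrt{-1}s\arg z}$ and $\ln z=\ln|z|+\sqrt{-1}\arg z$. $\mathscr O(D;V)$ is the space of $V$-valued holomorphic functions on $D$. $\mathfrak{gl}(n,\mathbb C)$ carries an arbitrary norm. A closed sector is a set of the form $\{\theta_1\le\arg z\le\theta_2\}$ with $\theta_1\le\theta_2$ real. *)

(* Defs.v *)
From HB Require Import structures.
From mathcomp Require Export all_boot all_order all_algebra.
From mathcomp Require Export all_classical all_reals all_analysis.
From mathcomp Require Export complex.

Set Implicit Arguments.
Unset Strict Implicit.
Unset Printing Implicit Defensive.

Export Order.TTheory GRing.Theory Num.Theory.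
Export numFieldNormedType.Exports.

Local Open Scope classical_set_scope.
Local Open Scope ring_scope.
Local Open Scope complex_scope.

(* R[i] packed as a numClosedFieldType: MathComp-Analysis puts the topology of
   the norm on such types, but not on R[i] itself. *)
Definition C (R : realType) : numClosedFieldType := R[i].

Section Complex.
Variable R : realType.

(* exp (i t) *)
Definition expi (t : R) : C R := cos t +i* sin t.

Definition cexp (w : C R) : C R :=
  (expR (complex.Re w))%:C * expi (complex.Im w).

(* In MathComp-Analysis the norm of a complex normed module takes its values in
   the complex numbers; this is the same norm, as a real number. *)
Definition rnorm (V : normedModType (C R)) (v : V) : R := complex.Re `|v|.

Definition is_norm (n : nat) (nrm : 'M[C R]_n -> R) : Prop :=
  [/\ forall A B, nrm (A + B) <= nrm A + nrm B,
      forall (k : C R) A, nrm (k *: A) = rnorm k * nrm A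
    & forall A, nrm A = 0 -> A = 0].

Definition is_domain (U : set (C R)) : Prop :=
  [/\ U !=set0, open U & connected U].

End Complex.

Section UniversalCover.
Variable R : realType.

(* The universal cover of C^*, in polar coordinates. *)
Record ucover := UCover {
  umod : R;
  uarg : R;
  umod_gt0 : 0 < umod
}.

Definition uln (z : ucover) : C R := ln (umod z) +i* uarg z.

Definition uexp (w : C R) : ucover :=
  UCover (complex.Im w) (expR_gt0 (complex.Re w)).

(* The covering map onto C^*. *)
Definition uproj (z : ucover) : C R := (umod z)%:C * expi (uarg z).

Definition upow (z : ucover) (s : R) : C R :=
  (umod z `^ s)%:C * expi (s * uarg z).

Lemma ulnK : cancel uln uexp.
Proof.
case=> r t r0; rewrite /uexp /uln /=.
have e : expR (ln r) = r by rewrite lnK // posrE.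
move: (expR_gt0 (ln r)); rewrite e => r0'.
by rewrite (eq_irrelevance r0' r0).
Qed.

Lemma uexpK : cancel uexp uln.
Proof. by case=> x y; rewrite /uln /uexp /= expRK. Qed.

Lemma uproj_uexp (w : C R) : uproj (uexp w) = cexp w.
Proof. by []. Qed.

(* The complex structure of the cover is the one for which uln is a global
   chart with values in C.  The derivative, however, is taken with respect to
   the local coordinate uproj z: it is the limit of
   (f z' - f z) / (uproj z' - uproj z) as z' --> z. *)
Definition is_uderive (n : nat) (f : ucover -> 'cV[C R]_n) (z : ucover)
    (l : 'cV[C R]_n) : Prop :=
  (uproj (uexp w) - uproj z)^-1 *: (f (uexp w) - f z) @[w --> (uln z)^'] --> l.

(* Joint holomorphy on {|z| > M} * Omega, as complex differentiability in the
   two variables (ln z, omega). *)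
Definition uholomorphic (M : R) (Omega : set (C R))
    (V : normedModType (C R)) (f : ucover -> C R -> V) : Prop :=
  forall z omega, M < umod z -> Omega omega ->
    differentiable (fun x : C R * C R => f (uexp x.1) x.2) (uln z, omega).

Definition in_sector (theta1 theta2 : R) (z : ucover) : Prop :=
  theta1 <= uarg z <= theta2.

(* g (z; omega) = O(|z|^s) as z tends to infinity in the sector, uniformly with
   respect to omega in Omega. *)
Definition uniform_bigO (Omega : set (C R)) (theta1 theta2 : R)
    (g : ucover -> C R -> R) (s : R) : Prop :=
  exists K r0 : R, forall z omega, Omega omega ->
    in_sector theta1 theta2 z -> r0 < umod z -> g z omega <= K * umod z `^ s.

End UniversalCover.

Section Equation.
Variable R : realType.

(* Exponents beta_0, ..., beta_H and coefficients c_1, ..., c_H are indexed by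
   natural numbers; values at other indices are not used. *)
Definition pfun (H : nat) (beta : nat -> R) (c : nat -> C R -> C R)
    (z : ucover R) (omega : C R) : C R :=
  upow z (beta 0%N) + \sum_(1 <= k < H.+1) c k omega * upow z (beta k).

Definition Pfun (H : nat) (beta : nat -> R) (c : nat -> C R -> C R)
    (z : ucover R) (omega : C R) : C R :=
  upow z (beta 0%N + 1) / (beta 0%N + 1)%:C
  + \sum_(1 <= k < H) c k omega * (upow z (beta k + 1) / (beta k + 1)%:C)
  + c H omega * uln z.

Variables (n : nat) (M : R).

(* f is a solution on {|z| > M} of df/dz = B f. *)
Definition solution (B : ucover R -> 'M[C R]_n) (f : ucover R -> 'cV[C R]_n) :
    Prop :=
  forall z, M < umod z -> is_uderive f z (B z *m f z).

Definition solution_basis (B : ucover R -> 'M[C R]_n)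
    (f : 'I_n -> ucover R -> 'cV[C R]_n) : Prop :=
  [/\ forall j, solution B (f j),
      forall a : 'I_n -> C R,
        (forall z, M < umod z -> \sum_j a j *: f j z = 0) ->
        forall j, a j = 0
    & forall g, solution B g ->
        exists a : 'I_n -> C R,
          forall z, M < umod z -> g z = \sum_j a j *: f j z].

(* f (z; omega) = (v + O(|z|^(- delta))) E (z; omega) as z tends to infinity in
   the sector, uniformly with respect to omega in Omega. *)
Definition asymptotic (Omega : set (C R)) (theta1 theta2 delta : R)
    (f : ucover R -> C R -> 'cV[C R]_n) (v : 'cV[C R]_n)
    (E : ucover R -> C R -> C R) : Prop :=
  exists eps : ucover R -> C R -> 'cV[C R]_n,
    uniform_bigO Omega theta1 theta2
      (fun z omega => rnorm (eps z omega)) (- delta) /\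
    forall z omega, M < umod z -> Omega omega -> in_sector theta1 theta2 z ->
      f z omega = E z omega *: (v + eps z omega).

End Equation.

(* Main.v *)
(* In the coordinate [w = ln z] the components of a solution in the basis [psi], divided by
   [exp (- nu_j P)], satisfy [phi_i' = (nu_j - nu_i) P' phi_i + (B phi)_i] with [B = O(|z|^(-delta))].
   With [y = z^kappa], [kappa = beta_0 + 1], one has [B dw = O(|y|^(-1 - delta / kappa)) dy] and [P]
   is close to [y / kappa].  Integrating the i-th equation from infinity along a ray of [y] on which
   [Re ((nu_j - nu_i) P)] increases turns the system into the fixed point equation of a contraction
   on bounded holomorphic functions, over the whole region from which all these rays stay in
   [{N > r}], [N] being a weight that grows linearly along them.  With
   [N(y) = Re y sin gamma + |Im y| cos gamma] this region contains sectors of half-opening up to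
   [pi - gamma], and the rays must lie within angle [gamma] of the axis: this is where the sector
   [a <= kappa arg z <= b + pi] comes from.  With [- |Im y|] in place of [|Im y|] the region lies
   inside the sector of half-opening [gamma], and the contraction gives uniqueness there.  The
   local solutions extend to [|z| > M] by the linear theory.  In (2), the solutions on
   [a, b + pi] and [a - pi, b] coincide by uniqueness near [a <= kappa arg z <= b]. *)

From HB Require Import structures.
Require Import Defs.
From mathcomp Require Import ring lra.

Set Implicit Arguments.
Unset Strict Implicit.
Unset Printing Implicit Defensive.

Local Open Scope classical_set_scope.
Local Open Scope ring_scope.
Local Open Scope complex_scope.

(** * The norm as a real number *)

(** Holomorphy in the pair (w, omega) has to survive integration over unbounded rays and the passage
    to the limit in the fixed point iteration. Both rest on one quantitative estimate: a
    differentiable function bounded by M on a ball of radius r differs from its first order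
    expansion by at most a universal constant times M |h|^2 / r^2. It is proved in one variable,
    from Goursat's theorem in a logarithmic coordinate, and transferred to normed spaces along
    complex lines. Once the j-th component has exponent 0, the j-th basis vector solves the
    unperturbed system and can start the iteration. The same abstract flow also solves the initial
    value problem, with segments towards a base point and exponent 0 in place of rays to infinity.
    The competitors in the uniqueness claims solve the equation for each omega but depend on omega
    in an arbitrary way. *)

Section ComplexNorm.
Variable R : realType.
Implicit Types z w : C R.

Lemma rnormE (V : normedModType (C R)) (v : V) : `|v| = (rnorm v)%:C.
Proof.
rewrite /rnorm; apply/esym/RRe_real; apply: ger0_real; exact: normr_ge0.
Qed.

Lemma rnorm_ge0 (V : normedModType (C R)) (v : V) : 0 <= rnorm v.
Proof. by have := normr_ge0 v; rewrite rnormE ler0c. Qed.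

Lemma rnorm0 (V : normedModType (C R)) : rnorm (0 : V) = 0.
Proof. by rewrite /rnorm normr0. Qed.

Lemma rnormD (V : normedModType (C R)) (u v : V) : rnorm (u + v) <= rnorm u + rnorm v.
Proof. by have := ler_normD u v; rewrite !rnormE -rmorphD /= lecR. Qed.

Lemma rnormN (V : normedModType (C R)) (v : V) : rnorm (- v) = rnorm v.
Proof. by rewrite /rnorm normrN. Qed.

Lemma rnormBC (V : normedModType (C R)) (u v : V) : rnorm (u - v) = rnorm (v - u).
Proof. by rewrite -rnormN opprB. Qed.

Lemma rnormB (V : normedModType (C R)) (u v : V) : rnorm (u - v) <= rnorm u + rnorm v.
Proof. by rewrite -(rnormN v) rnormD. Qed.

Lemma rnorm_eq0 (V : normedModType (C R)) (v : V) : (rnorm v == 0) = (v == 0).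
Proof. by rewrite -(normr_eq0 v) rnormE -(inj_eq (@complexI R)). Qed.

Lemma rnorm_gt0 (V : normedModType (C R)) (v : V) : (0 < rnorm v) = (v != 0).
Proof. by rewrite lt_def rnorm_ge0 andbT rnorm_eq0. Qed.

Lemma rnormZ (V : normedModType (C R)) (k : C R) (v : V) : rnorm (k *: v) = rnorm k * rnorm v.
Proof. by have := normrZ k v; rewrite !rnormE -rmorphM /= => /complexI. Qed.

Lemma rnormM z w : rnorm (z * w) = rnorm z * rnorm w.
Proof. exact: (rnormZ z w). Qed.

Lemma rnorm1 : rnorm (1 : C R) = 1.
Proof. by rewrite /rnorm normr1. Qed.

Lemma rnormV z : rnorm z^-1 = (rnorm z)^-1.
Proof. by have := normfV z; rewrite !rnormE -fmorphV /= => /complexI. Qed.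

Lemma rnorm_sum (V : normedModType (C R)) (I : Type) (s : seq I) (P : pred I) (F : I -> V) :
  rnorm (\sum_(i <- s | P i) F i) <= \sum_(i <- s | P i) rnorm (F i).
Proof.
elim: s => [|i s IH]; rewrite ?big_nil ?rnorm0 // !big_cons; case: ifP => // _.
exact: le_trans (rnormD _ _) (lerD _ _).
Qed.

Lemma rnorm_real (x : R) : rnorm (x%:C : C R) = `|x|.
Proof. by rewrite /rnorm /= expr0n /= addr0 sqrtr_sqr. Qed.

Lemma rnorm_nneg (x : R) : 0 <= x -> rnorm (x%:C : C R) = x.
Proof. by move=> x0; rewrite rnorm_real ger0_norm. Qed.

Lemma rnorm_sqr z : rnorm z ^+ 2 = complex.Re z ^+ 2 + complex.Im z ^+ 2.
Proof.
by case: z => a b; rewrite /rnorm /= sqr_sqrtr // addr_ge0 // sqr_ge0.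
Qed.

Lemma Re_le_rnorm z : `|complex.Re z| <= rnorm z.
Proof.
rewrite -(ger0_norm (rnorm_ge0 z)) -ler_sqr ?nnegrE // !real_normK ?num_real //.
by rewrite rnorm_sqr lerDl sqr_ge0.
Qed.

Lemma Im_le_rnorm z : `|complex.Im z| <= rnorm z.
Proof.
rewrite -(ger0_norm (rnorm_ge0 z)) -ler_sqr ?nnegrE // !real_normK ?num_real //.
by rewrite rnorm_sqr lerDr sqr_ge0.
Qed.

Lemma rnorm_le_ReIm z : rnorm z <= `|complex.Re z| + `|complex.Im z|.
Proof.
rewrite -ler_sqr ?nnegrE ?rnorm_ge0 ?addr_ge0 // rnorm_sqr sqrrD !real_normK ?num_real //.
by rewrite addrAC lerDl mulrn_wge0 // mulr_ge0.
Qed.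

Lemma rnorm_pair (V W : normedModType (C R)) (v : V * W) :
  rnorm v = Num.max (rnorm v.1) (rnorm v.2).
Proof.
apply: (@complexI R); rewrite -rnormE prod_normE !rnormE /Num.max ltcR.
by rewrite /Order.max; case: ifP.
Qed.

Lemma rnorm_fst (V W : normedModType (C R)) (v : V * W) : rnorm v.1 <= rnorm v.
Proof. by rewrite rnorm_pair le_max lexx. Qed.

Lemma rnorm_snd (V W : normedModType (C R)) (v : V * W) : rnorm v.2 <= rnorm v.
Proof. by rewrite rnorm_pair le_max lexx orbT. Qed.

Lemma posC_real (e : C R) : 0 < e -> exists2 r : R, 0 < r & e = r%:C.
Proof.
move=> e0; exists (complex.Re e); last by rewrite RRe_real // gtr0_real.
by move: e0; rewrite ltcE => /andP[].
Qed.

Lemma nbhs_rnormP (V : normedModType (C R)) (x : V) (P : set V) :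
  nbhs x P <-> exists2 d : R, 0 < d & forall y, rnorm (y - x) < d -> P y.
Proof.
split=> [/nbhs_normP[e /= /posC_real[d d0 ->] H]|[d d0 H]].
  exists d => // y yd; apply: H => /=; by rewrite distrC rnormE ltcR.
apply/nbhs_normP; exists d%:C => /=; first by rewrite ltcR.
by move=> y /=; rewrite distrC rnormE ltcR => /H.
Qed.

Lemma cvg_rnormP (T : Type) (F : set_system T) (FF : Filter F)
    (V : normedModType (C R)) (f : T -> V) (l : V) :
  (f @ F --> l) <-> (forall e : R, 0 < e -> \forall t \near F, rnorm (f t - l) < e).
Proof.
split=> [/cvgrPdist_lt H e e0|H].
  have := H e%:C; rewrite ltcR => /(_ e0); apply: filterS => t.
  by rewrite rnormE ltcR rnormBC.
apply/cvgrPdist_lt => e /posC_real[r r0 ->].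
by apply: filterS (H r r0) => t; rewrite rnormE ltcR rnormBC.
Qed.

Lemma continuous_rnormP (V W : normedModType (C R)) (f : V -> W) (x : V) :
  {for x, continuous f} <-> (forall e : R, 0 < e -> exists2 d : R, 0 < d &
    forall y, rnorm (y - x) < d -> rnorm (f y - f x) < e).
Proof.
split=> [/cvg_rnormP H e e0|H]; first by have /nbhs_rnormP := H e e0.
by apply/cvg_rnormP => e e0; apply/nbhs_rnormP; apply: H.
Qed.

Lemma differentiable_rnorm (V W : normedModType (C R)) (f : V -> W) (x : V) :
  differentiable f x -> forall e : R, 0 < e -> exists2 d : R, 0 < d &
    forall h, rnorm h < d -> rnorm (f (x + h) - f x - 'd f x h) <= e * rnorm h.
Proof.
move=> df e e0.
have /eqaddoP/(_ e%:C) := diff_locally df.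
rewrite ltcR => /(_ e0) /nbhs_rnormP[d d0 H]; exists d => // h hd.
have := H h; rewrite subr0 => /(_ hd).
rewrite !rnormE -rmorphM lecR /= opprD addrA addrC addrA.
by rewrite !fctE /= [h + x]addrC [-_ + _]addrC addrAC.
Qed.

(** The bound by [K] makes [L] continuous, which together with the first order expansion identifies
    it as the differential. *)
Lemma rnorm_differentiable (V : normedModType (C R)) (f : V -> C R) (x : V)
    (L : V -> C R) (K : R) :
  linear L -> (forall h, rnorm (L h) <= K * rnorm h) ->
  (forall e : R, 0 < e -> exists2 d : R, 0 < d &
    forall h, rnorm h < d -> rnorm (f (x + h) - f x - L h) <= e * rnorm h) ->
  differentiable f x /\ 'd f x = L :> (V -> C R).
Proof.
move=> Llin Lb H.
pose l : {linear V -> C R} := HB.pack L (GRing.isLinear.Build _ _ _ _ L Llin).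
have lc : continuous l.
  move=> y; apply/continuous_rnormP => e e0.
  have K0 : 0 < `|K| + 1 by rewrite ltr_wpDl.
  exists (e / (`|K| + 1)); first by rewrite divr_gt0.
  move=> z; rewrite ltr_pdivlMr // => yz; rewrite -linearB /=.
  apply: le_lt_trans (Lb _) _; apply: le_lt_trans yz.
  rewrite mulrC ler_wpM2l ?rnorm_ge0 //; apply: le_trans (ler_norm K) _.
  by rewrite lerDl.
have E : f \o shift x = cst (f x) + l +o_ (0 : V) id.
  apply/eqaddoP => e /posC_real[r r0 ->]; apply/nbhs_rnormP.
  have [d d0 Hd] := H r r0; exists d => // h; rewrite subr0 => /Hd.
  rewrite !fctE !rnormE -rmorphM lecR /= opprD addrA.
  by rewrite [h + x]addrC.
have dl := diff_unique lc E.
split; last by rewrite dl.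
apply/diff_locallyP; rewrite dl; split => //; exact: E.
Qed.

Lemma linear_rnorm_bound (V : normedModType (C R)) (L : {linear V -> C R}) :
  continuous L -> exists2 K : R, 0 <= K & forall h, rnorm (L h) <= K * rnorm h.
Proof.
move=> /linear_lipschitz[k /posC_real[r r0 ->] H]; exists r; first exact: ltW.
by move=> h; have := H h; rewrite !rnormE -rmorphM lecR.
Qed.

End ComplexNorm.

(** * Integrals of continuous functions *)

Section RealPrimitive.
Variable R : realType.
Implicit Types (f g F G h H : R -> R) (a b c x : R).

Lemma is_derive_continuous f x df : is_derive x 1 f df -> {for x, continuous f}.
Proof.
move=> [dfx _]; apply: differentiable_continuous; exact/derivable1_diffP.
Qed.

Lemma mean_value F f a b : a <= b ->
  (forall x, a <= x <= b -> is_derive x 1 F (f x)) ->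
  exists2 c, a <= c <= b & F b - F a = f c * (b - a).
Proof.
move=> ab dF; have [|x xab|c cab ->] := @MVT_segment R F f a b ab.
- by move=> x; rewrite in_itv /= => /andP[x1 x2]; apply: dF; rewrite !ltW.
- apply/continuous_in_subspaceT : x xab => x.
  rewrite inE /= in_itv /= => xab; exact: is_derive_continuous (dF x xab).
- by exists c => //; move: cab; rewrite in_itv.
Qed.

Lemma derive_le F f H h a b : a <= b ->
  (forall x, a <= x <= b -> is_derive x 1 F (f x)) ->
  (forall x, a <= x <= b -> is_derive x 1 H (h x)) ->
  (forall x, a <= x <= b -> f x <= h x) -> F b - F a <= H b - H a.
Proof.
move=> ab dF dH fh.
have [|c cab] := @mean_value (fun x => H x - F x) (fun x => h x - f x) a b ab.
  by move=> x xab; apply: is_deriveB; [apply: dH|apply: dF].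
rewrite -subr_ge0 [X in 0 <= X](_ : _ = H b - F b - (H a - F a)); last by ring.
by move=> ->; rewrite mulr_ge0 ?subr_ge0 // fh.
Qed.

Lemma derive_eq F G f a b :
  (forall x, Num.min a b <= x <= Num.max a b -> is_derive x 1 F (f x)) ->
  (forall x, Num.min a b <= x <= Num.max a b -> is_derive x 1 G (f x)) -> F b - F a = G b - G a.
Proof.
wlog ab : a b / a <= b.
  move=> W dF dG; have [ab|/ltW ab] := leP a b; first exact: W.
  by apply: oppr_inj; rewrite !opprB; apply: W; rewrite // minC maxC.
rewrite min_l // max_r // => dF dG; apply/eqP; rewrite eq_le.
by rewrite !(@derive_le _ f _ f) //.
Qed.

Lemma primitive_ex f : continuous f -> exists F, forall x, is_derive x 1 F (f x).
Proof.
move=> cf.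
pose P a x := (\int[lebesgue_measure]_(t in [set` `[a, x]]) f t)%R.
have dP a x : a < x -> is_derive x 1 (P a) (f x).
  move=> ax; have xu : x < x + 1 by rewrite ltrDl.
  have [|d1 d2] := @continuous_FTC1_closed R f a x (x + 1) xu _ ax (cf x).
  - apply: continuous_compact_integrable; first exact: segment_compact.
    exact: continuous_subspaceT.
  - apply: DeriveDef; first exact: d1.
    by rewrite -derive1E.
(* The fundamental theorem is applied from a base point to the left of [x]. Here the base point
   moves with [x] and also stays below 0; [FE] shows that every such base point gives the same
   value. *)
pose F x := P (- (`|x| + 1)) x - P (- (`|x| + 1)) 0.
have FE a x : a < x -> a < 0 -> F x = P a x - P a 0.
  move=> ax a0; rewrite /F; set b := - _.
  have bx : b < x by rewrite /b ltrNl ltr_pwDr // -normrN ler_norm.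
  have b0 : b < 0 by rewrite /b oppr_lt0 ltr_pwDr.
  by apply: (@derive_eq _ _ f) => y /andP[y1 _]; apply: dP; apply: lt_le_trans y1; rewrite lt_min ?bx ?b0 ?ax ?a0.
exists F => x.
set a := - (`|x| + 1).
have ax : a < x by rewrite /a ltrNl ltr_pwDr // -normrN ler_norm.
have a0 : a < 0 by rewrite /a oppr_lt0 ltr_pwDr.
apply: (@near_eq_is_derive _ _ _ (fun x => P a x - P a 0)).
  near=> y; rewrite (FE a) //; near: y; exact: lt_nbhsr.
have := dP a x ax => dPx.
by apply: is_derive_eq; rewrite subr0.
Unshelve. all: by end_near. Qed.

(** Integrals of continuous functions are differences of a chosen primitive, so that additivity and
    estimates reduce to statements on derivatives. For continuous [f] the default value is never
    met, by [primitive_ex]. *)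
Definition prim f : R -> R := xget (fun=> 0) [set F | forall x, is_derive x 1 F (f x)].

Lemma is_derive_prim f x : continuous f -> is_derive x 1 (prim f) (f x).
Proof.
move=> /primitive_ex [F dF]; rewrite /prim; case: xgetP => [G _|]; first exact.
by move=> /(_ F).
Qed.

Definition integ f a b := prim f b - prim f a.

Lemma integE F f a b : continuous f -> (forall x, is_derive x 1 F (f x)) ->
  integ f a b = F b - F a.
Proof. by move=> cf dF; apply: derive_eq => x _ //; apply: is_derive_prim. Qed.

Lemma integ_le F f a b : continuous f -> a <= b ->
  (forall x, a <= x <= b -> is_derive x 1 F (f x)) ->  integ f a b = F b - F a.
Proof.
move=> cf ab dF; apply: derive_eq => x; rewrite min_l ?max_r // => xab; last exact: dF.
exact: is_derive_prim.
Qed.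

Lemma integ_cat f a b c : integ f a b + integ f b c = integ f a c.
Proof. by rewrite /integ; ring. Qed.

Lemma integD f g a b : continuous f -> continuous g ->
  integ (fun x => f x + g x) a b = integ f a b + integ g a b.
Proof.
move=> cf cg; apply: etrans (@integE (fun x => prim f x + prim g x) (fun x => f x + g x) a b _ _) _.
- by move=> x; apply: continuousD; [exact: cf|exact: cg].
- by move=> x; have := is_derive_prim x cf; have := is_derive_prim x cg => dg df; apply: is_deriveD.
- by rewrite /integ; ring.
Qed.

Lemma integZ f (k : R) a b : continuous f ->
  integ (fun x => k * f x) a b = k * integ f a b.
Proof.
move=> cf; apply: etrans (@integE (fun x => k * prim f x) (fun x => k * f x) a b _ _) _.
- by move=> x; apply: continuousM; [exact: cst_continuous|exact: cf].
- by move=> x; have df := is_derive_prim x cf; apply: is_deriveZ.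
- by rewrite /integ; ring.
Qed.

Lemma integ_bound f h H a b : continuous f -> a <= b ->
  (forall x, a <= x <= b -> is_derive x 1 H (h x)) ->
  (forall x, a <= x <= b -> `|f x| <= h x) -> `|integ f a b| <= H b - H a.
Proof.
move=> cf ab dH fh; rewrite ler_norml; apply/andP; split; last first.
  apply: (@derive_le _ f _ h) => // x xab; first exact: is_derive_prim.
  exact: le_trans (ler_norm _) (fh x xab).
rewrite lerNl /integ opprB.
have -> : prim f a - prim f b = (fun x => - prim f x) b - (fun x => - prim f x) a by ring.
apply: (@derive_le (fun x => - prim f x) (fun x => - f x) H h) => // x xab.
  by have df := is_derive_prim x cf; apply: is_deriveN.
by rewrite lerNl; have := fh x xab; rewrite ler_norml => /andP[].
Qed.

End RealPrimitive.

(** * Integrals of complex-valued functions of a real variable *)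

Section LineIntegral.
Variable R : realType.
Implicit Types (g : R -> C R) (a b c x y : R) (z w : C R).

Lemma continuous_Re (T : topologicalType) (f : T -> C R) (t : T) :
  {for t, continuous f} -> {for t, continuous (fun t => complex.Re (f t))}.
Proof.
move=> /cvg_rnormP H; apply/cvgrPdist_lt => e e0; apply: filterS (H e e0) => u.
by rewrite rnormBC; apply: le_lt_trans; rewrite -raddfB; exact: Re_le_rnorm.
Qed.

Lemma continuous_Im (T : topologicalType) (f : T -> C R) (t : T) :
  {for t, continuous f} -> {for t, continuous (fun t => complex.Im (f t))}.
Proof.
move=> /cvg_rnormP H; apply/cvgrPdist_lt => e e0; apply: filterS (H e e0) => u.
by rewrite rnormBC; apply: le_lt_trans; rewrite -raddfB; exact: Im_le_rnorm.
Qed.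

Lemma rnorm_dist (V : normedModType (C R)) (u v : V) : `|rnorm u - rnorm v| <= rnorm (u - v).
Proof.
have H1 : rnorm u <= rnorm (u - v) + rnorm v by apply: le_trans (rnormD _ _); rewrite subrK.
have H2 : rnorm v <= rnorm (u - v) + rnorm u.
  by rewrite rnormBC; apply: le_trans (rnormD _ _); rewrite subrK.
by rewrite ler_norml; apply/andP; split; lra.
Qed.

Lemma continuous_rnorm (T : topologicalType) (V : normedModType (C R)) (f : T -> V) (t : T) :
  {for t, continuous f} -> {for t, continuous (fun t => rnorm (f t))}.
Proof.
move=> /cvg_rnormP H; apply/cvgrPdist_lt => e e0; apply: filterS (H e e0) => u.
apply: le_lt_trans; rewrite distrC; exact: rnorm_dist.
Qed.

Lemma continuous_complex (T : topologicalType) (u v : T -> R) (t : T) :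
  {for t, continuous u} -> {for t, continuous v} ->
  {for t, continuous (fun t => u t +i* v t : C R)}.
Proof.
move=> /cvgrPdist_lt cu /cvgrPdist_lt cv; apply/cvg_rnormP => e e0.
have e2 : 0 < e / 2 by rewrite divr_gt0.
near=> s; apply: le_lt_trans (rnorm_le_ReIm _) _.
rewrite (splitr e) /= ltrD // distrC; near: s; [exact: cu|exact: cv].
Unshelve. all: by end_near. Qed.

Definition ccont g := forall x, {for x, continuous (g : R -> C R)}.

Lemma ccont_Re g : ccont g -> continuous (fun x => complex.Re (g x)).
Proof. by move=> cg x; apply: continuous_Re (cg x). Qed.

Lemma ccont_Im g : ccont g -> continuous (fun x => complex.Im (g x)).
Proof. by move=> cg x; apply: continuous_Im (cg x). Qed.

Definition cinteg g a b : C R :=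
  integ (fun x => complex.Re (g x)) a b +i* integ (fun x => complex.Im (g x)) a b.

Lemma cinteg_cat g a b c : cinteg g a b + cinteg g b c = cinteg g a c.
Proof. by apply/eqP; rewrite eq_complex /= !integ_cat !eqxx. Qed.

Lemma cintegD g h a b : ccont g -> ccont h ->
  cinteg (fun x => g x + h x) a b = cinteg g a b + cinteg h a b.
Proof.
move=> cg ch.
have ER := @integD _ _ _ a b (ccont_Re cg) (ccont_Re ch).
have EI := @integD _ _ _ a b (ccont_Im cg) (ccont_Im ch).
apply/eqP; rewrite eq_complex /cinteg /= -ER -EI; apply/andP; split; apply/eqP.
- by congr integ; apply/funext => x; rewrite raddfD.
- by congr integ; apply/funext => x; rewrite raddfD.
Qed.

Lemma cintegZ g (k : C R) a b : ccont g ->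
  cinteg (fun x => k * g x) a b = k * cinteg g a b.
Proof.
move=> cg.
have c1 := ccont_Re cg; have c2 := ccont_Im cg.
have cZ (f : R -> R) r : continuous f -> continuous (fun x => r * f x).
  by move=> cf x; apply: continuousM; [exact: cst_continuous|exact: cf].
case: k => k1 k2.
have ER := @integD _ _ _ a b (cZ _ k1 c1) (cZ _ (- k2) c2).
have EI := @integD _ _ _ a b (cZ _ k1 c2) (cZ _ k2 c1).
apply/eqP; rewrite eq_complex /cinteg /= -mulNr -(integZ k1 _ _ c1) -(integZ (- k2) _ _ c2).
rewrite -(integZ k1 _ _ c2) -(integZ k2 _ _ c1) -ER -EI.
apply/andP; split; apply/eqP; congr integ; apply/funext => x; case: (g x) => u v //=.
by rewrite mulNr.
Qed.

(** Real and imaginary parts are estimated separately, whence the factor 2, which reappears in the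
    constants below. The majorant comes with a primitive [H], so that no integral of [h] has to be
    formed. *)
Lemma cinteg_bound g h H a b : ccont g -> a <= b ->
  (forall x, a <= x <= b -> is_derive x 1 H (h x)) ->
  (forall x, a <= x <= b -> rnorm (g x) <= h x) -> rnorm (cinteg g a b) <= 2 * (H b - H a).
Proof.
move=> cg ab dH gh; apply: le_trans (rnorm_le_ReIm _) _ => /=.
rewrite mulr2n mulrDl mul1r lerD //; apply: (@integ_bound _ _ h H) => //.
- exact: ccont_Re.
- by move=> x xab; apply: le_trans (Re_le_rnorm _) (gh x xab).
- exact: ccont_Im.
- by move=> x xab; apply: le_trans (Im_le_rnorm _) (gh x xab).
Qed.

Lemma cinteg_cst_bound g (M : R) a b : ccont g -> a <= b ->
  (forall x, a <= x <= b -> rnorm (g x) <= M) -> rnorm (cinteg g a b) <= 2 * (M * (b - a)).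
Proof.
move=> cg ab gM; rewrite mulrBr.
apply: (@cinteg_bound _ (fun=> M) (fun x => M * x)) => // x _.
apply: is_derive_eq; exact: mulr1.
Qed.

Lemma cinteg_ext g h a b : (forall x, g x = h x) -> cinteg g a b = cinteg h a b.
Proof. by move=> /funext ->. Qed.

End LineIntegral.

(** * Goursat's theorem *)

Section Bisection.
Variable R : realType.
Implicit Types (x y : R).

(** The common point of the nested intervals is the supremum of their left ends, since each right
    end bounds all left ends. *)
Lemma nested_limit (x : nat -> R) (l : R) : 0 <= l ->
  (forall k, x k <= x k.+1 /\ x k.+1 + l * 2^-1 ^+ k.+1 <= x k + l * 2^-1 ^+ k) ->
  exists c, forall k, x k <= c <= x k + l * 2^-1 ^+ k.
Proof.
move=> l0 H.
have up m k : (k <= m)%N -> x k <= x m /\ x m + l * 2^-1 ^+ m <= x k + l * 2^-1 ^+ k.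
  elim: m => [|m IH]; first by rewrite leqn0 => /eqP ->.
  rewrite leq_eqVlt => /orP[/eqP ->//|/IH[h1 h2]]; have [h3 h4] := H m.
  by split; [exact: le_trans h3|exact: le_trans h2].
have le_ub m k : x m <= x k + l * 2^-1 ^+ k.
  have pos j : 0 <= l * 2^-1 ^+ j by rewrite mulr_ge0 // exprn_ge0 // invr_ge0.
  have [km|/ltnW mk] := leqP k m.
    by have [_] := up m k km; apply: le_trans; rewrite lerDl.
  by have [h _] := up k m mk; apply: le_trans h _; rewrite lerDl.
exists (sup (range x)) => k; apply/andP; split.
  apply: ub_le_sup; last by exists k.
  by exists (x 0%N + l * 2^-1 ^+ 0) => _ [m _ <-].
apply: ge_sup; first by exists (x 0%N), 0%N.
by move=> _ [m _ <-].
Qed.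

(** A rectangle is encoded by its lower left corner: at stage [k] its sides are [lx / 2^k] and
    [ly / 2^k], and the two booleans select one of its four quarters. The last two clauses keep all
    rectangles inside the first one, where alone differentiability will be known. *)
Lemma bisection (B : nat -> R -> R -> Prop) (x0 y0 lx ly : R) :
  0 <= lx -> 0 <= ly -> B 0%N x0 y0 ->
  (forall k x y, B k x y -> exists b b' : bool,
     B k.+1 (x + b%:R * (lx * 2^-1 ^+ k.+1)) (y + b'%:R * (ly * 2^-1 ^+ k.+1))) ->
  exists cx cy, forall k, exists x y, [/\ B k x y,
    x <= cx <= x + lx * 2^-1 ^+ k, y <= cy <= y + ly * 2^-1 ^+ k,
    x0 <= x /\ x + lx * 2^-1 ^+ k <= x0 + lx &
    y0 <= y /\ y + ly * 2^-1 ^+ k <= y0 + ly].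
Proof.
move=> lx0 ly0 B0 Bstep.
pose child k (p q : R * R) := exists b b' : bool,
  q = (p.1 + b%:R * (lx * 2^-1 ^+ k.+1), p.2 + b'%:R * (ly * 2^-1 ^+ k.+1)).
pose step k (p : R * R) := xget p [set q | child k p q /\ B k.+1 q.1 q.2].
pose fix s k : R * R := if k is k'.+1 then step k' (s k') else (x0, y0).
have sP k : B k (s k).1 (s k).2 /\ child k (s k) (s k.+1).
  have st j : B j (s j).1 (s j).2 -> child j (s j) (s j.+1) /\ B j.+1 (s j.+1).1 (s j.+1).2.
    move=> Bj; rewrite [s j.+1]/=.
    apply: (@xgetPex _ (s j) [set q | child j (s j) q /\ B j.+1 q.1 q.2]).
    have [b [b' Bb]] := Bstep _ _ _ Bj.
    by eexists (_, _); split; [exists b, b'; reflexivity|exact: Bb].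
  elim: k => [|k [_ _]]; first by split=> //; have [] := st 0%N B0.
  have Bk : B k (s k).1 (s k).2 by elim: k => // k /st[].
  by have [_ Bk1] := st k Bk; split=> //; have [] := st _ Bk1.
have half k (l : R) : l * 2^-1 ^+ k = l * 2^-1 ^+ k.+1 + l * 2^-1 ^+ k.+1.
  by rewrite exprSr; field.
have mono (l x : R) k (b : bool) : 0 <= l ->
    x <= x + b%:R * (l * 2^-1 ^+ k.+1) /\
    x + b%:R * (l * 2^-1 ^+ k.+1) + l * 2^-1 ^+ k.+1 <= x + l * 2^-1 ^+ k.
  move=> l0; rewrite (half k).
  have : 0 <= l * 2^-1 ^+ k.+1 by rewrite mulr_ge0 // exprn_ge0 // invr_ge0.
  by case: b => /=; split; lra.
have mx k : (s k).1 <= (s k.+1).1 /\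
    (s k.+1).1 + lx * 2^-1 ^+ k.+1 <= (s k).1 + lx * 2^-1 ^+ k.
  by have [_ [b [b' ->]]] := sP k; exact: mono.
have my k : (s k).2 <= (s k.+1).2 /\
    (s k.+1).2 + ly * 2^-1 ^+ k.+1 <= (s k).2 + ly * 2^-1 ^+ k.
  by have [_ [b [b' ->]]] := sP k; exact: mono.
have [cx Hx] := nested_limit lx0 mx.
have [cy Hy] := nested_limit ly0 my.
exists cx, cy => k; exists (s k).1, (s k).2; split=> //.
- by have [] := sP k.
- elim: k => [|k [h1 h2]]; first by rewrite expr0 mulr1.
  by have [h3 h4] := mx k; split; [exact: le_trans h3|exact: le_trans h2].
- elim: k => [|k [h1 h2]]; first by rewrite expr0 mulr1.
  by have [h3 h4] := my k; split; [exact: le_trans h3|exact: le_trans h2].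
Qed.

End Bisection.

Section Goursat.
Variable R : realType.
Implicit Types (f g : C R -> C R) (x y : R) (z w : C R).

Definition bd f x1 x2 y1 y2 : C R :=
  cinteg (fun x => f (x +i* y1)) x1 x2 - cinteg (fun x => f (x +i* y2)) x1 x2
  + 'i%C * (cinteg (fun y => f (x2 +i* y)) y1 y2 - cinteg (fun y => f (x1 +i* y)) y1 y2).

Lemma continuous_hline y : continuous (fun x => x +i* y : C R).
Proof. by move=> x; apply: continuous_complex; [exact: cvg_id|exact: cvg_cst]. Qed.

Lemma continuous_vline x : continuous (fun y => x +i* y : C R).
Proof. by move=> y; apply: continuous_complex; [exact: cvg_cst|exact: cvg_id]. Qed.

Lemma ccont_h f y : continuous f -> ccont (fun x => f (x +i* y)).
Proof. by move=> cf x; apply: (@continuous_comp _ _ _ (fun x : R => x +i* y : C R) f); [exact: continuous_hline|exact: cf]. Qed.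

Lemma ccont_v f x : continuous f -> ccont (fun y => f (x +i* y)).
Proof. by move=> cf y; apply: (@continuous_comp _ _ _ (fun y : R => x +i* y : C R) f); [exact: continuous_vline|exact: cf]. Qed.

Lemma ccont_cst (a : C R) : ccont (fun=> a).
Proof. by move=> x; exact: cvg_cst. Qed.

Lemma cinteg_cst (a : C R) x1 x2 : cinteg (fun=> a) x1 x2 = a * (x2 - x1)%:C.
Proof.
apply/eqP; rewrite eq_complex /cinteg /=.
have E (r : R) : integ (fun=> r) x1 x2 = r * (x2 - x1).
  apply: etrans (@integE _ (fun x => r * x) _ x1 x2 _ _) _.
  - by move=> x; exact: cvg_cst.
  - by move=> x; apply: is_derive_eq; exact: mulr1.
  - by rewrite mulrBr.
by case: a => u v /=; rewrite !E; apply/andP; split; apply/eqP; ring.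
Qed.

Lemma bdD f g x1 x2 y1 y2 : continuous f -> continuous g ->
  bd (fun z => f z + g z) x1 x2 y1 y2 = bd f x1 x2 y1 y2 + bd g x1 x2 y1 y2.
Proof.
move=> cf cg; rewrite /bd.
rewrite (cintegD _ _ (@ccont_h _ y1 cf) (@ccont_h _ y1 cg)) (cintegD _ _ (@ccont_h _ y2 cf) (@ccont_h _ y2 cg)).
rewrite (cintegD _ _ (@ccont_v _ x1 cf) (@ccont_v _ x1 cg)) (cintegD _ _ (@ccont_v _ x2 cf) (@ccont_v _ x2 cg)).
ring.
Qed.

Lemma continuous_affine (a b : C R) : continuous (fun z : C R => a + b * z).
Proof.
move=> z; apply: differentiable_continuous.
apply: differentiableD; first exact: differentiable_cst.
by apply: differentiableM; [exact: differentiable_cst|exact: ex_diff].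
Qed.

(** The values on opposite sides differ by the constants [b i (y2 - y1)] and [b (x2 - x1)]. Both
    pairs of sides contribute [b i (x2 - x1) (y2 - y1)], with opposite signs. *)
Lemma bd_affine (a b : C R) x1 x2 y1 y2 : bd (fun z => a + b * z) x1 x2 y1 y2 = 0.
Proof.
have ca := @continuous_affine a b.
rewrite /bd.
have -> : cinteg (fun x => a + b * (x +i* y2)) x1 x2 =
   cinteg (fun x => a + b * (x +i* y1)) x1 x2 + b * 'i%C * (y2 - y1)%:C * (x2 - x1)%:C.
  rewrite -cinteg_cst -cintegD; [|exact: (@ccont_h _ y1 ca)|exact: (@ccont_cst (b * 'i%C * (y2 - y1)%:C))].
  apply: cinteg_ext => x; rewrite -addrA -!mulrA -mulrDr; congr (_ + _ * _).
  by apply/eqP; rewrite eq_complex /=; apply/andP; split; apply/eqP; ring.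
have -> : cinteg (fun y => a + b * (x2 +i* y)) y1 y2 =
   cinteg (fun y => a + b * (x1 +i* y)) y1 y2 + b * (x2 - x1)%:C * (y2 - y1)%:C.
  rewrite -cinteg_cst -cintegD; [|exact: (@ccont_v _ x1 ca)|exact: (@ccont_cst (b * (x2 - x1)%:C))].
  apply: cinteg_ext => x; rewrite -addrA -!mulrDr; congr (_ + _ * _).
  by apply/eqP; rewrite eq_complex /=; apply/andP; split; apply/eqP; ring.
ring.
Qed.

Lemma bd_split f x1 x x2 y1 y y2 : bd f x1 x2 y1 y2 =
  (bd f x1 x y1 y + bd f x x2 y1 y) + (bd f x1 x y y2 + bd f x x2 y y2).
Proof.
rewrite /bd -(cinteg_cat _ x1 x x2) -(cinteg_cat (fun x => f (x +i* y2)) x1 x x2).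
rewrite -(cinteg_cat _ y1 y y2) -(cinteg_cat (fun y => f (x1 +i* y)) y1 y y2).
ring.
Qed.

Lemma bd_bound f x1 x2 y1 y2 (M : R) : continuous f -> x1 <= x2 -> y1 <= y2 ->
  (forall x y, x1 <= x <= x2 -> y1 <= y <= y2 -> rnorm (f (x +i* y)) <= M) ->
  rnorm (bd f x1 x2 y1 y2) <= 4 * M * ((x2 - x1) + (y2 - y1)).
Proof.
move=> cf x12 y12 H.
have hx y : y1 <= y <= y2 -> rnorm (cinteg (fun x => f (x +i* y)) x1 x2) <= 2 * (M * (x2 - x1)).
  by move=> hy; apply: cinteg_cst_bound => //; [exact: ccont_h|move=> x hx; exact: H].
have hy x : x1 <= x <= x2 -> rnorm (cinteg (fun y => f (x +i* y)) y1 y2) <= 2 * (M * (y2 - y1)).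
  by move=> hx'; apply: cinteg_cst_bound => //; [exact: ccont_v|move=> y hy; exact: H].
have ni : rnorm ('i%C : C R) = 1.
  by apply/eqP; rewrite -sqrp_eq1 ?rnorm_ge0 // rnorm_sqr /= expr0n add0r expr1n.
rewrite /bd; apply: le_trans (rnormD _ _) _; rewrite rnormM ni mul1r.
apply: le_trans (lerD (rnormB _ _) (rnormB _ _)) _.
have := hx y1; have := hx y2; have := hy x1; have := hy x2.
rewrite !lexx x12 y12 /= => /(_ isT) + /(_ isT) + /(_ isT) + /(_ isT).
lra.
Qed.

(** If the boundary integral had modulus [c > 0], at each stage one quarter would keep at least a
    fourth of it. Near the limit point [f] is affine up to [e |z - w0|], and the boundary integral
    of this error at stage [k] is at most [4 e s^2 / 4^k], with [s] the sum of the two sides; this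
    is below [c / 4^k]. Slopes are taken within the closed rectangle only, so that the lemma applies
    to functions composed with a clamp. *)
Lemma goursat f x1 x2 y1 y2 : continuous f -> x1 <= x2 -> y1 <= y2 ->
  (forall u v, x1 <= u <= x2 -> y1 <= v <= y2 -> exists a : C R,
    forall e : R, 0 < e -> exists2 d : R, 0 < d &
    forall x y, x1 <= x <= x2 -> y1 <= y <= y2 -> rnorm ((x +i* y) - (u +i* v) : C R) < d ->
    rnorm (f (x +i* y) - f (u +i* v) - a * ((x +i* y) - (u +i* v))) <= e * rnorm ((x +i* y) - (u +i* v) : C R)) ->
  bd f x1 x2 y1 y2 = 0.
Proof.
move=> cf x12 y12 df.
apply/eqP; apply: contraT => bd0; exfalso.
set c := rnorm (bd f x1 x2 y1 y2).
have c0 : 0 < c by rewrite rnorm_gt0.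
pose lx := x2 - x1; pose ly := y2 - y1.
have lx0 : 0 <= lx by rewrite subr_ge0.
have ly0 : 0 <= ly by rewrite subr_ge0.
pose B k x y := c * 4^-1 ^+ k <=
  rnorm (bd f x (x + lx * 2^-1 ^+ k) y (y + ly * 2^-1 ^+ k)).
have half k (l : R) : l * 2^-1 ^+ k = l * 2^-1 ^+ k.+1 + l * 2^-1 ^+ k.+1.
  by rewrite exprSr; field.
have [|k x y Bk|cx [cy Hc]] := @bisection _ B x1 y1 lx ly lx0 ly0.
- by rewrite /B expr0 !mulr1 /lx /ly ![_ + (_ - _)]addrC !subrK.
- apply: contrapT => nB.
  have lt (b b' : bool) : rnorm (bd f (x + b%:R * (lx * 2^-1 ^+ k.+1)) (x + b%:R * (lx * 2^-1 ^+ k.+1) + lx * 2^-1 ^+ k.+1) (y + b'%:R * (ly * 2^-1 ^+ k.+1)) (y + b'%:R * (ly * 2^-1 ^+ k.+1) + ly * 2^-1 ^+ k.+1)) < c * 4^-1 ^+ k.+1.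
    by rewrite ltNge; apply/negP => H; apply: nB; exists b, b'.
  move: Bk; rewrite /B (half k lx) (half k ly) !addrA.
  rewrite (@bd_split f x (x + lx * 2^-1 ^+ k.+1) _ y (y + ly * 2^-1 ^+ k.+1)).
  move=> /le_trans/(_ (rnormD _ _)).
  have := rnormD (bd f x (x + lx * 2^-1 ^+ k.+1) y (y + ly * 2^-1 ^+ k.+1))
    (bd f (x + lx * 2^-1 ^+ k.+1) (x + lx * 2^-1 ^+ k.+1 + lx * 2^-1 ^+ k.+1) y (y + ly * 2^-1 ^+ k.+1)).
  have := rnormD (bd f x (x + lx * 2^-1 ^+ k.+1) (y + ly * 2^-1 ^+ k.+1) (y + ly * 2^-1 ^+ k.+1 + ly * 2^-1 ^+ k.+1))
    (bd f (x + lx * 2^-1 ^+ k.+1) (x + lx * 2^-1 ^+ k.+1 + lx * 2^-1 ^+ k.+1) (y + ly * 2^-1 ^+ k.+1) (y + ly * 2^-1 ^+ k.+1 + ly * 2^-1 ^+ k.+1)).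
  have := lt false false; have := lt true false; have := lt false true; have := lt true true.
  rewrite /= !mul1r !mul0r !addr0.
  have -> : c * 4^-1 ^+ k = 4 * (c * 4^-1 ^+ k.+1) by rewrite exprSr; field.
  lra.
have : x1 <= cx <= x2 /\ y1 <= cy <= y2.
  have [x [y [_]]] := Hc 0%N; rewrite expr0 !mulr1 /lx /ly.
  by move=> /andP[h1 h2] /andP[h3 h4] [h5 h6] [h7 h8]; split; apply/andP; split; lra.
move=> [cx12 cy12]; have [a Ha] := df _ _ cx12 cy12.
pose s := lx + ly.
have s0 : 0 <= s by rewrite addr_ge0.
(* [e] is chosen for [4 e s^2 < c]; the summand 1 covers the degenerate case [s = 0]. *)
pose e := c / (8 * (s ^+ 2 + 1)).
have e0 : 0 < e by rewrite divr_gt0 // mulr_gt0 // ltr_wpDl // sqr_ge0.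
have es : 4 * e * s ^+ 2 < c.
  rewrite /e [ltLHS](_ : _ = c * (s ^+ 2 / (2 * (s ^+ 2 + 1)))); last first.
    by field; rewrite gt_eqF // ltr_wpDl // sqr_ge0.
  rewrite gtr_pMr // ltr_pdivrMr ?mul1r; have := sqr_ge0 s; lra.
have [d d0 Hd] := Ha e e0.
have [k kd] : exists k, s * 2^-1 ^+ k < d.
  have : (fun k => s * 2^-1 ^+ k : R) @ \oo --> (s * 0 : R).
    by apply: cvgM; [exact: cvg_cst|apply: cvg_expr; rewrite ger0_norm ?invf_lt1 ?ltr1n ?invr_ge0].
  rewrite mulr0 => /cvgrPdist_lt/(_ d d0)[k _ /(_ k (leqnn k))] /=.
  by rewrite sub0r normrN ger0_norm ?mulr_ge0 ?exprn_ge0 ?invr_ge0 // => H; exists k.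
have [x [y [Bk /andP[hx1 hx2] /andP[hy1 hy2] [hx3 hx4] [hy3 hy4]]]] := Hc k.
pose t k := 2^-1 ^+ k : R.
have t0 : 0 <= t k by rewrite exprn_ge0 // invr_ge0.
pose w0 : C R := cx +i* cy.
(* Subtracting the affine approximation changes no boundary integral, so only the remainder [r] has
   to be estimated. *)
pose r z := f z - (f w0 - a * w0 + a * z).
have cr : continuous r.
  by move=> z; exact: (continuousB (@cf z) (@continuous_affine (f w0 - a * w0) a z)).
have fE : f = fun z => (f w0 - a * w0 + a * z) + r z.
  by apply/funext => z; rewrite /r addrC subrK.
have bdr p q p' q' : bd f p q p' q' = bd r p q p' q'.
  by rewrite {1}fE (bdD p q p' q' (@continuous_affine (f w0 - a * w0) a) cr) bd_affine add0r.
move: Bk; rewrite /B bdr => Bk.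
have hsx : lx * 2^-1 ^+ k <= s * t k by rewrite ler_wpM2r // /s lerDl.
have hsy : ly * 2^-1 ^+ k <= s * t k by rewrite ler_wpM2r // /s lerDr.
have dist u v : x <= u <= x + lx * 2^-1 ^+ k -> y <= v <= y + ly * 2^-1 ^+ k ->
    rnorm ((u +i* v : C R) - w0) <= s * t k.
  move=> /andP[u1 u2] /andP[v1 v2]; apply: le_trans (rnorm_le_ReIm _) _ => /=.
  rewrite /s mulrDl; clear -u1 u2 v1 v2 hx1 hx2 hy1 hy2.
  by rewrite lerD // ler_norml; apply/andP; rewrite /t; split; lra.
have xs : x <= x + lx * 2^-1 ^+ k by rewrite lerDl mulr_ge0.
have ys : y <= y + ly * 2^-1 ^+ k by rewrite lerDl mulr_ge0.
have Hr u v : x <= u <= x + lx * 2^-1 ^+ k -> y <= v <= y + ly * 2^-1 ^+ k ->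
    rnorm (r (u +i* v)) <= e * (s * t k).
  move=> hu hv; rewrite /r [X in rnorm X](_ : _ = f (u +i* v) - f w0 - a * ((u +i* v : C R) - w0)); last by ring.
  have hd := dist u v hu hv.
  apply: le_trans (Hd u v _ _ _) _.
  - move: hu => /andP[u1 u2]; apply/andP; split; first exact: le_trans u1.
    by apply: le_trans u2 (le_trans hx4 _); rewrite addrC subrK.
  - move: hv => /andP[v1 v2]; apply/andP; split; first exact: le_trans v1.
    by apply: le_trans v2 (le_trans hy4 _); rewrite addrC subrK.
  - exact: le_lt_trans hd kd.
  - by rewrite ler_wpM2l // ltW.
have := le_trans Bk (bd_bound cr xs ys Hr).
have -> : 4^-1 ^+ k = t k * t k by rewrite /t -exprMn; congr (_ ^+ k); field.
rewrite [leRHS](_ : _ = 4 * e * s ^+ 2 * (t k * t k)); last by rewrite /t /s; ring.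
have tt : 0 < t k * t k by rewrite mulr_gt0 // exprn_gt0 // invr_gt0.
by rewrite (ler_pM2r tt) leNgt es.
Qed.

End Goursat.

(** * The exponential *)

Section ComplexExp.
Variable R : realType.
Implicit Types (x y t : R) (z w : C R).

Lemma is_derive_eps (f : R -> R) x l : is_derive x 1 f l ->
  forall e : R, 0 < e -> exists2 d : R, 0 < d &
    forall h, `|h| < d -> `|f (x + h) - f x - l * h| <= e * `|h|.
Proof.
move=> dfl e e0.
have [dfx Dl] := dfl; have /derivable1_diffP df := dfx.
have dE h : 'd f x h = l * h.
  by rewrite -[h in LHS]mulr1 -[h * 1]/(h *: (1 : R)) linearZ -deriveE // Dl /= mulrC.
have /eqaddoP/(_ e e0) := diff_locally df.
move=> /nbhs_ballP[d d0 H]; exists d => // h hd.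
have := H h; rewrite /ball /= sub0r normrN => /(_ hd).
by rewrite !fctE dE opprD addrA [h + x]addrC.
Qed.

Lemma expiD x y : expi (x + y) = expi x * expi y.
Proof. by rewrite /expi cosD sinD; apply/eqP; rewrite eq_complex /=; apply/andP; split; apply/eqP; ring. Qed.

Lemma expi0 : expi 0 = 1 :> C R.
Proof. by rewrite /expi cos0 sin0. Qed.

Lemma rnorm_expi x : rnorm (expi x) = 1.
Proof. by apply/eqP; rewrite -sqrp_eq1 ?rnorm_ge0 // rnorm_sqr /= cos2Dsin2. Qed.

Lemma expi_2pi x : expi (x + 2 * pi) = expi x.
Proof. by rewrite /expi mulr_natl cosD2pi sinD2pi. Qed.

Lemma expi_pi x : expi (x + pi) = - expi x.
Proof. by rewrite /expi cosDpi sinDpi; apply/eqP; rewrite eq_complex /= !eqxx. Qed.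

Lemma cexpD z w : cexp (z + w) = cexp z * cexp w.
Proof. by rewrite /cexp !raddfD /= expRD expiD rmorphM mulrACA. Qed.

Lemma cexp0 : cexp 0 = 1 :> C R.
Proof. by rewrite /cexp /= expR0 expi0 mul1r. Qed.

Lemma rnorm_cexp z : rnorm (cexp z) = expR (complex.Re z).
Proof. by rewrite /cexp rnormM rnorm_nneg ?expR_ge0 // rnorm_expi mulr1. Qed.

Lemma cexp_neq0 z : cexp z != 0.
Proof. by rewrite -rnorm_gt0 rnorm_cexp expR_gt0. Qed.

Lemma cexpN z : cexp (- z) = (cexp z)^-1.
Proof.
apply: (mulIf (cexp_neq0 z)); by rewrite -cexpD addNr cexp0 mulVf // cexp_neq0.
Qed.

Lemma cexp_expi (x : R) : cexp (0 +i* x) = expi x.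
Proof. by rewrite /cexp /= expR0 mul1r. Qed.

Lemma cexp_complex x y : cexp (x +i* y) = (expR x)%:C * expi y.
Proof. by []. Qed.

Lemma cexp_o0 (e : R) : 0 < e -> exists2 d : R, 0 < d &
  forall h : C R, rnorm h < d -> rnorm (cexp h - 1 - h) <= e * rnorm h.
Proof.
move=> e0.
(* The error terms below add up to at most [6 e' r], with [r] the norm of [h]; [e' <= 1] absorbs the
   products of two small factors. *)
pose e' := Num.min (e / 8) 1.
have e'0 : 0 < e' by rewrite lt_min ltr01 divr_gt0.
have e'1 : e' <= 1 by rewrite ge_min lexx orbT.
have e'e : 8 * e' <= e by rewrite mulrC -ler_pdivlMr // ge_min lexx.
have [d1 d10 H1] := is_derive_eps (is_derive_expR 0) e'0.
have [d2 d20 H2] := is_derive_eps (is_derive_cos 0) e'0.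
have [d3 d30 H3] := is_derive_eps (is_derive_sin 0) e'0.
exists (Num.min (Num.min d1 (e' / 2)) (Num.min d2 d3)) => [|[x y]].
  by rewrite !lt_min d10 d20 d30 divr_gt0.
rewrite !lt_min => /andP[/andP[h1 h4] /andP[h2 h3]].
have xr : `|x| <= rnorm (x +i* y : C R) := Re_le_rnorm (x +i* y).
have yr : `|y| <= rnorm (x +i* y : C R) := Im_le_rnorm (x +i* y).
have := H1 x (le_lt_trans xr h1); have := H2 y (le_lt_trans yr h2).
have := H3 y (le_lt_trans yr h3).
rewrite !add0r sin0 cos0 expR0 oppr0 mul0r !subr0 !mul1r addr0.
set r := rnorm _ in xr yr h1 h2 h3 h4 *.
move=> hs hc he.
have ex : `|expR x - 1| <= e'.
  have -> : expR x - 1 = (expR x - 1 - x) + x by ring.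
  apply: le_trans (ler_normD _ _) _.
  have : e' * `|x| <= `|x| by rewrite ler_piMl.
  lra.
have sy : `|sin y| <= 2 * r.
  have -> : sin y = (sin y - y) + y by ring.
  apply: le_trans (ler_normD _ _) _.
  have : e' * `|y| <= `|y| by rewrite ler_piMl.
  lra.
have ex' : e' * `|x| <= e' * r by rewrite ler_wpM2l // ltW.
have ey' : e' * `|y| <= e' * r by rewrite ler_wpM2l // ltW.
have r0 : 0 <= r by rewrite rnorm_ge0.
have er0 : 0 <= e' * r by rewrite mulr_ge0 // ltW.
apply: le_trans (rnorm_le_ReIm _) _ => /=.
rewrite !(mulr0, mul0r, subr0, addr0, add0r, oppr0).
have -> : expR x * cos y - 1 - x = (expR x - 1) * (cos y - 1) + (expR x - 1 - x) + (cos y - 1) by ring.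
have -> : expR x * sin y - y = (expR x - 1) * sin y + (sin y - y) by ring.
have m1 : `|(expR x - 1) * (cos y - 1)| <= e' * r.
  rewrite normrM -[leRHS]mul1r ler_pM // ?(le_trans ex) //; lra.
have m2 : `|(expR x - 1) * sin y| <= e' * (2 * r) by rewrite normrM ler_pM.
apply: le_trans (_ : 6 * (e' * r) <= _); last first.
  by apply: le_trans (ler_wpM2r r0 e'e); lra.
have := ler_normD ((expR x - 1) * (cos y - 1) + (expR x - 1 - x)) (cos y - 1).
have := ler_normD ((expR x - 1) * (cos y - 1)) (expR x - 1 - x).
have := ler_normD ((expR x - 1) * sin y) (sin y - y).
lra.
Qed.

Lemma diff_cexp z : differentiable (@cexp R) z /\ 'd (@cexp R) z = (fun h => cexp z * h) :> (C R -> C R).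
Proof.
apply: (@rnorm_differentiable _ _ _ _ _ (rnorm (cexp z))).
- by move=> a u v; rewrite mulrDr -[a *: u]/(a * u) -[_ *: (_ : C R)]/(a * (cexp z * u)) mulrCA.
- by move=> h; rewrite rnormM.
- move=> e e0; have e'0 : 0 < e / rnorm (cexp z) by rewrite divr_gt0 // rnorm_gt0 cexp_neq0.
  have [d d0 H] := cexp_o0 e'0; exists d => // h /H.
  rewrite mulrAC ler_pdivlMr ?rnorm_gt0 ?cexp_neq0 // => He.
  rewrite cexpD [X in rnorm X](_ : _ = cexp z * (cexp h - 1 - h)); last by ring.
  by rewrite rnormM mulrC.
Qed.

Lemma differentiable_cexp (V : normedModType (C R)) (f : V -> C R) (v : V) :
  differentiable f v -> differentiable (fun u => cexp (f u)) v.
Proof. by move=> df; apply: (differentiable_comp df); have [] := diff_cexp (f v). Qed.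

End ComplexExp.

(** * Cauchy estimates *)

Section CauchyEstimate.
Variable R : realType.
Implicit Types (x y t : R) (z w a : C R) (g : C R -> C R).

Lemma complexRI z : z = (complex.Re z +i* complex.Im z).
Proof. by case: z. Qed.

Lemma slope_differentiable (f : C R -> C R) z a :
  (forall e : R, 0 < e -> exists2 d : R, 0 < d &
    forall h, rnorm h < d -> rnorm (f (z + h) - f z - a * h) <= e * rnorm h) ->
  differentiable f z /\ 'd f z = (fun h => a * h) :> (C R -> C R).
Proof.
apply: (@rnorm_differentiable _ _ _ _ _ (rnorm a)) => [k u v|h]; last by rewrite rnormM.
by rewrite mulrDr -[k *: u]/(k * u) -[_ *: (_ : C R)]/(k * (a * u)) mulrCA.
Qed.

Lemma diffCE g z h : 'd g z h = 'd g z 1 * h.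
Proof.
have {1}-> : h = h *: (1 : C R) by apply/esym; exact: mulr1.
by rewrite linearZ mulrC.
Qed.

Lemma differentiable_slope g z : differentiable g z -> exists a : C R,
  forall e : R, 0 < e -> exists2 d : R, 0 < d &
    forall w, rnorm (w - z) < d -> rnorm (g w - g z - a * (w - z)) <= e * rnorm (w - z).
Proof.
move=> dg; exists ('d g z 1) => e e0.
have [d d0 H] := differentiable_rnorm dg e0; exists d => // w wz.
have := H _ wz; rewrite [z + _]addrC subrK.
by rewrite (diffCE g z (w - z)).
Qed.

(* Cauchy's theorem on a rectangle whose horizontal sides cancel by periodicity. *)
Lemma vertical_integral_const (q : C R -> C R) (s0 s l : R) : s <= s0 -> 0 <= l ->
  (forall w, complex.Re w <= s0 -> differentiable q w) ->
  (forall x, q (x +i* l) = q (x +i* 0)) ->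
  cinteg (fun y => q (s +i* y)) 0 l = cinteg (fun y => q (s0 +i* y)) 0 l.
Proof.
move=> ss0 l0 dq per.
(* Clamping the real part to [[s, s0]] makes the integrand continuous on the whole plane, as
   [goursat] asks, and changes nothing on the rectangle. *)
pose cl (w : C R) : C R := Num.max s (Num.min s0 (complex.Re w)) +i* complex.Im w.
have ccl : continuous cl.
  move=> w.
  have cRe : {for w, continuous (fun w : C R => complex.Re w)}  by apply: (@continuous_Re _ _ (fun w : C R => w)); exact: cvg_id.
  have cIm : {for w, continuous (fun w : C R => complex.Im w)}  by apply: (@continuous_Im _ _ (fun w : C R => w)); exact: cvg_id.
  apply: (@continuous_complex _ _ (fun w : C R => Num.max s (Num.min s0 (complex.Re w))) (fun w : C R => complex.Im w)); last exact: cIm.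
  apply: (@continuous_max _ _ (fun=> s) (fun w : C R => Num.min s0 (complex.Re w))).
    exact: cst_continuous.
  apply: (@continuous_min _ _ (fun=> s0) (fun w : C R => complex.Re w)); last exact: cRe.
  exact: cst_continuous.
have Recl w : complex.Re (cl w) <= s0 by rewrite /cl /= ge_max ss0 ge_min lexx.
have clE u v : s <= u <= s0 -> cl (u +i* v) = u +i* v.
  by move=> /andP[u1 u2]; rewrite /cl /= min_r // max_r.
pose f w := q (cl w).
have cf : continuous f.
  move=> w; apply: (continuous_comp (@ccl w)); apply: differentiable_continuous; exact: dq.
have := @goursat _ f s s0 0 l cf ss0 l0.
have -> : bd f s s0 0 l = 'i%C * (cinteg (fun y => f (s0 +i* y)) 0 l - cinteg (fun y => f (s +i* y)) 0 l).
  rewrite /bd; set A := cinteg _ s s0; set B := cinteg _ s s0.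
  suff -> : A = B by rewrite subrr add0r.
  by apply: cinteg_ext => x; rewrite /f /cl /= per.
move=> H; have {}H : 'i%C * (cinteg (fun y => f (s0 +i* y)) 0 l - cinteg (fun y => f (s +i* y)) 0 l) = 0.
  apply: H => u v hu hv.
  have [|a Ha] := @differentiable_slope q (u +i* v); first by apply: dq; case/andP: hu.
  exists a => e e0; have [d d0 Hd] := Ha e e0; exists d => // x y hx hy.
  by rewrite /f !clE //; exact: Hd.
move/eqP : H; rewrite mulf_eq0 subr_eq0 => /orP[/eqP/(congr1 (@complex.Im R))/= /eqP|/eqP].
  by rewrite oner_eq0.
have -> : (fun y => f (s0 +i* y)) = (fun y => q (s0 +i* y)).
  by apply/funext => y; rewrite /f clE // lexx ss0.
have -> : (fun y => f (s +i* y)) = (fun y => q (s +i* y)).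
  by apply/funext => y; rewrite /f clE // lexx ss0.
by [].
Qed.

Lemma eps_is_derive (f : R -> R) x l :
  (forall e : R, 0 < e -> exists2 d : R, 0 < d &
    forall h, `|h| < d -> `|f (x + h) - f x - l * h| <= e * `|h|) -> is_derive x 1 f l.
Proof.
move=> H.
have L : (fun h : R => h^-1 *: ((f \o shift x) (h *: 1) - f x)) @ 0^' --> l.
  apply/cvgrPdist_le => e e0; have [d d0 Hd] := H e e0.
  near=> h.
  have h0 : h != 0 by near: h; exact: nbhs_dnbhs_neq.
  have hd : `|h| < d by near: h; exact: dnbhs0_lt.
  have := Hd h hd; rewrite /= [h *: 1]mulr1 [h + x]addrC => Hh.
  rewrite distrC -(ler_pM2r (_ : 0 < `|h|)) ?normr_gt0 // -normrM.
  by rewrite -[_ *: _]/(_ * _) mulrBl mulrAC mulVf // mul1r.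
by apply: DeriveDef; [apply/cvg_ex; exists l|apply/cvg_lim].
Unshelve. all: by end_near. Qed.

(** [P] stands for the real or the imaginary part; what enters is that it is real-linear and does
    not increase norms. *)
Lemma is_derive_path (V : normedModType (C R)) (f : V -> C R) (v h : V) (t : R) (P : C R -> R) :
  (forall z w, P (z - w) = P z - P w) -> (forall (r : R) z, P (z * r%:C) = P z * r) ->
  (forall z, `|P z| <= rnorm z) -> differentiable f (v + t%:C *: h) ->
  is_derive t 1 (fun t : R => P (f (v + t%:C *: h))) (P ('d f (v + t%:C *: h) h)).
Proof.
move=> PB PM Pb df; apply: eps_is_derive => e e0.
have n0 : 0 < rnorm h + 1 by rewrite ltr_wpDl ?rnorm_ge0.
have e'0 : 0 < e / (rnorm h + 1) by rewrite divr_gt0.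
have [d d0 H] := differentiable_rnorm df e'0.
exists (d / (rnorm h + 1)); first by rewrite divr_gt0.
move=> s; rewrite ltr_pdivlMr // => sd.
have sh : rnorm (s%:C *: h) <= `|s| * (rnorm h + 1).
  by rewrite rnormZ rnorm_real ler_wpM2l // lerDl.
have := H _ (le_lt_trans sh sd).
have -> : v + t%:C *: h + s%:C *: h = v + (t + s)%:C *: h by rewrite rmorphD scalerDl addrA.
have -> : 'd f (v + t%:C *: h) (s%:C *: h) = 'd f (v + t%:C *: h) h * s%:C.
  by rewrite linearZ [RHS]mulrC.
move=> Hs.
rewrite -PM -!PB; apply: le_trans (Pb _) (le_trans Hs _).
by apply: le_trans (ler_wpM2l (ltW e'0) sh) _; rewrite mulrCA mulfVK ?gt_eqF // mulrC.
Qed.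

Lemma is_derive_Re (V : normedModType (C R)) (f : V -> C R) (v h : V) (t : R) :
  differentiable f (v + t%:C *: h) ->
  is_derive t 1 (fun t : R => complex.Re (f (v + t%:C *: h))) (complex.Re ('d f (v + t%:C *: h) h)).
Proof.
apply: is_derive_path => [z w|r [x y]|z]; first by rewrite raddfB.
  by rewrite /= mulr0 subr0.
exact: Re_le_rnorm.
Qed.

Lemma is_derive_Im (V : normedModType (C R)) (f : V -> C R) (v h : V) (t : R) :
  differentiable f (v + t%:C *: h) ->
  is_derive t 1 (fun t : R => complex.Im (f (v + t%:C *: h))) (complex.Im ('d f (v + t%:C *: h) h)).
Proof.
apply: is_derive_path => [z w|r [x y]|z]; first by rewrite raddfB.
  by rewrite /= mulr0 add0r.
exact: Im_le_rnorm.
Qed.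

(** The real mean value theorem is applied to the real and to the imaginary part, at two different
    points of the segment, which costs the factor 2. *)
Lemma mean_value_ineq (V : normedModType (C R)) (f : V -> C R) (u v : V) (K : R) :
  (forall t : R, 0 <= t <= 1 -> differentiable f (u + t%:C *: (v - u)) /\
     rnorm ('d f (u + t%:C *: (v - u)) (v - u)) <= K) ->
  rnorm (f v - f u) <= 2 * K.
Proof.
move=> H.
have E0 : u + (0 : R)%:C *: (v - u) = u by rewrite scale0r addr0.
have E1 : u + (1 : R)%:C *: (v - u) = v by rewrite scale1r addrC subrK.
apply: le_trans (rnorm_le_ReIm _) _; rewrite !raddfB mulr2n mulrDl mul1r.
apply: lerD.
- have [t t01|c c01] := @mean_value _ (fun t : R => complex.Re (f (u + t%:C *: (v - u))))
      (fun t => complex.Re ('d f (u + t%:C *: (v - u)) (v - u))) 0 1 ler01.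
    by apply: is_derive_Re; have [] := H t t01.
  rewrite E0 E1 subr0 mulr1 => ->; apply: le_trans (Re_le_rnorm _) _.
  by have [] := H c c01.
- have [t t01|c c01] := @mean_value _ (fun t : R => complex.Im (f (u + t%:C *: (v - u))))
      (fun t => complex.Im ('d f (u + t%:C *: (v - u)) (v - u))) 0 1 ler01.
    by apply: is_derive_Im; have [] := H t t01.
  rewrite E0 E1 subr0 mulr1 => ->; apply: le_trans (Im_le_rnorm _) _.
  by have [] := H c c01.
Qed.

Lemma le_eps_eq0 (V : normedModType (C R)) (v : V) (K : R) :
  (forall e : R, 0 < e -> rnorm v <= K * e) -> v = 0.
Proof.
move=> H; apply/eqP; rewrite -rnorm_eq0 eq_le rnorm_ge0 andbT.
apply/ler_addgt0Pl => e e0; rewrite addr0.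
have K0 : 0 < `|K| + 1 by rewrite ltr_wpDl.
apply: le_trans (H (e / (`|K| + 1)) _) _; first by rewrite divr_gt0.
rewrite mulrA ler_pdivrMr // mulrC; apply: ler_wpM2l; first exact: ltW.
by apply: le_trans (ler_norm _) _; rewrite lerDl.
Qed.

Lemma two_pi_ge0 : 0 <= 2 * pi :> R. Proof. by rewrite mulr_ge0 // pi_ge0. Qed.

Section Disk.
Variables (g : C R -> C R) (M : R).
Hypothesis dg : forall z, rnorm z < 1 -> differentiable g z.
Hypothesis gM : forall z, rnorm z < 1 -> rnorm (g z) <= M.

Let rho : R := 4^-1.
Let s0 : R := ln rho.
(** With [h = exp w] this is the difference quotient [(g (a + h) - g a) / h]. In the coordinate [w],
    circles about [a] become vertical segments of length [2 pi], and the singularity at [h = 0] is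
    moved to infinity. *)
Let q a (w : C R) : C R := (g (a + cexp w) - g a) * cexp (- w).

Let rho0 : 0 < rho. Proof. by rewrite invr_gt0. Qed.

Let rnorm_circle w : complex.Re w <= s0 -> rnorm (cexp w) <= 4^-1.
Proof. by move=> ws; rewrite rnorm_cexp -[leRHS](@lnK R) ?posrE // ler_expR. Qed.

Let in_disk a w : rnorm a <= 2^-1 -> complex.Re w <= s0 -> rnorm (a + cexp w) < 1.
Proof.
move=> a2 ws; apply: le_lt_trans (rnormD _ _) _.
have := rnorm_circle ws; lra.
Qed.

Let dq a w : rnorm a <= 2^-1 -> complex.Re w <= s0 -> differentiable (q a) w.
Proof.
move=> a2 ws; apply: differentiableM.
  apply: differentiableB; last exact: differentiable_cst.
  apply: (@differentiable_comp _ _ _ _ (fun w => a + cexp w) g); last by apply: dg; exact: in_disk.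
  apply: differentiableD; first exact: differentiable_cst.
  by have [] := diff_cexp w.
apply: differentiable_cexp; apply: differentiableN; exact: ex_diff.
Qed.

Let cq a s : rnorm a <= 2^-1 -> s <= s0 -> ccont (fun y => q a (s +i* y)).
Proof.
move=> a2 ss0 y; apply: (@continuous_comp _ _ _ (fun y : R => s +i* y : C R) (q a)).
  exact: continuous_vline.
by apply: differentiable_continuous; exact: dq.
Qed.

(** The integral of the difference quotient over a vertical period does not depend on the real part.
    At real part [s] very negative the quotient is within [e] of the derivative. So the derivative
    is the mean of the quotient over the circle of radius 1/4. *)
Lemma circle_formula a : rnorm a <= 2^-1 ->
  'd g a 1 * (2 * pi)%:C = cinteg (fun y => q a (s0 +i* y)) 0 (2 * pi).
Proof.
move=> a2; apply/esym/eqP; rewrite -subr_eq0; apply/eqP.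
apply: (@le_eps_eq0 _ _ (4 * pi)) => e e0.
have [|d d0 Hd] := differentiable_rnorm (f := g) (x := a) _ e0.
  by apply: dg; apply: le_lt_trans a2 _; rewrite invf_lt1 ?ltr1n.
pose s := Num.min s0 (ln (d / 2)).
have ss0 : s <= s0 by rewrite ge_min lexx.
have p0 := two_pi_ge0.
have per x : q a (x +i* (2 * pi)) = q a (x +i* 0).
  by rewrite /q !cexpN !cexp_complex -[2 * pi]add0r expi_2pi.
rewrite -(vertical_integral_const ss0 p0 (fun w => dq a2) per).
have -> : 'd g a 1 * (2 * pi)%:C = cinteg (fun=> 'd g a 1) 0 (2 * pi).
  by rewrite cinteg_cst subr0.
have -> : cinteg (fun y => q a (s +i* y)) 0 (2 * pi) - cinteg (fun=> 'd g a 1) 0 (2 * pi) =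
   cinteg (fun y => q a (s +i* y) + (-1) * 'd g a 1) 0 (2 * pi).
  rewrite (cintegD _ _ (cq a2 ss0) (@ccont_cst _ (-1 * 'd g a 1))).
  by rewrite (cintegZ (-1) _ _ (@ccont_cst _ ('d g a 1))) mulN1r.
rewrite (_ : 4 * pi * e = 2 * (e * (2 * pi - 0))); last by rewrite subr0; ring.
apply: cinteg_cst_bound; [|exact: two_pi_ge0|].
  move=> y; apply: continuousD; [exact: (cq a2 ss0)|exact: (@ccont_cst _ (-1 * 'd g a 1))].
move=> y _; rewrite /q mulN1r.
set h := cexp (s +i* y).
have h0 : h != 0 by exact: cexp_neq0.
have hd : rnorm h < d.
  rewrite rnorm_cexp /=; apply: le_lt_trans (_ : d / 2 < d); last by rewrite gtr_pMr // invf_lt1 ?ltr1n.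
  by rewrite -[leRHS](@lnK R) ?posrE ?divr_gt0 // ler_expR ge_min lexx orbT.
have := Hd h hd; rewrite (diffCE g a h) cexpN -/h => H.
rewrite [X in rnorm X](_ : _ = (g (a + h) - g a - 'd g a 1 * h) / h); last by field.
by rewrite rnormM rnormV ler_pdivrMr ?rnorm_gt0.
Qed.

Let M0 : 0 <= M.
Proof. by apply: le_trans (gM (z := 0) _); rewrite ?rnorm_ge0 ?rnorm0. Qed.

Let cancel_2pi (z : C R) (K : R) : rnorm (z * (2 * pi)%:C) <= 2 * (K * (2 * pi - 0)) -> rnorm z <= 2 * K.
Proof.
have p0' : 0 < 2 * pi :> R by rewrite mulr_gt0 // pi_gt0.
by rewrite rnormM rnorm_nneg ?two_pi_ge0 // subr0 (mulrA 2 K) (ler_pM2r p0').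
Qed.

Let rnorm_circle_inv y : rnorm (cexp (- (s0 +i* y))) = 4.
Proof. by rewrite rnorm_cexp /= expRN /s0 lnK ?posrE // /rho invrK. Qed.

(** On the circle the quotient is at most [2 M / (1/4) = 8 M], and the integral estimate doubles
    this. *)
Lemma cauchy_deriv a : rnorm a <= 2^-1 -> rnorm ('d g a 1) <= 16 * M.
Proof.
move=> a2; have -> : 16 * M = 2 * (8 * M) by ring.
apply: cancel_2pi; rewrite circle_formula //.
apply: cinteg_cst_bound; [exact: cq|exact: two_pi_ge0|] => y _.
rewrite /q rnormM rnorm_circle_inv mulrC.
have a1 : rnorm a < 1 by apply: le_lt_trans a2 _; rewrite invf_lt1 ?ltr1n.
have := rnormB (g (a + cexp (s0 +i* y))) (g a).
have := gM a1; have := gM (in_disk a2 (lexx s0 : complex.Re (s0 +i* y) <= s0)).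
lra.
Qed.

Let segment_in (a b : C R) (r : R) (t : R) : rnorm a <= r -> rnorm b <= r -> 0 <= t <= 1 ->
  rnorm (a + t%:C *: (b - a)) <= r.
Proof.
move=> ar br /andP[t0 t1].
have -> : a + t%:C *: (b - a) = (1 - t)%:C * a + t%:C * b.
  by rewrite -[t%:C *: _]/(t%:C * _) rmorphB /=; ring.
apply: le_trans (rnormD _ _) _.
rewrite !rnormM !rnorm_nneg ?subr_ge0 //.
have : (1 - t) * rnorm a <= (1 - t) * r by rewrite ler_wpM2l ?subr_ge0.
have : t * rnorm b <= t * r by rewrite ler_wpM2l.
lra.
Qed.

Lemma cauchy_lipschitz a b : rnorm a <= 2^-1 -> rnorm b <= 2^-1 ->
  rnorm (g b - g a) <= 32 * M * rnorm (b - a).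
Proof.
move=> a2 b2; have -> : 32 * M * rnorm (b - a) = 2 * (16 * M * rnorm (b - a)) by ring.
apply: mean_value_ineq => t t01; have h := segment_in a2 b2 t01; split.
  by apply: dg; apply: le_lt_trans h _; rewrite invf_lt1 ?ltr1n.
by rewrite diffCE rnormM ler_wpM2r ?rnorm_ge0 // cauchy_deriv.
Qed.

(** The circle formulas at [a] and at 0 are subtracted, and no second derivative is formed. Each of
    the two increments of [g] is at most [32 M |a|]; division by the radius 1/4 and the factor 2 of
    the integral estimate give [512 = 64 * 4 * 2]. *)
Lemma cauchy_deriv_lipschitz a : rnorm a <= 4^-1 ->
  rnorm ('d g a 1 - 'd g 0 1) <= 512 * M * rnorm a.
Proof.
move=> a4.
have a2 : rnorm a <= 2^-1 by apply: le_trans a4 _; rewrite lef_pV2 ?posrE ?ler_nat.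
have z2 : rnorm (0 : C R) <= 2^-1 by rewrite rnorm0 invr_ge0.
have -> : 512 * M * rnorm a = 2 * (256 * M * rnorm a) by ring.
apply: cancel_2pi.
have sub_eq (u v p A B : C R) : u * p = A -> v * p = B -> (u - v) * p = A + (-1) * B.
  by move=> <- <-; ring.
rewrite (sub_eq _ _ _ _ _ (circle_formula a2) (circle_formula z2)).
rewrite -(cintegZ (-1) _ _ (cq z2 (lexx s0))).
have c0 : ccont (fun y => -1 * q 0 (s0 +i* y)).
  by move=> y; apply: continuousM; [exact: (@ccont_cst _ (-1))|exact: (cq z2)].
rewrite -(cintegD _ _ (cq a2 (lexx s0)) c0).
apply: cinteg_cst_bound; [|exact: two_pi_ge0|].
  by move=> y; apply: continuousD; [exact: (cq a2)|exact: c0].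
move=> y _; rewrite /q add0r.
set w := s0 +i* y.
rewrite [X in rnorm X](_ : _ = ((g (a + cexp w) - g (cexp w)) - (g a - g 0)) * cexp (- w)); last by ring.
rewrite rnormM rnorm_circle_inv mulrC.
have w4 : rnorm (cexp w) <= 4^-1 by exact: rnorm_circle.
have L1 : rnorm (g (a + cexp w) - g (cexp w)) <= 32 * M * rnorm a.
  rewrite -[in rnorm a](addrK (cexp w) a); apply: cauchy_lipschitz.
    by apply: le_trans w4 _; rewrite lef_pV2 ?posrE ?ler_nat.
  apply: le_trans (rnormD _ _) _; lra.
have L2 : rnorm (g a - g 0) <= 32 * M * rnorm a.
  by have := cauchy_lipschitz z2 a2; rewrite subr0.
have := rnormB (g (a + cexp w) - g (cexp w)) (g a - g 0).
lra.
Qed.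

(** The mean value inequality for [g] minus its linear part at 0, whose derivative is small by
    [cauchy_deriv_lipschitz]. *)
Lemma cauchy_second z : rnorm z <= 4^-1 ->
  rnorm (g z - g 0 - 'd g 0 z) <= 1024 * M * rnorm z ^+ 2.
Proof.
move=> z4.
pose h w := g w - 'd g 0 1 * w.
rewrite diffCE [X in rnorm X](_ : _ = h z - h 0); last by rewrite /h; ring.
have -> : 1024 * M * rnorm z ^+ 2 = 2 * (512 * M * rnorm z * rnorm z) by ring.
have z0 : rnorm (0 : C R) <= 4^-1 by rewrite rnorm0 invr_ge0.
apply: mean_value_ineq => t t01; have := segment_in z0 z4 t01.
rewrite add0r subr0; set w := _ *: z => w4.
have w1 : rnorm w < 1 by apply: le_lt_trans w4 _; rewrite invf_lt1 ?ltr1n.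
have [e e0|dh dhE] := @slope_differentiable h w ('d g w 1 - 'd g 0 1).
  have [d d0 H] := differentiable_rnorm (dg w1) e0; exists d => // u /H.
  have key (p r x y D : C R) : x = y * u ->
      p - r - x = p - D * (w + u) - (r - D * w) - (y - D) * u by move=> ->; ring.
  by rewrite (key _ _ _ _ ('d g 0 1) (diffCE g w u)).
split; first exact: dh.
rewrite dhE.
rewrite rnormM ler_wpM2r ?rnorm_ge0 //.
apply: le_trans (cauchy_deriv_lipschitz w4) _.
apply: ler_wpM2l; first exact: (mulr_ge0 (ler0n _ 512) M0).
case/andP: t01 => t0 t1.
by rewrite /w rnormZ rnorm_nneg // ler_piMl ?rnorm_ge0.
Qed.

End Disk.

End CauchyEstimate.

(** * Holomorphic functions on normed spaces *)

Section SeveralVariables.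
Variables (R : realType) (V : normedModType (C R)).
Implicit Types (f g : V -> C R) (x u v h : V).

(** The one-variable estimates are applied on the unit disk to the restriction of [f] to the complex
    line through [x] in the direction [k], for each [k] of norm [r]. A general [h] is a multiple of
    such a [k], so the constants do not depend on the space. *)
Lemma second_order_bound f x (r M : R) : 0 < r ->
  (forall u, rnorm (u - x) < r -> differentiable f u /\ rnorm (f u) <= M) ->
  (forall h, rnorm h <= r / 4 -> rnorm (f (x + h) - f x - 'd f x h) <= 1024 * M / r ^+ 2 * rnorm h ^+ 2) /\
  (forall h, rnorm ('d f x h) <= 16 * M / r * rnorm h).
Proof.
move=> r0 H.
have dfx : differentiable f x by have [] := H x; rewrite ?subrr ?rnorm0.
have key k : rnorm k = r -> 
    (forall z : C R, rnorm z <= 4^-1 -> rnorm (f (x + z *: k) - f x - z * 'd f x k) <= 1024 * M * rnorm z ^+ 2) /\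
    rnorm ('d f x k) <= 16 * M.
  move=> kr; pose g (z : C R) := f (x + z *: k).
  have hb (z : C R) : rnorm z < 1 -> rnorm (x + z *: k - x) < r.
    by move=> z1; rewrite addrC addKr rnormZ kr gtr_pMl.
  have dg (z : C R) : rnorm z < 1 -> differentiable g z.
    move=> z1; apply: (@differentiable_comp _ _ _ _ (fun z : C R => x + z *: k) f); last by have [] := H _ (hb z z1).
    apply: differentiableD; first exact: differentiable_cst.
    by apply: differentiableZl; exact: ex_diff.
  have gM (z : C R) : rnorm z < 1 -> rnorm (g z) <= M by move=> z1; have [] := H _ (hb z z1).
  have [e e0|_ dE] := @slope_differentiable R g 0 ('d f x k).
    have [d d0 Hd] := differentiable_rnorm dfx (divr_gt0 e0 r0).
    exists (d / r) => [|z zd]; first by rewrite divr_gt0.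
    have := Hd (z *: k); rewrite rnormZ kr -ltr_pdivlMr // => /(_ zd).
    have -> : e / r * (rnorm z * r) = e * rnorm z by field; rewrite gt_eqF.
    have -> : 'd f x (z *: k) = 'd f x k * z by rewrite linearZ [RHS]mulrC.
    by rewrite /g add0r scale0r addr0.
  have dE1 : 'd g 0 1 = 'd f x k by rewrite dE mulr1.
  split=> [z z4|].
    have := cauchy_second dg gM z4.
    by rewrite dE /g scale0r addr0 [_ * z]mulrC.
  have := cauchy_deriv dg gM (a := 0); rewrite dE1; apply.
  by rewrite rnorm0 invr_ge0.
have scale h : h != 0 -> exists2 k, rnorm k = r & h = (rnorm h / r)%:C *: k.
  move=> h0; have nh : 0 < rnorm h by rewrite rnorm_gt0.
  exists ((r / rnorm h)%:C *: h).
    by rewrite rnormZ rnorm_nneg ?divfK ?gt_eqF // divr_ge0 // ltW.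
  by rewrite scalerA -rmorphM mulrA divfK ?gt_eqF // divff ?gt_eqF // scale1r.
split=> h.
  have [->|h0] := eqVneq h 0; first by rewrite addr0 subrr linear0 subrr !rnorm0 expr0n mulr0.
  have [k kr hE] := scale h h0; have [K1 _] := key k kr.
  rewrite ler_pdivlMr // => h4.
  have := K1 (rnorm h / r)%:C; rewrite rnorm_nneg ?divr_ge0 ?rnorm_ge0 ?(ltW r0) //.
  rewrite ler_pdivrMr // mulrC ler_pdivlMr // => /(_ h4).
  rewrite -hE -[_ * 'd f x k]/(_ *: 'd f x k) -linearZ -hE expr_div_n.
  by rewrite mulrA [X in _ <= X -> _]mulrAC.
have [->|h0] := eqVneq h 0; first by rewrite linear0 !rnorm0 mulr0.
have [k kr hE] := scale h h0; have [_ K2] := key k kr.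
rewrite hE linearZ rnormZ -hE rnorm_nneg ?divr_ge0 ?rnorm_ge0 ?(ltW r0) // mulrC.
rewrite mulrAC ler_pdivlMr // mulrA divfK ?gt_eqF //.
by rewrite ler_wpM2r // rnorm_ge0.
Qed.

Lemma second_order : exists2 K : R, 0 <= K & forall f x (r M : R), 0 < r ->
  (forall u, rnorm (u - x) < r -> differentiable f u /\ rnorm (f u) <= M) ->
  (forall h, rnorm h <= r / 4 -> rnorm (f (x + h) - f x - 'd f x h) <= K * M / r ^+ 2 * rnorm h ^+ 2) /\
  (forall h, rnorm ('d f x h) <= K * M / r * rnorm h).
Proof.
exists (1024%:R : R) => [|f x r M r0 H]; first exact: ler0n.
have M0 : 0 <= M.
  by have [|_] := H x; rewrite ?subrr ?rnorm0 //; apply: le_trans; exact: rnorm_ge0.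
have [H1 H2] := second_order_bound r0 H; split=> // h.
apply: le_trans (H2 h) _; apply: ler_wpM2r; first exact: rnorm_ge0.
apply: ler_wpM2r; first by rewrite invr_ge0 ltW.
by apply: ler_wpM2r; [exact: M0|rewrite ler_nat].
Qed.

Lemma locally_bounded (W : normedModType (C R)) (f : V -> W) x (U : set V) : open U -> U x ->
  {for x, continuous f} ->
  exists r M : R, [/\ 0 < r, 0 <= M & forall u, rnorm (u - x) < r -> U u /\ rnorm (f u) <= M].
Proof.
move=> oU Ux /continuous_rnormP cf.
have [d d0 Hd] := cf 1 ltr01.
have /nbhs_rnormP[r r0 Hr] : nbhs x U by exact: open_nbhs_nbhs.
exists (Num.min r d), (rnorm (f x) + 1); split.
- by rewrite lt_min r0 d0.
- by rewrite addr_ge0 ?rnorm_ge0.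
- move=> u; rewrite lt_min => /andP[u1 u2]; split; first exact: Hr.
  rewrite -lerBlDl; apply: le_trans (ltW (Hd u u2)).
  by apply: le_trans (rnorm_dist _ _); exact: ler_norm.
Qed.

Lemma hol_locally_bounded f x (U : set V) : open U -> U x ->
  (forall u, U u -> differentiable f u) ->
  exists r M : R, [/\ 0 < r, 0 <= M & forall u, rnorm (u - x) < r -> differentiable f u /\ rnorm (f u) <= M].
Proof.
move=> oU Ux dU; have [r [M [r0 M0 H]]] := locally_bounded oU Ux (differentiable_continuous (dU x Ux)).
by exists r, M; split=> // u /H[/dU].
Qed.

Lemma eq_le_of (a b : R) : a = b -> a <= b.
Proof. by move=> ->. Qed.

(** The derivatives [p] and [q] are compared through difference quotients of step [t]: each is
    within [e / 4] of its quotient, and the endpoint values differ by less than [t e / 8]. This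
    carries continuity over from a function to its derivative. *)
Lemma quotient_close (t e : R) (a b a' b' p q : C R) : 0 < t ->
  rnorm (a - a' - t%:C * p) <= t * (e / 4) -> rnorm (b - b' - t%:C * q) <= t * (e / 4) ->
  rnorm (a - b) < t * (e / 8) -> rnorm (a' - b') < t * (e / 8) -> rnorm (p - q) < e.
Proof.
move=> t0 i1 i2 i3 i4.
have E : t * rnorm (p - q) = rnorm (t%:C * (p - q) : C R) by rewrite rnormM rnorm_nneg // ltW.
rewrite -(ltr_pM2l t0) E.
have -> : t%:C * (p - q) = (b - b' - t%:C * q) - (a - a' - t%:C * p) + (a - b) - (a' - b') by ring.
apply: le_lt_trans (rnormB _ _) _.
have := rnormD ((b - b' - t%:C * q) - (a - a' - t%:C * p)) (a - b).
have := rnormB (b - b' - t%:C * q) (a - a' - t%:C * p).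
have := rnorm_ge0 (a - b); move: i1 i2 i3 i4; rewrite !(mulrA t e); set te := t * e.
lra.
Qed.

(** By the second order bound, the difference quotients with one small fixed step are uniformly
    close to the derivative near [x], and these quotients are continuous. *)
Lemma continuous_diff f h (U : set V) x : open U -> (forall u, U u -> differentiable f u) -> U x ->
  {for x, continuous (fun u => 'd f u h)}.
Proof.
move=> oU dU Ux.
have [h0|hn0] := eqVneq h 0.
  apply/continuous_rnormP => e e0; exists 1 => // u _.
  have d0 v : 'd f v 0 = 0 by exact: linear0.
  by rewrite h0 !d0 subrr rnorm0.
have nh : 0 < rnorm h by rewrite rnorm_gt0.
have [A A0 HA] := second_order.
have [r [M [r0 M0 H]]] := hol_locally_bounded oU Ux dU.
have r2 : 0 < r / 2 by rewrite divr_gt0.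
have B u : rnorm (u - x) < r / 2 -> forall k, rnorm k <= r / 2 / 4 ->
    rnorm (f (u + k) - f u - 'd f u k) <= A * M / (r / 2) ^+ 2 * rnorm k ^+ 2.
  move=> ux; apply: (proj1 (HA _ _ _ _ r2 _)) => v vu; apply: H.
  rewrite -(subrK u v) -addrA; apply: le_lt_trans (rnormD _ _) _.
  by rewrite [ltRHS]splitr ltrD.
apply/continuous_rnormP => e e0.
pose K := A * M / (r / 2) ^+ 2 * rnorm h ^+ 2.
have K0 : 0 <= K by rewrite mulr_ge0 ?sqr_ge0 // mulr_ge0 ?invr_ge0 ?sqr_ge0 // mulr_ge0.
have K1 : 0 < K + 1 by rewrite ltr_wpDl.
(* The first bound keeps the increment [t h] in the range of the second order estimate; the second
   makes the error of that estimate at most [t e / 4]. *)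
pose t := Num.min (r / 2 / 4 / rnorm h) (e / 4 / (K + 1)).
have t0 : 0 < t by rewrite lt_min !divr_gt0.
have th : rnorm (t%:C *: h) <= r / 2 / 4.
  by rewrite rnormZ rnorm_nneg ?(ltW t0) // -ler_pdivlMr // ge_min lexx.
have tK : t * K <= e / 4.
  apply: le_trans (_ : t * (K + 1) <= _); first by rewrite (ler_pM2l t0) lerDl.
  by rewrite -ler_pdivlMr // ge_min lexx orbT.
have Q u : rnorm (u - x) < r / 2 ->
    rnorm (f (u + t%:C *: h) - f u - t%:C * 'd f u h) <= t * (e / 4).
  move=> ux; have := B u ux _ th; rewrite linearZ => /le_trans; apply.
  rewrite rnormZ rnorm_nneg ?(ltW t0) //.
  have -> : A * M / (r / 2) ^+ 2 * (t * rnorm h) ^+ 2 = t * (t * K).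
    by rewrite /K; ring.
  by rewrite ler_pM2l.
have e8 : 0 < t * (e / 8) by rewrite mulr_gt0 // divr_gt0.
have xth : rnorm (x + t%:C *: h - x) < r.
  by rewrite addrC addKr; apply: le_lt_trans th _; lra.
have Dx : rnorm (x - x) < r / 2 by rewrite subrr rnorm0.
have dx0 : differentiable f x by exact: dU.
have dxth : differentiable f (x + t%:C *: h) by have [] := H _ xth.
have /continuous_rnormP/(_ _ e8)[d1 d10 H1] := differentiable_continuous dx0.
have /continuous_rnormP/(_ _ e8)[d2 d20 H2] := differentiable_continuous dxth.
exists (Num.min (r / 2) (Num.min d1 d2)) => [|u]; first by rewrite !lt_min r2 d10 d20.
rewrite !lt_min => /and3P[u1 u2 u3].
have := Q u u1; have := Q x Dx; have := H1 u u2.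
have := H2 (u + t%:C *: h); rewrite opprD addrACA subrr addr0 => /(_ u3).
move=> i1 i2 i3 i4; exact: (quotient_close t0 i4 i3 i1 i2).
Qed.

Lemma complex_complete (u : nat -> C R) :
  (forall e : R, 0 < e -> exists N, forall k l, (N <= k)%N -> (N <= l)%N -> rnorm (u k - u l) <= e) ->
  exists l : C R, forall e : R, 0 < e -> exists N, forall k, (N <= k)%N -> rnorm (u k - l) <= e.
Proof.
move=> H.
have cv (P : C R -> R) : (forall z w, `|P z - P w| <= rnorm (z - w)) -> exists l : R,
    forall e : R, 0 < e -> exists N, forall k, (N <= k)%N -> `|P (u k) - l| <= e.
  move=> HP; have cu : cauchy ((fun k => P (u k)) @ \oo).
    apply/cauchyP => e /= e0; have [N HN] := H (e / 2) (divr_gt0 e0 (ltr0Sn _ 1)).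
    exists (P (u N)); exists N => // k /= Nk.
    rewrite /ball /= distrC; apply: le_lt_trans (HP _ _) _.
    by apply: le_lt_trans (HN k N Nk (leqnn N)) _; rewrite gtr_pMr // invf_lt1 ?ltr1n.
  have [l Hl] : exists l : R, (fun k => P (u k)) @ \oo --> l by exists (lim ((fun k => P (u k)) @ \oo)); exact: cauchy_cvg.
  exists l => e e0; have /cvgrPdist_le/(_ e e0)[N _ HN] := Hl.
  by exists N => k Nk; rewrite distrC; exact: HN.
have [|l1 H1] := cv (@complex.Re R) _; first by move=> z w; rewrite -raddfB; exact: Re_le_rnorm.
have [|l2 H2] := cv (@complex.Im R) _; first by move=> z w; rewrite -raddfB; exact: Im_le_rnorm.
exists (l1 +i* l2) => e e0; have e2 : 0 < e / 2 by rewrite divr_gt0.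
have [N1 HN1] := H1 _ e2; have [N2 HN2] := H2 _ e2.
exists (maxn N1 N2) => k; rewrite geq_max => /andP[k1 k2].
apply: le_trans (rnorm_le_ReIm _) _; rewrite [leRHS]splitr !raddfB /=.
by apply: lerD; [exact: HN1|exact: HN2].
Qed.

(** The first order Cauchy estimate, applied to differences of approximants, makes their derivatives
    at [x] a Cauchy sequence. The second order bound is uniform in the approximants, so it survives
    in the limit and shows that the limit of the derivatives is the derivative of [f]. *)
Lemma weierstrass f x (r : R) : 0 < r ->
  (forall e : R, 0 < e -> exists2 g, (forall u, rnorm (u - x) < r -> differentiable g u) &
     forall u, rnorm (u - x) < r -> rnorm (f u - g u) <= e) ->
  differentiable f x.
Proof.
move=> r0 H; have [A A0 HA] := second_order.
pose ep k : R := k.+1%:R^-1.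
have ep0 k : 0 < ep k by rewrite invr_gt0.
have /choice[g gP] : forall k, exists g, (forall u, rnorm (u - x) < r -> differentiable g u) /\
     forall u, rnorm (u - x) < r -> rnorm (f u - g u) <= ep k.
  by move=> k; have [g h1 h2] := H (ep k) (ep0 k); exists g.
have epN (e : R) : 0 < e -> exists N, forall k, (N <= k)%N -> ep k <= e.
  move=> e0; exists (Num.bound e^-1) => k Nk.
  rewrite /ep -[leRHS]invrK lef_pV2 ?posrE ?invr_gt0 //.
  apply: le_trans (_ : (Num.bound e^-1)%:R <= _); last by rewrite ler_nat leqW.
  by apply: ltW; apply: archi_boundP; rewrite invr_ge0 ltW.
have xx : rnorm (x - x) < r by rewrite subrr rnorm0.
have dif k l h : rnorm ('d (g k) x h - 'd (g l) x h) <= A * (ep k + ep l) / r * rnorm h.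
  have [dk fk] := gP k; have [dl fl] := gP l.
  have E : 'd (g k - g l) x = 'd (g k) x \- 'd (g l) x :> (V -> C R) by apply: diffB; [exact: dk|exact: dl].
  have [|_ /(_ h)] := HA (g k - g l) x r (ep k + ep l) r0.
    move=> u ux; split; first by apply: differentiableB; [exact: dk|exact: dl].
    rewrite [X in rnorm X](_ : _ = (f u - g l u) - (f u - g k u)); last by rewrite !fctE; ring.
    by apply: le_trans (rnormB _ _) _; rewrite addrC lerD ?fk ?fl.
  have E1 : rnorm ('d (g k) x h - 'd (g l) x h) = rnorm ('d (g k - g l) x h).
    by congr rnorm; exact: (esym (congr1 (fun F => F h) E)).
  exact: (le_trans (eq_le_of E1)).
have /choice[L LP] : forall h, exists l : C R, forall e : R, 0 < e ->
    exists N, forall k, (N <= k)%N -> rnorm ('d (g k) x h - l) <= e.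
  move=> h; apply: complex_complete => e e0.
  pose B := A / r * rnorm h + 1.
  have B0 : 0 < B by rewrite ltr_wpDl // mulr_ge0 ?rnorm_ge0 // divr_ge0 // ltW.
  have [N HN] := epN (e / 2 / B) (divr_gt0 (divr_gt0 e0 (ltr0Sn _ 1)) B0).
  exists N => k l Nk Nl; apply: le_trans (dif k l h) _.
  have -> : A * (ep k + ep l) / r * rnorm h = (ep k + ep l) * (A / r * rnorm h) by ring.
  apply: le_trans (_ : (ep k + ep l) * B <= _).
    by rewrite ler_wpM2l ?lerDl // addr_ge0 // ltW.
  have := HN k Nk; have := HN l Nl.
  rewrite !ler_pdivlMr // mulrDl; lra.
have dg0 : forall u, rnorm (u - x) < r -> differentiable (g 0%N) u by have [] := gP 0%N.
have oB : open [set u | rnorm (u - x) < r].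
  rewrite openE => u /= ux; apply/nbhs_rnormP; exists (r - rnorm (u - x)); first by rewrite subr_gt0.
  by move=> v vu /=; rewrite -(subrK u v) -addrA; apply: le_lt_trans (rnormD _ _) _; rewrite -ltrBrDr.
have [r1 [M1 [r10 M10 H1]]] := hol_locally_bounded oB xx dg0.
(* On this smaller ball [g 0] is bounded by [M1]; all approximants lie within 1 of [f], so they
   share the bound [M1 + 2]. *)
pose r' := Num.min r r1; have r'0 : 0 < r' by rewrite lt_min r0 r10.
have ep1 k : ep k <= 1 by rewrite invf_le1 // ler1n.
have gM k u : rnorm (u - x) < r' -> differentiable (g k) u /\ rnorm (g k u) <= M1 + 2.
  rewrite lt_min => /andP[ur ur1]; have [dk fk] := gP k; have [_ f0] := gP 0%N.
  split; first exact: dk.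
  have -> : g k u = g 0%N u + (f u - g 0%N u) - (f u - g k u) by ring.
  have := rnormB (g 0%N u + (f u - g 0%N u)) (f u - g k u).
  have := rnormD (g 0%N u) (f u - g 0%N u).
  have := fk u ur; have := f0 u ur; have := ep1 k; have := ep1 0%N; have [_] := H1 u ur1.
  lra.
pose B := A * (M1 + 2) / r' ^+ 2; pose K := A * (M1 + 2) / r'.
have M2 : 0 <= M1 + 2 by rewrite addr_ge0.
have B0 : 0 <= B by rewrite divr_ge0 ?sqr_ge0 // mulr_ge0.
have g2 k h : rnorm h <= r' / 4 -> rnorm (g k (x + h) - g k x - 'd (g k) x h) <= B * rnorm h ^+ 2.
  by have [+ _] := HA _ _ _ _ r'0 (gM k) => /(_ h).
have g1 k h : rnorm ('d (g k) x h) <= K * rnorm h.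
  by have [_ /(_ h)] := HA _ _ _ _ r'0 (gM k).
have linL : linear L.
  move=> a h h'; apply/eqP; rewrite -subr_eq0; apply/eqP.
  apply: (@le_eps_eq0 _ _ _ (2 + rnorm a)) => e e0.
  have [N1 L1] := LP (a *: h + h') e e0; have [N2 L2] := LP h e e0; have [N3 L3] := LP h' e e0.
  pose N := maxn N1 (maxn N2 N3).
  have := L1 N (leq_maxl _ _).
  have := L2 N (leq_trans (leq_maxl N2 N3) (leq_maxr _ _)).
  have := L3 N (leq_trans (leq_maxr N2 N3) (leq_maxr _ _)).
  rewrite linearD linearZ.
  set p := 'd (g N) x h; set q := 'd (g N) x h' => i3 i2 i1.
  have -> : L (a *: h + h') - (a *: L h + L h') =
    a * (p - L h) + (q - L h') - (a *: p + q - L (a *: h + h')).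
    by rewrite -[a *: p]/(a * p) -[a *: L h]/(a * L h); ring.
  apply: le_trans (rnormB _ _) _.
  have := rnormD (a * (p - L h)) (q - L h'); rewrite rnormM.
  have := ler_wpM2l (rnorm_ge0 a) i2.
  rewrite mulrDl; lra.
suff [] : differentiable f x /\ 'd f x = L :> (V -> C R) by [].
apply: (@rnorm_differentiable _ _ f x L K linL).
- move=> h; apply/ler_addgt0Pl => e e0; have [N /(_ N (leqnn N)) LN] := LP h e e0.
  have -> : L h = 'd (g N) x h - ('d (g N) x h - L h) by ring.
  by apply: le_trans (rnormB _ _) _; rewrite addrC lerD.
- move=> e e0; exists (Num.min (r' / 4) (e / (B + 1))).
    by rewrite lt_min !divr_gt0 // ltr_wpDl.
  move=> h; rewrite lt_min => /andP[h1 h2].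
  have hB : B * rnorm h ^+ 2 <= e * rnorm h.
    rewrite expr2 mulrA ler_wpM2r ?rnorm_ge0 //.
    apply: le_trans (_ : (B + 1) * rnorm h <= _).
      by rewrite ler_wpM2r ?rnorm_ge0 // lerDl.
    by rewrite mulrC -ler_pdivlMr ?ltr_wpDl // ltW.
  apply: le_trans hB; apply/ler_addgt0Pl => e1 e10.
  have e3 : 0 < e1 / 3 by rewrite divr_gt0.
  have [N1 HN1] := epN _ e3; have [N2 HN2] := LP h _ e3.
  pose N := maxn N1 N2.
  have [_ fN] := gP N.
  have hr : rnorm (x + h - x) < r.
    rewrite addrC addKr; apply: lt_le_trans h1 _.
    apply: le_trans (_ : r' <= _); last by rewrite ge_min lexx.
    by move: r'0; clear; lra.
  have := fN _ hr; have := fN _ xx; have := HN1 N (leq_maxl _ _); have := HN2 N (leq_maxr _ _).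
  have := g2 N h (ltW h1).
  set p := 'd _ x h; set a := f (x + h); set b := f x; set a' := g N (x + h); set b' := g N x.
  move=> i1 i2 i3 i4 i5.
  have -> : a - b - L h = (a - a') - (b - b') + (a' - b' - p) + (p - L h) by ring.
  have := rnormD ((a - a') - (b - b') + (a' - b' - p)) (p - L h).
  have := rnormD ((a - a') - (b - b')) (a' - b' - p).
  have := rnormB (a - a') (b - b').
  lra.
Qed.

End SeveralVariables.

(** * Improper integrals *)

Section TailIntegral.
Variable R : realType.
Implicit Types (k : R -> C R) (s t : R) (l : C R) (h H : R -> R).

(* Only the values of [k] on [0, +oo) matter: the clamp makes the integrand continuous on [R]. *)
Definition cont0 k := ccont (fun s => k (Num.max s 0)).

Definition is_tint k l := forall e : R, 0 < e -> exists2 S : R, 0 <= S &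
  forall s, S <= s -> rnorm (cinteg (fun s => k (Num.max s 0)) 0 s - l) <= e.

Definition tint k : C R := xget 0 [set l | is_tint k l].

Lemma is_tint_unique k l l' : is_tint k l -> is_tint k l' -> l = l'.
Proof.
move=> Hl Hl'; apply/eqP; rewrite -subr_eq0; apply/eqP.
apply: (@le_eps_eq0 _ _ _ 2) => e e0.
have [S S0 HS] := Hl e e0; have [S' S'0 HS'] := Hl' e e0.
have i1 := HS (Num.max S S') _; have i2 := HS' (Num.max S S') _.
rewrite !le_max !lexx ?orbT in i1 i2; have {}i1 := i1 isT; have {}i2 := i2 isT.
set c := cinteg _ _ _ in i1 i2.
have -> : l - l' = (c - l') - (c - l) by ring.
have := rnormB (c - l') (c - l); lra.
Qed.

Lemma is_tintE k l : is_tint k l -> tint k = l.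
Proof.
move=> Hl; rewrite /tint; case: xgetP => [l' _ Hl'|/(_ l)//].
exact: is_tint_unique Hl' Hl.
Qed.

Lemma is_tint_eq k k' l : (forall s, 0 <= s -> k s = k' s) -> is_tint k l -> is_tint k' l.
Proof.
move=> E; rewrite /is_tint.
suff -> : (fun s => k (Num.max s 0)) = (fun s => k' (Num.max s 0)) by [].
by apply/funext => s; apply: E; rewrite le_max lexx orbT.
Qed.

Lemma is_tintD k k' l l' : cont0 k -> cont0 k' -> is_tint k l -> is_tint k' l' ->
  is_tint (fun s => k s + k' s) (l + l').
Proof.
move=> ck ck' Hl Hl' e e0; have e2 : 0 < e / 2 by rewrite divr_gt0.
have [S S0 HS] := Hl _ e2; have [S' S'0 HS'] := Hl' _ e2.
exists (Num.max S S') => [|s]; first by rewrite le_max S0.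
rewrite ge_max => /andP[/HS i1 /HS' i2]; rewrite (cintegD _ _ ck ck') opprD addrACA.
by apply: le_trans (rnormD _ _) _; rewrite [leRHS]splitr lerD.
Qed.

Lemma is_tintZ k (a : C R) l : cont0 k -> is_tint k l -> is_tint (fun s => a * k s) (a * l).
Proof.
move=> ck Hl e e0; have a0 : 0 < rnorm a + 1 by rewrite ltr_wpDl ?rnorm_ge0.
have [S S0 HS] := Hl _ (divr_gt0 e0 a0); exists S => // s /HS.
rewrite (cintegZ a _ _ ck) -mulrBr rnormM ler_pdivlMr // mulrC => /(le_trans _); apply.
by rewrite ler_wpM2r ?rnorm_ge0 // lerDl.
Qed.

Section Majorant.
Variables (h H : R -> R) (B : R).
Hypothesis dH : forall s, 0 <= s -> is_derive s 1 H (h s).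
Hypothesis HB : forall s, 0 <= s -> H s <= B.

Lemma tail_bound k a b : cont0 k -> (forall s, 0 <= s -> rnorm (k s) <= h s) ->
  0 <= a -> a <= b -> rnorm (cinteg (fun s => k (Num.max s 0)) a b) <= 2 * (H b - H a).
Proof.
move=> ck kh a0 ab; apply: (@cinteg_bound _ _ h) => // s /andP[as_ sb].
  by apply: dH; exact: le_trans as_.
have s0 : 0 <= s by exact: le_trans as_.
by rewrite max_l //; exact: kh.
Qed.

(** The increments of the partial integrals are bounded by those of [H], which is nondecreasing and
    bounded above, so the partial integrals satisfy the Cauchy criterion. *)
Lemma is_tint_ex k : cont0 k -> (forall s, 0 <= s -> rnorm (k s) <= h s) ->
  is_tint k (tint k).
Proof.
move=> ck kh; suff [l Hl] : exists l, is_tint k l by rewrite (is_tintE Hl).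
pose I s := cinteg (fun s => k (Num.max s 0)) 0 s.
have dI a b : 0 <= a -> a <= b -> rnorm (I b - I a) <= 2 * (H b - H a).
  by move=> a0 ab; rewrite /I -(cinteg_cat _ 0 a b) addrC addKr; exact: tail_bound.
(* The increment of [H] is nonnegative because, by [dI], twice this increment bounds a norm. *)
have Hmono a b : 0 <= a -> a <= b -> H a <= H b.
  move=> a0 ab; rewrite -subr_ge0; have := le_trans (rnorm_ge0 _) (dI a b a0 ab).
  by rewrite pmulr_rge0.
pose E := [set H s | s in [set s | 0 <= s]].
have supE : has_sup E by split; [exists (H 0), 0 => //=|exists B => _ [s /= s0 <-]; exact: HB].
have tail (e : R) : 0 < e -> exists2 S, 0 <= S & forall s t, S <= s -> S <= t -> rnorm (I s - I t) <= e.
  move=> e0; have e2 : 0 < e / 2 by rewrite divr_gt0.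
  have [_ [S /= S0 <-] HS] := sup_adherent e2 supE.
  have up s : S <= s -> H s <= sup E.
    by move=> Ss; apply: ub_le_sup; [case: supE|exists s => //=; exact: le_trans Ss].
  exists S => // s t; wlog st : s t / s <= t.
    move=> W Ss St; have [st|/ltW ts] := leP s t; first exact: W.
    by rewrite rnormBC; exact: W.
  move=> Ss St; rewrite rnormBC; apply: le_trans (dI s t (le_trans S0 Ss) st) _.
  have := up t St; have := Hmono S s S0 Ss; lra.
have [e e0|l Hl] := @complex_complete R (fun n => I n%:R).
  have [S S0 HS] := tail e e0; exists (Num.bound S) => m n Nm Nn.
  have big p : (Num.bound S <= p)%N -> S <= p%:R.
    move=> Np; apply: le_trans (_ : (Num.bound S)%:R <= _); last by rewrite ler_nat.
    by apply: ltW; exact: archi_boundP.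
  by apply: HS; exact: big.
exists l => e e0; have e2 : 0 < e / 2 by rewrite divr_gt0.
have [S S0 HS] := tail _ e2; have [N HN] := Hl _ e2.
exists S => // s Ss.
pose p := maxn N (Num.bound S).
have Sp : S <= p%:R.
  apply: le_trans (_ : (Num.bound S)%:R <= _); last by rewrite ler_nat leq_maxr.
  by apply: ltW; exact: archi_boundP.
rewrite -/(I s); have -> : I s - l = (I s - I p%:R) + (I p%:R - l) by ring.
apply: le_trans (rnormD _ _) _; rewrite [leRHS]splitr.
by apply: lerD; [exact: HS|apply: HN; exact: leq_maxl].
Qed.

Lemma tint_bound k : cont0 k -> (forall s, 0 <= s -> rnorm (k s) <= h s) ->
  rnorm (tint k) <= 2 * (B - H 0).
Proof.
move=> ck kh; apply/ler_addgt0Pl => e e0.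
have [S S0 HS] := is_tint_ex ck kh e0.
have := HS S (lexx _); have := tail_bound ck kh (lexx 0) S0.
set c := cinteg _ _ _ => i1 i2; have -> : tint k = c - (c - tint k) by ring.
have := rnormB c (c - tint k); have := HB S0; lra.
Qed.

End Majorant.

Lemma is_tint_shift k k' l t : cont0 k -> cont0 k' -> 0 <= t ->
  (forall s, 0 <= s -> k' s = k (s + t)) -> is_tint k l ->
  is_tint k' (l - cinteg (fun s => k (Num.max s 0)) 0 t).
Proof.
move=> ck ck' t0 E Hl e e0; have [S S0 HS] := Hl e e0; exists S => // s Ss.
have s0 : 0 <= s by exact: le_trans Ss.
suff -> : cinteg (fun s => k' (Num.max s 0)) 0 s = cinteg (fun s => k (Num.max s 0)) t (s + t).
  rewrite opprB addrA [_ + cinteg _ _ _]addrC cinteg_cat; apply: HS.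
  by apply: le_trans Ss _; rewrite lerDl.
have sh (P : C R -> R) : (forall k, ccont k -> continuous (fun s => P (k s))) ->
    integ (fun s => P (k' (Num.max s 0))) 0 s = integ (fun s => P (k (Num.max s 0))) t (s + t).
  move=> cP; have ckP := cP _ ck.
  have := @integ_le _ (fun s => prim (fun s => P (k (Num.max s 0))) (s + t)) _ 0 s (cP _ ck') s0.
  rewrite add0r; apply => u /andP[u0 us].
  have -> : k' (Num.max u 0) = k (Num.max (u + t) 0).
    by rewrite !max_l ?addr_ge0 // E.
  have := is_derive_prim (u + t) ckP => d1.
  apply: eps_is_derive => e1 /(is_derive_eps d1)[d d0 Hd]; exists d => // v /Hd.
  by rewrite [u + v + t]addrAC.
by apply/eqP; rewrite eq_complex; apply/andP; split; apply/eqP; apply: sh; [exact: ccont_Re|exact: ccont_Im].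
Qed.

End TailIntegral.

(** * Improper integrals depending holomorphically on a parameter *)

Section ParameterIntegral.
Variables (R : realType) (V : normedModType (C R)).
Variables (K : V -> R -> C R) (x : V) (r : R) (h H : R -> R) (B Mh : R).
Hypothesis r0 : 0 < r.
Hypothesis dH : forall s : R, 0 <= s -> is_derive s 1 H (h s).
Hypothesis HB : forall s : R, 0 <= s -> H s <= B.
Hypothesis hM : forall s : R, 0 <= s -> h s <= Mh.
Hypothesis cK : forall u, rnorm (u - x) < r -> cont0 (K u).
Hypothesis Kh : forall u s, rnorm (u - x) < r -> 0 <= s -> rnorm (K u s) <= h s.
Hypothesis dK : forall u s, rnorm (u - x) < r -> 0 <= s -> differentiable (K^~ s) u.

Let xx : rnorm (x - x) < r. Proof. by rewrite subrr rnorm0. Qed.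

Let h0 s : 0 <= s -> 0 <= h s.
Proof. by move=> s0; apply: le_trans (rnorm_ge0 _) (Kh xx s0). Qed.

(** Differentiation under the integral sign: the second order bound for the integrand holds with
    [M = h s], so its error is integrable in [s] and quadratic in the increment of the parameter. *)
Lemma differentiable_tint : differentiable (fun u => tint (K u)) x.
Proof.
have [A A0 HA] := @second_order R V.
pose D s v := 'd (K^~ s) x v.
have K2 s v : 0 <= s -> rnorm v <= r / 4 ->
    rnorm (K (x + v) s - K x s - D s v) <= A * h s / r ^+ 2 * rnorm v ^+ 2.
  move=> s0; apply: (proj1 (HA (K^~ s) x r (h s) r0 _)) => u ur.
  by split; [exact: dK|exact: Kh].
have K1 s v : 0 <= s -> rnorm (D s v) <= A * h s / r * rnorm v.
  move=> s0; apply: (proj2 (HA (K^~ s) x r (h s) r0 _)) => u ur.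
  by split; [exact: dK|exact: Kh].
have Mh0 : 0 <= Mh by apply: le_trans (hM (lexx 0)); exact: h0.
have inB v : rnorm v <= r / 4 -> rnorm (x + v - x) < r.
  by rewrite addrC addKr => v4; apply: le_lt_trans v4 _; rewrite gtr_pMr // invf_lt1 ?ltr1n.
(* The derivative in the parameter is continuous in [s]: the bound [Mh] on [h] provides one step [t]
   whose difference quotients are good for all [s] at once, and these are continuous in [s]. *)
have cD v : cont0 (D^~ v).
  move=> s0; apply/cvg_rnormP => e e0.
  pose Q := A * Mh / r ^+ 2 * rnorm v ^+ 2.
  have Q0 : 0 <= Q by rewrite mulr_ge0 ?sqr_ge0 // divr_ge0 ?sqr_ge0 // mulr_ge0.
  have Q1 : 0 < Q + 1 by rewrite ltr_wpDl.
  have v1 : 0 < rnorm v + 1 by rewrite ltr_wpDl ?rnorm_ge0.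
  pose t := Num.min (r / 4 / (rnorm v + 1)) (e / 4 / (Q + 1)).
  have t0 : 0 < t by rewrite lt_min !divr_gt0.
  have tv : rnorm (t%:C *: v) <= r / 4.
    rewrite rnormZ rnorm_nneg ?(ltW t0) //.
    apply: le_trans (_ : t * (rnorm v + 1) <= _); first by rewrite (ler_pM2l t0) lerDl.
    by rewrite -ler_pdivlMr // ge_min lexx.
  have tQ : t * Q <= e / 4.
    apply: le_trans (_ : t * (Q + 1) <= _); first by rewrite (ler_pM2l t0) lerDl.
    by rewrite -ler_pdivlMr // ge_min lexx orbT.
  have Est s : rnorm (K (x + t%:C *: v) (Num.max s 0) - K x (Num.max s 0) - t%:C * D (Num.max s 0) v) <= t * (e / 4).
    have m0 : 0 <= Num.max s 0 by rewrite le_max lexx orbT.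
    have := K2 _ _ m0 tv; rewrite /D linearZ => /le_trans; apply.
    apply: le_trans (_ : A * Mh / r ^+ 2 * rnorm (t%:C *: v) ^+ 2 <= _).
      apply: ler_wpM2r; first exact: sqr_ge0.
      apply: ler_wpM2r; first by rewrite invr_ge0 sqr_ge0.
      by apply: ler_wpM2l => //; exact: hM.
    rewrite rnormZ rnorm_nneg ?(ltW t0) //.
    have -> : A * Mh / r ^+ 2 * (t * rnorm v) ^+ 2 = t * (t * Q) by rewrite /Q; ring.
    by rewrite ler_pM2l.
  have e8 : 0 < t * (e / 8) by rewrite mulr_gt0 // divr_gt0.
  have /cvg_rnormP/(_ _ e8) N1 := cK (inB _ tv) (x := s0).
  have /cvg_rnormP/(_ _ e8) N2 := cK xx (x := s0).
  apply: filterS2 N1 N2 => s i1 i2; exact: (quotient_close t0 (Est s) (Est s0) i1 i2).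
pose HH c s := c * H s.
have dHH (c s : R) : 0 <= s -> is_derive s 1 (HH c) (c * h s).
  by move=> s0; have d1 := dH s0; exact: is_deriveZ.
have HBB (c s : R) : 0 <= c -> 0 <= s -> HH c s <= c * B.
  by move=> c0 s0; apply: ler_wpM2l => //; exact: HB.
have Ar (v : V) : 0 <= A / r * rnorm v by rewrite mulr_ge0 ?rnorm_ge0 // divr_ge0 // ltW.
have DK v s : 0 <= s -> rnorm (D s v) <= A / r * rnorm v * h s.
  by move=> s0; have := K1 s v s0; move=> /le_trans; apply; apply: eq_le_of; ring.
have DE v : is_tint (D^~ v) (tint (D^~ v)).
  exact: (is_tint_ex (dHH (A / r * rnorm v)) (fun s => HBB (A / r * rnorm v) s (Ar v)) (cD v) (DK v)).
have DB v : rnorm (tint (D^~ v)) <= 2 * (A / r * rnorm v * B - A / r * rnorm v * H 0).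
  exact: (tint_bound (dHH (A / r * rnorm v)) (fun s => HBB (A / r * rnorm v) s (Ar v)) (cD v) (DK v)).
have KE u : rnorm (u - x) < r -> is_tint (K u) (tint (K u)).
  by move=> ur; exact: (is_tint_ex dH HB (cK ur) (fun s => Kh ur)).
have linL : linear (fun v => tint (D^~ v)).
  move=> a u v /=; apply: is_tintE.
  apply: is_tint_eq (is_tintD _ (cD v) (is_tintZ a (cD u) (DE u)) (DE v)).
    by move=> s _; rewrite /D linearP.
  by move=> s; apply: continuousM; [exact: (@ccont_cst _ a)|exact: cD].
have H0B : H 0 <= B by exact: HB.
suff [] : differentiable (fun u => tint (K u)) x /\ 'd (fun u => tint (K u)) x = (fun v => tint (D^~ v)) :> (V -> C R) by [].
apply: (@rnorm_differentiable _ _ _ _ _ (2 * (A / r) * (B - H 0)) linL).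
  by move=> v; apply: le_trans (DB v) _; rewrite le_eqVlt; apply/orP; left; apply/eqP; ring.
move=> e e0.
pose Q := 2 * (A / r ^+ 2 * (B - H 0)).
have Q0 : 0 <= Q by rewrite mulr_ge0 // mulr_ge0 ?subr_ge0 // divr_ge0 ?sqr_ge0.
exists (Num.min (r / 4) (e / (Q + 1))) => [|v].
  by rewrite lt_min !divr_gt0 // ltr_wpDl.
rewrite lt_min => /andP[/ltW v1 v2].
have ck1 : cont0 (fun s => -1 * K x s).
  by move=> s; apply: continuousM; [exact: (@ccont_cst _ (-1))|exact: cK].
have ck2 : cont0 (fun s => -1 * D s v).
  by move=> s; apply: continuousM; [exact: (@ccont_cst _ (-1))|exact: cD].
have ck3 : cont0 (fun s => K (x + v) s + -1 * K x s).
  by move=> s; apply: continuousD; [exact: (cK (inB v v1))|exact: ck1].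
have ck4 : cont0 (fun s => K (x + v) s + -1 * K x s + -1 * D s v).
  by move=> s; apply: continuousD; [exact: ck3|exact: ck2].
have E := is_tintE (is_tintD ck3 ck2 (is_tintD (cK (inB v v1)) ck1 (KE _ (inB v v1)) (is_tintZ (-1) (cK xx) (KE _ xx))) (is_tintZ (-1) (cD v) (DE v))).
rewrite [X in rnorm X](_ : _ = tint (K (x + v)) + -1 * tint (K x) + -1 * tint (D^~ v)); last by ring.
rewrite -E.
pose q := A / r ^+ 2 * rnorm v ^+ 2.
have q0 : 0 <= q by rewrite mulr_ge0 ?sqr_ge0 // divr_ge0 ?sqr_ge0.
have K4 s : 0 <= s -> rnorm (K (x + v) s + -1 * K x s + -1 * D s v) <= q * h s.
  move=> s0; have := K2 s v s0 v1.
  rewrite (_ : K (x + v) s + -1 * K x s + -1 * D s v = K (x + v) s - K x s - D s v); last by ring.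
  by move=> /le_trans; apply; apply: eq_le_of; rewrite /q; ring.
apply: le_trans (tint_bound (dHH q) (fun s => HBB q s q0) ck4 K4) _.
have -> : 2 * (q * B - HH q 0) = Q * rnorm v * rnorm v by rewrite /q /Q /HH; ring.
apply: ler_wpM2r; first exact: rnorm_ge0.
apply: le_trans (_ : (Q + 1) * rnorm v <= _).
  by apply: ler_wpM2r; [exact: rnorm_ge0|rewrite lerDl].
by rewrite mulrC -ler_pdivlMr ?ltr_wpDl // ltW.
Qed.

End ParameterIntegral.

(** * Integration along holomorphic flows *)

Lemma continuous_comp_diff (R : realType) (T : topologicalType) (V W : normedModType (C R))
    (p : T -> V) (g : V -> W) (t : T) :
  {for t, continuous p} -> differentiable g (p t) -> {for t, continuous (fun s => g (p s))}.
Proof. by move=> cp dg; exact: (continuous_comp cp (differentiable_continuous dg)). Qed.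

Lemma differentiable_fst (R : realType) (V W : normedModType (C R)) (x : V * W) :
  differentiable (fun v : V * W => v.1) x.
Proof. by apply: (@linear_differentiable _ _ _ (fst : {linear _ -> _})) => y; exact: cvg_fst. Qed.

Lemma differentiable_snd (R : realType) (V W : normedModType (C R)) (x : V * W) :
  differentiable (fun v : V * W => v.2) x.
Proof. by apply: (@linear_differentiable _ _ _ (snd : {linear _ -> _})) => y; exact: cvg_snd. Qed.

Lemma diffM_apply (R : realType) (V : normedModType (C R)) (f g : V -> C R) (x h : V) :
  differentiable f x -> differentiable g x ->
  'd (fun u => f u * g u) x h = f x * 'd g x h + g x * 'd f x h.
Proof. by move=> df dg; exact: (congr1 (fun F => F h) (diffM df dg)). Qed.

Lemma diffB_apply (R : realType) (V : normedModType (C R)) (f g : V -> C R) (x h : V) :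
  differentiable f x -> differentiable g x ->
  'd (fun u => f u - g u) x h = 'd f x h - 'd g x h.
Proof. by move=> df dg; exact: (congr1 (fun F => F h) (diffB df dg)). Qed.

Lemma diffD_apply (R : realType) (V : normedModType (C R)) (f g : V -> C R) (x h : V) :
  differentiable f x -> differentiable g x ->
  'd (fun u => f u + g u) x h = 'd f x h + 'd g x h.
Proof. by move=> df dg; exact: (congr1 (fun F => F h) (diffD df dg)). Qed.

Lemma diff_comp_apply (R : realType) (V W U : normedModType (C R)) (f : V -> W) (g : W -> U) (x h : V) :
  differentiable f x -> differentiable g (f x) ->
  'd (fun u => g (f u)) x h = 'd g (f x) ('d f x h).
Proof. by move=> df dg; exact: (congr1 (fun F => F h) (diff_comp df dg)). Qed.

Lemma diff_cexp_comp (R : realType) (V : normedModType (C R)) (f : V -> C R) (x h : V) :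
  differentiable f x -> 'd (fun u => cexp (f u)) x h = cexp (f x) * 'd f x h.
Proof.
move=> df; have [dc E] := diff_cexp (f x).
by apply: etrans (diff_comp_apply _ df dc) _; rewrite E.
Qed.

Section Flow.
Variable R : realType.
Local Notation E := (C R * C R)%type.
Implicit Types (x u v : E) (s t : R) (f g : E -> C R).

Definition D1 f x : C R := 'd f x ((1, 0) : E).

Lemma diff_fst f x (a : C R) : 'd f x ((a, 0) : E) = a * D1 f x.
Proof.
rewrite /D1; have {1}-> : ((a, 0) : E) = a *: ((1, 0) : E).
  by apply: injective_projections; rewrite /= ?scaler0 //; exact/esym/mulr1.
by rewrite linearZ.
Qed.

Definition majorant (g : R -> R) (T : R) := exists (h H : R -> R) (B Mh : R),
  [/\ forall s : R, 0 <= s -> is_derive s 1 H (h s), forall s : R, 0 <= s -> H s <= B,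
      forall s : R, 0 <= s -> h s <= Mh, forall s : R, 0 <= s -> g s <= h s & B - H 0 <= T].

Definition flow_map (phi : R -> C R -> C R) s x : E := (phi s x.1, x.2).

(* A holomorphic semiflow [phi] of the first variable with velocity field [X], an exponent [G]
   whose real part does not decrease along the flow, and a weight [sigma] whose integral along
   the orbit of [x] is at most [tau x]. *)
Record flow_data (U : set E) (phi : R -> C R -> C R) (X : C R -> C R) (G : E -> C R)
    (sigma tau : E -> R) : Prop := FlowData {
  flow_open : open U;
  flow_stable : forall s x, 0 <= s -> U x -> U (flow_map phi s x);
  flow_zero : forall y, phi 0 y = y;
  flow_add : forall s t y, 0 <= s -> 0 <= t -> phi (s + t) y = phi s (phi t y);
  flow_diff : forall s y, differentiable (phi s) y;
  flow_cont : forall y, ccont (phi^~ y);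
  flow_velocity : forall y (e : R), 0 < e -> exists2 d : R, 0 < d &
    forall s, 0 <= s -> s < d -> rnorm (phi s y - y - s%:C * X y) <= e * s;
  velocity_diff : forall y, differentiable X y;
  exponent_diff : forall x, U x -> differentiable G x;
  exponent_mono : forall s x, 0 <= s -> U x -> complex.Re (G x) <= complex.Re (G (flow_map phi s x));
  weight_ge0 : forall x, 0 <= sigma x;
  weight_loc : forall x, U x -> exists (r : R) (h H : R -> R) (B Mh : R), [/\ 0 < r,
    forall s : R, 0 <= s -> is_derive s 1 H (h s), forall s : R, 0 <= s -> H s <= B,
    forall s : R, 0 <= s -> h s <= Mh &
    forall u, rnorm (u - x) < r ->
      U u /\ forall s, 0 <= s -> sigma (flow_map phi s u) * rnorm (X (phi s u.1)) <= h s];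
  weight_integral : forall x, U x ->
    majorant (fun s => sigma (flow_map phi s x) * rnorm (X (phi s x.1))) (tau x)
}.

Variables (U : set E) (phi : R -> C R -> C R) (X : C R -> C R) (G : E -> C R) (sigma tau : E -> R).
Local Notation Phi := (flow_map phi).
Hypothesis FD : flow_data U phi X G sigma tau.

Let oU := flow_open FD.
Let UPhi := flow_stable FD.
Let phi0 := flow_zero FD.
Let phiD := flow_add FD.
Let dphi := flow_diff FD.
Let cphi := flow_cont FD.
Let derphi := flow_velocity FD.
Let dX := velocity_diff FD.
Let dG := exponent_diff FD.
Let Gmono := exponent_mono FD.
Let sigma0 := weight_ge0 FD.
Let sigma_loc := weight_loc FD.
Let sigma_tau := weight_integral FD.

Definition flow_kernel f x s := cexp (- G (Phi s x)) * f (Phi s x) * X (phi s x.1).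

(** Variation of constants for [D1 y = D1 G * y + f], integrated from the far end of the orbit back
    to [x]. The sign accounts for the orbit leaving [x], and the factor [X] of the kernel is the
    line element along it. *)
Definition flow_op f x := cexp (G x) * (- tint (flow_kernel f x)).

Section Operand.
Variables (f : E -> C R) (K : R).
Hypothesis K0 : 0 <= K.
Hypothesis df : forall x, U x -> differentiable f x.
Hypothesis fK : forall x, U x -> rnorm (f x) <= K * sigma x.

Lemma kernel_cont x : U x -> cont0 (flow_kernel f x).
Proof.
move=> Ux s0.
have cmax : {for s0, continuous (fun s : R => Num.max s 0)}.
  by apply: (@continuous_max _ _ (fun s : R => s) (fun=> 0)); [exact: cvg_id|exact: cst_continuous].
have c1 : {for s0, continuous (fun s : R => phi (Num.max s 0) x.1)}.
  exact: (continuous_comp cmax (@cphi x.1 _)).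
have c2 : {for s0, continuous (fun s : R => Phi (Num.max s 0) x)}.
  apply/cvg_rnormP => e e0; have /cvg_rnormP/(_ e e0) := c1; apply: filterS => s.
  rewrite rnorm_pair /= subrr rnorm0.
  by rewrite [X in _ -> X < _]max_l ?rnorm_ge0.
have U0 : U (Phi (Num.max s0 0) x) by apply: UPhi => //; rewrite le_max lexx orbT.
have c3 := continuous_comp_diff c1 (dX _).
have c4 := continuous_comp_diff c2 (df U0).
have dGN : differentiable (fun v => cexp (- G v)) (Phi (Num.max s0 0) x).
  by apply: differentiable_cexp; apply: differentiableN; exact: dG.
have c5 := continuous_comp_diff c2 dGN.
apply: continuousM; last exact: c3.
by apply: continuousM; [exact: c5|exact: c4].
Qed.

Let kernel_bound x s : U x -> 0 <= s ->
  rnorm (flow_kernel f x s) <= expR (- complex.Re (G x)) * (K * (sigma (Phi s x) * rnorm (X (phi s x.1)))).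
Proof.
move=> Ux s0; rewrite /flow_kernel rnormM (rnormM (cexp _)) rnorm_cexp raddfN.
rewrite (mulrA K) (mulrA (expR _)); apply: ler_wpM2r; first exact: rnorm_ge0.
apply: ler_pM; [exact: expR_ge0|exact: rnorm_ge0| |by apply: fK; exact: UPhi].
by rewrite ler_expR; change (- complex.Re (G (Phi s x)) <= - complex.Re (G x)); rewrite lerN2; exact: Gmono.
Qed.

Lemma flow_is_tint x : U x -> is_tint (flow_kernel f x) (tint (flow_kernel f x)).
Proof.
move=> Ux; have [h [H [B [Mh [dH HB hM gh BT]]]]] := sigma_tau Ux.
pose c := expR (- complex.Re (G x)) * K.
have c0 : 0 <= c by rewrite mulr_ge0 ?expR_ge0.
apply: (@is_tint_ex _ (fun s => c * h s) (fun s => c * H s) (c * B)).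
- by move=> s s0; have d1 := dH s s0; exact: is_deriveZ.
- by move=> s s0; apply: ler_wpM2l => //; exact: HB.
- exact: kernel_cont.
- move=> s s0; apply: le_trans (kernel_bound Ux s0) _; rewrite mulrA.
  by apply: ler_wpM2l => //; exact: gh.
Qed.

(** As [Re G] does not decrease along the orbit, the exponential in the kernel is at most its value
    at [x], which the outer factor [exp (G x)] cancels. *)
Lemma flow_bound x : U x -> rnorm (flow_op f x) <= 2 * (K * tau x).
Proof.
move=> Ux; have [h [H [B [Mh [dH HB hM gh BT]]]]] := sigma_tau Ux.
pose c := expR (- complex.Re (G x)) * K.
have c0 : 0 <= c by rewrite mulr_ge0 ?expR_ge0.
rewrite /flow_op rnormM rnormN rnorm_cexp.
have : rnorm (tint (flow_kernel f x)) <= 2 * (c * B - c * H 0).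
  apply: (@tint_bound _ (fun s => c * h s) (fun s => c * H s) (c * B)).
  - by move=> s s0; have d1 := dH s s0; exact: is_deriveZ.
  - by move=> s s0; apply: ler_wpM2l => //; exact: HB.
  - exact: kernel_cont.
  - move=> s s0; apply: le_trans (kernel_bound Ux s0) _; rewrite mulrA.
    by apply: ler_wpM2l => //; exact: gh.
move=> /(ler_wpM2l (expR_ge0 (complex.Re (G x)))) /le_trans; apply.
have -> : expR (complex.Re (G x)) * (2 * (c * B - c * H 0)) = 2 * (K * (B - H 0)).
  by rewrite /c expRN; field; rewrite gt_eqF // expR_gt0.
by rewrite ler_wpM2l // ler_wpM2l.
Qed.

Lemma differentiable_flow x : U x -> differentiable (flow_op f) x.
Proof.
move=> Ux; apply: differentiableM; first by apply: differentiable_cexp; exact: dG.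
apply: differentiableN.
have [r [h [H [B [Mh [r0 dH HB hM gh]]]]]] := sigma_loc Ux.
have [r1 [M1 [r10 M10 HG]]] := hol_locally_bounded oU Ux dG.
pose c := expR M1 * K.
have c0 : 0 <= c by rewrite mulr_ge0 ?expR_ge0.
apply: (@differentiable_tint _ _ _ x (Num.min r r1) (fun s => c * h s) (fun s => c * H s) (c * B) (c * Mh)).
- by rewrite lt_min r0 r10.
- by move=> s s0; have d1 := dH s s0; exact: is_deriveZ.
- by move=> s s0; apply: ler_wpM2l => //; exact: HB.
- by move=> s s0; apply: ler_wpM2l => //; exact: hM.
- by move=> u; rewrite lt_min => /andP[/gh[Uu _] _]; exact: kernel_cont.
- move=> u s; rewrite lt_min => /andP[/gh[Uu ghu] /HG[_ Gu]] s0.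
  have Kh : K * (sigma (Phi s u) * rnorm (X (phi s u.1))) <= K * h s.
    by apply: ler_wpM2l => //; exact: ghu.
  have K0' : 0 <= K * (sigma (Phi s u) * rnorm (X (phi s u.1))).
    by rewrite mulr_ge0 // mulr_ge0 ?rnorm_ge0.
  apply: le_trans (kernel_bound Uu s0) _; rewrite /c -mulrA.
  apply: ler_pM; [exact: expR_ge0|exact: K0'| |exact: Kh].
  rewrite ler_expR; apply: le_trans (le_trans (ler_norm _) _) Gu.
  by rewrite normrN; exact: Re_le_rnorm.
- move=> u s; rewrite lt_min => /andP[/gh[Uu _] _] s0.
  have U1 : U (Phi s u) by exact: UPhi.
  have d1 : differentiable (fun v : E => phi s v.1) u.
    by apply: (@differentiable_comp _ _ _ _ (fun v : E => v.1) (phi s)); [exact: differentiable_fst|exact: dphi].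
  have dP : differentiable (Phi s) u.
    by apply: differentiable_pair; [exact: d1|exact: differentiable_snd].
  apply: differentiableM; last exact: (differentiable_comp d1 (dX _)).
  apply: differentiableM; last exact: (differentiable_comp dP (df U1)).
  by apply: differentiable_cexp; apply: differentiableN; exact: (differentiable_comp dP (dG U1)).
Qed.

Lemma flow_tint_shift x t : U x -> 0 <= t ->
  - tint (flow_kernel f (Phi t x)) =
  - tint (flow_kernel f x) + cinteg (fun s => flow_kernel f x (Num.max s 0)) 0 t.
Proof.
move=> Ux t0; have Ut : U (Phi t x) by exact: UPhi.
have shift s : 0 <= s -> flow_kernel f (Phi t x) s = flow_kernel f x (s + t).
  by move=> s0; rewrite /flow_kernel /flow_map /= phiD.
rewrite (is_tintE (is_tint_shift (kernel_cont Ux) (kernel_cont Ut) t0 shift (flow_is_tint Ux))).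
by rewrite opprB addrC.
Qed.

(** Moving the starting point along the orbit by time [t] removes the integral over [[0, t]], so the
    derivative of the tail in the direction [(X, 0)] is given by the kernel at time 0.
    Differentiability is known already, and complex linearity of the differential allows the
    division by [X]. *)
Lemma D1_flow x : U x -> X x.1 != 0 -> D1 (flow_op f) x = D1 G x * flow_op f x + f x.
Proof.
move=> Ux X0.
pose F u : C R := - tint (flow_kernel f u).
pose k u : C R := cexp (- G u) * f u * X u.1.
(* [F] is [flow_op f] times a holomorphic exponential, so it inherits differentiability. *)
have dF : differentiable F x.
  have E1 : F = fun u => cexp (- G u) * flow_op f u.
    by apply/funext => u; rewrite /flow_op mulrA -cexpD addNr cexp0 mul1r.
  rewrite E1; apply: differentiableM; last exact: differentiable_flow.
  by apply: differentiable_cexp; apply: differentiableN; exact: dG.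
have Fk : 'd F x (X x.1, 0) = k x.
  apply/eqP; rewrite -subr_eq0; apply/eqP.
  have [A A0 HA] := linear_rnorm_bound (diff_continuous dF).
  pose Q := 3 + A + rnorm (X x.1).
  apply: (@le_eps_eq0 _ _ _ Q) => e0 e00.
  wlog e1 : e0 e00 / e0 <= 1.
    move=> W; have [|/ltW e1] := leP e0 1; first exact: W.
    apply: le_trans (W 1 ltr01 (lexx _)) _; apply: ler_wpM2l => //.
    by rewrite /Q !addr_ge0 ?rnorm_ge0.
  have [d1 d10 H1] := differentiable_rnorm dF e00.
  have [d2 d20 H2] := derphi x.1 e00.
  have /cvg_rnormP/(_ _ e00)/nbhs_ballP[d3 /= d30 H3] := @kernel_cont x Ux 0.
  (* The step is within the range of three approximations: velocity of the flow, continuity of the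
     kernel, differentiability of [F]. *)
  pose t := Num.min (d2 / 2) (Num.min (d3 / 2) (d1 / 2 / (rnorm (X x.1) + 1))).
  have nX : 0 < rnorm (X x.1) + 1 by rewrite ltr_wpDl ?rnorm_ge0.
  have t0 : 0 < t by rewrite !lt_min !divr_gt0.
  have td2 : t < d2 by apply: le_lt_trans (_ : d2 / 2 < d2); [rewrite ge_min lexx|rewrite gtr_pMr // invf_lt1 ?ltr1n].
  have td3 : t < d3.
    by apply: le_lt_trans (_ : d3 / 2 < d3); [rewrite !ge_min lexx orbT|rewrite gtr_pMr // invf_lt1 ?ltr1n].
  have td1 : t * (rnorm (X x.1) + 1) < d1.
    apply: le_lt_trans (_ : d1 / 2 < d1); last by rewrite gtr_pMr // invf_lt1 ?ltr1n.
    by rewrite -ler_pdivlMr // !ge_min lexx !orbT.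
  pose w : E := (phi t x.1 - x.1, 0).
  have wE : Phi t x = x + w.
    by apply: injective_projections; rewrite /= ?addr0 // addrC subrK.
  pose w' : E := (phi t x.1 - x.1 - t%:C * X x.1, 0).
  have w'e : rnorm w' <= e0 * t.
    by rewrite rnorm_pair /= rnorm0 max_l ?rnorm_ge0 //; apply: H2 => //; exact: ltW.
  have ww' : w = t%:C *: ((X x.1, 0) : E) + w'.
    apply: injective_projections => /=; last by rewrite scaler0 addr0.
    by rewrite [RHS]addrC; exact: (esym (subrK _ _)).
  have wt : rnorm w <= t * (rnorm (X x.1) + 1).
    rewrite ww'; apply: le_trans (rnormD _ _) _.
    rewrite rnormZ rnorm_nneg ?(ltW t0) // rnorm_pair /= rnorm0 max_l ?rnorm_ge0 //.
    rewrite mulrDr mulr1; apply: lerD => //; apply: le_trans w'e _.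
    by rewrite ler_piMl // ltW.
  have := H1 w (le_lt_trans wt td1).
  rewrite -wE /F flow_tint_shift ?(ltW t0) // => I1.
  have I2 : rnorm (cinteg (fun s => flow_kernel f x (Num.max s 0)) 0 t - t%:C * k x) <= 2 * (e0 * (t - 0)).
    have -> : t%:C * k x = cinteg (fun=> k x) 0 t by rewrite cinteg_cst subr0 mulrC.
    have -> : cinteg (fun s => flow_kernel f x (Num.max s 0)) 0 t - cinteg (fun=> k x) 0 t =
       cinteg (fun s => flow_kernel f x (Num.max s 0) + -1 * k x) 0 t.
      rewrite (cintegD _ _ (kernel_cont Ux) (@ccont_cst _ (-1 * k x))).
      by rewrite (cintegZ (-1) _ _ (@ccont_cst _ (k x))) mulN1r.
    apply: cinteg_cst_bound; [|exact: ltW|].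
      by move=> s; apply: continuousD; [exact: (kernel_cont Ux)|exact: (@ccont_cst _ (-1 * k x))].
    move=> s /andP[s0 st]; rewrite mulN1r.
    have := H3 s; rewrite /ball /= sub0r normrN ger0_norm // => /(_ (le_lt_trans st td3)).
    rewrite /= maxxx {2}/flow_kernel /flow_map phi0 /k.
    by case: (x) => a b /= /ltW.
  have I3 : rnorm ('d F x w') <= A * (e0 * t).
    by apply: le_trans (HA _) _; apply: ler_wpM2l.
  have I4 : rnorm ('d F x w - t%:C * k x) <= e0 * rnorm w + 2 * (e0 * t).
    move: I1 I2; set I := cinteg _ _ _; rewrite subr0 => I1 I2.
    have -> : 'd F x w - t%:C * k x = (I - t%:C * k x) - (- tint (flow_kernel f x) + I - - tint (flow_kernel f x) - 'd F x w) by ring.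
    by apply: le_trans (rnormB _ _) _; rewrite addrC lerD.
  have E2 : 'd F x w = t%:C * 'd F x (X x.1, 0) + 'd F x w'.
    by rewrite ww' linearD linearZ.
  rewrite -(ler_pM2l t0) -[X in X * rnorm _](rnorm_nneg (ltW t0)) -rnormM mulrBr.
  have -> : t%:C * 'd F x (X x.1, 0) - t%:C * k x = ('d F x w - t%:C * k x) - 'd F x w'.
    by rewrite E2; ring.
  apply: le_trans (rnormB _ _) _; apply: le_trans (lerD I4 I3) _.
  apply: le_trans (lerD (lerD (ler_wpM2l (ltW e00) wt) (lexx _)) (lexx _)) _.
  by apply: eq_le_of; rewrite /Q; ring.
have Fk1 : D1 F x = cexp (- G x) * f x.
  by apply: (mulfI X0); rewrite -diff_fst Fk /k mulrC.
have dcG : differentiable (fun u => cexp (G u)) x by apply: differentiable_cexp; exact: dG.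
have EM := diffM_apply ((1, 0) : E) dcG dF.
have EC := diff_cexp_comp ((1, 0) : E) (dG Ux).
have D : D1 (flow_op f) x = cexp (G x) * D1 F x + F x * (cexp (G x) * D1 G x).
  by apply: etrans EM _; congr (_ + _ * _); exact: EC.
have cG : cexp (G x) * cexp (- G x) = 1 by rewrite -cexpD subrr cexp0.
rewrite D Fk1 mulrA cG mul1r /flow_op -/(F x).
ring.
Qed.

End Operand.

Lemma flow_opB f g (K : R) x : 0 <= K ->
  (forall u, U u -> differentiable f u) -> (forall u, U u -> rnorm (f u) <= K * sigma u) ->
  (forall u, U u -> differentiable g u) -> (forall u, U u -> rnorm (g u) <= K * sigma u) ->
  U x -> flow_op (fun u => f u - g u) x = flow_op f x - flow_op g x.
Proof.
move=> K0 df fK dg gK Ux.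
have tf := flow_is_tint K0 df fK Ux; have tg := flow_is_tint K0 dg gK Ux.
have cf := kernel_cont df Ux; have cg := kernel_cont dg Ux.
have cg1 : cont0 (fun s => -1 * flow_kernel g x s).
  by move=> s; apply: continuousM; [exact: (@ccont_cst _ (-1))|exact: cg].
have E1 := is_tintE (is_tintD cf cg1 tf (is_tintZ (-1) cg tg)).
rewrite /flow_op -mulrBr; congr (_ * _); rewrite -opprD; congr (- _).
rewrite -[X in _ + X]mulN1r -E1; congr tint; apply/funext => s.
by rewrite /flow_kernel; ring.
Qed.

End Flow.

(** * Contracting operators on spaces of holomorphic functions *)

Section FixedPoint.
Variables (R : realType) (V : normedModType (C R)) (n : nat).
Implicit Types (p q : 'I_n -> V -> C R) (x : V) (i : 'I_n).
Variables (U : set V) (rho : V -> R).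
Hypothesis rho_loc : forall x, U x -> exists r M : R, 0 < r /\
  forall u, rnorm (u - x) < r -> U u /\ rho u <= M.

(** The ball of radius [K] for the supremum norm with weight [rho], among tuples of holomorphic
    functions. *)
Definition hol_bounded (K : R) p := forall i x, U x ->
  differentiable (p i) x /\ rnorm (p i x) <= K * rho x.

Variable T : ('I_n -> V -> C R) -> ('I_n -> V -> C R).
Hypothesis T_half : forall K p, 0 <= K -> hol_bounded K p -> hol_bounded (K / 2) (T p).
Hypothesis T_sub : forall K p q i x, 0 <= K -> hol_bounded K p -> hol_bounded K q -> U x ->
  T (fun i x => p i x - q i x) i x = T p i x - T q i x.

Lemma le_half_pow (a : R) (K : R) : (forall m : nat, a <= K * 2^-1 ^+ m) -> a <= 0.
Proof.
move=> H; have : (fun m => K * 2^-1 ^+ m : R) @ \oo --> (K * 0 : R).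
  by apply: cvgM; [exact: cvg_cst|apply: cvg_expr; rewrite ger0_norm ?invf_lt1 ?ltr1n ?invr_ge0].
rewrite mulr0 leNgt => /cvgrPdist_lt L; apply/negP => a0.
have [m _ /(_ m (leqnn m))] := L a a0.
rewrite /= sub0r normrN; apply/negP; rewrite -leNgt.
exact: le_trans (H m) (ler_norm _).
Qed.

(** Each use of the equation [p = T p] halves the bound on [p]. *)
Lemma fixpoint_unique K p : 0 <= K -> hol_bounded K p ->
  (forall i x, U x -> p i x = T p i x) -> forall i x, U x -> p i x = 0.
Proof.
move=> K0 Hp E i x Ux.
have Hm m : hol_bounded (K * 2^-1 ^+ m) p.
  elim: m => [|m IH]; first by rewrite expr0 mulr1.
  move=> j u Uu; split; first by have [] := Hp j u Uu.
  have [] := T_half _ IH (j) Uu; first by rewrite mulr_ge0 // exprn_ge0 // invr_ge0.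
  by rewrite -E // exprSr mulrA.
apply/eqP; rewrite -rnorm_eq0 eq_le rnorm_ge0 andbT.
apply: (@le_half_pow _ (K * rho x)) => m.
by have [_] := Hm m i x Ux; rewrite mulrAC.
Qed.

(** Picard iteration from [p0]. The [m]-th iterate has weighted norm at most [K (2 - 2^-m)], because
    [T] halves the previous bound before [p0] is added. Local boundedness of [rho] makes the
    convergence locally uniform, so the limit is holomorphic by [weierstrass]. *)
Lemma fixpoint_exists K p0 : 0 <= K -> hol_bounded K p0 ->
  exists2 p, hol_bounded (2 * K) p & forall i x, U x -> p i x = p0 i x + T p i x.
Proof.
move=> K0 H0.
have rho0 i x : U x -> 0 <= K * rho x.
  by move=> Ux; have [_] := H0 i x Ux; apply: le_trans; exact: rnorm_ge0.
pose fix g m : 'I_n -> V -> C R := if m is m'.+1 then fun i x => p0 i x + T (g m') i x else p0.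
pose h m : R := 2^-1 ^+ m.
have h0 m : 0 <= h m by rewrite exprn_ge0 // invr_ge0.
have hS m : h m = h m.+1 + h m.+1 by rewrite /h exprSr; field.
have gb m : hol_bounded (K * (2 - h m)) (g m).
  elim: m => [|m IH] i x Ux.
    by rewrite /h expr0 (_ : 2 - 1 = 1) ?mulr1; [exact: H0|ring].
  have hm : h m <= 1 by rewrite /h exprn_ile1 ?invr_ge0 // invf_le1 // ler1n.
  have [d1 b1] := H0 i x Ux.
  have [|d2 b2] := T_half _ IH i Ux; first by rewrite mulr_ge0 // subr_ge0 (le_trans hm) // ler1n.
  split; first exact: (differentiableD d1 d2).
  apply: le_trans (rnormD _ _) (le_trans (lerD b1 b2) _); apply: eq_le_of.
  by rewrite (hS m); field.
have gb2 m : hol_bounded (2 * K) (g m).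
  move=> i x Ux; have [d b] := gb m i x Ux; split=> //; apply: le_trans b _.
  have := rho0 i x Ux; have -> : 2 * K * rho x = K * (2 - h m) * rho x + h m * (K * rho x) by ring.
  by move=> c0; rewrite lerDl mulr_ge0.
have dg m i x : U x -> differentiable (g m i) x by move=> Ux; have [] := gb2 m i x Ux.
have K20 : 0 <= 2 * K by rewrite mulr_ge0.
have gd m i x : U x -> rnorm (g m.+1 i x - g m i x) <= h m.+1 * (K * rho x).
  elim: m i x => [|m IH] i x Ux.
    have -> : g 1%N i x - g 0%N i x = T p0 i x by rewrite /= addrC addKr.
    have [_ b] := T_half K0 H0 i Ux; apply: le_trans b (eq_le_of _).
    by rewrite /h expr1; ring.
  have -> : g m.+2 i x - g m.+1 i x = T (fun i x => g m.+1 i x - g m i x) i x.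
    by rewrite (T_sub i K20 (gb2 m.+1) (gb2 m) Ux) /= opprD addrACA subrr add0r.
  have Hm : hol_bounded (K * h m.+1) (fun i x => g m.+1 i x - g m i x).
    move=> j u Uu; split; first exact: (differentiableB (dg _ j u Uu) (dg _ j u Uu)).
    by apply: le_trans (IH j u Uu) (eq_le_of _); ring.
  have [_ b] := T_half (mulr_ge0 K0 (h0 _)) Hm i Ux; apply: le_trans b (eq_le_of _).
  by rewrite /h (exprSr _ m.+1); ring.
have gc m d i x : U x -> rnorm (g (m + d)%N i x - g m i x) <= h m * (K * rho x).
  move=> Ux; have c0 := rho0 i x Ux.
  suff : rnorm (g (m + d)%N i x - g m i x) <= (h m - h (m + d)%N) * (K * rho x).
    by move=> /le_trans; apply; apply: ler_wpM2r => //; rewrite lerBlDr lerDl.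
  elim: d => [|d IH]; first by rewrite addn0 !subrr rnorm0 mul0r.
  rewrite addnS -(subrK (g (m + d)%N i x) (g (m + d).+1 i x)) -addrA.
  apply: le_trans (rnormD _ _) (le_trans (lerD (gd (m + d)%N i x Ux) IH) (eq_le_of _)).
  by rewrite (hS (m + d)%N); ring.
have small (c e : R) : 0 < e -> exists N, forall m, (N <= m)%N -> h m * c <= e.
  move=> e0; have : (fun m => 2^-1 ^+ m * c : R) @ \oo --> (0 * c : R).
    by apply: cvgM; [apply: cvg_expr; rewrite ger0_norm ?invf_lt1 ?ltr1n ?invr_ge0|exact: cvg_cst].
  rewrite mul0r => /cvgrPdist_lt/(_ e e0)[N _ HN]; exists N => m Nm.
  have := HN m Nm; rewrite /= sub0r normrN => /ltW; apply: le_trans; exact: ler_norm.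
have /choice[p Hp] : forall i, exists pi : V -> C R, forall x, U x ->
    forall m, rnorm (pi x - g m i x) <= h m * (K * rho x).
  move=> i.
  have /choice[pi Hpi] : forall x, exists l : C R, U x -> forall m, rnorm (l - g m i x) <= h m * (K * rho x).
    move=> x; have [Ux|nUx] := pselect (U x); last by exists 0.
    have [e e0|l Hl] := @complex_complete R (fun m => g m i x).
      have [N HN] := small (K * rho x) (e / 2) (divr_gt0 e0 (ltr0Sn _ 1)).
      exists N => k l Nk Nl.
      have := gc N (k - N)%N i x Ux; have := gc N (l - N)%N i x Ux; have := HN N (leqnn N).
      rewrite !subnKC // => i1 i2 i3.
      have -> : g k i x - g l i x = (g k i x - g N i x) - (g l i x - g N i x) by ring.
      have := rnormB (g k i x - g N i x) (g l i x - g N i x); lra.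
    exists l => _ m; apply/ler_addgt0Pl => e e0.
    have [N HN] := Hl e e0; have := HN (m + N)%N (leq_addl _ _); have := gc m N i x Ux.
    move=> i1 i2; have -> : l - g m i x = (g (m + N)%N i x - g m i x) - (g (m + N)%N i x - l) by ring.
    by apply: le_trans (rnormB _ _) _; rewrite addrC lerD.
  by exists pi => x Ux; exact: Hpi.
have dp i x : U x -> differentiable (p i) x.
  move=> Ux; have [r [M [r0 HM]]] := rho_loc Ux.
  apply: (@weierstrass _ _ _ _ r) => // e e0.
  have [N HN] := small (K * M) e e0; exists (g N i) => u ux; have [Uu uM] := HM u ux.
    exact: dg.
  apply: le_trans (Hp i u Uu N) (le_trans _ (HN N (leqnn N))).
  by apply: ler_wpM2l => //; apply: ler_wpM2l.
have pb : hol_bounded (2 * K) p.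
  move=> i x Ux; split; first exact: dp.
  have := Hp i x Ux 0%N; have [_ b0] := H0 i x Ux.
  rewrite /h expr0 mul1r => b1; rewrite -(subrK (g 0%N i x) (p i x)).
  by apply: le_trans (rnormD _ _) (le_trans (lerD b1 b0) (eq_le_of _)); ring.
exists p => // i x Ux; apply/eqP; rewrite -subr_eq0 -rnorm_eq0 eq_le rnorm_ge0 andbT.
apply: (@le_half_pow _ (K * rho x)) => m.
have Hm : hol_bounded (K * h m) (fun i x => p i x - g m i x).
  move=> j u Uu; split; first exact: (differentiableB (dp j u Uu) (dg _ j u Uu)).
  by apply: le_trans (Hp j u Uu m) (eq_le_of _); ring.
have [_ b] := T_half (mulr_ge0 K0 (h0 _)) Hm i Ux; move: b.
rewrite (T_sub i K20 pb (gb2 m) Ux) => b.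
have -> : p i x - (p0 i x + T p i x) = (p i x - g m.+1 i x) - (T p i x - T (g m) i x) by rewrite /=; ring.
apply: le_trans (rnormB _ _) (le_trans (lerD (Hp i x Ux m.+1) b) (eq_le_of _)).
by rewrite -/(h m) (hS m); field.
Qed.

End FixedPoint.

(** * Linear differential equations with a parameter *)

Lemma diff_eq_on (R : realType) (V : normedModType (C R)) (D : set V) (f g : V -> C R) (x : V) : open D -> D x ->
  (forall v, D v -> f v = g v) -> differentiable g x ->
  differentiable f x /\ 'd f x = 'd g x :> (V -> C R).
Proof.
move=> oD Dx fg dg; have [K K0 HK] := linear_rnorm_bound (diff_continuous dg).
apply: (@rnorm_differentiable _ _ _ _ _ K); [exact: linearP|exact: HK|] => e e0.
have /nbhs_rnormP[r r0 Hr] : nbhs x D by exact: open_nbhs_nbhs.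
have [d d0 Hd] := differentiable_rnorm dg e0.
exists (Num.min r d) => [|h]; first by rewrite lt_min r0 d0.
rewrite lt_min => /andP[hr hd]; rewrite !fg //; first exact: Hd.
by apply: Hr; rewrite addrC addKr.
Qed.

Section LinearODE.
Variables (R : realType) (n : nat).
Local Notation E := (C R * C R)%type.
Implicit Types (x u : E) (i k : 'I_n) (y : 'I_n -> E -> C R) (A : 'I_n -> 'I_n -> E -> C R).

Definition row_app A y i x : C R := \sum_k A i k x * y k x.

Lemma differentiable_row_app A y i x : (forall k, differentiable (A i k) x) ->
  (forall k, differentiable (y k) x) -> differentiable (row_app A y i) x.
Proof.
move=> dA dy.
have -> : row_app A y i = \sum_k (fun x => A i k x * y k x) by apply/funext => u; rewrite fct_sumE.
by apply: differentiable_sum => k; apply: differentiableM; [exact: dA|exact: dy].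
Qed.

Lemma row_appB A y z i :
  row_app A (fun k x => y k x - z k x) i = fun x => row_app A y i x - row_app A z i x.
Proof.
by apply/funext => x; rewrite /row_app -sumrB; apply: eq_bigr => k _; rewrite mulrBr.
Qed.

Definition ode A y x := forall i, differentiable (y i) x /\ D1 (y i) x = row_app A y i x.

Definition hseg (x : E) (w : C R) (t : R) : E := x + t%:C *: ((w - x.1, 0) : E).

Lemma hseg0 x w : hseg x w 0 = x.
Proof. by rewrite /hseg scale0r addr0. Qed.

Lemma hseg1 x w : hseg x w 1 = (w, x.2).
Proof.
by apply: injective_projections; rewrite /hseg /= ?scale1r ?addr0 // addrC subrK.
Qed.

Lemma continuous_hseg x w : continuous (hseg x w).
Proof.
move=> t; apply/cvg_rnormP => e e0; apply/nbhs_ballP.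
pose d : E := (w - x.1, 0).
have d0 : 0 < rnorm d + 1 by rewrite ltr_wpDl ?rnorm_ge0.
exists (e / (rnorm d + 1)) => [|s /=]; first by rewrite /= divr_gt0.
rewrite /ball /= distrC ltr_pdivlMr // => st.
rewrite /hseg opprD addrACA subrr add0r -scalerBl -rmorphB rnormZ rnorm_real.
by apply: le_lt_trans st; rewrite ler_wpM2l // lerDl.
Qed.

Lemma continuous_sum (T : topologicalType) (I : Type) (s : seq I) (f : I -> T -> R) (t : T) :
  (forall j : I, {for t, continuous (f j)}) -> {for t, continuous (fun t => \sum_(j <- s) f j t)}.
Proof.
move=> cf; elim: s => [|j s IH].
  rewrite (_ : (fun t => _) = fun=> 0); first exact: cst_continuous.
  by apply/funext => u; rewrite big_nil.
rewrite (_ : (fun t => _) = fun t => f j t + \sum_(k <- s) f k t).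
  by apply: continuousD; [exact: cf|exact: IH].
by apply/funext => u; rewrite big_cons.
Qed.

Lemma is_derive_cast (f : R -> R) (t l l' : R) : is_derive t 1 f l -> l = l' -> is_derive t 1 f l'.
Proof. by move=> df <-. Qed.

Lemma sum_sqr_le (a : 'I_n -> R) : (forall i, 0 <= a i) ->
  \sum_i \sum_k a i * a k <= n%:R * \sum_i a i ^+ 2.
Proof.
move=> a0.
have H : \sum_i \sum_k a i * a k <= \sum_(i < n) \sum_(k < n) (a i ^+ 2 / 2 + a k ^+ 2 / 2).
  apply: ler_sum => i _; apply: ler_sum => k _.
  have := sqr_ge0 (a i - a k); rewrite sqrrB; lra.
apply: le_trans H (eq_le_of _).
under eq_bigr => i _ do rewrite big_split /= sumr_const card_ord -!mulr_suml.
rewrite big_split /= sumr_const card_ord sumrMnl -mulr_suml.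
by rewrite -mulr_natl -mulr_natl; field.
Qed.

(** Gronwall's argument on the segment, for the sum [q] of the squared moduli: [q' <= C0 q], so
    [exp (- C0 t) q] does not increase from its initial value 0. *)
Lemma ode_unique A y x w :
  (forall t : R, 0 <= t <= 1 -> ode A y (hseg x w t)) ->
  (forall t : R, 0 <= t <= 1 -> forall i k, {for hseg x w t, continuous (A i k)}) ->
  (forall i, y i x = 0) -> forall i, y i (w, x.2) = 0.
Proof.
move=> Hy cA y0.
pose b t := \sum_i \sum_k rnorm (A i k (hseg x w t)).
have cb t : 0 <= t <= 1 -> {for t, continuous b}.
  move=> t01; apply: continuous_sum => i; apply: continuous_sum => k.
  apply: continuous_rnorm; apply: (continuous_comp (@continuous_hseg x w t)); exact: cA.
have [|c c01 bc] := @EVT_max _ b 0 1 ler01.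
  by apply: continuous_in_subspaceT => t; rewrite inE /= in_itv /=; exact: cb.
pose M := b c.
have AM t i k : 0 <= t <= 1 -> rnorm (A i k (hseg x w t)) <= M.
  move=> t01; apply: le_trans (bc t _); last by rewrite in_itv.
  rewrite /b (bigD1 i) //= (bigD1 k) //= -addrA lerDl addr_ge0 //.
    by apply: sumr_ge0 => ? _; exact: rnorm_ge0.
  by apply: sumr_ge0 => ? _; apply: sumr_ge0 => ? _; exact: rnorm_ge0.
have b0 t : 0 <= b t by apply: sumr_ge0 => i _; apply: sumr_ge0 => k _; exact: rnorm_ge0.
pose d : E := (w - x.1, 0).
pose N := rnorm (w - x.1); have N0 : 0 <= N by exact: rnorm_ge0.
pose re i t := complex.Re (y i (hseg x w t)); pose im i t := complex.Im (y i (hseg x w t)).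
pose re' i t := complex.Re ('d (y i) (hseg x w t) d); pose im' i t := complex.Im ('d (y i) (hseg x w t) d).
pose a i t := rnorm (y i (hseg x w t)).
(* [N] is the length of the segment and [M] bounds the coefficients on it. One factor 2 comes from
   differentiating squares, the other from treating real and imaginary parts separately, and [n]
   from [sum_sqr_le]. *)
pose C0 := 4 * N * M * n%:R.
pose q t := \sum_i (re i t ^+ 2 + im i t ^+ 2).
pose q' t := \sum_i (2 * (re i t * re' i t + im i t * im' i t)).
have qE t : q t = \sum_i a i t ^+ 2 by apply: eq_bigr => i _; rewrite /a rnorm_sqr.
have dq (t : R) : 0 <= t <= 1 -> is_derive t 1 q (q' t).
  move=> t01.
  have := @is_derive_sum _ _ _ n (fun i t => re i t ^+ 2 + im i t ^+ 2) t 1 (fun i => 2 * (re i t * re' i t + im i t * im' i t)).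
  rewrite (_ : \sum_(i < n) (fun t => re i t ^+ 2 + im i t ^+ 2) = q); last first.
    by apply/funext => u; rewrite fct_sumE.
  apply=> i; have [dy _] := Hy t t01 i.
  have d1 : is_derive t 1 (re i) (re' i t) by exact: is_derive_Re.
  have d2 : is_derive t 1 (im i) (im' i t) by exact: is_derive_Im.
  have d3 := is_deriveM d1 d1; have d4 := is_deriveM d2 d2.
  have := is_deriveD d3 d4.
  rewrite (_ : re i * re i + im i * im i = fun t => re i t ^+ 2 + im i t ^+ 2); last first.
    by apply/funext => u; rewrite !fctE !expr2.
  by move=> /is_derive_cast; apply; rewrite -![_ *: _]/(_ * _); ring.
have q'q t : 0 <= t <= 1 -> q' t <= C0 * q t.
  move=> t01.
  have d'b i : rnorm ('d (y i) (hseg x w t) d) <= N * (M * \sum_k a k t).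
    rewrite /d diff_fst rnormM; apply: ler_wpM2l => //.
    have [_ ->] := Hy t t01 i; apply: le_trans (rnorm_sum _ _ _) _.
    rewrite mulr_sumr; apply: ler_sum => k _; rewrite rnormM.
    by apply: ler_wpM2r; [exact: rnorm_ge0|exact: AM].
  apply: le_trans (_ : \sum_i 4 * (a i t * (N * (M * \sum_k a k t))) <= _).
    apply: ler_sum => i _.
    have r1 : re i t * re' i t <= a i t * (N * (M * \sum_k a k t)).
      apply: le_trans (ler_norm _) _; rewrite normrM; apply: ler_pM => //.
        exact: Re_le_rnorm.
      exact: le_trans (Re_le_rnorm _) (d'b i).
    have r2 : im i t * im' i t <= a i t * (N * (M * \sum_k a k t)).
      apply: le_trans (ler_norm _) _; rewrite normrM; apply: ler_pM => //.
        exact: Im_le_rnorm.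
      exact: le_trans (Im_le_rnorm _) (d'b i).
    lra.
  have a0 i : 0 <= a i t by exact: rnorm_ge0.
  apply: le_trans (_ : 4 * N * M * (\sum_i \sum_k a i t * a k t) <= _).
    apply: eq_le_of; set S := \sum_k a k t.
    have -> : \sum_i \sum_k a i t * a k t = S * S.
      by rewrite {1}/S mulr_suml; apply: eq_bigr => i _; rewrite mulr_sumr.
    have -> : 4 * N * M * (S * S) = (4 * N * M * S) * \sum_k a k t by rewrite -/S; ring.
    rewrite [RHS]mulr_sumr; apply: eq_bigr => i _; ring.
  rewrite qE /C0 -(mulrA (4 * N * M)); apply: ler_wpM2l; last exact: sum_sqr_le.
  by rewrite !mulr_ge0 // /M.
pose g t := expR (- C0 * t) * q t.
have dg (t : R) : 0 <= t <= 1 -> is_derive t 1 g (expR (- C0 * t) * (q' t - C0 * q t)).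
  move=> t01; have d1 := dq t t01.
  have d2 : is_derive t 1 (fun t => expR (- C0 * t)) (expR (- C0 * t) * - C0).
    have d3 : is_derive t 1 (fun t => - C0 * t) (- C0) by apply: is_derive_eq; exact: mulr1.
    have d4 := is_derive_expR (- C0 * t).
    by have := @is_derive1_comp _ expR (fun t => - C0 * t) t _ _ d4 d3; move=> /is_derive_cast; apply; rewrite mulrC.
  have := is_deriveM d2 d1.
  by move=> /is_derive_cast; apply; rewrite -![_ *: _]/(_ * _); ring.
have g0 : g 0 = 0.
  rewrite /g; suff -> : q 0 = 0 by rewrite mulr0.
  rewrite /q big1 // => i _.
  by rewrite /re /im hseg0 y0 /= expr0n addr0.
have g1 : g 1 <= 0.
  have := @derive_le _ g _ (fun=> 0) (fun=> 0) 0 1 ler01 dg.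
  rewrite g0 subrr subr0; apply => t t01.
  by rewrite pmulr_rle0 ?expR_gt0 // subr_le0; exact: q'q.
have q1 : q 1 = 0.
  apply/eqP; rewrite eq_le; apply/andP; split.
    by move: g1; rewrite /g pmulr_rle0 ?expR_gt0.
  by rewrite qE; apply: sumr_ge0 => i _; exact: sqr_ge0.
move=> i; apply/eqP; rewrite -rnorm_eq0 -sqrf_eq0; apply/eqP.
have := q1; rewrite qE => /eqP; rewrite psumr_eq0; last by move=> ? _; exact: sqr_ge0.
by move=> /allP/(_ i (mem_index_enum _))/eqP; rewrite /a hseg1.
Qed.

End LinearODE.

(** * The initial value problem on a half-plane *)

Section InitialValueProblem.
Variables (R : realType) (n : nat) (m : R) (Omega : set (C R)) (w0 : C R).
Local Notation E := (C R * C R)%type.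
Implicit Types (x u : E) (i k : 'I_n) (s t : R).
Variable A : 'I_n -> 'I_n -> E -> C R.
Hypothesis oO : open Omega.
Hypothesis mw0 : m < complex.Re w0.

Definition half_plane : set E := [set x | m < complex.Re x.1 /\ Omega x.2].
Local Notation U := half_plane.

Hypothesis dA : forall i k x, U x -> differentiable (A i k) x.

Lemma open_half_plane : open U.
Proof.
rewrite openE => x [/= mx Ox]; apply/nbhs_rnormP.
have /nbhs_rnormP[r r0 Hr] : nbhs x.2 Omega by exact: open_nbhs_nbhs.
exists (Num.min (complex.Re x.1 - m) r) => [|u]; first by rewrite lt_min subr_gt0 mx r0.
rewrite lt_min => /andP[u1 u2]; split.
  have := le_lt_trans (Re_le_rnorm _) (le_lt_trans (rnorm_fst (u - x)) u1).
  by rewrite raddfB /= ltr_norml => /andP[+ _]; rewrite opprB ltrBrDl addrC subrK.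
by apply: Hr; apply: le_lt_trans u2; exact: (rnorm_snd (u - x)).
Qed.

Definition rseg t x : E := (w0 + t%:C * (x.1 - w0), x.2).

Lemma rseg_in t x : 0 <= t <= 1 -> U x -> U (rseg t x).
Proof.
move=> /andP[t0 t1] [/= mx Ox]; split => //=.
have -> : w0 + t%:C * (x.1 - w0) = (1 - t)%:C * w0 + t%:C * x.1 by rewrite rmorphB /=; ring.
rewrite raddfD.
have E1 (a : R) (z : C R) : complex.Re (a%:C * z) = a * complex.Re z by case: z => p q /=; rewrite mul0r subr0.
change (m < complex.Re ((1 - t)%:C * w0) + complex.Re (t%:C * x.1)).
rewrite !E1; have [->|tn0] := eqVneq t 0; first by rewrite subr0 mul1r mul0r addr0.
have t0' : 0 < t by rewrite lt_def tn0.
have i1 : (1 - t) * m <= (1 - t) * complex.Re w0 by rewrite ler_wpM2l ?subr_ge0 // ltW.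
have i2 : t * m < t * complex.Re x.1 by rewrite ltr_pM2l.
lra.
Qed.

Lemma rnorm_rseg t x u : 0 <= t -> rnorm (rseg t u - rseg t x) <= (t + 1) * rnorm (u - x).
Proof.
move=> t0; rewrite rnorm_pair ge_max; apply/andP; split => /=.
  have -> : w0 + t%:C * (u.1 - w0) - (w0 + t%:C * (x.1 - w0)) = t%:C * (u - x).1 by rewrite /=; ring.
  rewrite rnormM rnorm_nneg // mulrDl mul1r; apply: le_trans (ler_wpM2l t0 (rnorm_fst _)) _.
  by rewrite lerDl rnorm_ge0.
apply: le_trans (rnorm_snd (u - x)) _; rewrite mulrDl mul1r lerDr.
by rewrite mulr_ge0 // rnorm_ge0.
Qed.

Lemma rseg_dist t t' x : rnorm (rseg t x - rseg t' x) <= `|t - t'| * rnorm (x.1 - w0).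
Proof.
rewrite rnorm_pair ge_max /= subrr rnorm0 mulr_ge0 ?rnorm_ge0 // andbT.
have -> : w0 + t%:C * (x.1 - w0) - (w0 + t'%:C * (x.1 - w0)) = (t - t')%:C * (x.1 - w0) by rewrite rmorphB /=; ring.
by rewrite rnormM rnorm_real.
Qed.

Definition coef_size x : R := \sum_i \sum_k rnorm (A i k x).

Lemma size_ge0 x : 0 <= coef_size x.
Proof. by apply: sumr_ge0 => i _; apply: sumr_ge0 => k _; exact: rnorm_ge0. Qed.

Lemma continuous_coef_size x : U x -> {for x, continuous coef_size}.
Proof.
move=> Ux; apply: continuous_sum => i; apply: continuous_sum => k.
by apply: continuous_rnorm; apply: differentiable_continuous; exact: dA.
Qed.

(** Compactness of [[0, 1]]. This is the local uniformity in the end point that holomorphy of the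
    integrals along these segments requires. *)
Lemma tube x : U x -> exists r b : R, 0 < r /\ forall u, rnorm (u - x) < r ->
  forall t, 0 <= t <= 1 -> U (rseg t u) /\ coef_size (rseg t u) <= b.
Proof.
move=> Ux.
have rad t p : U p -> exists r : R, 0 < r /\ forall u, rnorm (u - p) < r -> U u /\ `|coef_size u - coef_size p| < 1.
  move=> Up; have /nbhs_rnormP[r1 r10 H1] : nbhs p U by apply: open_nbhs_nbhs; split; [exact: open_half_plane|].
  have /cvgrPdist_lt/(_ 1 ltr01)/nbhs_rnormP[r2 r20 H2] := continuous_coef_size Up.
  exists (Num.min r1 r2); split; first by rewrite lt_min r10 r20.
  by move=> u; rewrite lt_min => /andP[/H1 Uu /H2]; rewrite distrC.
have loc t : 0 <= t <= 1 -> exists2 d : R, 0 < d & forall t' u, 0 <= t' -> `|t' - t| < d -> rnorm (u - x) < d ->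
    U (rseg t' u) /\ `|coef_size (rseg t' u) - coef_size (rseg t x)| < 1.
  move=> t01; have [r [r0 Hr]] := rad t _ (rseg_in t01 Ux).
  pose c := t + 3 + rnorm (x.1 - w0).
  have /andP[t0 t1] := t01.
  have c0 : 0 < c by rewrite /c; have := rnorm_ge0 (x.1 - w0); lra.
  exists (Num.min 1 (r / c)) => [|t' u t'0]; first by rewrite lt_min ltr01 divr_gt0.
  rewrite !lt_min => /andP[i1 i2] /andP[_ i3].
  apply: Hr; have -> : rseg t' u - rseg t x = (rseg t' u - rseg t' x) + (rseg t' x - rseg t x) by rewrite addrA subrK.
  apply: le_lt_trans (rnormD _ _) _.
  apply: le_lt_trans (lerD (rnorm_rseg x u t'0) (rseg_dist t' t x)) _.
  have j1 : (t' + 1) * rnorm (u - x) <= (t + 2) * rnorm (u - x).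
    apply: ler_wpM2r; first exact: rnorm_ge0.
    by have := ler_norm (t' - t); lra.
  have j2 : (t + 2) * rnorm (u - x) <= (t + 2) * (r / c) by apply: ler_wpM2l; [lra|exact: ltW].
  have j3 : `|t' - t| * rnorm (x.1 - w0) <= r / c * rnorm (x.1 - w0).
    by apply: ler_wpM2r; [exact: rnorm_ge0|exact: ltW].
  have j4 : r = (t + 2) * (r / c) + r / c * rnorm (x.1 - w0) + r / c.
    by rewrite /c; field; rewrite -/c gt_eqF.
  have j5 : 0 < r / c by rewrite divr_gt0.
  lra.
have [c c01 Hc] : exists2 c, c \in `[0, 1] & forall t, t \in `[0, 1] -> coef_size (rseg t x) <= coef_size (rseg c x).
  apply: (@EVT_max _ (fun t => coef_size (rseg t x))) => //.
  apply: continuous_in_subspaceT => t; rewrite inE /= => t01.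
  apply: (@continuous_comp _ _ _ (fun t => rseg t x) coef_size).
    apply/cvg_rnormP => e e0; apply/nbhs_ballP.
    have d0 : 0 < rnorm (x.1 - w0) + 1 by rewrite ltr_wpDl ?rnorm_ge0.
    exists (e / (rnorm (x.1 - w0) + 1)) => [|s /=]; first by rewrite /= divr_gt0.
    rewrite /ball /= distrC ltr_pdivlMr // => st; apply: le_lt_trans (rseg_dist _ _ _) _.
    by apply: le_lt_trans st; rewrite ler_wpM2l // lerDl.
  by apply: continuous_coef_size; apply: rseg_in => //; move: t01; rewrite in_itv.
have /compact_near_coveringP nc := @segment_compact R 0 1.
have /nbhs_rnormP[r r0 Hr] : \forall u \near x, `[0, 1]%classic `<=`
    (fun t => 0 <= t -> U (rseg t u) /\ coef_size (rseg t u) <= coef_size (rseg c x) + 1).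
  apply: (nc E (nbhs x) (fun u t => 0 <= t -> U (rseg t u) /\ coef_size (rseg t u) <= coef_size (rseg c x) + 1) _) => t.
  rewrite /= in_itv /= => t01; have [d d0 Hd] := loc t t01.
  exists ([set t' | `|t' - t| < d], [set u | rnorm (u - x) < d]).
    split; last by change (nbhs x [set u | rnorm (u - x) < d]); apply/nbhs_rnormP; exists d.
    change (nbhs t [set t' | `|t' - t| < d]).
    by apply/nbhs_ballP; exists d => // t'; rewrite /ball /= distrC.
  move=> [t' u] /= [i1 i2] t'0; have [Uu] := Hd t' u t'0 i1 i2; split=> //.
  have := Hc t; rewrite in_itv /= => /(_ t01).
  by move: b; rewrite ltr_distl => /andP[_]; lra.
exists r, (coef_size (rseg c x) + 1); split=> // u ux t t01.
by apply: (Hr u ux t); [rewrite /= in_itv|case/andP: t01].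
Qed.

Lemma rseg_rseg t t' x : rseg t' (rseg t x) = rseg (t' * t) x.
Proof. by apply: injective_projections => //=; rewrite rmorphM /=; ring. Qed.

(** With the supremum over the whole segment, this size does not increase along the radial flow,
    whereas [coef_size] may. *)
Definition size_sup x : R := sup [set coef_size (rseg t x) | t in [set t : R | 0 <= t <= 1]].

Lemma size_le_sup t x : U x -> 0 <= t <= 1 -> coef_size (rseg t x) <= size_sup x.
Proof.
move=> Ux t01; apply: ub_le_sup; last by exists t.
have [r [b [r0 Hb]]] := tube Ux; exists b => _ [t' /= t'01 <-].
by have [] := Hb x _ t' t'01; rewrite ?subrr ?rnorm0.
Qed.

Lemma size_sup_ge0 x : U x -> 0 <= size_sup x.
Proof.
move=> Ux; apply: le_trans (size_ge0 (rseg 0 x)) (size_le_sup Ux _).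
by rewrite lexx ler01.
Qed.

Lemma size_sup_le x (b : R) : (forall t, 0 <= t <= 1 -> coef_size (rseg t x) <= b) -> size_sup x <= b.
Proof.
move=> H; apply: ge_sup; last by move=> _ [t /= t01 <-]; exact: H.
by exists (coef_size (rseg 0 x)), 0 => //=; rewrite lexx ler01.
Qed.

Lemma size_sup_rseg t x : U x -> 0 <= t <= 1 -> size_sup (rseg t x) <= size_sup x.
Proof.
move=> Ux /andP[t0 t1]; apply: size_sup_le => t' /andP[t'0 t'1]; rewrite rseg_rseg.
by apply: size_le_sup => //; rewrite mulr_ge0 //= mulr_ile1.
Qed.

Definition rad s (w : C R) : C R := w0 + (expR (- s))%:C * (w - w0).
(** A Bielecki weight: the iteration contracts on the whole half-plane at once. The 4 in the
    exponent leads to [tau = rad_weight / 4], hence to the ratio 1/2 after the factor 2 of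
    [flow_bound]. *)
Definition rad_weight x : R := expR (4 * (size_sup x * rnorm (x.1 - w0))).

Lemma expRN01 s : 0 <= s -> 0 <= expR (- s) <= 1.
Proof. by move=> s0; rewrite expR_ge0 -expR0 ler_expR oppr_le0. Qed.

Lemma flow_rad s x : flow_map rad s x = rseg (expR (- s)) x.
Proof. by []. Qed.

Lemma rad_majorant (c : R) : 0 <= c ->
  let h s := c * expR (- s) * expR (4 * (c * expR (- s))) in
  let H s := - (expR (4 * (c * expR (- s))) / 4) in
  [/\ forall s : R, 0 <= s -> is_derive s 1 H (h s), forall s : R, 0 <= s -> H s <= 0 &
      forall s : R, 0 <= s -> h s <= c * expR (4 * c)].
Proof.
move=> c0 h H; split=> s s0.
- have d1 : is_derive s 1 (fun s : R => - s) (-1) by apply: is_derive_eq.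
  have d2 : is_derive s 1 (fun s => expR (- s)) (- expR (- s)).
    have := @is_derive1_comp _ expR (fun s => - s) s _ _ (is_derive_expR _) d1.
    by move=> /is_derive_cast; apply; rewrite mulrN1.
  have d3 : is_derive s 1 (fun s => 4 * (c * expR (- s))) (4 * (c * - expR (- s))).
    by have := is_deriveZ 4 (is_deriveZ c d2).
  have d4 := @is_derive1_comp _ expR _ s _ _ (is_derive_expR _) d3.
  have d5 := is_deriveZ (- 4^-1) d4.
  have -> : H = fun s => - 4^-1 * expR (4 * (c * expR (- s))) by apply/funext => u; rewrite /H; ring.
  by apply: (is_derive_cast d5); rewrite /h -[_ *: _]/(_ * _); field.
- by rewrite /H oppr_le0 divr_ge0 // expR_ge0.
- have /andP[e0 e1] := expRN01 s0; have ce : c * expR (- s) <= c by rewrite ler_piMr.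
  by rewrite /h ler_pM ?mulr_ge0 ?expR_ge0 // ler_expR ler_wpM2l.
Qed.

(** Allowing any [c] above the value at [x] lets one majorant serve all orbits that start near a
    point, and also the single orbit with its sharp value. *)
Lemma rad_weight_bound s x (c : R) : U x -> 0 <= s -> size_sup x * rnorm (x.1 - w0) <= c ->
  coef_size (flow_map rad s x) * rad_weight (flow_map rad s x) * rnorm (w0 - (rad s x.1)) <=
  c * expR (- s) * expR (4 * (c * expR (- s))).
Proof.
move=> Ux s0 cx; have e01 := expRN01 s0; have /andP[e0 e1] := e01.
have n1 : rnorm (w0 - rad s x.1) = expR (- s) * rnorm (x.1 - w0).
  by rewrite /rad opprD addrA subrr add0r rnormN rnormM rnorm_nneg.
have n2 : rnorm ((flow_map rad s x).1 - w0) = expR (- s) * rnorm (x.1 - w0).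
  by rewrite -n1 rnormBC.
have b1 : coef_size (flow_map rad s x) <= size_sup x by rewrite flow_rad; exact: size_le_sup.
have b2 : size_sup (flow_map rad s x) <= size_sup x by rewrite flow_rad; exact: size_sup_rseg.
have N0 := rnorm_ge0 (x.1 - w0).
rewrite n1 mulrAC; apply: ler_pM.
- by rewrite mulr_ge0 ?size_ge0 // mulr_ge0.
- exact: expR_ge0.
- apply: le_trans (_ : size_sup x * rnorm (x.1 - w0) * expR (- s) <= _); last by rewrite ler_wpM2r.
  by rewrite mulrAC -mulrA; apply: ler_wpM2r => //; rewrite mulr_ge0.
- rewrite ler_expR n2; apply: ler_wpM2l => //.
  apply: le_trans (_ : size_sup x * rnorm (x.1 - w0) * expR (- s) <= _); last by rewrite ler_wpM2r.
  by rewrite mulrA mulrAC; apply: ler_wpM2r => //; apply: ler_wpM2r.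
Qed.

(** The orbit of [x] follows the segment to [w0], which it approaches in infinite time; with
    exponent 0, [flow_op] is the integral from [w0] to [x]. *)
Lemma flow_data_rad : flow_data U rad (fun w => w0 - w) (fun=> 0)
  (fun x => coef_size x * rad_weight x) (fun x => rad_weight x / 4).
Proof.
split.
- exact: open_half_plane.
- by move=> s x s0 Ux; rewrite flow_rad; apply: rseg_in => //; exact: expRN01.
- by move=> y; rewrite /rad oppr0 expR0 mul1r addrC subrK.
- by move=> s t y _ _; rewrite /rad opprD expRD rmorphM /=; ring.
- move=> s y; apply: differentiableD; first exact: differentiable_cst.
  apply: differentiableM; first exact: differentiable_cst.
  by apply: differentiableB; [exact: ex_diff|exact: differentiable_cst].
- move=> y s; rewrite /rad.
  have c1 : {for s, continuous (fun s : R => (expR (- s))%:C : C R)}.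
    apply: (@continuous_complex _ _ (fun s => expR (- s)) (fun=> 0)); last exact: cst_continuous.
    apply: (@continuous_comp _ _ _ (fun s : R => - s) expR); first exact: opp_continuous.
    exact: continuous_expR.
  apply: continuousD; first exact: (@ccont_cst _ w0).
  by apply: continuousM; [exact: c1|exact: (@ccont_cst _ (y - w0))].
- move=> y e e0; have d0 : 0 < rnorm (y - w0) + 1 by rewrite ltr_wpDl ?rnorm_ge0.
  have [d dd0 Hd] := is_derive_eps (is_derive_expR 0) (divr_gt0 e0 d0).
  exists d => // s s0 sd; have := Hd (- s); rewrite normrN ger0_norm // => /(_ sd).
  rewrite add0r expR0 mul1r opprK => Hs.
  rewrite /rad (_ : w0 + _ - y - _ = (expR (- s) - 1 + s)%:C * (y - w0)); last first.
    by rewrite rmorphD rmorphB /=; ring.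
  rewrite rnormM rnorm_real; apply: le_trans (ler_wpM2r (rnorm_ge0 _) Hs) _.
  set N := rnorm _; have -> : e / (N + 1) * s * N = (e * s) * (N / (N + 1)) by ring.
  rewrite ler_piMr //; first by rewrite mulr_ge0 // ltW.
  by rewrite ler_pdivrMr // mul1r lerDl.
- by move=> y; apply: differentiableB; [exact: differentiable_cst|exact: ex_diff].
- by move=> x _; exact: differentiable_cst.
- by move=> s x _ _.
- by move=> x; rewrite mulr_ge0 ?size_ge0 ?expR_ge0.
- move=> x Ux; have [r [b [r0 Hb]]] := tube Ux.
  have xx : rnorm (x - x) < r by rewrite subrr rnorm0.
  have b0 : 0 <= b.
    have [|_] := Hb x xx 0; first by rewrite lexx ler01.
    by apply: le_trans; exact: size_ge0.
  pose c := b * (rnorm (x.1 - w0) + r).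
  have c0 : 0 <= c by rewrite mulr_ge0 // addr_ge0 ?rnorm_ge0 // ltW.
  have [dH HB hM] := rad_majorant c0.
  exists r, (fun s => c * expR (- s) * expR (4 * (c * expR (- s)))), (fun s => - (expR (4 * (c * expR (- s))) / 4)), 0, (c * expR (4 * c)).
  split=> // u ux; have Uu : U u.
    have [|+ _] := Hb u ux 1; first by rewrite ler01 lexx.
    by rewrite /rseg mul1r addrC subrK; case: (u).
  split=> // s s0; apply: rad_weight_bound => //.
  apply: ler_pM; [exact: size_sup_ge0|exact: rnorm_ge0| |].
    by apply: size_sup_le => t t01; have [] := Hb u ux t t01.
  have -> : u.1 - w0 = (u - x).1 + (x.1 - w0) by rewrite /= addrA subrK.
  apply: le_trans (rnormD _ _) _; rewrite addrC lerD2l.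
  exact: le_trans (rnorm_fst _) (ltW ux).
- move=> x Ux; pose c := size_sup x * rnorm (x.1 - w0).
  have c0 : 0 <= c by rewrite mulr_ge0 ?size_sup_ge0 ?rnorm_ge0.
  have [dH HB hM] := rad_majorant c0.
  exists (fun s => c * expR (- s) * expR (4 * (c * expR (- s)))), (fun s => - (expR (4 * (c * expR (- s))) / 4)), 0, (c * expR (4 * c)).
  split=> //; first by move=> s s0; exact: rad_weight_bound.
  by rewrite oppr0 expR0 mulr1 sub0r opprK.
Qed.

Definition rad_op (p : 'I_n -> E -> C R) i := flow_op rad (fun w => w0 - w) (fun=> 0) (row_app A p i).

Lemma row_app_size (rho : E -> R) (K : R) p i x : hol_bounded U rho K p -> U x ->
  rnorm (row_app A p i x) <= K * rho x * coef_size x.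
Proof.
move=> Hp Ux; apply: le_trans (rnorm_sum _ _ _) _.
have c0 : 0 <= K * rho x.
  by have [_ b] := Hp i x Ux; exact: le_trans (rnorm_ge0 _) b.
apply: le_trans (_ : \sum_k K * rho x * rnorm (A i k x) <= _).
  apply: ler_sum => k _; rewrite rnormM mulrC; apply: ler_wpM2r; first exact: rnorm_ge0.
  by have [] := Hp k x Ux.
rewrite -mulr_sumr; apply: ler_wpM2l => //.
rewrite /coef_size [leRHS](bigD1 i) //= lerDl; apply: sumr_ge0 => j _.
by apply: sumr_ge0 => k _; exact: rnorm_ge0.
Qed.

Lemma fundamental_solution : exists Y : 'I_n -> 'I_n -> E -> C R, forall j,
  (forall x, U x -> ode A (Y j) x) /\
  forall i omega, Omega omega -> Y j i (w0, omega) = (i == j)%:R.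
Proof.
suff H j : exists p : 'I_n -> E -> C R, (forall x, U x -> ode A p x) /\
    forall i omega, Omega omega -> p i (w0, omega) = (i == j)%:R.
  by have /choice[Y HY] := H; exists Y.
pose p0 (i : 'I_n) (x : E) : C R := (i == j)%:R.
have rho1 x : U x -> 1 <= rad_weight x.
  by move=> Ux; rewrite -expR0 ler_expR !mulr_ge0 ?size_sup_ge0 ?rnorm_ge0.
have rloc x : U x -> exists r M : R, 0 < r /\ forall u, rnorm (u - x) < r -> U u /\ rad_weight u <= M.
  move=> Ux; have [r [b [r0 Hb]]] := tube Ux.
  exists r, (expR (4 * (b * (rnorm (x.1 - w0) + r)))); split=> // u ux.
  have Uu : U u.
    have [|+ _] := Hb u ux 1; first by rewrite ler01 lexx.
    by rewrite /rseg mul1r addrC subrK; case: (u).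
  split=> //; rewrite ler_expR; apply: ler_wpM2l => //.
  apply: ler_pM; [exact: size_sup_ge0|exact: rnorm_ge0| |].
    by apply: size_sup_le => t t01; have [] := Hb u ux t t01.
  have -> : u.1 - w0 = (u - x).1 + (x.1 - w0) by rewrite /= addrA subrK.
  apply: le_trans (rnormD _ _) _; rewrite addrC lerD2l.
  exact: le_trans (rnorm_fst _) (ltW ux).
have fdiff K p i u : hol_bounded U rad_weight K p -> U u -> differentiable (row_app A p i) u.
  by move=> Hp Uu; apply: differentiable_row_app => k; [exact: dA|have [] := Hp k u Uu].
have fbound K p i u : hol_bounded U rad_weight K p -> U u ->
    rnorm (row_app A p i u) <= K * (coef_size u * rad_weight u).
  by move=> Hp Uu; apply: le_trans (row_app_size i Hp Uu) (eq_le_of _); ring.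
have [K p K0 Hp i x Ux|K p q i x K0 Hp Hq Ux|||p Hp E1] := @fixpoint_exists R (E : normedModType (C R)) n U rad_weight rloc rad_op _ _ 1 p0.
- have dp := fun u => fdiff K p i u Hp; have bp := fun u => fbound K p i u Hp.
  split; first exact: (differentiable_flow flow_data_rad K0 dp bp).
  by apply: le_trans (flow_bound flow_data_rad K0 dp bp Ux) (eq_le_of _); field.
- have dp := fun u => fdiff K p i u Hp; have bp := fun u => fbound K p i u Hp.
  have dq := fun u => fdiff K q i u Hq; have bq := fun u => fbound K q i u Hq.
  by rewrite /rad_op row_appB (flow_opB flow_data_rad K0 dp bp dq bq Ux).
- exact: ler01.
- move=> i x Ux; split; first exact: differentiable_cst.
  rewrite mul1r; apply: le_trans (rho1 x Ux); rewrite /p0.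
  by case: eqP => _ /=; rewrite ?rnorm1 ?rnorm0.
exists p.
have dp i x : U x -> differentiable (p i) x by move=> Ux; have [] := Hp i x Ux.
have K2 : 0 <= 2 * 1 :> R by rewrite mulr_ge0.
have ode1 i x : U x -> x.1 != w0 -> D1 (p i) x = row_app A p i x.
  move=> Ux xw.
  have dpi := fun u => fdiff _ p i u Hp; have bpi := fun u => fbound _ p i u Hp.
  have dT := differentiable_flow flow_data_rad K2 dpi bpi Ux.
  have dc : differentiable (p0 i) x by exact: differentiable_cst.
  have [_ E2] := diff_eq_on open_half_plane Ux (E1 i) (differentiableD dc dT).
  have X0 : w0 - x.1 != 0 by rewrite subr_eq0 eq_sym.
  have E3 := D1_flow flow_data_rad K2 dpi bpi Ux X0.
  have E4 := diffD_apply ((1, 0) : E) dc dT.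
  have z1 : D1 (p0 i) x = 0 by rewrite /D1 /p0 diff_cst.
  have z2 : D1 (fun=> 0 : C R) x = 0 by rewrite /D1 diff_cst.
  have comb (a b c d e : C R) : a = 0 -> b = d * e + c -> d = 0 -> a + b = c.
    by move=> -> -> ->; rewrite mul0r !add0r.
  by rewrite {1}/D1 E2; apply: etrans E4 _; exact: (comb _ _ _ _ _ z1 E3 z2).
(* The velocity vanishes over [w0], where [D1_flow] says nothing. The equation extends there by
   continuity, since the derivative of a holomorphic function is continuous. *)
have ode2 i x : U x -> D1 (p i) x = row_app A p i x.
  move=> Ux; have [xw|] := eqVneq x.1 w0; last exact: ode1.
  have c1 : {for x, continuous (fun u => D1 (p i) u)}.
    exact: (continuous_diff open_half_plane (dp i) Ux).
  have c2 : {for x, continuous (row_app A p i)}.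
    exact: (differentiable_continuous (fdiff _ p i x Hp Ux)).
  have /nbhs_rnormP[r r0 Hr] : nbhs x U by apply: open_nbhs_nbhs; split; [exact: open_half_plane|].
  apply/eqP; rewrite -subr_eq0; apply/eqP; apply: (@le_eps_eq0 _ _ _ 2) => e e0.
  have /continuous_rnormP/(_ e e0)[d1 d10 H1] := c1.
  have /continuous_rnormP/(_ e e0)[d2 d20 H2] := c2.
  pose t := Num.min (r / 2) (Num.min (d1 / 2) (d2 / 2)).
  have t0 : 0 < t by rewrite !lt_min !divr_gt0.
  pose u : E := (x.1 + t%:C, x.2).
  have un : rnorm (u - x) = t.
    have -> : u - x = (t%:C, 0) by apply: injective_projections; rewrite /= ?subrr // addrC addKr.
    by rewrite rnorm_pair /= rnorm0 max_l ?rnorm_ge0 // rnorm_nneg // ltW.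
  have half (c : R) : 0 < c -> c / 2 < c by move=> c0; rewrite gtr_pMr // invf_lt1 ?ltr1n.
  have ur : rnorm (u - x) < r by rewrite un; apply: le_lt_trans (half r r0); rewrite ge_min lexx.
  have u1 : rnorm (u - x) < d1 by rewrite un; apply: le_lt_trans (half d1 d10); rewrite !ge_min lexx orbT.
  have u2 : rnorm (u - x) < d2 by rewrite un; apply: le_lt_trans (half d2 d20); rewrite !ge_min lexx !orbT.
  have E2 : D1 (p i) u = row_app A p i u.
    apply: ode1; first exact: Hr.
    by rewrite /u /= xw -subr_eq0 addrC addKr -rnorm_eq0 rnorm_nneg ?gt_eqF // ltW.
  have := H1 u u1; have := H2 u u2; rewrite E2 => i1 i2.
  have -> : D1 (p i) x - row_app A p i x = (row_app A p i u - row_app A p i x) - (row_app A p i u - D1 (p i) x) by ring.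
  by apply: le_trans (rnormB _ _) _; rewrite mulr2n mulrDl mul1r; apply: lerD; exact: ltW.
split=> [x Ux i|i omega Oo]; first by split; [exact: dp|exact: ode2].
rewrite E1 /p0 //.
(* The orbit of the base point is constant, so the kernel vanishes and the initial value is that of
   [p0]. *)
suff -> : rad_op p i (w0, omega) = 0 by rewrite addr0.
rewrite /rad_op /flow_op.
have -> : flow_kernel rad (fun w => w0 - w) (fun=> 0) (row_app A p i) (w0, omega) = fun=> 0.
  apply/funext => s; rewrite /flow_kernel /rad /= subrr mulr0 addr0 subrr mulr0.
  by [].
rewrite (is_tintE (l := 0)) ?oppr0 ?mulr0 // => e e0; exists 0 => // s s0.
by rewrite cinteg_cst mul0r subrr rnorm0 ltW.
Qed.

End InitialValueProblem.

(** * Perturbations of diagonal equations *)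

Section Translation.
Variable R : realType.
Local Notation E := (C R * C R)%type.
Implicit Types (x u : E) (y : C R) (s t : R).

(* [H0] is a nonpositive primitive of the nonincreasing function [h0] on [[r, +oo[]. *)
Record profile (r : R) (h0 H0 : R -> R) : Prop := Profile {
  profile_ge0 : forall t, 0 <= h0 t;
  profile_anti : forall s t, r < s -> s <= t -> h0 t <= h0 s;
  profile_prim : forall t, r < t -> is_derive t 1 H0 (h0 t);
  profile_le0 : forall t, r < t -> H0 t <= 0;
  profile_lim : forall e : R, 0 < e -> exists T : R, forall t, T < t -> - e <= H0 t
}.

Variables (Omega V : set (C R)) (N : C R -> R) (r : R) (h0 H0 : R -> R) (c : R).
Hypothesis oO : open Omega.
Hypothesis oV : open V.
Hypothesis cN : forall y, {for y, continuous N}.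
Hypothesis PR : profile r h0 H0.
Hypothesis c0 : 0 < c.

Definition level : set E := [set x | [/\ V x.1, r < N x.1 & Omega x.2]].
Local Notation D := level.

(** The growth rate [c] of [N] along the ray turns a bound that decays with [N] into one that is
    integrable along the ray. *)
Definition admissible (d : C R) := rnorm d = 1 /\
  forall y s, 0 <= s -> V y -> V (y + s%:C * d) /\ N y + c * s <= N (y + s%:C * d).

Lemma open_level : open D.
Proof.
rewrite openE => x [/= Vx rx Ox]; apply/nbhs_rnormP.
have /nbhs_rnormP[r1 r10 H1] : nbhs x.1 V by exact: open_nbhs_nbhs.
have /nbhs_rnormP[r2 r20 H2] : nbhs x.2 Omega by exact: open_nbhs_nbhs.
have /cvgrPdist_lt/(_ (N x.1 - r))/(_ _)/nbhs_rnormP[|r3 r30 H3] := @cN x.1; first by rewrite subr_gt0.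
exists (Num.min r1 (Num.min r2 r3)) => [|u]; first by rewrite !lt_min r10 r20 r30.
rewrite !lt_min => /and3P[u1 u2 u3]; split.
- by apply: H1; apply: le_lt_trans u1; exact: (rnorm_fst (u - x)).
- have := H3 u.1 (le_lt_trans (rnorm_fst (u - x)) u3) => /=.
  by rewrite ltr_distl => /andP[_]; lra.
- by apply: H2; apply: le_lt_trans u2; exact: (rnorm_snd (u - x)).
Qed.

Variable d : C R.
Hypothesis ad : admissible d.

Definition shift s y : C R := y + s%:C * d.

Lemma level_shift s x : 0 <= s -> D x -> D (flow_map shift s x).
Proof.
move=> s0 [Vx rx Ox]; have [_ /(_ x.1 s s0 Vx)[V1 N1]] := ad.
split=> //=; apply: lt_le_trans N1; apply: lt_le_trans rx _.
by rewrite lerDl mulr_ge0 // ltW.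
Qed.

Lemma shift_weight s (b : R) x : 0 <= s -> D x -> r < b -> b <= N x.1 ->
  h0 (N (shift s x.1)) * rnorm d <= h0 (b + c * s).
Proof.
move=> s0 [Vx rx Ox] rb bN; have [d1 /(_ x.1 s s0 Vx)[V1 N1]] := ad.
rewrite d1 mulr1; apply: (profile_anti PR).
  by apply: lt_le_trans rb _; rewrite lerDl mulr_ge0 // ltW.
by apply: le_trans N1; rewrite lerD2r.
Qed.

Lemma profile_majorant (b : R) : r < b ->
  [/\ forall s, 0 <= s -> is_derive s 1 (fun s => H0 (b + c * s) / c) (h0 (b + c * s)),
      forall s, 0 <= s -> H0 (b + c * s) / c <= 0 &
      forall s, 0 <= s -> h0 (b + c * s) <= h0 b].
Proof.
move=> rb.
have bs s : 0 <= s -> b <= b + c * s by move=> s0; rewrite lerDl mulr_ge0 // ltW.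
split=> s s0; have rs := lt_le_trans rb (bs s s0).
- have d1 : is_derive s 1 (fun s => b + c * s) c.
    have d2 := is_deriveD (is_derive_cst b s 1) (is_deriveZ c (is_derive_id s 1)).
    by apply: (is_derive_cast d2); rewrite add0r -[_ *: _]/(_ * _) mulr1.
  have d2 := @is_derive1_comp _ H0 _ s _ _ (profile_prim PR rs) d1.
  have d3 := is_deriveZ c^-1 d2.
  have -> : (fun s => H0 (b + c * s) / c) = fun s => c^-1 * H0 (b + c * s) by apply/funext => t; rewrite mulrC.
  by apply: (is_derive_cast d3); rewrite -[_ *: _]/(_ * _); field; rewrite gt_eqF.
- by rewrite pmulr_lle0 ?invr_gt0 //; exact: (profile_le0 PR).
- by apply: (profile_anti PR) => //; exact: bs.
Qed.

Lemma flow_data_shift (G : E -> C R) : (forall x, D x -> differentiable G x) ->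
  (forall x, D x -> 0 <= complex.Re (D1 G x * d)) ->
  flow_data D shift (fun=> d) G (fun x => h0 (N x.1)) (fun x => - H0 (N x.1) / c).
Proof.
move=> dG posG; have [d1 Hd] := ad; split.
- exact: open_level.
- exact: level_shift.
- by move=> y; rewrite /shift mul0r addr0.
- by move=> s t y _ _; rewrite /shift rmorphD /=; ring.
- by move=> s y; apply: differentiableD; [exact: ex_diff|exact: differentiable_cst].
- move=> y s; rewrite /shift; apply: continuousD; first exact: (@ccont_cst _ y).
  apply: continuousM; last exact: (@ccont_cst _ d).
  by apply: (@continuous_complex _ _ id (fun=> 0)); [exact: cvg_id|exact: cst_continuous].
- move=> y e e0; exists 1 => // s s0 _; rewrite (_ : _ - _ = 0) ?rnorm0; last by rewrite /shift; ring.
  by rewrite mulr_ge0 // ltW.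
- by move=> y; exact: differentiable_cst.
- exact: dG.
- move=> s x s0 Dx.
  pose h : E := (d, 0).
  have pathE (t : R) : x + t%:C *: h = flow_map shift t x.
    by apply: injective_projections; rewrite /= ?scaler0 ?addr0.
  have dP (t : R) : 0 <= t <= s -> is_derive t 1 (fun t : R => complex.Re (G (x + t%:C *: h))) (complex.Re ('d G (x + t%:C *: h) h)).
    move=> /andP[t0 _]; apply: is_derive_Re; apply: dG; rewrite pathE; exact: level_shift.
  have := derive_le s0 (fun t _ => is_derive_cst (0 : R) t 1) dP.
  rewrite subrr subr_ge0 scale0r addr0 pathE; apply => t /andP[t0 _].
  rewrite pathE; have Dt := level_shift t0 Dx.
  by rewrite /h (diff_fst G _ d) mulrC; exact: posG.
- by move=> x; exact: (profile_ge0 PR).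
- move=> x Dx; have [_ rx _] := Dx.
  (* By continuity of [N], this intermediate level lies below the starting level of all nearby
     orbits, which gives them a common majorant. *)
  pose b := (r + N x.1) / 2.
  have rb : r < b by rewrite /b; lra.
  have bN : b < N x.1 by rewrite /b; lra.
  have [m1 m2 m3] := profile_majorant rb.
  have oD := open_level.
  have /nbhs_rnormP[r1 r10 H1] : nbhs x D by exact: open_nbhs_nbhs.
  have /cvgrPdist_lt/(_ (N x.1 - b))/(_ _)/nbhs_rnormP[|r2 r20 H2] := @cN x.1; first by rewrite subr_gt0.
  exists (Num.min r1 r2), (fun s => h0 (b + c * s)), (fun s => H0 (b + c * s) / c), 0, (h0 b).
  split=> //; first by rewrite lt_min r10.
  move=> u; rewrite lt_min => /andP[u1 u2]; split; first exact: H1.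
  move=> s s0; apply: shift_weight => //; first exact: H1.
  have := H2 u.1 (le_lt_trans (rnorm_fst (u - x)) u2) => /=.
  by rewrite ltr_distl => /andP[_]; lra.
- move=> x Dx; have [_ rx _] := Dx; have [m1 m2 m3] := profile_majorant rx.
  exists (fun s => h0 (N x.1 + c * s)), (fun s => H0 (N x.1 + c * s) / c), 0, (h0 (N x.1)).
  split=> //; first by move=> s s0; exact: shift_weight.
  by rewrite mulr0 addr0 sub0r mulNr.
Qed.

End Translation.

Lemma diff_mull (R : realType) (V : normedModType (C R)) (a : C R) (f : V -> C R) (x h : V) :
  differentiable f x -> 'd (fun u => a * f u) x h = a * 'd f x h.
Proof.
move=> df; have dc : differentiable (fun=> a : C R) x by exact: differentiable_cst.
have E0 : 'd (fun=> a : C R) x h = 0 by exact: (congr1 (fun F => F h) (diff_cst a x)).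
have comb (b c d e : C R) : e = 0 -> b = a * c + d * e -> b = a * c.
  by move=> ->; rewrite mulr0 addr0.
exact: (comb _ _ _ _ E0 (diffM_apply h dc df)).
Qed.

Lemma diff_sum_apply (R : realType) (V : normedModType (C R)) (I : Type) (r : seq I) (f : I -> V -> C R)
    (x h : V) : (forall l, differentiable (f l) x) ->
  differentiable (fun v => \sum_(l <- r) f l v) x /\
  'd (fun v => \sum_(l <- r) f l v) x h = \sum_(l <- r) 'd (f l) x h.
Proof.
move=> df; elim: r => [|l r [d1 E1]].
  have -> : (fun v => \sum_(l <- [::]) f l v) = (fun=> 0) by apply/funext => v; rewrite big_nil.
  split; first exact: differentiable_cst.
  by rewrite big_nil; exact: (congr1 (fun F => F h) (diff_cst (0 : C R) x)).
have -> : (fun v => \sum_(o <- l :: r) f o v) = (fun v => f l v + \sum_(o <- r) f o v).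
  by apply/funext => v; rewrite big_cons.
split; first exact: differentiableD.
by rewrite big_cons; apply: etrans (diffD_apply h (df l) d1) _; exact: congr1.
Qed.

Lemma diff_fst0 (R : realType) (f : C R * C R -> C R) (x h : C R * C R) (a : C R) :
  D1 f x = 0 -> h = (a, 0) -> rnorm ('d f x h) <= 0.
Proof. by move=> f0 ->; rewrite (diff_fst f x a) f0 mulr0 rnorm0. Qed.

Section Perturbation.
Variables (R : realType) (n : nat).
Local Notation E := (C R * C R)%type.
Implicit Types (x u : E) (y : C R) (s t : R) (i j k : 'I_n) (p q : 'I_n -> E -> C R).

Definition perturbed (lam : 'I_n -> C R) (g : E -> C R) (S : 'I_n -> 'I_n -> E -> C R) i k x : C R :=
  (i == k)%:R * (lam i * g x) + S i k x.

Lemma row_app_perturbed lam g S p i x :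
  row_app (perturbed lam g S) p i x = lam i * g x * p i x + row_app S p i x.
Proof.
rewrite /row_app /perturbed (eq_bigr (fun k => (i == k)%:R * (lam i * g x * p i x) + S i k x * p k x)).
  rewrite big_split /= (bigD1 i) //= eqxx mul1r big1 ?addr0 // => k ki.
  by rewrite eq_sym (negbTE ki) mul0r.
by move=> k _; have [->|_] := eqVneq i k; rewrite ?mul0r ?mul1r ?add0r // mulrDl.
Qed.

Variables (Omega V : set (C R)) (N : C R -> R) (r : R) (h0 H0 : R -> R) (c : R).
Hypothesis oO : open Omega.
Hypothesis oV : open V.
Hypothesis cN : forall y, {for y, continuous N}.
Hypothesis PR : profile r h0 H0.
Hypothesis c0 : 0 < c.
Local Notation D := (level Omega V N r).

Variables (lam d : 'I_n -> C R) (P : E -> C R) (S : 'I_n -> 'I_n -> E -> C R) (CS : R).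
Hypothesis ad : forall i, admissible V N c (d i).
Hypothesis dP : forall x, D x -> differentiable P x.
Hypothesis posP : forall i x, D x -> 0 <= complex.Re (lam i * D1 P x * d i).
Hypothesis dS : forall i k x, D x -> differentiable (S i k) x.
Hypothesis CS0 : 0 <= CS.
Hypothesis bS : forall i k x, D x -> rnorm (S i k x) <= CS * h0 (N x.1).
Hypothesis small : forall t, r < t -> 4 * (n%:R * CS * (- H0 t / c)) <= 1.

Let G i x := lam i * P x.
Let oD : open D := open_level oO oV cN.

Let dG i x : D x -> differentiable (G i) x.
Proof. by move=> Dx; apply: differentiableM; [exact: differentiable_cst|exact: dP]. Qed.

Let D1G i x : D x -> D1 (G i) x = lam i * D1 P x.
Proof.
by move=> Dx; exact: diff_mull (dP Dx).
Qed.

Let FD i : flow_data D (shift (d i)) (fun=> d i) (G i) (fun x => h0 (N x.1)) (fun x => - H0 (N x.1) / c).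
Proof.
apply: (flow_data_shift oO oV cN PR c0 (ad i) (@dG i)).
by move=> x Dx; rewrite D1G //; exact: posP.
Qed.

Let T p i := flow_op (shift (d i)) (fun=> d i) (G i) (row_app S p i).

Let d_neq0 i : d i != 0.
Proof. by rewrite -rnorm_eq0; have [-> _] := ad i; exact: oner_neq0. Qed.

Let f_diff K p i x : hol_bounded D (fun=> 1) K p -> D x -> differentiable (row_app S p i) x.
Proof. by move=> Hp Dx; apply: differentiable_row_app => k; [exact: dS|have [] := Hp k x Dx]. Qed.

Let f_bound K p i x : hol_bounded D (fun=> 1) K p -> D x ->
  rnorm (row_app S p i x) <= K * (n%:R * CS) * h0 (N x.1).
Proof.
move=> Hp Dx; apply: le_trans (rnorm_sum _ _ _) _.
apply: le_trans (_ : \sum_(k < n) K * CS * h0 (N x.1) <= _).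
  apply: ler_sum => k _; rewrite rnormM mulrC -mulrA; have [_ b] := Hp k x Dx.
  by apply: ler_pM; [exact: rnorm_ge0|exact: rnorm_ge0|rewrite mulr1 in b|exact: bS].
by rewrite sumr_const card_ord -mulr_natr; apply: eq_le_of; ring.
Qed.

Let T_bound K p i x : 0 <= K -> hol_bounded D (fun=> 1) K p -> D x ->
  rnorm (T p i x) <= 2 * (K * (n%:R * CS) * (- H0 (N x.1) / c)).
Proof.
move=> K0 Hp Dx.
have K1 : 0 <= K * (n%:R * CS) by rewrite !mulr_ge0.
exact: (flow_bound (FD i) K1 (fun u => f_diff i Hp) (fun u => f_bound i Hp) Dx).
Qed.

Let T_diff K p i x : 0 <= K -> hol_bounded D (fun=> 1) K p -> D x -> differentiable (T p i) x.
Proof.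
move=> K0 Hp Dx.
have K1 : 0 <= K * (n%:R * CS) by rewrite !mulr_ge0.
exact: (differentiable_flow (FD i) K1 (fun u => f_diff i Hp) (fun u => f_bound i Hp) Dx).
Qed.

Let D1_T K p i x : 0 <= K -> hol_bounded D (fun=> 1) K p -> D x ->
  D1 (T p i) x = lam i * D1 P x * T p i x + row_app S p i x.
Proof.
move=> K0 Hp Dx.
have K1 : 0 <= K * (n%:R * CS) by rewrite !mulr_ge0.
rewrite -D1G //.
exact: (D1_flow (FD i) K1 (fun u => f_diff i Hp) (fun u => f_bound i Hp) Dx (d_neq0 i)).
Qed.

Let T_half K p : 0 <= K -> hol_bounded D (fun=> 1) K p -> hol_bounded D (fun=> 1) (K / 2) (T p).
Proof.
move=> K0 Hp i x Dx; split; first exact: T_diff Hp Dx.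
apply: le_trans (T_bound i K0 Hp Dx) _; have [_ rx _] := Dx.
have -> : 2 * (K * (n%:R * CS) * (- H0 (N x.1) / c)) = (K / 2) * (4 * (n%:R * CS * (- H0 (N x.1) / c))).
  by field; rewrite gt_eqF.
by apply: ler_wpM2l; [exact: divr_ge0|exact: small].
Qed.

Let T_sub K p q i x : 0 <= K -> hol_bounded D (fun=> 1) K p -> hol_bounded D (fun=> 1) K q -> D x ->
  T (fun i x => p i x - q i x) i x = T p i x - T q i x.
Proof.
move=> K0 Hp Hq Dx.
have K1 : 0 <= K * (n%:R * CS) by rewrite !mulr_ge0.
rewrite /T row_appB.
exact: (flow_opB (FD i) K1 (fun u => f_diff i Hp) (fun u => f_bound i Hp) (fun u => f_diff i Hq) (fun u => f_bound i Hq) Dx).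
Qed.

(** As [lam j = 0], the constant vector [p0] solves the unperturbed system, and the fixed point of
    [p = p0 + T p] solves the perturbed one. It has norm at most 2, so the deviation [T p] obeys
    [T_bound] with [K = 2]. *)
Lemma perturbed_exists j : lam j = 0 -> exists p : 'I_n -> E -> C R, forall x, D x ->
  ode (perturbed lam (D1 P) S) p x /\
  forall i, rnorm (p i x - (i == j)%:R) <= 4 * (n%:R * CS * (- H0 (N x.1) / c)).
Proof.
move=> lamj; pose p0 i (x : E) : C R := (i == j)%:R.
have loc x : D x -> exists r M : R, 0 < r /\ forall u, rnorm (u - x) < r -> D u /\ (1 : R) <= M.
  move=> Dx; have /nbhs_rnormP[r1 r10 H1] : nbhs x D by exact: open_nbhs_nbhs.
  by exists r1, 1; split=> // u /H1.
have b0 : hol_bounded D (fun=> 1) 1 p0.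
  move=> i x Dx; split; first exact: differentiable_cst.
  by rewrite /p0 mulr1; case: (i == j); rewrite ?rnorm1 ?rnorm0.
have [p Hp Ep] := @fixpoint_exists R (E : normedModType (C R)) n D (fun=> 1) loc T T_half T_sub 1 p0 ler01 b0.
have K2 : 0 <= 2 * 1 :> R by rewrite mulr_ge0.
exists p => x Dx; split=> i; last first.
  rewrite Ep // addrAC subrr add0r; apply: le_trans (T_bound i K2 Hp Dx) (eq_le_of _).
  by field; rewrite gt_eqF.
have dc : differentiable (p0 i) x by exact: differentiable_cst.
have dT := T_diff i K2 Hp Dx.
have [dp E2] := diff_eq_on oD Dx (Ep i) (differentiableD dc dT); split; first exact: dp.
have z1 : D1 (p0 i) x = 0 by rewrite /D1 /p0 diff_cst.
have E3 := D1_T i K2 Hp Dx.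
have l0 : lam i * p0 i x = 0.
  by rewrite /p0; have [->|_] := eqVneq i j; rewrite ?lamj ?mul0r ?mulr0.
have comb (a b l q p0' p' t w : C R) : a = 0 -> b = l * q * t + w -> l * p0' = 0 -> p' = p0' + t ->
    a + b = l * q * p' + w.
  by move=> -> -> l0' ->; rewrite add0r mulrDr (mulrAC l q p0') l0' mul0r add0r.
rewrite row_app_perturbed {1}/D1 E2; apply: etrans (diffD_apply ((1, 0) : E) dc dT) _.
exact: (comb _ _ _ _ _ _ _ _ z1 E3 l0 (Ep i x Dx)).
Qed.

(** The difference [h = p - T p] solves the diagonal system, so [exp (- lam_i P) h_i] is constant
    along the [i]-th ray. As [Re (lam_i P)] does not decrease there, [|h_i|] at [x] is at most its
    value far out, which tends to 0. Hence [p] is a fixed point of the contraction [T]. *)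
Lemma perturbed_unique p K b : (forall t, r < t -> - H0 t <= b) -> 0 <= K ->
  (forall x, D x -> ode (perturbed lam (D1 P) S) p x) ->
  (forall i x, D x -> rnorm (p i x) <= K * - H0 (N x.1)) -> forall i x, D x -> p i x = 0.
Proof.
move=> Hb K0 Hode pK.
have dp i x : D x -> differentiable (p i) x by move=> /Hode/(_ i)[].
have H00 x : D x -> 0 <= - H0 (N x.1).
  by move=> [_ rx _]; rewrite oppr_ge0; exact: (profile_le0 PR).
pose K1 := K * b.
have Hp : hol_bounded D (fun=> 1) `|K1| p.
  move=> i x Dx; split; first exact: dp.
  rewrite mulr1; apply: le_trans (pK i x Dx) (le_trans _ (ler_norm _)).
  by apply: ler_wpM2l => //; apply: Hb; have [] := Dx.
apply: (@fixpoint_unique R (E : normedModType (C R)) n D (fun=> 1) T T_half `|K1| p) => // i x Dx.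
pose K2 := K + 2 * (`|K1| * (n%:R * CS) / c).
have K20 : 0 <= K2 by rewrite addr_ge0 // mulr_ge0 // divr_ge0 ?mulr_ge0 // ltW.
pose h u := p i u - T p i u.
have hK u : D u -> rnorm (h u) <= K2 * - H0 (N u.1).
  move=> Du; apply: le_trans (rnormB _ _) (le_trans (lerD (pK i u Du) (T_bound i (normr_ge0 K1) Hp Du)) (eq_le_of _)).
  by rewrite /K2; field; rewrite gt_eqF.
have dh u : D u -> differentiable h u /\ D1 h u = lam i * D1 P u * h u.
  move=> Du; have dT := T_diff i (normr_ge0 K1) Hp Du; have dpu := dp i u Du.
  split; first exact: differentiableB.
  have E1 := D1_T i (normr_ge0 K1) Hp Du; have [_ E2] := Hode u Du i.
  rewrite row_app_perturbed in E2.
  have comb (a b' c' d' e f : C R) : a = e * c' + f -> b' = e * d' + f -> a - b' = e * (c' - d').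
    by move=> -> ->; ring.
  by apply: etrans (diffB_apply ((1, 0) : E) dpu dT) _; exact: (comb _ _ _ _ _ _ E2 E1).
pose g u := cexp (- G i u) * h u.
have dg u : D u -> differentiable g u /\ D1 g u = 0.
  move=> Du; have [dhu Eh] := dh u Du.
  have dNG : differentiable (fun u => - G i u) u by apply: differentiableN; exact: dG.
  have dc : differentiable (fun u => cexp (- G i u)) u by apply: differentiable_cexp.
  split; first exact: differentiableM.
  have E1 := diff_cexp_comp ((1, 0) : E) dNG.
  have E2 : 'd (fun u => - G i u) u ((1, 0) : E) = - D1 (G i) u.
    exact: (congr1 (fun F => F ((1, 0) : E)) (diffN (dG i Du))).
  have E3 := D1G i Du.
  have comb (a b' c' e l hu : C R) : b' = l * hu -> c' = e * - l -> a = e * b' + hu * c' -> a = 0.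
    by move=> -> -> ->; ring.
  apply: (comb _ _ _ _ _ _ Eh _ (diffM_apply ((1, 0) : E) dc dhu)).
  by apply: etrans E1 _; congr (_ * _); apply: etrans E2 _; rewrite E3.
apply/eqP; rewrite -subr_eq0 -/(h x); apply/eqP.
apply: (@le_eps_eq0 _ _ _ K2) => e e0.
have [A HA] := profile_lim PR e0; have [_ /(_ x.1)ad2] := ad i.
have [Vx _ _] := Dx.
(* Far enough along the ray for [N], which grows at rate at least [c], to exceed [A]. *)
pose s := (`|A| + `|N x.1| + 1) / c.
have s0 : 0 <= s by rewrite divr_ge0 ?addr_ge0 // ltW.
have [_ Ns] := ad2 s s0 Vx.
have Ds : D (flow_map (shift (d i)) s x) by exact: (level_shift c0 (ad i) s0 Dx).
have AN : A < N (flow_map (shift (d i)) s x).1.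
  apply: lt_le_trans Ns; rewrite /s mulrC divfK ?gt_eqF //.
  have := ler_norm A; have := ler_norm (- N x.1); rewrite normrN; lra.
set v := flow_map (shift (d i)) s x in Ds AN.
have ev : h x = cexp (G i x - G i v) * h v.
  have : rnorm (g v - g x) <= 2 * 0.
    apply: mean_value_ineq => t /andP[t0 t1].
    have vx : v - x = (s%:C * d i, 0).
      by apply: injective_projections; rewrite /= ?subrr // /shift addrC addKr.
    have pt : x + t%:C *: (v - x) = flow_map (shift (d i)) (t * s) x.
      rewrite vx; apply: injective_projections; rewrite /= ?scaler0 ?addr0 // /shift.
      by rewrite -[_ *: _]/(_ * _) mulrA -rmorphM.
    have Dt : D (x + t%:C *: (v - x)) by rewrite pt; exact: (level_shift c0 (ad i) (mulr_ge0 t0 s0) Dx).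
    have [dgt E0] := dg _ Dt; split=> //.
    exact: (diff_fst0 E0 vx).
  rewrite mulr0 => g0; have /eqP/subr0_eq E0 : g v - g x == 0 by rewrite -rnorm_eq0 eq_le rnorm_ge0 g0.
  have comb (a' b' y z : C R) : cexp (- b') * z = cexp (- a') * y -> y = cexp (a' - b') * z.
    by move=> Eb; rewrite cexpD -mulrA Eb mulrA -cexpD subrr cexp0 mul1r.
  exact: (comb _ _ _ _ E0).
rewrite ev rnormM rnorm_cexp.
have mono := exponent_mono (FD i) s0 Dx.
apply: le_trans (_ : 1 * (K2 * - H0 (N v.1)) <= _).
  apply: ler_pM; [exact: expR_ge0|exact: rnorm_ge0| |exact: hK].
  by rewrite -expR0 ler_expR raddfB /= subr_le0.
by rewrite mul1r; apply: ler_wpM2l => //; rewrite lerNl; exact: HA.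
Qed.

End Perturbation.

(** * The logarithm on the slit plane *)

Section ComplexLog.
Variable R : realType.
Implicit Types (u w h : C R) (t : R).

(* The slit plane, the complement of the half-line of nonpositive reals, is [0 < slit u]. *)
Definition slit u : R := rnorm u + complex.Re u.

(** The half-angle formula for the principal argument, valid on the whole slit plane without case
    distinction. *)
Definition carg u : R := 2 * atan (complex.Im u / slit u).

Definition clog u : C R := ln (rnorm u) +i* carg u.

Lemma slit_rnorm u : 0 < slit u -> 0 < rnorm u.
Proof.
rewrite /slit => u0; rewrite lt_def rnorm_ge0 andbT; apply/eqP => E.
by have := Re_le_rnorm u; have := ler_norm (complex.Re u); move: u0; rewrite E; lra.
Qed.

Lemma carg_bound u : `|carg u| < pi.
Proof.
rewrite /carg ltr_norml; set t := _ / _.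
by have := atan_ltpi2 t; have := atan_gtNpi2 t; lra.
Qed.

Lemma expi_double_atan t : expi (2 * atan t) = ((1 - t ^+ 2) / (1 + t ^+ 2)) +i* (2 * t / (1 + t ^+ 2)) :> C R.
Proof.
have t0 : 0 < 1 + t ^+ 2 by rewrite ltr_pwDl // sqr_ge0.
have c2 : cos (atan t) ^+ 2 = (1 + t ^+ 2)^-1 by rewrite cos_atan exprVn sqr_sqrtr // ltW.
have cn : cos (atan t) != 0 by rewrite -sqrf_eq0 c2 invr_neq0 // gt_eqF.
have st : sin (atan t) = t * cos (atan t).
  by rewrite -[X in X * _]atanK /tan divfK.
rewrite /expi mulr_natl mulr2n cosD sinD st.
have -> : cos (atan t) * cos (atan t) = (1 + t ^+ 2)^-1 by rewrite -c2 expr2.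
have -> : t * cos (atan t) * (t * cos (atan t)) = t ^+ 2 * (1 + t ^+ 2)^-1 by rewrite -c2; ring.
have -> : t * cos (atan t) * cos (atan t) = t * (1 + t ^+ 2)^-1 by rewrite -c2; ring.
have -> : cos (atan t) * (t * cos (atan t)) = t * (1 + t ^+ 2)^-1 by rewrite -c2; ring.
by congr (_ +i* _); field; rewrite gt_eqF.
Qed.

Lemma cexp_clog u : 0 < slit u -> cexp (clog u) = u.
Proof.
move=> u0; have r0 := slit_rnorm u0.
have sq := rnorm_sqr u.
rewrite /clog cexp_complex lnK ?posrE // /carg expi_double_atan.
have sn : slit u != 0 by rewrite gt_eqF.
have d0 : slit u ^+ 2 + complex.Im u ^+ 2 = 2 * rnorm u * slit u.
  by rewrite (_ : complex.Im u ^+ 2 = rnorm u ^+ 2 - complex.Re u ^+ 2) /slit; [ring|rewrite sq; ring].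
have dn : slit u ^+ 2 + complex.Im u ^+ 2 != 0 by rewrite d0 !mulf_neq0 ?gt_eqF.
rewrite [RHS]complexRI; apply/eqP; rewrite eq_complex /=.
set a := slit u in sn d0 dn *; set b := complex.Im u in d0 dn *.
have E1 : 1 + (b / a) ^+ 2 = 2 * rnorm u / a.
  by apply: (mulIf sn); rewrite divfK // mulrDl mul1r; apply: (mulIf sn); rewrite -d0; field.
have E2 : 1 - (b / a) ^+ 2 = 2 * complex.Re u / a.
  have bb : b ^+ 2 = rnorm u ^+ 2 - complex.Re u ^+ 2 by rewrite sq addrC addKr.
  by apply: (mulIf sn); apply: (mulIf sn); rewrite expr_div_n bb (_ : rnorm u = a - complex.Re u) /a ?/slit; [field|ring].
by rewrite E1 E2 !mul0r subr0 addr0; apply/andP; split; apply/eqP; field; rewrite ?sn ?gt_eqF.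
Qed.

Lemma clog_cexp w : `|complex.Im w| < pi -> 0 < slit (cexp w) /\ clog (cexp w) = w.
Proof.
case: w => x y /= yp; pose a := y / 2.
have ya : y = a + a by rewrite /a; field.
have ca : 0 < cos a.
  by apply: cos_gt0_pihalf; move: yp; rewrite ltr_norml /a => /andP[y1 y2]; apply/andP; split; lra.
have cs : sin a ^+ 2 = 1 - cos a ^+ 2 by rewrite -(cos2Dsin2 a) addrC addKr.
have E0 := expR_gt0 x.
have sE : slit (cexp (x +i* y)) = expR x * (2 * cos a ^+ 2).
  rewrite /slit rnorm_cexp cexp_complex /= mul0r subr0 ya cosD -!expr2 cs.
  by ring.
have s0 : 0 < slit (cexp (x +i* y)) by rewrite sE !mulr_gt0 // exprn_gt0.
split=> //; rewrite /clog rnorm_cexp /= expRK /carg sE cexp_complex /= mul0r addr0.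
have -> : expR x * sin y / (expR x * (2 * cos a ^+ 2)) = tan a.
  by rewrite ya sinD /tan; field; rewrite !gt_eqF.
rewrite tanK ?in_itv /=; first by congr (_ +i* _); rewrite /a; field.
by move: yp; rewrite ltr_norml /a => /andP[y1 y2]; apply/andP; split; lra.
Qed.

Lemma continuous_slit u : {for u, continuous slit}.
Proof.
apply: continuousD; first by apply: (@continuous_rnorm _ _ _ id); exact: cvg_id.
by apply: (@continuous_Re _ _ id); exact: cvg_id.
Qed.

Lemma continuous_clog u : 0 < slit u -> {for u, continuous clog}.
Proof.
move=> u0; have r0 := slit_rnorm u0.
apply: (@continuous_complex _ _ (fun u => ln (rnorm u)) carg).
  apply: (@continuous_comp _ _ _ (@rnorm R _) (@ln R)); last exact: continuous_ln.
  by apply: (@continuous_rnorm _ _ _ id); exact: cvg_id.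
rewrite /carg; apply: continuousM; first exact: cst_continuous.
apply: (@continuous_comp _ _ _ (fun u => complex.Im u / slit u) (@atan R)); last exact: continuous_atan.
apply: continuousM; first by apply: (@continuous_Im _ _ id); exact: cvg_id.
by apply: continuousV; [rewrite gt_eqF|exact: continuous_slit].
Qed.

(** Inverse function argument: the increment [k] of [clog] satisfies [exp k = 1 + h / u], it is
    small by continuity of [clog], and [cexp] has slope 1 at 0. The bound 1/2 in [e1] first gives
    [|k| <= 2 |h / u|]. *)
Lemma diff_clog u : 0 < slit u ->
  differentiable clog u /\ 'd clog u = (fun h => u^-1 * h) :> (C R -> C R).
Proof.
move=> u0; have r0 := slit_rnorm u0; have un : u != 0 by rewrite -rnorm_eq0 gt_eqF.
apply: slope_differentiable => e e0.
pose e1 := Num.min 2^-1 (e * rnorm u / 2).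
have e10 : 0 < e1 by rewrite lt_min invr_gt0 ltr0n divr_gt0 // mulr_gt0.
have [d1 d10 H1] := cexp_o0 e10.
have /continuous_rnormP/(_ d1 d10)[d2 d20 H2] := continuous_clog u0.
have /cvgrPdist_lt/(_ (slit u) u0)/nbhs_rnormP[d3 d30 H3] := @continuous_slit u.
exists (Num.min d2 d3) => [|h]; first by rewrite lt_min d20 d30.
rewrite lt_min => /andP[h2 h3].
have hu : rnorm (u + h - u) = rnorm h by rewrite addrAC subrr add0r.
have s1 : 0 < slit (u + h).
  by have := H3 (u + h); rewrite hu => /(_ h3) /=; rewrite ltr_distl => /andP[_]; lra.
have := H2 (u + h); rewrite hu => /(_ h2); set k := clog (u + h) - clog u => k1.
have Ek : cexp k = 1 + u^-1 * h.
  by rewrite /k cexpD cexpN !cexp_clog // mulrDl mulfV // mulrC.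
have := H1 k k1; rewrite Ek (addrC 1) addrK rnormBC => b1.
have b2 : rnorm k <= 2 * rnorm (u^-1 * h).
  have := rnormD (k - u^-1 * h) (u^-1 * h); rewrite subrK => b3.
  have b4 : e1 * rnorm k <= 2^-1 * rnorm k by rewrite ler_wpM2r ?rnorm_ge0 // ge_min lexx.
  lra.
apply: le_trans b1 _.
apply: le_trans (_ : e1 * (2 * rnorm (u^-1 * h)) <= _); first by rewrite ler_wpM2l // ltW.
apply: le_trans (_ : (e * rnorm u / 2) * (2 * rnorm (u^-1 * h)) <= _).
  by rewrite ler_wpM2r ?mulr_ge0 ?rnorm_ge0 // ge_min lexx orbT.
by rewrite rnormM rnormV; apply: eq_le_of; field; rewrite gt_eqF.
Qed.

End ComplexLog.

(** * Wedges and sectors *)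

Section PowerProfile.
Variables (R : realType) (q : R).
Hypothesis q0 : 0 < q.
Implicit Types (s t : R).

Lemma profile_exp r : profile r (fun t => expR (- (q * t))) (fun t => - (expR (- (q * t)) / q)).
Proof.
split.
- by move=> t; exact: expR_ge0.
- by move=> s t _ st; rewrite ler_expR lerN2 ler_wpM2l // ltW.
- move=> t _.
  have d1 : is_derive t 1 (fun t => - q * t) (- q).
    by have := is_deriveZ (- q) (is_derive_id t 1) => /is_derive_cast; apply; rewrite -[_ *: _]/(_ * _) mulr1.
  have d2 := @is_derive1_comp _ expR _ t _ _ (is_derive_expR _) d1.
  have d3 := is_deriveZ (- q^-1) d2.
  have -> : (fun t => - (expR (- (q * t)) / q)) = fun t => - q^-1 * expR (- q * t).
    by apply/funext => u; rewrite !mulNr mulrC.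
  by apply: (is_derive_cast d3); rewrite -[_ *: _]/(_ * _) !mulNr; field; rewrite gt_eqF.
- by move=> t _; rewrite oppr_le0 divr_ge0 ?expR_ge0 // ltW.
- move=> e e0; have eq0 : 0 < e * q by rewrite mulr_gt0.
  exists (- ln (e * q) / q) => t; rewrite ltr_pdivrMr // => tq.
  rewrite lerN2 ler_pdivrMr // -[leRHS]lnK ?posrE // ler_expR; lra.
Qed.

(** The function [t^(- 1 - q)] with primitive [- t^(- q) / q], obtained from [profile_exp] by the
    substitution [ln t]. *)
Lemma profile_pow r : 0 <= r ->
  profile r (fun t => expR (- ((1 + q) * ln t))) (fun t => - (expR (- (q * ln t)) / q)).
Proof.
move=> r0; have pos t : r < t -> 0 < t by exact: le_lt_trans.
have [e0 e1 e2 e3 e4] := profile_exp r; split.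
- by move=> t; exact: expR_ge0.
- move=> s t rs st; have s0 := pos _ rs; rewrite ler_expR lerN2 ler_wpM2l //.
    by rewrite addr_ge0 // ltW.
  by rewrite ler_ln ?posrE //; exact: lt_le_trans st.
- move=> t rt; have t0 := pos _ rt.
  have l1 : ln t - 1 < ln t by lra.
  have d1 := @is_derive1_comp _ _ (@ln R) t _ _ (profile_prim (profile_exp (ln t - 1)) l1) (is_derive1_ln t0).
  apply: (is_derive_cast d1).
  by rewrite -{2}[t]lnK ?posrE // -expRN -expRD; congr expR; ring.
- by move=> t _; rewrite oppr_le0 divr_ge0 ?expR_ge0 // ltW.
- move=> e /e4[T HT]; exists (Num.max r (expR T)) => t; rewrite gt_max => /andP[rt Tt].
  by apply: HT; rewrite -ltr_expR lnK // posrE; exact: pos.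
Qed.

End PowerProfile.

Section Wedge.
Variables (R : realType) (gam : R).
Hypothesis gam0 : 0 < gam.
Hypothesis gam1 : gam < pi / 2.
Implicit Types (y : C R) (s t eta : R).

Definition wedge (b : bool) y : R :=
  complex.Re y * sin gam + (-1) ^+ b * (`|complex.Im y| * cos gam).

Lemma sin_gam : 0 < sin gam.
Proof. by apply: sin_gt0_pi; rewrite gam0 /=; have := pi_gt0 R; move: gam1; lra. Qed.

Lemma cos_gam : 0 < cos gam.
Proof. by apply: cos_gt0_pihalf; rewrite gam1 andbT; have := pi_gt0 R; move: gam0; lra. Qed.

Lemma continuous_wedge b y : {for y, continuous (wedge b)}.
Proof.
apply: continuousD; apply: continuousM.
- by apply: (@continuous_Re _ _ id); exact: cvg_id.
- exact: cst_continuous.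
- exact: cst_continuous.
- apply: continuousM; last exact: cst_continuous.
  apply: (@continuous_comp _ _ _ (fun y : C R => complex.Im y) (fun t : R => `|t|)); last exact: norm_continuous.
  by apply: (@continuous_Im _ _ id); exact: cvg_id.
Qed.

Lemma sin_abs t : `|t| <= pi -> `|sin t| = sin `|t|.
Proof.
move=> tp; have [t0|t0] := leP 0 t.
  by rewrite !ger0_norm // sin_ge0_pi // t0 /=; move: tp; rewrite ger0_norm.
by rewrite -normrN -sinN (ltr0_norm t0) ger0_norm // sin_ge0_pi // oppr_ge0 ltW //=; move: tp; rewrite ltr0_norm.
Qed.

(** The real part contributes [t cos eta sin gam]. By the triangle inequality the term in [|Im y|],
    with either sign, loses at most [t sin |eta| cos gam]. *)
Lemma wedge_shift b y t eta : 0 <= t -> `|eta| <= pi ->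
  wedge b y + sin (gam - `|eta|) * t <= wedge b (y + t%:C * expi eta).
Proof.
move=> t0 etap; have cg := ltW cos_gam.
have se : `|t * sin eta| = t * sin `|eta| by rewrite normrM (ger0_norm t0) sin_abs.
have ce : cos `|eta| = cos eta by case: ger0P => _ //; rewrite cosN.
rewrite /wedge sinB ce; case: y => y1 y2; rewrite /expi /= !mul0r subr0 addr0.
set e1 := t * sin eta in se *.
have i1 : `|y2| - `|e1| <= `|y2 + e1|.
  by have := ler_normB (y2 + e1) e1; rewrite addrK; lra.
have i2 := ler_normD y2 e1.
have i3 := ler_wpM2r cg i1; have i4 := ler_wpM2r cg i2.
move: i3 i4; rewrite se; case: b => /=; rewrite ?expr1 ?expr0; nra.
Qed.

Lemma wedge_le b y : wedge b y <= rnorm y.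
Proof.
have sg := ltW sin_gam; have cg := ltW cos_gam.
have : wedge b y <= `|complex.Re y| * sin gam + `|complex.Im y| * cos gam.
  apply: lerD; first by rewrite ler_wpM2r // ler_norm.
  by case: b; rewrite ?expr1 ?expr0 ?mulN1r ?mul1r // -subr_ge0 opprK addr_ge0 // mulr_ge0.
move=> /le_trans; apply.
rewrite -ler_sqr ?nnegrE ?rnorm_ge0 ?addr_ge0 ?mulr_ge0 // rnorm_sqr.
have := cos2Dsin2 gam; rewrite -(real_normK (num_real (complex.Re y))) -(real_normK (num_real (complex.Im y))).
set a := `|_|; set b' := `|_|; set s := sin _; set c := cos _ => cs.
have E : a ^+ 2 + b' ^+ 2 = (a * s + b' * c) ^+ 2 + (a * c - b' * s) ^+ 2.
  by rewrite -[LHS]mulr1 -cs; ring.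
by rewrite E lerDl sqr_ge0.
Qed.

(** On the removed half-line the imaginary part is 0 and the real part is not positive, so neither
    is the weight. *)
Lemma wedge_slit b y : 0 < wedge b y -> 0 < slit y.
Proof.
move=> w0; have y0 : 0 < rnorm y by exact: lt_le_trans (wedge_le b y).
rewrite /slit -ltrBlDr sub0r ltNge; apply/negP => yn.
have re : complex.Re y = - rnorm y.
  by apply/eqP; rewrite eq_le; have := Re_le_rnorm y; rewrite ler_norml => /andP[-> _]; move: yn; lra.
have im : complex.Im y = 0.
  by have := rnorm_sqr y; rewrite re sqrrN => /eqP; rewrite -subr_eq0 opprD addrA subrr sub0r oppr_eq0 sqrf_eq0 => /eqP.
move: w0; rewrite /wedge re im normr0 mul0r mulr0 addr0 mulNr oppr_gt0 ltNge => /negP; apply.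
by rewrite mulr_ge0 ?rnorm_ge0 // ltW // sin_gam.
Qed.

(** The addition formula for the sine. For [rho > 0] the weight is thus positive when
    [|chi| < pi - gam] if [b] is false, and when [|chi| < gam] if [b] is true. *)
Lemma wedge_polar b (rho chi : R) : 0 <= rho -> `|chi| <= pi ->
  wedge b (rho%:C * expi chi) = rho * sin (gam + (-1) ^+ b * `|chi|).
Proof.
move=> r0 cp; rewrite /wedge /expi /= !mul0r subr0 addr0 normrM (ger0_norm r0) sin_abs //.
have cc : cos chi = cos `|chi| by case: ger0P => _ //; rewrite cosN.
by rewrite cc sinD; case: b => /=; rewrite ?expr1 ?expr0 ?mulN1r ?mul1r ?sinN ?cosN; ring.
Qed.

Lemma polar y : 0 < slit y -> y = (rnorm y)%:C * expi (carg y).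
Proof.
move=> y0; rewrite -{1}(cexp_clog y0) /clog cexp_complex lnK //.
by rewrite posrE; exact: slit_rnorm.
Qed.

Lemma wedge_carg y : 0 < wedge true y -> `|carg y| < gam.
Proof.
move=> w0; have s0 := wedge_slit w0; have y0 := slit_rnorm s0.
have cp := carg_bound y; move: w0.
rewrite {1}(polar s0) wedge_polar ?ltW // expr1 mulN1r pmulr_rgt0 // => sg.
rewrite ltNge; apply/negP => gc.
suff : sin (gam - `|carg y|) <= 0 by rewrite leNgt sg.
rewrite -oppr_ge0 -sinN opprB sin_ge0_pi // subr_ge0 gc /=.
by move: gam0; lra.
Qed.

End Wedge.

Lemma diff_id1 (R : realType) (w : C R) : 'd (fun u : C R => u) w 1 = 1.
Proof.
have [_ ->] : differentiable (fun u : C R => u) w /\ 'd (fun u : C R => u) w = (fun h => 1 * h) :> (C R -> C R).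
  apply: slope_differentiable => e e0; exists 1 => // h _.
  by rewrite (_ : _ - _ = 0) ?rnorm0 ?mulr_ge0 ?rnorm_ge0 ?(ltW e0) //; ring.
by rewrite mulr1.
Qed.

(** A change of the first variable alone maps the direction [(1, 0)] to [(a, 0)], so the derivative
    in the parameter never enters. *)
Lemma D1_comp_fst (R : realType) (g : C R -> C R) (f : C R * C R -> C R) (x : C R * C R) (a : C R) :
  differentiable g x.1 -> 'd g (x.1) 1 = a -> differentiable f (g x.1, x.2) ->
  differentiable (fun u => f (g u.1, u.2)) x /\ D1 (fun u => f (g u.1, u.2)) x = a * D1 f (g x.1, x.2).
Proof.
move=> dg ga df.
have dg1 : differentiable (fun u : C R * C R => g u.1) x by exact: (differentiable_comp (@differentiable_fst _ _ _ x) dg).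
have d2 : differentiable (fun u : C R * C R => u.2) x by exact: differentiable_snd.
have dp : differentiable (fun u : C R * C R => (g u.1, u.2)) x by exact: differentiable_pair.
split; first exact: (differentiable_comp dp df).
have E0 := diff_comp_apply ((1, 0) : C R * C R) dp df.
have e1 : 'd (fun u : C R * C R => u.1) x ((1, 0) : C R * C R) = 1.
  have l1 : 'd (fst : {linear (C R * C R)%type -> C R}) x = (fst : {linear (C R * C R)%type -> C R}) :> (C R * C R -> C R).
    by apply: diff_lin => y; exact: cvg_fst.
  exact: (congr1 (fun F => F ((1, 0) : C R * C R)) l1).
have e2 : 'd (fun u : C R * C R => u.2) x ((1, 0) : C R * C R) = 0.
  have l1 : 'd (snd : {linear (C R * C R)%type -> C R}) x = (snd : {linear (C R * C R)%type -> C R}) :> (C R * C R -> C R).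
    by apply: diff_lin => y; exact: cvg_snd.
  exact: (congr1 (fun F => F ((1, 0) : C R * C R)) l1).
have E1 : 'd (fun u : C R * C R => (g u.1, u.2)) x ((1, 0) : C R * C R) = (a, 0).
  have E2 := congr1 (fun F => F ((1, 0) : C R * C R)) (diff_pair dg1 d2).
  apply: etrans E2 _; congr pair; last exact: e2.
  apply: etrans (diff_comp_apply ((1, 0) : C R * C R) (@differentiable_fst _ _ _ x) dg) _.
  by apply: etrans (congr1 ('d g (x.1)) e1) _.
apply: etrans E0 _; apply: etrans (congr1 ('d f (g x.1, x.2)) E1) _.
exact: diff_fst.
Qed.

(** * The slit plane as a chart of a sector *)

Section SectorChart.
Variables (R : realType) (kappa alpha : R).
Hypothesis kappa0 : 0 < kappa.
Implicit Types (y w : C R).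

(* [w = ln z] corresponds to [y = z^kappa e^(- i alpha)], which turns the sector
   [|kappa arg z - alpha| < pi] into the slit plane. *)
Definition of_slit y : C R := (kappa^-1)%:C * (clog y + (0 +i* alpha)).
Definition to_slit w : C R := cexp (kappa%:C * w - (0 +i* alpha)).

Lemma ReZ (a : R) w : complex.Re (a%:C * w) = a * complex.Re w.
Proof. by case: w => u v /=; rewrite mul0r subr0. Qed.

Lemma ImZ (a : R) w : complex.Im (a%:C * w) = a * complex.Im w.
Proof. by case: w => u v /=; rewrite mul0r addr0. Qed.

Lemma ReD w y : complex.Re (w + y) = complex.Re w + complex.Re y.
Proof. by case: w; case: y. Qed.

Lemma ImD w y : complex.Im (w + y) = complex.Im w + complex.Im y.
Proof. by case: w; case: y. Qed.

Lemma ReN w : complex.Re (- w) = - complex.Re w.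
Proof. by case: w. Qed.

Lemma ImN w : complex.Im (- w) = - complex.Im w.
Proof. by case: w. Qed.

Lemma Re_of_slit y : complex.Re (of_slit y) = ln (rnorm y) / kappa.
Proof. by rewrite /of_slit ReZ ReD /= addr0 mulrC. Qed.

Lemma Im_of_slit y : complex.Im (of_slit y) = (carg y + alpha) / kappa.
Proof. by rewrite /of_slit ImZ ImD /= mulrC. Qed.

Lemma of_slitE y : kappa%:C * of_slit y = clog y + (0 +i* alpha).
Proof.
by rewrite /of_slit mulrA -rmorphM mulfV ?gt_eqF // rmorph1 mul1r.
Qed.

Lemma cexp_of_slit y : 0 < slit y -> cexp (kappa%:C * of_slit y) = y * expi alpha.
Proof. by move=> y0; rewrite of_slitE cexpD cexp_clog // cexp_expi. Qed.

Lemma Re_to_slit_arg w : complex.Re (kappa%:C * w - (0 +i* alpha)) = kappa * complex.Re w.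
Proof. by rewrite ReD ReN ReZ /= subr0. Qed.

Lemma Im_to_slit_arg w : complex.Im (kappa%:C * w - (0 +i* alpha)) = kappa * complex.Im w - alpha.
Proof. by rewrite ImD ImN ImZ. Qed.

Lemma to_slitK w : `|kappa * complex.Im w - alpha| < pi -> 0 < slit (to_slit w) /\ of_slit (to_slit w) = w.
Proof.
move=> wa; have [|s0 E] := @clog_cexp R (kappa%:C * w - (0 +i* alpha)); first by rewrite Im_to_slit_arg.
split=> //; rewrite /of_slit /to_slit E subrK mulrA -rmorphM mulVf ?gt_eqF //.
by rewrite rmorph1 mul1r.
Qed.

Lemma to_slitE w : to_slit w = (expR (kappa * complex.Re w))%:C * expi (kappa * complex.Im w - alpha).
Proof. by rewrite /to_slit [X in cexp X]complexRI cexp_complex Re_to_slit_arg Im_to_slit_arg. Qed.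

Lemma diff_of_slit y : 0 < slit y ->
  differentiable of_slit y /\ 'd of_slit y 1 = (kappa%:C * y)^-1.
Proof.
move=> y0; have [dl El] := diff_clog y0.
have dc : differentiable (fun=> 0 +i* alpha : C R) y by exact: differentiable_cst.
have ds : differentiable (fun u => clog u + (0 +i* alpha)) y by exact: differentiableD.
have dk : differentiable (fun=> (kappa^-1)%:C : C R) y by exact: differentiable_cst.
split; first exact: (differentiableM dk ds).
have E0 := diff_mull ((kappa^-1)%:C : C R) (1 : C R) ds.
have E1 := diffD_apply (1 : C R) dl dc.
have E2 : 'd (fun=> 0 +i* alpha : C R) y 1 = 0 by exact: (congr1 (fun F => F (1 : C R)) (diff_cst _ y)).
apply: etrans E0 _; apply: etrans (congr1 (fun z => (kappa^-1)%:C * z) E1) _.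
have comb (a b c : C R) : a = y^-1 * 1 -> b = 0 -> (kappa^-1)%:C * (a + b) = (kappa%:C * y)^-1.
  by move=> -> ->; rewrite mulr1 addr0 invfM fmorphV.
by apply: comb => //; rewrite El.
Qed.

Lemma diff_to_slit w : differentiable to_slit w /\ 'd to_slit w 1 = kappa%:C * to_slit w.
Proof.
have dc : differentiable (fun=> (0 +i* alpha) : C R) w by exact: differentiable_cst.
have dk : differentiable (fun u : C R => kappa%:C * u : C R) w.
  by apply: differentiableM; [exact: differentiable_cst|exact: ex_diff].
have db : differentiable (fun u : C R => kappa%:C * u - (0 +i* alpha) : C R) w by exact: differentiableB.
split; first exact: differentiable_cexp.
have E0 := diff_cexp_comp (1 : C R) db.
have E1 := diffB_apply (1 : C R) dk dc.
have di : differentiable (fun u : C R => u) w by exact: ex_diff.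
have E2 := diff_mull (kappa%:C : C R) (1 : C R) di.
have E3 := diff_id1 w.
have E4 : 'd (fun=> 0 +i* alpha : C R) w 1 = 0 by exact: (congr1 (fun F => F (1 : C R)) (diff_cst _ w)).
apply: etrans E0 _; have comb (a b c d e : C R) : b = c - d -> c = kappa%:C * e -> e = 1 -> d = 0 -> a * b = kappa%:C * a.
  by move=> -> -> -> ->; rewrite subr0 mulr1 mulrC.
exact: (comb _ _ _ _ _ E1 E2 E3 E4).
Qed.

End SectorChart.

(** * Solutions with prescribed asymptotics *)

Lemma finite_upper (R : realType) (n : nat) (f : 'I_n -> R) : exists M : R, forall i, f i <= M.
Proof.
exists (\sum_i `|f i|) => i; rewrite (bigD1 i) //=.
by apply: le_trans (ler_norm _) _; rewrite lerDl sumr_ge0.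
Qed.

Lemma finite_lower (R : realType) (n : nat) (f : 'I_n -> R) : (forall i, 0 < f i) ->
  exists2 c : R, 0 < c & forall i, c <= f i.
Proof.
move=> f0; have [M HM] := finite_upper (fun i => (f i)^-1).
have M0 : 0 < Num.max M 1 by rewrite lt_max ltr01 orbT.
exists (Num.max M 1)^-1 => [|i]; first by rewrite invr_gt0.
by rewrite -[leRHS]invrK lef_pV2 ?posrE ?invr_gt0 // le_max HM.
Qed.

Lemma continuous_Re_mul_expi (R : realType) (l : C R) : continuous (fun s : R => complex.Re (l * expi s)).
Proof.
have -> : (fun s : R => complex.Re (l * expi s)) = fun s => complex.Re l * cos s - complex.Im l * sin s.
  by apply/funext => s; case: l.
move=> s; suff H : {for s, continuous (fun s => complex.Re l * cos s - complex.Im l * sin s)} by exact: H.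
apply: continuousB; apply: continuousM.
- exact: cst_continuous.
- exact: continuous_cos.
- exact: cst_continuous.
- exact: continuous_sin.
Qed.

Lemma expi_direction (R : realType) (lam : C R) (t : R) : 0 < complex.Re (lam * expi t) ->
  exists2 d : R, 0 < d & forall h, `|h| < d -> 0 < complex.Re (lam * expi (t + h)).
Proof.
move=> l0; have cc : {for t, continuous (fun s : R => complex.Re (lam * expi s))}.
  exact: continuous_Re_mul_expi.
have /cvgrPdist_lt/(_ _ l0)/nbhs_ballP[d d0 Hd] := cc.
exists d => // h hd; have := Hd (t + h); rewrite /ball /= opprD addrA subrr add0r normrN => /(_ hd).
by rewrite ltr_distl => /andP[_]; lra.
Qed.

(** A real part that is positive at [b] stays so slightly beyond [b]; one that is negative at [a] is
    positive slightly before [a + pi]. So the ray is turned to [b + 2 eps] or to [a + pi - 2 eps],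
    both within [gam = (a + pi - b) / 2 - eps] of the axis [(a + b + pi) / 2]. Since
    [pi - gam = (b - a + pi) / 2 + eps], the sector of half-opening [pi - gam] about the axis
    exceeds [[a, b + pi]] by [eps] on either side. *)
Lemma directions (R : realType) (n : nat) (lam : 'I_n -> C R) (a b : R) : a <= b -> b - a < pi ->
  (forall i, [\/ lam i = 0, 0 < complex.Re (lam i * expi a) /\ 0 < complex.Re (lam i * expi b) |
     complex.Re (lam i * expi a) < 0 /\ complex.Re (lam i * expi b) < 0]) ->
  exists (eps : R) (eta : 'I_n -> R), [/\ 0 < eps, 0 < (a + pi - b) / 2 - eps, (a + pi - b) / 2 - eps < pi / 2,
    forall i, `|eta i| < (a + pi - b) / 2 - eps &
    forall i, lam i = 0 \/ 0 < complex.Re (lam i * expi ((a + b + pi) / 2 + eta i))].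
Proof.
move=> ab ba sgn.
have pos i : exists d : R, 0 < d /\ [\/ lam i = 0, forall h, `|h| < d -> 0 < complex.Re (lam i * expi (b + h)) |
    forall h, `|h| < d -> 0 < complex.Re (lam i * expi (a + pi + h))].
  have [l0|[_ pb]|[na _]] := sgn i; first by exists 1; split=> //; apply: Or31.
    by have [d d0 Hd] := expi_direction pb; exists d; split=> //; apply: Or32.
  have pa : 0 < complex.Re (lam i * expi (a + pi)) by rewrite expi_pi mulrN ReN oppr_gt0.
  by have [d d0 Hd] := expi_direction pa; exists d; split=> //; apply: Or33.
have /choice[d Hd] := pos.
have [|d1 d10 Hd1] := @finite_lower R n d; first by move=> i; have [] := Hd i.
(* [d1] is a common range of positivity, so that turning by [2 eps] is allowed; the other bound
   keeps the half-opening positive. *)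
pose eps := Num.min (d1 / 4) ((pi - (b - a)) / 8).
have eps0 : 0 < eps by rewrite lt_min !divr_gt0 // subr_gt0.
have eps1 : eps <= d1 / 4 by rewrite ge_min lexx.
have eps2 : eps <= (pi - (b - a)) / 8 by rewrite ge_min lexx orbT.
have H i : exists e : R, `|e| < (a + pi - b) / 2 - eps /\ (lam i = 0 \/ 0 < complex.Re (lam i * expi ((a + b + pi) / 2 + e))).
  have [di0 [l0|pb|pa]] := Hd i; have di := Hd1 i.
  - by exists 0; split; [rewrite normr0; lra|left].
  - exists (b + 2 * eps - (a + b + pi) / 2); split; first by rewrite ltr_norml; apply/andP; split; lra.
    right; have -> : (a + b + pi) / 2 + (b + 2 * eps - (a + b + pi) / 2) = b + 2 * eps by ring.
    by apply: pb; rewrite ger0_norm ?mulr_ge0 ?(ltW eps0) //; lra.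
  - exists (a + pi - 2 * eps - (a + b + pi) / 2); split; first by rewrite ltr_norml; apply/andP; split; lra.
    right; have -> : (a + b + pi) / 2 + (a + pi - 2 * eps - (a + b + pi) / 2) = a + pi + - (2 * eps) by ring.
    by apply: pa; rewrite normrN ger0_norm ?mulr_ge0 ?(ltW eps0) //; lra.
have /choice[eta Heta] := H.
exists eps, eta; split=> //; try lra; first by move=> i; have [] := Heta i.
by move=> i; have [] := Heta i.
Qed.

Section NormalForm.
Variables (R : realType) (n : nat) (m : R) (Omega : set (C R)) (kappa delta : R).
Local Notation E := (C R * C R)%type.
Implicit Types (x u : E) (y w : C R) (i j k : 'I_n).
Local Notation U := (half_plane m Omega).
Variables (P p1 : E -> C R) (B : 'I_n -> 'I_n -> E -> C R).
Hypothesis oO : open Omega.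
Hypothesis kappa0 : 0 < kappa.
Hypothesis delta0 : 0 < delta.
Hypothesis dP : forall x, U x -> differentiable P x /\ D1 P x = p1 x.
Hypothesis dp1 : forall x, U x -> differentiable p1 x.
Hypothesis p1_lim : forall e : R, 0 < e -> exists X : R, forall x, Omega x.2 -> X < complex.Re x.1 ->
  rnorm (p1 x - cexp (kappa%:C * x.1)) <= e * expR (kappa * complex.Re x.1).
Hypothesis dB : forall i k x, U x -> differentiable (B i k) x.
Hypothesis bB : forall t1 t2 : R, exists K X : R, forall i k x, Omega x.2 ->
  t1 <= complex.Im x.1 <= t2 -> X < complex.Re x.1 -> rnorm (B i k x) <= K * expR (- (delta * complex.Re x.1)).

(** * Solutions in the slit plane *)

Section Slit.
Variables (alpha gam : R) (b : bool) (lam : 'I_n -> C R) (eta : 'I_n -> R).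
Hypothesis gam0 : 0 < gam.
Hypothesis gam1 : gam < pi / 2.
Hypothesis eta_gam : forall i, `|eta i| < gam.
Hypothesis lam_eta : forall i, lam i = 0 \/ 0 < complex.Re (lam i * expi (alpha + eta i)).

Let W := of_slit kappa alpha.
Let q := delta / kappa.
Let h0 (t : R) := expR (- ((1 + q) * ln t)).
Let H0 (t : R) := - (expR (- (q * ln t)) / q).

Definition slit_P x : C R := P (W x.1, x.2).
(** The factor is [dw / dy]. *)
Definition slit_B i k x : C R := (kappa%:C * x.1)^-1 * B i k (W x.1, x.2).

Let q0 : 0 < q. Proof. exact: divr_gt0. Qed.

Let pos_kappa : kappa != 0. Proof. by rewrite gt_eqF. Qed.

Lemma slit_admissible : exists2 c : R, 0 < c & forall i, admissible setT (wedge gam b) c (expi (eta i)).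
Proof.
have [i|c c0 Hc] := @finite_lower R n (fun i => sin (gam - `|eta i|)).
  apply: sin_gt0_pi; have := eta_gam i; have := normr_ge0 (eta i); have := pi_gt0 R; move: gam1.
  by move=> *; apply/andP; split; lra.
exists c => // i; split; first exact: rnorm_expi.
move=> y s s0 _; split=> //; apply: le_trans (wedge_shift gam0 gam1 b y s0 _).
  by rewrite lerD2l; apply: ler_wpM2r.
by have := eta_gam i; have := pi_gt0 R; move: gam1; lra.
Qed.

(** In the coordinate [y] the leading term of the derivative of [P] is the constant
    [exp (i alpha) / kappa]. It contributes at least [e |lam i| / kappa] to the real part, and the
    error takes away at most as much. *)
Lemma slit_P_pos (e : R) x i : (lam i = 0 \/ e <= complex.Re (lam i * expi (alpha + eta i)) / rnorm (lam i)) ->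
  0 < slit x.1 -> rnorm (p1 (W x.1, x.2) - cexp (kappa%:C * W x.1)) <= e * expR (kappa * complex.Re (W x.1)) ->
  0 <= complex.Re (lam i * ((kappa%:C * x.1)^-1 * p1 (W x.1, x.2)) * expi (eta i)).
Proof.
move=> [->|le] x0; first by rewrite !mul0r.
have [->|l0] := eqVneq (lam i) 0; first by rewrite !mul0r.
have y0 := slit_rnorm x0; have yn : x.1 != 0 by rewrite -rnorm_eq0 gt_eqF.
rewrite cexp_of_slit // Re_of_slit [kappa * _]mulrC divfK // lnK // => pe.
set D := p1 _ - _ in pe.
have -> : lam i * ((kappa%:C * x.1)^-1 * p1 (W x.1, x.2)) * expi (eta i) =
    (kappa^-1)%:C * (lam i * expi (alpha + eta i) + lam i * expi (eta i) * (x.1^-1 * D)).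
  have kn : kappa%:C != 0 :> C R by apply/eqP => /(congr1 (@complex.Re R)) /= /eqP; apply/negP.
  have pD : p1 (W x.1, x.2) = D + x.1 * expi alpha by rewrite /D subrK.
  by rewrite pD fmorphV expiD; field; rewrite yn kn.
rewrite ReZ ReD mulr_ge0 ?invr_ge0 ?(ltW kappa0) //.
have l1 : 0 < rnorm (lam i) by rewrite rnorm_gt0.
have i1 : - rnorm (lam i * expi (eta i) * (x.1^-1 * D)) <= complex.Re (lam i * expi (eta i) * (x.1^-1 * D)).
  by have := Re_le_rnorm (lam i * expi (eta i) * (x.1^-1 * D)); rewrite ler_norml => /andP[].
have i2 : rnorm (lam i * expi (eta i) * (x.1^-1 * D)) <= rnorm (lam i) * e.
  rewrite rnormM (rnormM (lam i)) rnorm_expi mulr1; apply: ler_wpM2l; first exact: ltW.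
  by rewrite rnormM rnormV mulrC ler_pdivrMr.
move: le; rewrite ler_pdivlMr // mulrC => i3; lra.
Qed.

Lemma slit_setup : exists (r CS c : R), [/\ 1 <= r, 0 <= CS, 0 < c & [/\
  forall i, admissible setT (wedge gam b) c (expi (eta i)),
  forall t, r < t -> 4 * (n%:R * CS * (- H0 t / c)) <= 1 &
  forall x, level Omega setT (wedge gam b) r x -> [/\ 0 < slit x.1, U (W x.1, x.2),
    differentiable slit_P x /\ D1 slit_P x = (kappa%:C * x.1)^-1 * p1 (W x.1, x.2),
    forall i, 0 <= complex.Re (lam i * D1 slit_P x * expi (eta i)) &
    forall i k, differentiable (slit_B i k) x /\ rnorm (slit_B i k x) <= CS * h0 (wedge gam b x.1)]]].
Proof.
have [c c0 ad] := slit_admissible.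
(* [e] is a positive lower bound for the cosines of the arguments of
   [lam i exp (i (alpha + eta i))], over the nonzero [lam i]; a relative error [e] in [p1] cannot
   reverse the signs. *)
have [i|e e0 He] := @finite_lower R n (fun i => if lam i == 0 then 1 else complex.Re (lam i * expi (alpha + eta i)) / rnorm (lam i)).
  by case: eqVneq => [//|l0]; have [/eqP|h] := lam_eta i; [rewrite (negbTE l0)|rewrite divr_gt0 // rnorm_gt0].
have [X1 HX1] := p1_lim e0.
(* Arguments on the slit plane lie between [- pi] and [pi], so one bound on this closed strip serves
   every [y]. *)
have [K [X2 HX2]] := bB ((alpha - pi) / kappa) ((alpha + pi) / kappa).
pose CS := `|K| / kappa.
have CS0 : 0 <= CS by rewrite divr_ge0 // ltW.
(* Once [- H0] is below this threshold the operator contracts by 1/2; the summand 1 avoids a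
   division by zero. *)
have e1p : 0 < c / (4 * (n%:R * CS + 1)) by rewrite divr_gt0 // mulr_gt0 // ltr_wpDl // mulr_ge0.
have [T HT] := profile_lim (profile_pow q0 ler01) e1p.
pose X := Num.max m (Num.max X1 X2).
(* The weight is at most [|y|], so a weight above [r] forces [|y| > exp (kappa X)], that is
   [Re w > X]. *)
pose r := Num.max (Num.max 1 T) (expR (kappa * X)).
exists r, CS, c; split; [by rewrite !le_max lexx|exact: CS0|exact: c0|split; [exact: ad|move=> t|move=> x [_ rx Ox]]].
  rewrite !gt_max => /andP[/andP[_ Tt] _]; have := HT t Tt; rewrite -/(H0 t) lerNl => Ht.
  have n0 : 0 <= n%:R * CS by rewrite mulr_ge0.
  apply: le_trans (_ : 4 * (n%:R * CS * ((c / (4 * (n%:R * CS + 1))) / c)) <= _).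
    by do 2! (apply: ler_wpM2l => //); rewrite ler_wpM2r // invr_ge0 ltW.
  have -> : 4 * (n%:R * CS * ((c / (4 * (n%:R * CS + 1))) / c)) = (n%:R * CS) / (n%:R * CS + 1).
    have cn : c != 0 by rewrite gt_eqF.
    have nn : n%:R * CS + 1 != 0 by rewrite gt_eqF // ltr_wpDl.
    by field; rewrite nn cn.
  by rewrite ler_pdivrMr ?mul1r ?ltr_wpDl // lerDl.
have w0 : 0 < wedge gam b x.1.
  by apply: le_lt_trans rx; rewrite !le_max ler01.
have s0 := wedge_slit gam0 gam1 w0.
have y0 := slit_rnorm s0; have yn : x.1 != 0 by rewrite -rnorm_eq0 gt_eqF.
have XW : X < complex.Re (W x.1).
  rewrite Re_of_slit ltr_pdivlMr // mulrC -ltr_expR lnK //; apply: lt_le_trans (wedge_le gam0 gam1 b x.1).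
  by apply: le_lt_trans rx; rewrite le_max lexx orbT.
move: XW; rewrite !gt_max => /and3P[mW X1W X2W].
have Ux : U (W x.1, x.2) by [].
have [dPx EP] := dP Ux; have [dW EW] := @diff_of_slit R kappa alpha x.1 s0.
have [dS ES] := D1_comp_fst dW EW dPx.
have ES2 := etrans ES (congr1 (fun z => (kappa%:C * x.1)^-1 * z) EP).
split; [exact: s0|exact: Ux|by split; [exact: dS|exact: ES2]| |].
- move=> i; have Pe := HX1 (W x.1, x.2) Ox X1W.
  have ci : lam i = 0 \/ e <= complex.Re (lam i * expi (alpha + eta i)) / rnorm (lam i).
    by have := He i; case: eqVneq; [left|right].
  have comb (z z' : C R) : z = z' -> 0 <= complex.Re (lam i * z' * expi (eta i)) ->
      0 <= complex.Re (lam i * z * expi (eta i)) by move=> ->.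
  exact: (comb _ _ ES2 (slit_P_pos ci s0 Pe)).
- move=> i k; split.
    have dk : differentiable (fun u : E => kappa%:C * u.1 : C R) x.
      by apply: differentiableM; [exact: differentiable_cst|exact: differentiable_fst].
    have [dBx _] := D1_comp_fst dW EW (dB i k Ux).
    have kn : kappa%:C * x.1 != 0.
      apply: mulf_neq0; last exact: yn.
      by rewrite -[_ == _](rnorm_eq0 (kappa%:C : C R)) rnorm_real normr_eq0.
    apply: differentiableM; last exact: dBx.
    exact: (differentiableV dk kn).
  have HB : (alpha - pi) / kappa <= complex.Im (W x.1) <= (alpha + pi) / kappa -> X2 < complex.Re (W x.1) ->
      rnorm (B i k (W x.1, x.2)) <= K * expR (- (delta * complex.Re (W x.1))) := HX2 i k (W x.1, x.2) Ox.
  have {}HB := HB^~ X2W; rewrite Im_of_slit Re_of_slit in HB.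
  rewrite /slit_B rnormM rnormV rnormM rnorm_nneg ?(ltW kappa0) //.
  have cb := carg_bound x.1; move: cb; rewrite ltr_norml => /andP[cb1 cb2].
  have ki : 0 <= (kappa * rnorm x.1)^-1 by rewrite invr_ge0 mulr_ge0 ?rnorm_ge0 // ltW.
  apply: le_trans (ler_wpM2l ki (HB _)) _.
    by rewrite !ler_pM2r ?invr_gt0 //; apply/andP; split; lra.
  apply: le_trans (_ : CS * h0 (rnorm x.1) <= _).
    have -> : (kappa * rnorm x.1)^-1 * (K * expR (- (delta * (ln (rnorm x.1) / kappa)))) = K / kappa * h0 (rnorm x.1).
      rewrite /h0 mulrDl mul1r opprD expRD (expRN (ln _)) (lnK y0).
      have -> : q * ln (rnorm x.1) = delta * (ln (rnorm x.1) / kappa) by rewrite /q mulrAC mulrA.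
      by field; rewrite pos_kappa gt_eqF.
    by rewrite /CS !ler_wpM2r ?expR_ge0 ?invr_ge0 ?ler_norm // ltW.
  apply: ler_wpM2l => //; apply: (profile_anti (profile_pow q0 ler01)); last exact: wedge_le.
  by apply: le_lt_trans rx; rewrite !le_max lexx.
Qed.

Local Notation coef := (perturbed lam p1 B).
Local Notation coefS := (perturbed lam (D1 slit_P) slit_B).

Lemma row_app_slit (phi psi : 'I_n -> E -> C R) i x v : x.1 != 0 ->
  v = (W x.1, x.2) -> D1 slit_P x = (kappa%:C * x.1)^-1 * p1 v -> (forall k, phi k v = psi k x) ->
  kappa%:C * x.1 * row_app coefS psi i x = row_app coef phi i v.
Proof.
move=> x0 -> EP pp; have kn : kappa%:C != 0 :> C R.
  by rewrite -[_ == _](rnorm_eq0 (kappa%:C : C R)) rnorm_real normr_eq0.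
have k1 (z : C R) : kappa%:C * x.1 * ((kappa%:C * x.1)^-1 * z) = z by rewrite mulVKf // mulf_neq0.
rewrite !row_app_perturbed EP mulrDr pp; congr (_ + _).
  by rewrite -[RHS]k1; ring.
rewrite /row_app mulr_sumr; apply: eq_bigr => k _.
by rewrite /slit_B -(pp k) mulrA -/W; congr (_ * _); exact: k1.
Qed.

Lemma slit_solution_exists j (eps : R) : b = false -> lam j = 0 -> 0 < eps ->
  exists (p : 'I_n -> E -> C R) (X K : R), forall x, Omega x.2 ->
    `|kappa * complex.Im x.1 - alpha| <= pi - gam - eps -> X < complex.Re x.1 ->
    ode coef p x /\ forall i, rnorm (p i x - (i == j)%:R) <= K * expR (- (delta * complex.Re x.1)).
Proof.
move=> bF lamj eps0; have [r [CS [c [r1 CS0 c0 [ad small HD]]]]] := slit_setup.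
have r0 : 0 <= r by exact: le_trans r1.
have [||||pt Hpt] := @perturbed_exists R n Omega setT (wedge gam b) r h0 H0 c oO openT
  (@continuous_wedge R gam b) (profile_pow q0 r0) c0 lam (fun i => expi (eta i)) slit_P slit_B CS ad _ _ _ CS0 _ small j lamj.
- by move=> x /HD[_ _ [d _] _ _].
- by move=> i x /HD[_ _ _ h _].
- by move=> i k x /HD[_ _ _ _ h]; have [] := h i k.
- by move=> i k x /HD[_ _ _ _ h]; have [] := h i k.
have pg : gam < pi by move: gam1; have := pi_gt0 R; lra.
(* On the slightly smaller closed sector the weight is at least [s1 |y|], which converts decay in
   the weight into decay in [|y|]. *)
have [s1 s10 Hs1] : exists2 s1 : R, 0 < s1 & forall t, gam <= t <= pi - eps -> s1 <= sin t.
  have [ge|ge] := leP gam (pi - eps); last first.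
    exists 1 => // t /andP[t1 t2]; have : gam <= pi - eps by exact: le_trans t2.
    by rewrite leNgt ge.
  have [|z zi Hz] := @EVT_min _ (@sin R) _ _ ge.
    by apply: continuous_subspaceT; exact: continuous_sin.
  move: zi; rewrite in_itv /= => /andP[z1 z2].
  exists (sin z) => [|t tt]; last by apply: Hz; rewrite in_itv.
  by apply: sin_gt0_pi; apply/andP; split; [exact: lt_le_trans z1|lra].
pose X := ln (r / s1) / kappa.
exists (fun i x => pt i (to_slit kappa alpha x.1, x.2)), X, (4 * (n%:R * CS / c / q) * expR (- (q * ln s1))).
move=> x Ox xs Xx; set y := to_slit kappa alpha x.1.
have xpi : `|kappa * complex.Im x.1 - alpha| < pi.
  by apply: le_lt_trans xs _; rewrite -addrA gtrDl -opprD oppr_lt0 addr_gt0.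
have [ys Wy] := to_slitK kappa0 xpi.
have Ny : s1 * expR (kappa * complex.Re x.1) <= wedge gam b y.
  rewrite /y to_slitE bF wedge_polar ?expR_ge0 ?(ltW xpi) // expr0 mul1r mulrC.
  apply: ler_wpM2l; first exact: expR_ge0.
  by apply: Hs1; rewrite lerDl normr_ge0 /=; lra.
have rs : 0 < r / s1 by rewrite divr_gt0 //; exact: lt_le_trans r1.
have ry : r < wedge gam b y.
  apply: lt_le_trans Ny; rewrite mulrC -ltr_pdivrMr // -ltr_ln ?posrE ?expR_gt0 // expRK.
  by move: Xx; rewrite /X ltr_pdivrMr // [_ * kappa]mulrC.
have Dy : level Omega setT (wedge gam b) r (y, x.2) by [].
have [Hode Hb] := Hpt _ Dy; have [_ _ [_ EP] _ _] := HD _ Dy.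
have yn : y != 0 by rewrite -rnorm_eq0 gt_eqF // slit_rnorm.
have xE : x = (W y, x.2) by rewrite /W Wy; case: (x).
split=> i; last first.
  apply: le_trans (Hb i) _.
  have -> : 4 * (n%:R * CS * (- H0 (wedge gam b y) / c)) = 4 * (n%:R * CS / c / q) * expR (- (q * ln (wedge gam b y))).
    have cn : c != 0 by rewrite gt_eqF.
    have qn : q != 0 by rewrite gt_eqF.
    by rewrite /H0; field; rewrite qn cn.
  rewrite -[leRHS]mulrA -expRD; apply: ler_wpM2l.
    by rewrite !mulr_ge0 ?invr_ge0 // ltW.
  rewrite ler_expR -opprD lerN2.
  have -> : delta * complex.Re x.1 = q * (kappa * complex.Re x.1) by rewrite mulrA /q divfK.
  rewrite -mulrDr; apply: ler_wpM2l; first exact: ltW.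
  rewrite -[X in _ + X]expRK -lnM ?posrE ?expR_gt0 // ler_ln ?posrE ?mulr_gt0 ?expR_gt0 //.
  by apply: le_lt_trans ry.
have [dpi Ei] := Hode i; have [dt Et] := diff_to_slit kappa alpha x.1.
have [d1 E1] := D1_comp_fst dt Et dpi; split; first exact: d1.
apply: etrans E1 _; apply: etrans (congr1 (fun z => kappa%:C * y * z) Ei) _.
have EP' := etrans EP (congr1 (fun v => (kappa%:C * y)^-1 * p1 v) (esym xE)).
pose phi k v := pt k (to_slit kappa alpha v.1, v.2).
exact: (@row_app_slit phi pt i (y, x.2) x yn xE EP' (fun k => erefl)).
Qed.

(** One point suffices, since [solution_zero] propagates the zero to the whole half-plane. As the
    weight is at most [|y|], decay in [|y|] implies the decay in the weight that [perturbed_unique]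
    asks for. *)
Lemma slit_solution_zero (p : 'I_n -> E -> C R) (X K : R) (omega : C R) : Omega omega -> b = true ->
  (forall x, U x -> ode coef p x) ->
  (forall i x, Omega x.2 -> `|kappa * complex.Im x.1 - alpha| <= gam -> X < complex.Re x.1 ->
     rnorm (p i x) <= K * expR (- (delta * complex.Re x.1))) ->
  exists2 w, m < complex.Re w & forall i omega, Omega omega -> p i (w, omega) = 0.
Proof.
move=> Oo bT Hp Kp; have [r [CS [c [r1 CS0 c0 [ad small HD]]]]] := slit_setup.
pose r' := Num.max r (expR (kappa * X)).
have rr : r <= r' by rewrite le_max lexx.
have r0 : 0 <= r' by exact: le_trans (le_trans r1 rr).
have sub x : level Omega setT (wedge gam b) r' x -> level Omega setT (wedge gam b) r x.
  by move=> [_ h ?]; split=> //; exact: le_lt_trans h.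
pose pt i x : C R := p i (W x.1, x.2).
have Z : forall i x, level Omega setT (wedge gam b) r' x -> pt i x = 0.
  apply: (@perturbed_unique R n Omega setT (wedge gam b) r' h0 H0 c oO openT
    (@continuous_wedge R gam b) (profile_pow q0 r0) c0 lam (fun i => expi (eta i)) slit_P slit_B CS ad _ _ _ CS0 _ _ pt (`|K| * q) q^-1).
  - by move=> x /sub/HD[_ _ [d _] _ _].
  - by move=> i x /sub/HD[_ _ _ h _].
  - by move=> i k x /sub/HD[_ _ _ _ h]; have [] := h i k.
  - by move=> i k x /sub/HD[_ _ _ _ h]; have [] := h i k.
  - by move=> t rt; apply: small; exact: le_lt_trans rt.
  - move=> t rt; rewrite /H0 opprK -[leRHS]mul1r ler_pM2r ?invr_gt0 // -expR0 ler_expR oppr_le0 mulr_ge0 ?(ltW q0) //.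
    by apply: ln_ge0; apply: le_trans r1 (le_trans rr (ltW rt)).
  - by rewrite mulr_ge0 // ltW.
  - move=> x Dx i; have [ys Ux [_ EP] _ _] := HD x (sub x Dx).
    have yn : x.1 != 0 by rewrite -rnorm_eq0 gt_eqF // slit_rnorm.
    have [dpi Ei] := Hp _ Ux i; have [dW EW] := @diff_of_slit R kappa alpha x.1 ys.
    have [d1 E1] := D1_comp_fst dW EW dpi; split; first exact: d1.
    apply: etrans E1 _; apply: etrans (congr1 (fun z => (kappa%:C * x.1)^-1 * z) Ei) _.
    have kn : kappa%:C != 0 :> C R.
      by rewrite -[_ == _](rnorm_eq0 (kappa%:C : C R)) rnorm_real normr_eq0.
    have := @row_app_slit p pt i x _ yn erefl EP (fun k => erefl) => <-.
    by rewrite mulKf // mulf_neq0.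
  - move=> i x Dx; have [ys Ux _ _ _] := HD x (sub x Dx).
    have [_ rx Ox] := Dx; have y0 := slit_rnorm ys.
    have cg : `|carg x.1| < gam.
      by apply: wedge_carg => //; rewrite -bT; exact: le_lt_trans rx.
    have ReW : complex.Re (W x.1) = ln (rnorm x.1) / kappa by exact: Re_of_slit.
    have : rnorm (p i (W x.1, x.2)) <= K * expR (- (delta * complex.Re (W x.1))).
      have ImW : complex.Im (W x.1) = (carg x.1 + alpha) / kappa by exact: Im_of_slit.
      apply: (Kp i (W x.1, x.2) Ox).
        change (`|kappa * complex.Im (W x.1) - alpha| <= gam).
        by rewrite ImW mulrC divfK // addrK ltW.
      change (X < complex.Re (W x.1)); rewrite ReW ltr_pdivlMr // mulrC -ltr_expR lnK //.
      by apply: lt_le_trans (wedge_le gam0 gam1 b x.1); apply: le_lt_trans rx; rewrite le_max lexx orbT.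
    rewrite ReW => /le_trans; apply.
    have -> : delta * (ln (rnorm x.1) / kappa) = q * ln (rnorm x.1) by rewrite /q mulrAC mulrA.
    have w0 : 0 < wedge gam b x.1 by exact: le_lt_trans rx.
    have -> : `|K| * q * - H0 (wedge gam b x.1) = `|K| * expR (- (q * ln (wedge gam b x.1))).
      by rewrite /H0; field; rewrite gt_eqF.
    apply: le_trans (_ : `|K| * expR (- (q * ln (rnorm x.1))) <= _).
      by rewrite ler_wpM2r ?expR_ge0 // ler_norm.
    apply: ler_wpM2l => //; rewrite ler_expR lerN2 ler_wpM2l ?(ltW q0) // ler_ln ?posrE //.
    exact: wedge_le.
have sg := sin_gam gam0 gam1.
(* The point of the axis with weight [r' + 1]. *)
pose y : C R := ((r' + 1) / sin gam)%:C.
have ry : r' < wedge gam b y.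
  by rewrite /wedge /y /= normr0 mul0r mulr0 addr0 divfK ?gt_eqF // ltrDl.
exists (W y) => [|i omega' Oo']; last exact: (Z i (y, omega') (And3 I ry Oo')).
by have [_ [mW _] _ _ _] := HD (y, omega) (sub (y, omega) (And3 I ry Oo)).
Qed.

End Slit.

(** * Continuation to the whole half-plane *)

Section Global.
Variable lam : 'I_n -> C R.
Local Notation coef := (perturbed lam p1 B).

Lemma differentiable_perturbed i k x : U x -> differentiable (coef i k) x.
Proof.
move=> Ux; apply: differentiableD; last exact: dB.
apply: differentiableM; first exact: differentiable_cst.
by apply: differentiableM; [exact: differentiable_cst|exact: dp1].
Qed.

Lemma hseg_half_plane x w t : 0 <= t <= 1 -> U x -> m < complex.Re w -> U (hseg x w t).
Proof.
move=> t01 [mx Ox] mw.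
have := @rseg_in R m Omega x.1 mx t (w, x.2) t01 (conj mw Ox).
rewrite /rseg /hseg /= => H.
have -> : x + t%:C *: ((w - x.1, 0) : E) = (x.1 + t%:C * (w - x.1), x.2); last exact: H.
by apply: injective_projections; rewrite /= ?scaler0 ?addr0.
Qed.

Lemma solution_zero (p : 'I_n -> E -> C R) w (omega : C R) : (forall x, U x -> ode coef p x) ->
  Omega omega -> m < complex.Re w -> (forall i, p i (w, omega) = 0) ->
  forall w', m < complex.Re w' -> forall i, p i (w', omega) = 0.
Proof.
move=> Hp Oo mw p0 w' mw'; have Hs t : 0 <= t <= 1 -> U (hseg (w, omega) w' t).
  by move=> t01; exact: hseg_half_plane.
apply: (@ode_unique R n coef p (w, omega) w' _ _ p0) => t t01; first exact: Hp (Hs t t01).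
by move=> i k; apply: differentiable_continuous; exact: differentiable_perturbed (Hs t t01).
Qed.

(* Over a half-strip, any solution is a combination of the fundamental solutions based at one
   point, with coefficients holomorphic in the parameter. *)
Lemma solution_extends (p : 'I_n -> E -> C R) (t1 t2 X : R) : t1 < t2 -> m <= X ->
  (forall x, Omega x.2 -> t1 < complex.Im x.1 < t2 -> X < complex.Re x.1 -> ode coef p x) ->
  exists phi : 'I_n -> E -> C R, (forall x, U x -> ode coef phi x) /\
    forall i x, Omega x.2 -> t1 < complex.Im x.1 < t2 -> X < complex.Re x.1 -> phi i x = p i x.
Proof.
(* A base point inside the half-strip. The combination and [p] agree there, and segments from it to
   points of the half-strip stay inside by convexity, so [ode_unique] applies on them. *)
move=> t12 mX Hp; pose w0 : C R := (X + 1) +i* ((t1 + t2) / 2).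
have X0 : X < complex.Re w0 by rewrite /= ltrDl.
have t0 : t1 < complex.Im w0 < t2 by rewrite /=; apply/andP; split; lra.
have mw0 : m < complex.Re w0 by exact: le_lt_trans X0.
have [Y HY] := @fundamental_solution R n m Omega w0 coef oO mw0 differentiable_perturbed.
pose phi i x := \sum_j Y j i x * p j (w0, x.2).
have dpj j x : Omega x.2 -> differentiable (fun u : E => p j (w0, u.2)) x /\
    D1 (fun u : E => p j (w0, u.2)) x = 0.
  move=> Ox; have [dj _] := Hp (w0, x.2) Ox t0 X0 j.
  have dc : differentiable (fun=> w0 : C R) x.1 by exact: differentiable_cst.
  have E0 : 'd (fun=> w0 : C R) (x.1) 1 = 0 by exact: (congr1 (fun F => F (1 : C R)) (diff_cst w0 x.1)).
  have [d1 E1] := D1_comp_fst dc E0 dj; split; first exact: d1.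
  by apply: etrans E1 _; exact: mul0r.
have Hphi x : U x -> ode coef phi x.
  move=> Ux i; have [_ Ox] := Ux.
  have dY j : differentiable (Y j i) x by have [/(_ x Ux i)[]] := HY j.
  have dt j : differentiable (fun u : E => Y j i u * p j (w0, u.2)) x.
    by apply: differentiableM; [exact: dY|have [] := dpj j x Ox].
  have [ds E1] := diff_sum_apply (index_enum 'I_n) ((1, 0) : E) dt.
  split; first exact: ds.
  apply: etrans E1 _; rewrite /row_app; under [RHS]eq_bigr do rewrite /phi mulr_sumr.
  rewrite exchange_big /=; apply: eq_bigr => j _.
  have [d2 E2] := dpj j x Ox; have E3 := diffM_apply ((1, 0) : E) (dY j) d2.
  have [/(_ x Ux i)[_ E4] _] := HY j.
  have comb (a b c d e : C R) : a = b * c + d * e -> c = 0 -> a = d * e by move=> -> ->; rewrite mulr0 add0r.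
  apply: etrans (comb _ _ _ _ _ E3 E2) _; rewrite mulrC.
  apply: etrans (congr1 (fun z => z * p j (w0, x.2)) E4) _.
  by rewrite /row_app mulr_suml; apply: eq_bigr => k _; rewrite mulrA.
exists phi; split=> // i [w omega] /= Oo tw Xw.
pose h i x := phi i x - p i x.
have phi0 k : phi k (w0, omega) = p k (w0, omega).
  rewrite /phi (bigD1 k) //= big1 ?addr0 => [|j jk].
    by have [_ ->] := HY k; rewrite ?eqxx ?mul1r.
  by have [_ ->] := HY j; rewrite // eq_sym (negbTE jk) mul0r.
have H0 k : h k (w0, omega) = 0 by rewrite /h phi0 subrr.
have ode_h x : U x -> Omega x.2 -> t1 < complex.Im x.1 < t2 -> X < complex.Re x.1 -> ode coef h x.
  move=> Ux Ox tx Xx k; have [d1 E1] := Hphi x Ux k; have [d2 E2] := Hp x Ox tx Xx k.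
  split; first exact: differentiableB.
  apply: etrans (diffB_apply ((1, 0) : E) d1 d2) _.
  by apply: etrans (congr2 (fun a b => a - b) E1 E2) _; rewrite row_appB.
have := @ode_unique R n coef h (w0, omega) w _ _ H0 i; rewrite /h => /= H1.
apply/eqP; rewrite -subr_eq0; apply/eqP; apply: H1 => t t01.
  have Us : U (hseg (w0, omega) w t) by apply: hseg_half_plane => //; exact: le_lt_trans Xw.
  have Es : hseg (w0, omega) w t = (w0 + t%:C * (w - w0), omega).
    by apply: injective_projections; rewrite /hseg /= ?scaler0 ?addr0.
  have /andP[ta tb] := t01; have /andP[tw1 tw2] := tw; have /andP[t01' t02] := t0.
  have conv (a b c : R) : c < a -> c < b -> c < a + t * (b - a).
    move=> ca cb; have -> : a + t * (b - a) = (1 - t) * a + t * b by ring.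
    have [->|tn] := eqVneq t 0; first by rewrite subr0 mul1r mul0r addr0.
    have t0' : 0 < t by rewrite lt_def tn.
    have i1 : (1 - t) * c <= (1 - t) * a by rewrite ler_wpM2l ?subr_ge0 // ltW.
    have i2 : t * c < t * b by rewrite ltr_pM2l.
    lra.
  apply: ode_h => //; rewrite Es; cbv [fst snd].
  - exact: Oo.
  - rewrite ImD ImZ ImD ImN; apply/andP; split; first exact: conv.
    by have := conv (- complex.Im w0) (- complex.Im w) (- t2); rewrite !ltrN2 => /(_ t02 tw2); lra.
  - by rewrite ReD ReZ ReD ReN; exact: conv.
move=> k l; apply: differentiable_continuous; apply: differentiable_perturbed.
by apply: hseg_half_plane => //; exact: le_lt_trans Xw.
Qed.

(* When all exponents vanish, the flow can be the horizontal translation of [w] in a half-strip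
   of any width. *)
Lemma strip_solution_exists j (t1 t2 : R) : (forall i, lam i = 0) ->
  exists (p : 'I_n -> E -> C R) (X K : R), forall x, Omega x.2 ->
    t1 < complex.Im x.1 < t2 -> X < complex.Re x.1 ->
    ode coef p x /\ forall i, rnorm (p i x - (i == j)%:R) <= K * expR (- (delta * complex.Re x.1)).
Proof.
move=> lam0; have [K [X1 HK]] := bB t1 t2.
pose V : set (C R) := [set y | t1 < complex.Im y < t2].
have cRe : forall y, {for y, continuous (fun y : C R => complex.Re y)}.
  by move=> y; apply: (@continuous_Re _ _ id); exact: cvg_id.
have oV : open V.
  rewrite openE => y /andP[y1 y2]; apply/nbhs_rnormP.
  exists (Num.min (complex.Im y - t1) (t2 - complex.Im y)); first by rewrite lt_min !subr_gt0 y1 y2.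
  move=> u; rewrite lt_min => /andP[u1 u2]; rewrite /V /=.
  have := Im_le_rnorm (u - y); rewrite ImD ImN ler_norml => /andP[i1 i2].
  by apply/andP; split; lra.
have e1p : 0 < 1 / (4 * (n%:R * `|K| + 1)) by rewrite divr_gt0 // mulr_gt0 // ltr_wpDl // mulr_ge0.
pose H0 (t : R) := - (expR (- (delta * t)) / delta).
have [T HT] := profile_lim (profile_exp delta0 0) e1p.
pose r := Num.max m (Num.max X1 T).
have ad i : admissible V (@complex.Re R) 1 ((fun=> 1) i : C R).
  split; first exact: rnorm1.
  move=> y s s0 Vy; rewrite mulr1 mul1r /V /= ImD ReD /= addr0; split=> //.
have sub x : level Omega V (@complex.Re R) r x -> [/\ U x, X1 < complex.Re x.1 & V x.1].
  by move=> [Vx]; rewrite !gt_max => /and3P[mx X1x _] Ox.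
have [|||||p Hp] := @perturbed_exists R n Omega V (@complex.Re R) r (fun t => expR (- (delta * t))) H0 1 oO oV
   cRe (profile_exp delta0 r) ltr01 lam (fun=> 1) P B `|K| ad _ _ _ (normr_ge0 K) _ _ j (lam0 j).
- by move=> x /sub[/dP[]].
- by move=> i x _; rewrite lam0 !mul0r.
- by move=> i k x /sub[/dB].
- move=> i k x /[dup] Dx /sub[[_ Ox] X1x Vx]; apply: le_trans (HK i k x Ox _ X1x) _.
    by move: Vx => /andP[v1 v2]; rewrite !ltW.
  by rewrite ler_wpM2r ?expR_ge0 // ler_norm.
- move=> t; rewrite !gt_max => /and3P[_ _ /HT]; rewrite -/(H0 t) lerNl => Ht.
  have n0 : 0 <= n%:R * `|K| by rewrite mulr_ge0.
  apply: le_trans (_ : 4 * (n%:R * `|K| * (1 / (4 * (n%:R * `|K| + 1)))) <= _).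
    by rewrite divr1; do 2! (apply: ler_wpM2l => //).
  have nn : n%:R * `|K| + 1 != 0 by rewrite gt_eqF // ltr_wpDl.
  have -> : 4 * (n%:R * `|K| * (1 / (4 * (n%:R * `|K| + 1)))) = (n%:R * `|K|) / (n%:R * `|K| + 1) by field.
  by rewrite ler_pdivrMr ?mul1r ?ltr_wpDl // lerDl.
exists p, r, (4 * (n%:R * `|K| / delta)) => x Ox Vx rx.
have Dx : level Omega V (@complex.Re R) r x by [].
have [Ux _ _] := sub x Dx; have [Ho Hb] := Hp x Dx; split=> i.
  have [di Ei] := Ho i; split=> //; apply: etrans Ei _; rewrite !row_app_perturbed.
  by have [_ ->] := dP Ux.
apply: le_trans (Hb i) (eq_le_of _); rewrite /H0; field.
by rewrite gt_eqF.
Qed.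

End Global.

(** * Existence and uniqueness in sectors *)

Definition near_delta (t1 t2 : R) (phi : 'I_n -> E -> C R) j := exists K X : R, forall x, Omega x.2 ->
  t1 <= complex.Im x.1 <= t2 -> X < complex.Re x.1 ->
  forall i, rnorm (phi i x - (i == j)%:R) <= K * expR (- (delta * complex.Re x.1)).

Definition small_on (t1 t2 : R) (phi : 'I_n -> E -> C R) := exists K X : R, forall x, Omega x.2 ->
  t1 <= complex.Im x.1 <= t2 -> X < complex.Re x.1 ->
  forall i, rnorm (phi i x) <= K * expR (- (delta * complex.Re x.1)).

Definition signed (a b : R) (l : C R) :=
  [\/ l = 0, forall t, a <= t <= b -> 0 < complex.Re (l * expi t) |
     forall t, a <= t <= b -> complex.Re (l * expi t) < 0].

Lemma signed_ends (lam : 'I_n -> C R) (a b : R) : a <= b -> (forall i, signed a b (lam i)) ->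
  forall i, [\/ lam i = 0, 0 < complex.Re (lam i * expi a) /\ 0 < complex.Re (lam i * expi b) |
     complex.Re (lam i * expi a) < 0 /\ complex.Re (lam i * expi b) < 0].
Proof.
move=> ab H i; have [l0|p|p] := H i; [by apply: Or31|apply: Or32|apply: Or33]; split; apply: p.
all: by rewrite lexx ab.
Qed.

(** Rotation by [pi] reverses the sign of the real part, so no nonzero [l] keeps one sign on an
    interval of length [pi]. *)
Lemma signed_width (a b : R) (l : C R) : l != 0 -> a <= b -> signed a b l -> b - a < pi.
Proof.
move=> l0 ab H; rewrite ltNge; apply/negP => ba.
have pi0 := pi_gt0 R.
have i1 : a <= a <= b by rewrite lexx ab.
have i2 : a <= a + pi <= b by apply/andP; split; lra.
have E1 : complex.Re (l * expi (a + pi)) = - complex.Re (l * expi a) by rewrite expi_pi mulrN ReN.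
have [/eqP|p|p] := H; first by rewrite (negbTE l0).
  by have := p _ i1; have := p _ i2; rewrite E1; lra.
by have := p _ i1; have := p _ i2; rewrite E1; lra.
Qed.

(** The margin [eps] left by [directions] is kept in the statement: it gives two such solutions an
    overlap of positive width, even when [a = b]. *)
Lemma sector_solution_exists (lam : 'I_n -> C R) j (a b : R) : a <= b -> lam j = 0 ->
  (forall i, signed a b (lam i)) ->
  exists2 eps : R, 0 < eps & exists2 phi : 'I_n -> E -> C R,
    (forall x, U x -> ode (perturbed lam p1 B) phi x) &
    near_delta ((a - eps) / kappa) ((b + pi + eps) / kappa) phi j.
Proof.
move=> ab lamj sgn; have pi0 := pi_gt0 R.
suff [eps eps0 [p [X [K Hp]]]] : exists2 eps : R, 0 < eps & exists (p : 'I_n -> E -> C R) (X K : R), forall x,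
    Omega x.2 -> (a - 2 * eps) / kappa < complex.Im x.1 < (b + pi + 2 * eps) / kappa -> X < complex.Re x.1 ->
    ode (perturbed lam p1 B) p x /\ forall i, rnorm (p i x - (i == j)%:R) <= K * expR (- (delta * complex.Re x.1)).
  have t12 : (a - 2 * eps) / kappa < (b + pi + 2 * eps) / kappa by rewrite ltr_pM2r ?invr_gt0 //; lra.
  have [|x Ox tx|phi [Hphi Ep]] := @solution_extends lam p _ _ (Num.max m X) t12; first by rewrite le_max lexx.
    by rewrite gt_max => /andP[_ Xx]; have [] := Hp x Ox tx Xx.
  exists eps => //; exists phi => //; exists K, (Num.max m X) => x Ox /andP[x1 x2] Xx i.
  have tx : (a - 2 * eps) / kappa < complex.Im x.1 < (b + pi + 2 * eps) / kappa.
    apply/andP; split.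
      by apply: lt_le_trans x1; rewrite ltr_pM2r ?invr_gt0 //; lra.
    by apply: le_lt_trans x2 _; rewrite ltr_pM2r ?invr_gt0 //; lra.
  rewrite Ep //; move: Xx; rewrite gt_max => /andP[_ Xx].
  by have [] := Hp x Ox tx Xx.
(* If all [lam i] vanish, the interval may be longer than [pi] and the slit plane too narrow;
   half-strips have no such limit. *)
have [all0|/existsNP[i0 /eqP li0]] := pselect (forall i, lam i = 0).
  by exists 1 => //; exact: strip_solution_exists.
have ba := signed_width li0 ab (sgn i0).
have [eps [eta [eps0 g0 g1 Heta Hlam]]] := directions ab ba (signed_ends ab sgn).
exists (eps / 8); first exact: divr_gt0.
have eps2 : 0 < eps / 2 by exact: divr_gt0.
have [p [X [K Hp]]] := @slit_solution_exists ((a + b + pi) / 2) _ false lam eta g0 g1 Heta Hlam j (eps / 2) erefl lamj eps2.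
exists p, X, K => x Ox /andP[x1 x2] Xx; apply: Hp => //.
move: x1 x2; rewrite ltr_pdivrMr // ltr_pdivlMr // => x1 x2.
by rewrite [kappa * _]mulrC ler_norml; apply/andP; split; lra.
Qed.

Lemma sector_solution_unique (lam : 'I_n -> C R) (phi : 'I_n -> E -> C R) (omega : C R) (a b : R) :
  Omega omega -> a <= b -> (forall i, signed a b (lam i)) ->
  (forall x, U x -> ode (perturbed lam p1 B) phi x) ->
  small_on (a / kappa) ((b + pi) / kappa) phi ->
  forall w, m < complex.Re w -> forall i, phi i (w, omega) = 0.
Proof.
move=> Oo ab sgn Hphi [K [X Hs]]; have pi0 := pi_gt0 R.
(* [directions] asks for a width below [pi]. If all [lam i] vanish, the interval is shrunk to a
   point; a part of the sector is enough for uniqueness. *)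
have [b' [ab' bb' ba' sgn']] : exists b', [/\ a <= b', b' <= b, b' - a < pi & forall i, signed a b' (lam i)].
  have [all0|/existsNP[i0 /eqP li0]] := pselect (forall i, lam i = 0).
    by exists a; rewrite lexx subrr; split=> // i; apply: Or31.
  by exists b; rewrite lexx; split=> //; exact: signed_width li0 ab (sgn i0).
have [eps [eta [eps0 g0 g1 Heta Hlam]]] := directions ab' ba' (signed_ends ab' sgn').
have [i x Ox tx Xx|w0 mw0 H0] := @slit_solution_zero ((a + b' + pi) / 2) _ true lam eta g0 g1 Heta Hlam phi X K omega Oo erefl Hphi.
  apply: Hs => //; rewrite ler_pdivrMr // ler_pdivlMr //.
  by move: tx; rewrite [kappa * _]mulrC ler_norml => /andP[t1 t2]; apply/andP; split; lra.
move=> w mw; apply: (solution_zero Hphi Oo mw0 _ mw) => i; exact: H0.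
Qed.

(** Here the axis itself is a good direction for every component, so all [eta i] are 0 and the
    half-opening may be as small as one likes. *)
Lemma narrow_solution_unique (lam : 'I_n -> C R) (phi : 'I_n -> E -> C R) (omega : C R) (t e : R) :
  Omega omega -> 0 < e -> (forall i, lam i = 0 \/ 0 < complex.Re (lam i * expi t)) ->
  (forall x, U x -> ode (perturbed lam p1 B) phi x) ->
  small_on ((t - e) / kappa) ((t + e) / kappa) phi ->
  forall w, m < complex.Re w -> forall i, phi i (w, omega) = 0.
Proof.
move=> Oo e0 pos Hphi [K [X Hs]]; have pi0 := pi_gt0 R.
pose gam := Num.min e (pi / 4).
have g0 : 0 < gam by rewrite lt_min e0 divr_gt0.
have g1 : gam < pi / 2 by apply: le_lt_trans (_ : pi / 4 < _); [rewrite ge_min lexx orbT|lra].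
have ge : gam <= e by rewrite ge_min lexx.
have [i|i|i x Ox tx Xx|w0 mw0 H0] := @slit_solution_zero t _ true lam (fun=> 0) g0 g1 _ _ phi X K omega Oo erefl Hphi.
- by rewrite normr0.
- by rewrite addr0.
- apply: Hs => //; rewrite ler_pdivrMr // ler_pdivlMr //.
  by move: tx; rewrite [kappa * _]mulrC ler_norml => /andP[t1 t2]; apply/andP; split; lra.
by move=> w mw; apply: (solution_zero Hphi Oo mw0 _ mw) => i; exact: H0.
Qed.

Lemma near_deltaB (t1 t2 s1 s2 r1 r2 : R) phi psi j : t1 <= r1 -> s1 <= r1 -> r2 <= t2 -> r2 <= s2 ->
  near_delta t1 t2 phi j -> near_delta s1 s2 psi j -> small_on r1 r2 (fun i x => phi i x - psi i x).
Proof.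
move=> h1 h2 h3 h4 [K [X HX]] [L [Y HY]]; exists (K + L), (Num.max X Y) => x Ox /andP[x1 x2].
rewrite gt_max => /andP[Xx Yx] i.
have i1 : rnorm (phi i x - (i == j)%:R) <= K * expR (- (delta * complex.Re x.1)).
  by apply: HX => //; rewrite (le_trans h1 x1) (le_trans x2 h3).
have i2 : rnorm (psi i x - (i == j)%:R) <= L * expR (- (delta * complex.Re x.1)).
  by apply: HY => //; rewrite (le_trans h2 x1) (le_trans x2 h4).
have -> : phi i x - psi i x = (phi i x - (i == j)%:R) - (psi i x - (i == j)%:R) by ring.
by rewrite mulrDl; exact: le_trans (rnormB _ _) (lerD i1 i2).
Qed.

Lemma odeB (A : 'I_n -> 'I_n -> E -> C R) (y z : 'I_n -> E -> C R) x : ode A y x -> ode A z x ->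
  ode A (fun i x => y i x - z i x) x.
Proof.
move=> Hy Hz i; have [dy Ey] := Hy i; have [dz Ez] := Hz i; split; first exact: differentiableB.
apply: etrans (diffB_apply ((1, 0) : E) dy dz) _.
by apply: etrans (congr2 (fun a b => a - b) Ey Ez) _; rewrite row_appB.
Qed.

Lemma subdominant_solution_exists (lam : 'I_n -> C R) j (a b : R) : a <= b -> lam j = 0 ->
  (forall i, lam i = 0 \/ forall t, a <= t <= b -> 0 < complex.Re (lam i * expi t)) ->
  exists2 phi : 'I_n -> E -> C R, (forall x, U x -> ode (perturbed lam p1 B) phi x) &
    near_delta ((a - pi) / kappa) ((b + pi) / kappa) phi j.
Proof.
move=> ab lamj pos; have pi0 := pi_gt0 R.
have sgn1 i : signed a b (lam i) by have [?|?] := pos i; [apply: Or31|apply: Or32].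
(* Rotation by [pi] reverses the signs, so the same existence result on this interval provides the
   second sector. *)
have sgn2 i : signed (a - pi) (b - pi) (lam i).
  have [?|H] := pos i; [by apply: Or31|apply: Or33 => t /andP[t1 t2]].
  have := H (t + pi); rewrite expi_pi mulrN ReN oppr_gt0; apply.
  by apply/andP; split; lra.
have ab' : a - pi <= b - pi by lra.
have [e1 e10 [phi Hphi nphi]] := sector_solution_exists ab lamj sgn1.
have [e2 e20 [psi Hpsi npsi]] := sector_solution_exists ab' lamj sgn2.
rewrite subrK in npsi.
(* The two margins provide a common sector about the midpoint of [[a, b]], on which uniqueness
   identifies the solutions. *)
pose e := Num.min e1 e2.
have e0 : 0 < e by rewrite lt_min e10.
have ee1 : e <= e1 by rewrite ge_min lexx.
have ee2 : e <= e2 by rewrite ge_min lexx orbT.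
pose t := (a + b) / 2.
have ki : 0 < kappa^-1 by rewrite invr_gt0.
have sm : small_on ((t - e) / kappa) ((t + e) / kappa) (fun i x => phi i x - psi i x).
  apply: near_deltaB nphi npsi; rewrite ler_pM2r // /t; lra.
have post i : lam i = 0 \/ 0 < complex.Re (lam i * expi t).
  by have [?|H] := pos i; [left|right; apply: H; rewrite /t; apply/andP; split; lra].
have Z x : U x -> forall i, phi i x = psi i x.
  move: x => [w o] [mw Oo] i; apply/eqP; rewrite -subr_eq0; apply/eqP.
  exact: (narrow_solution_unique Oo e0 post (fun x Ux => odeB (Hphi x Ux) (Hpsi x Ux)) sm mw).
exists phi => //.
have [K [X HX]] := nphi; have [L [Y HY]] := npsi.
exists (Num.max K L), (Num.max m (Num.max X Y)) => x Ox /andP[x1 x2].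
rewrite !gt_max => /and3P[mx Xx Yx] i.
have c (M : R) : M <= Num.max K L -> rnorm (phi i x - (i == j)%:R) <= M * expR (- (delta * complex.Re x.1)) ->
    rnorm (phi i x - (i == j)%:R) <= Num.max K L * expR (- (delta * complex.Re x.1)).
  by move=> ML /le_trans; apply; rewrite ler_wpM2r ?expR_ge0.
(* The sector is cut at [a]: the estimate of [phi] serves above it, that of [psi] below. *)
have [xa|xa] := leP (a / kappa) (complex.Im x.1).
  apply: (c K); first by rewrite le_max lexx.
  apply: HX => //; apply/andP; split.
    by apply: le_trans xa; rewrite ler_pM2r //; lra.
  by apply: le_trans x2 _; rewrite ler_pM2r //; lra.
apply: (c L); first by rewrite le_max lexx orbT.
rewrite Z //; apply: HY => //; apply/andP; split.
  by apply: le_trans x1; rewrite ler_pM2r //; lra.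
by apply: le_trans (ltW xa) _; rewrite ler_pM2r //; lra.
Qed.

(** The derivative of [exp (- a P)] shifts all exponents by [- a]. This passes between the original
    system and the one in which the index [j] has exponent 0. *)
Lemma ode_twist (lam : 'I_n -> C R) (a : C R) (phi : 'I_n -> E -> C R) x : U x ->
  ode (perturbed lam p1 B) phi x ->
  ode (perturbed (fun i => lam i - a) p1 B) (fun i u => cexp (- (a * P u)) * phi i u) x.
Proof.
move=> Ux Hphi i; have [dphi Ephi] := Hphi i; have [dPx EP] := dP Ux.
have da : differentiable (fun u => a * P u : C R) x.
  by apply: differentiableM; [exact: differentiable_cst|exact: dPx].
have dn : differentiable (fun u => - (a * P u) : C R) x by exact: differentiableN.
have dc : differentiable (fun u => cexp (- (a * P u)) : C R) x by exact: differentiable_cexp.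
split; first exact: differentiableM.
have E1 := diffM_apply ((1, 0) : E) dc dphi.
have E2 := diff_cexp_comp ((1, 0) : E) dn.
have E3 : 'd (fun u => - (a * P u) : C R) x ((1, 0) : E) = - 'd (fun u => a * P u : C R) x ((1, 0) : E).
  exact: (congr1 (fun F => F ((1, 0) : E)) (diffN da)).
have E4 := diff_mull a ((1, 0) : E) dPx.
apply: etrans E1 _; rewrite row_app_perturbed.
have -> : row_app B (fun i u => cexp (- (a * P u)) * phi i u) i x = cexp (- (a * P x)) * row_app B phi i x.
  by rewrite /row_app mulr_sumr; apply: eq_bigr => k _; rewrite mulrCA.
rewrite row_app_perturbed in Ephi.
have comb (e d f b c g l q r : C R) : d = l * q * f + r -> b = e * c -> c = - g -> g = a * q ->
    e * d + f * b = (l - a) * q * (e * f) + e * r.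
  by move=> -> -> -> ->; ring.
exact: (comb _ _ _ _ _ _ _ _ _ Ephi E2 E3 (etrans E4 (congr1 (fun z => a * z) EP))).
Qed.

Lemma ode_lincomb (A : 'I_n -> 'I_n -> E -> C R) (y : 'I_n -> 'I_n -> E -> C R) (a : 'I_n -> C R) x :
  (forall j, ode A (y j) x) -> ode A (fun i u => \sum_j a j * y j i u) x.
Proof.
move=> Hy i.
have dt j : differentiable (fun u => a j * y j i u : C R) x.
  by apply: differentiableM; [exact: differentiable_cst|have [] := Hy j i].
have [ds E1] := diff_sum_apply (index_enum 'I_n) ((1, 0) : E) dt; split; first exact: ds.
apply: etrans E1 _; rewrite /row_app; under [RHS]eq_bigr do rewrite mulr_sumr.
rewrite exchange_big /=; apply: eq_bigr => j _; have [dj Ej] := Hy j i.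
apply: etrans (diff_mull (a j) ((1, 0) : E) dj) _.
apply: etrans (congr1 (fun z => a j * z) Ej) _.
by rewrite /row_app mulr_sumr; apply: eq_bigr => k _; rewrite mulrCA.
Qed.

(** Along this ray the leading term of the derivative of [lam P] has a negative real part
    proportional to [exp (kappa Re w)], and far out the error in [p1] is too small to compensate it.
    So [Re (lam P)] does not increase there. *)
Lemma exponential_bounded (lam : C R) (t : R) (omega : C R) : Omega omega ->
  (lam = 0 \/ complex.Re (lam * expi t) < 0) ->
  exists M X : R, forall s, X < s -> rnorm (cexp (lam * P (s +i* (t / kappa), omega))) <= M.
Proof.
move=> Oo [->|neg]; first by exists 1, 0 => s _; rewrite mul0r cexp0 rnorm1.
have l0 : 0 < rnorm lam.
  rewrite rnorm_gt0; apply/eqP => E; move: neg; rewrite E mul0r /=.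
  by rewrite ltxx.
have e0 : 0 < - complex.Re (lam * expi t) / rnorm lam by rewrite divr_gt0 // oppr_gt0.
have [X HX] := p1_lim e0; pose X1 := Num.max m X + 1.
pose v : E := (X1 +i* (t / kappa), omega); pose h : E := (1, 0).
have pathE (s : R) : v + s%:C *: h = ((X1 + s) +i* (t / kappa), omega).
  apply: injective_projections; rewrite /= ?scaler0 ?addr0 // -[_ *: _]/(_ * _) mulr1.
  by apply/eqP; rewrite eq_complex /= addr0 !eqxx.
have Us s : 0 <= s -> U (v + s%:C *: h) /\ X < X1 + s.
  have i1 : m <= Num.max m X by rewrite le_max lexx.
  have i2 : X <= Num.max m X by rewrite le_max lexx orbT.
  by move=> s0; rewrite pathE; split; [split=> //=|]; rewrite /X1; lra.
pose f u : C R := lam * P u.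
have dle s : 0 <= s -> complex.Re (f (v + s%:C *: h)) <= complex.Re (f v).
  move=> s0.
  have df u : U u -> differentiable f u.
    by move=> Uu; apply: differentiableM; [exact: differentiable_cst|have [] := dP Uu].
  have dR (r : R) : 0 <= r <= s -> is_derive r 1 (fun r : R => complex.Re (f (v + r%:C *: h))) (complex.Re ('d f (v + r%:C *: h) h)).
    by move=> /andP[r0 _]; apply: is_derive_Re; apply: df; have [] := Us r r0.
  have := derive_le s0 dR (fun r _ => is_derive_cst (0 : R) r 1).
  rewrite subrr subr_le0 scale0r addr0; apply => r /andP[r0 _].
  have [Ur Xr] := Us r r0; have [dPr EPr] := dP Ur.
  have E1 : 'd f (v + r%:C *: h) h = lam * p1 (v + r%:C *: h).
    by apply: etrans (diff_mull lam h dPr) _; congr (_ * _).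
  rewrite E1; rewrite pathE in E1 *.
  have := HX ((X1 + r) +i* (t / kappa), omega) Oo Xr; rewrite [(_, _).1]/=.
  set w : C R := (X1 + r) +i* (t / kappa); set q := p1 _ => hq.
  have cw : cexp (kappa%:C * w) = (expR (kappa * (X1 + r)))%:C * expi t.
    rewrite [X in cexp X]complexRI cexp_complex ReZ ImZ /=; congr (_ * expi _).
    by rewrite mulrC divfK // gt_eqF.
  have -> : lam * q = (expR (kappa * (X1 + r)))%:C * (lam * expi t) + lam * (q - cexp (kappa%:C * w)).
    by rewrite cw; ring.
  rewrite ReD ReZ.
  have i1 := le_trans (ler_norm _) (Re_le_rnorm (lam * (q - cexp (kappa%:C * w)))).
  have i2 : rnorm (lam * (q - cexp (kappa%:C * w))) <= - complex.Re (lam * expi t) * expR (kappa * (X1 + r)).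
    rewrite rnormM; apply: le_trans (ler_wpM2l (ltW l0) hq) (eq_le_of _).
    by rewrite [complex.Re w]/=; field; rewrite gt_eqF.
  by rewrite mulNr [_ * expR _]mulrC in i2; lra.
exists (expR (complex.Re (f v))), X1 => s Xs; rewrite rnorm_cexp ler_expR.
have s0 : 0 <= s - X1 by rewrite subr_ge0 ltW.
by have := dle _ s0; rewrite pathE addrC subrK.
Qed.

(** * Linear independence and completeness *)

Section Basis.
Variables (nu : 'I_n -> C R) (phi : 'I_n -> 'I_n -> E -> C R) (t t' : R) (omega : C R).
Hypothesis Oo : Omega omega.
Hypothesis tt' : t <= t'.
Hypothesis separated : forall j k, complex.Re ((nu j - nu k) * expi t) = 0 -> nu j = nu k.
Hypothesis Hphi : forall j x, U x -> ode (perturbed (fun i => nu j - nu i) p1 B) (phi j) x.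
Hypothesis Nphi : forall j, near_delta (t / kappa) (t' / kappa) (phi j) j.

Definition twisted j i x := cexp (- (nu j * P x)) * phi j i x.
Local Notation coef := (perturbed (fun i => - nu i) p1 B).

Lemma ode_twisted j x : U x -> ode coef (twisted j) x.
Proof.
move=> Ux; have := ode_twist (nu j) Ux (Hphi j Ux).
by have -> : (fun i => nu j - nu i - nu j) = (fun i => - nu i) by apply/funext => i; ring.
Qed.

(** Among the indices with nonzero coefficient, [j0] minimises [Re (nu_k exp (i t))], so its
    exponential is dominant on the ray. After multiplication by [exp (nu_j0 P)], the component [j0]
    of the relation expresses [- a j0] as a sum of bounded exponentials times deviations of the
    [phi k] from the basis vectors, which tend to 0. In case of a tie, [separated] makes the
    exponent 0. *)
Lemma twisted_independent (a : 'I_n -> C R) :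
  (forall w, m < complex.Re w -> forall i, \sum_j a j * twisted j i (w, omega) = 0) -> forall j, a j = 0.
Proof.
move=> H j; apply/eqP; apply/negPn/negP => aj.
pose F k := complex.Re (nu k * expi t).
have [j0 /= aj0 Hj0] := @Order.TotalTheory.arg_minP _ _ _ j (fun k => a k != 0) F aj.
have bnd k : exists c X : R, forall s, X < s ->
    rnorm (a k * cexp ((nu j0 - nu k) * P (s +i* (t / kappa), omega)) *
      (phi k j0 (s +i* (t / kappa), omega) - (j0 == k)%:R)) <= c * expR (- (delta * s)).
  have [a0|ak] := eqVneq (a k) 0.
    by exists 0, 0 => s _; rewrite a0 !mul0r rnorm0.
  have le : complex.Re ((nu j0 - nu k) * expi t) <= 0.
    by rewrite mulrBl ReD ReN subr_le0; exact: Hj0.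
  have [M [X HM]] : exists M X : R, forall s, X < s -> rnorm (cexp ((nu j0 - nu k) * P (s +i* (t / kappa), omega))) <= M.
    apply: exponential_bounded => //; move: le; rewrite le_eqVlt => /orP[/eqP/separated->|]; last by right.
    by left; rewrite subrr.
  have [K [Y HY]] := Nphi k.
  exists (rnorm (a k) * (M * K)), (Num.max X Y) => s; rewrite gt_max => /andP[Xs Ys].
  rewrite rnormM (rnormM (a k)) -!mulrA; apply: ler_wpM2l; first exact: rnorm_ge0.
  apply: ler_pM; [exact: rnorm_ge0|exact: rnorm_ge0|exact: HM|].
  apply: (HY (s +i* (t / kappa), omega)) => //=.
  by rewrite lexx /= ler_pM2r // invr_gt0.
have /choice[c Hc] := bnd; have /choice[X HX] := Hc.
have [Xm HXm] := finite_upper X.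
pose Cs := \sum_k `|c k|.
suff : a j0 = 0 by move/eqP; rewrite (negbTE aj0).
apply: (@le_eps_eq0 _ _ _ Cs) => e e0.
pose s := Num.max (Num.max Xm m) (- ln e / delta) + 1.
have : Num.max (Num.max Xm m) (- ln e / delta) < s by rewrite /s ltrDl.
rewrite !gt_max => /andP[/andP[s1 s2] s3].
set x : E := (s +i* (t / kappa), omega).
have E1 : - a j0 = \sum_k a k * cexp ((nu j0 - nu k) * P x) * (phi k j0 x - (j0 == k)%:R).
  under eq_bigr do rewrite mulrBr; rewrite sumrB.
  have -> : \sum_k a k * cexp ((nu j0 - nu k) * P x) * phi k j0 x = 0.
    have := H (s +i* (t / kappa)) s2 j0 => H1.
    rewrite (eq_bigr (fun k => cexp (nu j0 * P x) * (a k * twisted k j0 x))).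
      by rewrite -mulr_sumr H1 mulr0.
    by move=> k _; rewrite /twisted mulrBl cexpD; ring.
  rewrite sub0r; congr (- _); rewrite (bigD1 j0) //= big1 => [|k kj].
    by rewrite eqxx subrr mul0r cexp0 !mulr1 addr0.
  by rewrite eq_sym (negbTE kj) mulr0.
rewrite -rnormN E1; apply: le_trans (rnorm_sum _ _ _) _.
have el : expR (- (delta * s)) <= e.
  by move: s3; rewrite ltr_pdivrMr // -[leRHS]lnK ?posrE // ler_expR; lra.
rewrite /Cs mulr_suml; apply: ler_sum => k _.
apply: le_trans (HX k s (le_lt_trans (HXm k) s1)) _.
apply: le_trans (ler_wpM2r (expR_ge0 _) (ler_norm _)) _.
by apply: ler_wpM2l.
Qed.

(** The matrix of values at one point is invertible: a relation between its rows holds everywhere by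
    [solution_zero], hence is trivial by [twisted_independent]. The coefficients are the coordinates
    of the value of [g] at that point. *)
Lemma twisted_span (g : 'I_n -> E -> C R) : (forall x, U x -> ode coef g x) ->
  exists a : 'I_n -> C R, forall w, m < complex.Re w -> forall i, g i (w, omega) = \sum_j a j * twisted j i (w, omega).
Proof.
move=> Hg; pose w1 : C R := (m + 1)%:C.
have mw1 : m < complex.Re w1 by rewrite /= ltrDl.
pose A : 'M[C R]_n := \matrix_(j, i) twisted j i (w1, omega).
have uA : A \in unitmx.
  rewrite -row_free_unit; apply: inj_row_free => v vA.
  have Z : forall w, m < complex.Re w -> forall i, \sum_j v 0 j * twisted j i (w, omega) = 0.
    have Ho x : U x -> ode coef (fun i u => \sum_j v 0 j * twisted j i u) x.
      by move=> Ux; apply: ode_lincomb => j; exact: ode_twisted.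
    apply: (solution_zero Ho Oo mw1) => i.
    have := congr1 (fun M : 'rV[C R]_n => M 0 i) vA; rewrite !mxE => vE.
    by apply: etrans vE; apply: eq_bigr => j _; rewrite mxE.
  apply/rowP => j; rewrite mxE; exact: (twisted_independent Z).
pose gv : 'rV[C R]_n := \row_i g i (w1, omega).
pose a := gv *m invmx A.
exists (fun j => a 0 j) => w mw i; apply/eqP; rewrite -subr_eq0; apply/eqP.
have Ho x : U x -> ode coef (fun i u => g i u - \sum_j a 0 j * twisted j i u) x.
  move=> Ux; apply: odeB; first exact: Hg.
  by apply: ode_lincomb => j; exact: ode_twisted.
apply: (solution_zero Ho Oo mw1 _ mw) => {}i.
have E1 : (a *m A) 0 i = gv 0 i by rewrite mulmxKV.
apply/eqP; rewrite subr_eq0; apply/eqP; move: E1; rewrite !mxE => <-.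
by apply: eq_bigr => j _; rewrite [A j i]mxE.
Qed.

End Basis.
End NormalForm.

(** * The derivative on the universal cover *)

Section Entries.
Variables (R : realType) (p q : nat).

Definition entry (i : 'I_p) (j : 'I_q) (A : 'M[C R]_(p, q)) : C R := A i j.

Lemma entry_is_linear i j : linear (entry i j).
Proof. by move=> k A B; rewrite /entry !mxE. Qed.

HB.instance Definition _ i j := GRing.isLinear.Build (C R) 'M[C R]_(p, q) (C R) _ (entry i j) (entry_is_linear i j).

Lemma continuous_entry i j : continuous (entry i j).
Proof. by move=> A; exact: coord_continuous. Qed.

Lemma differentiable_entry i j A : differentiable (entry i j) A.
Proof. by apply: linear_differentiable; exact: continuous_entry. Qed.

Lemma entry_bound : exists2 K : R, 0 <= K & forall i j (A : 'M[C R]_(p, q)), rnorm (A i j) <= K * rnorm A.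
Proof.
have H (ij : 'I_p * 'I_q) : exists K : R, 0 <= K /\ forall A : 'M[C R]_(p, q), rnorm (A ij.1 ij.2) <= K * rnorm A.
  by have [K K0 HK] := linear_rnorm_bound (@continuous_entry ij.1 ij.2); exists K.
have /choice[K HK] := H.
exists (\sum_ij K ij) => [|i j A]; first by apply: sumr_ge0 => ij _; have [] := HK ij.
have [_ /(_ A) b] := HK (i, j); apply: le_trans b _; apply: ler_wpM2r; first exact: rnorm_ge0.
by rewrite (bigD1 (i, j)) //= lerDl; apply: sumr_ge0 => ij _; have [] := HK ij.
Qed.

Lemma rnorm_le_entries : exists2 K : R, 0 <= K & forall (A : 'M[C R]_(p, q)) (e : R), 0 <= e ->
  (forall i j, rnorm (A i j) <= e) -> rnorm A <= K * e.
Proof.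
exists (\sum_i \sum_j rnorm (delta_mx i j : 'M[C R]_(p, q))) => [|A e e0 H].
  by apply: sumr_ge0 => i _; apply: sumr_ge0 => j _; exact: rnorm_ge0.
rewrite {1}[A]matrix_sum_delta; apply: le_trans (rnorm_sum _ _ _) _.
rewrite mulr_suml; apply: ler_sum => i _; apply: le_trans (rnorm_sum _ _ _) _.
rewrite mulr_suml; apply: ler_sum => j _; rewrite rnormZ mulrC.
by apply: ler_wpM2l; [exact: rnorm_ge0|exact: H].
Qed.

End Entries.

Section SlopeInExponential.
Variable R : realType.
Implicit Types (w l c h : C R) (g : C R -> C R).

(** The last clause is a quantitative local injectivity of [cexp]; it controls the denominators of
    difference quotients in [z = exp w]. *)
Lemma cexp_slope w (e : R) : 0 < e -> exists2 d : R, 0 < d & forall h, rnorm h < d ->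
  rnorm (cexp (w + h) - cexp w - cexp w * h) <= e * rnorm h /\ (h != 0 -> cexp (w + h) - cexp w != 0) /\
  rnorm (cexp w) / 2 * rnorm h <= rnorm (cexp (w + h) - cexp w).
Proof.
move=> e0; have c0 : 0 < rnorm (cexp w) by rewrite rnorm_gt0 cexp_neq0.
have [dc Ec] := diff_cexp w.
have e1 : 0 < Num.min e (rnorm (cexp w) / 2) by rewrite lt_min e0 divr_gt0.
have [d d0 Hd] := differentiable_rnorm dc e1.
exists d => // h /Hd; rewrite Ec => b.
have b2 : rnorm (cexp (w + h) - cexp w - cexp w * h) <= rnorm (cexp w) / 2 * rnorm h.
  by apply: le_trans b _; rewrite ler_wpM2r ?rnorm_ge0 // ge_min lexx orbT.
have b3 : rnorm (cexp w) / 2 * rnorm h <= rnorm (cexp (w + h) - cexp w).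
  have := rnormB (cexp (w + h) - cexp w) (cexp (w + h) - cexp w - cexp w * h).
  have -> : cexp (w + h) - cexp w - (cexp (w + h) - cexp w - cexp w * h) = cexp w * h by ring.
  rewrite rnormM => b4; have : rnorm (cexp w) * rnorm h = rnorm (cexp w) / 2 * rnorm h + rnorm (cexp w) / 2 * rnorm h by field.
  lra.
split; first by apply: le_trans b _; rewrite ler_wpM2r ?rnorm_ge0 // ge_min lexx.
split=> // h0; rewrite -rnorm_gt0; apply: lt_le_trans b3.
by rewrite mulr_gt0 ?divr_gt0 // rnorm_gt0.
Qed.

(** The chain rule for the local coordinate [z = exp u], in both directions: the derivative in [u]
    is [z] times the derivative in [z]. *)
Lemma slope_cexpP g w l :
  ((cexp u - cexp w)^-1 * (g u - g w) @[u --> w^'] --> l) <->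
  (differentiable g w /\ 'd g w 1 = cexp w * l).
Proof.
set c := cexp w; have c0 : 0 < rnorm c by rewrite rnorm_gt0 cexp_neq0.
have l0 := rnorm_ge0 l; split=> [/cvg_rnormP cvl|[dg Eg]].
  suff [dg Eg] : differentiable g w /\ 'd g w = (fun h => c * l * h) :> (C R -> C R).
    by split=> //; rewrite Eg mulr1.
  apply: slope_differentiable => e e0.
  pose e2 := Num.min 1 (e / (2 * rnorm c)).
  have e20 : 0 < e2 by rewrite lt_min ltr01 divr_gt0 // mulr_gt0.
  have e10 : 0 < e / (2 * (rnorm l + 1)) by rewrite divr_gt0 // mulr_gt0 // ltr_wpDl.
  have [d1 d10 H1] := cexp_slope w e10.
  have /nbhs_rnormP[d2 d20 H2] : nbhs w (fun u => u != w -> rnorm ((cexp u - c)^-1 * (g u - g w) - l) < e2) := cvl e2 e20.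
  exists (Num.min d1 d2) => [|h]; first by rewrite lt_min d10 d20.
  rewrite lt_min => /andP[/H1[h1 [h2 _]] hd2].
  have [->|hn] := eqVneq h 0; first by rewrite addr0 subrr mulr0 subrr rnorm0 mulr0.
  have := H2 (w + h); rewrite addrAC subrr add0r => /(_ hd2).
  rewrite -subr_eq0 addrAC subrr add0r => /(_ hn).
  set q := _ * (g _ - g _) => hq.
  have Eg : g (w + h) - g w = (cexp (w + h) - c) * q by rewrite /q mulVKf // h2.
  have -> : g (w + h) - g w - c * l * h = (cexp (w + h) - c - c * h) * q + c * h * (q - l) by rewrite Eg; ring.
  apply: le_trans (rnormD _ _) _; rewrite (rnormM _ q) (rnormM (c * h)) (rnormM c).
  have q1 : rnorm q <= rnorm l + 1.
    have := rnormD (q - l) l; rewrite subrK => /le_trans; apply; rewrite addrC lerD2l.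
    by apply: le_trans (ltW hq) _; rewrite ge_min lexx.
  have i1 : rnorm (cexp (w + h) - c - c * h) * rnorm q <= e / 2 * rnorm h.
    apply: le_trans (ler_pM (rnorm_ge0 _) (rnorm_ge0 _) h1 q1) (eq_le_of _).
    by field; rewrite gt_eqF // ltr_wpDl.
  have i2 : rnorm c * rnorm h * rnorm (q - l) <= e / 2 * rnorm h.
    apply: le_trans (_ : rnorm c * rnorm h * (e / (2 * rnorm c)) <= _).
      apply: ler_wpM2l; first by rewrite mulr_ge0 ?rnorm_ge0.
      by apply: le_trans (ltW hq) _; rewrite ge_min lexx orbT.
    by apply: eq_le_of; field; rewrite gt_eqF.
  apply: le_trans (lerD i1 i2) (eq_le_of _); by field.
apply/cvg_rnormP => e e0.
have e10 : 0 < e * rnorm c / (4 * (rnorm l + 1)) by rewrite divr_gt0 ?mulr_gt0 // ltr_wpDl.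
set e1 := _ / _ in e10.
have [d1 d10 H1] := cexp_slope w e10; have [d2 d20 H2] := differentiable_rnorm dg e10.
suff : nbhs w (fun u => u != w -> rnorm ((cexp u - c)^-1 * (g u - g w) - l) < e) by [].
apply/nbhs_rnormP; exists (Num.min d1 d2) => [|u]; first by rewrite lt_min d10 d20.
pose h := u - w; have uE : u = w + h by rewrite addrC subrK.
rewrite lt_min -/h uE => /andP[/H1[h1 [h2 h3]] /H2 h4] hn.
have {}hn : h != 0 by move: hn; rewrite -subr_eq0 addrAC subrr add0r.
have hg := rnorm_gt0 h; rewrite hn in hg.
have kn := h2 hn.
rewrite diffCE Eg in h4.
have -> : (cexp (w + h) - c)^-1 * (g (w + h) - g w) - l =
  ((g (w + h) - g w - c * l * h) - l * (cexp (w + h) - c - c * h)) / (cexp (w + h) - c) by field.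
rewrite rnormM rnormV ltr_pdivrMr ?rnorm_gt0 //.
apply: lt_le_trans (_ : e * (rnorm c / 2 * rnorm h) <= _); last by apply: ler_wpM2l => //; exact: ltW.
apply: le_lt_trans (rnormB _ _) _; rewrite (rnormM l).
apply: le_lt_trans (lerD h4 (ler_wpM2l l0 h1)) _.
have -> : e1 * rnorm h + rnorm l * (e1 * rnorm h) = e * (rnorm c / 2 * rnorm h) / 2.
  by rewrite /e1; field; rewrite gt_eqF // ltr_wpDl.
by rewrite gtr_pMr ?invf_lt1 ?ltr1n // !mulr_gt0 // invr_gt0.
Qed.

Lemma is_uderiveP (n : nat) (f : ucover R -> 'cV[C R]_n) w (l : 'cV[C R]_n) :
  is_uderive f (uexp w) l <->
  forall k, differentiable (fun u => f (uexp u) k 0) w /\ 'd (fun u => f (uexp u) k 0) w 1 = cexp w * l k 0.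
Proof.
rewrite /is_uderive uexpK.
pose F u := (uproj (uexp u) - uproj (uexp w))^-1 *: (f (uexp u) - f (uexp w)).
have FE u k : F u k 0 = (cexp u - cexp w)^-1 * (f (uexp u) k 0 - f (uexp w) k 0) by rewrite /F !mxE.
split=> [cv k|H].
  apply/slope_cexpP.
  have : entry k 0 (F u) @[u --> w^'] --> entry k 0 l.
    by apply: (@cvg_comp _ _ _ F (entry k 0)); [exact: cv|exact: continuous_entry].
  by rewrite /entry; under eq_fun do rewrite FE.
have cvk k : F u k 0 @[u --> w^'] --> l k 0.
  by have /slope_cexpP := H k; under [X in _ -> X @ _ --> _]eq_fun do rewrite FE.
have [K K0 HK] := @rnorm_le_entries R n 1.
apply/cvg_rnormP => e e0.
have e1 : 0 < e / (K + 1) by rewrite divr_gt0 // ltr_wpDl.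
have : \forall u \near w^', forall k : 'I_n, rnorm (F u k 0 - l k 0) < e / (K + 1).
  by apply: filter_forall => k; have /cvg_rnormP := cvk k; exact.
apply: filterS => u Hu; apply: le_lt_trans (_ : K * (e / (K + 1)) < _).
  apply: HK => [|k j]; first exact: ltW.
  by rewrite ord1; have := Hu k; rewrite !mxE => /ltW.
rewrite mulrCA gtr_pMr // ltr_pdivrMr ?mul1r ?ltrDl // ltr_wpDl //.
Qed.

End SlopeInExponential.

(** * Equivalence of norms *)

Section NormEquivalence.
Variables (R : realType) (n : nat) (nrm : 'M[C R]_n -> R).
Hypothesis hnrm : is_norm nrm.

Let nrmD A B : nrm (A + B) <= nrm A + nrm B. Proof. by have [H _ _] := hnrm. Qed.
Let nrmZ k A : nrm (k *: A) = rnorm k * nrm A. Proof. by have [_ H _] := hnrm. Qed.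
Let nrm0 A : nrm A = 0 -> A = 0. Proof. by have [_ _ H] := hnrm; exact: H. Qed.

Let nrmN A : nrm (- A) = nrm A.
Proof. by rewrite -scaleN1r nrmZ rnormN rnorm1 mul1r. Qed.

Let nrm_ge0 A : 0 <= nrm A.
Proof.
have z : nrm 0 = 0 by rewrite -(scale0r (0 : 'M[C R]_n)) nrmZ rnorm0 mul0r.
by have := nrmD A (- A); rewrite subrr z nrmN; lra.
Qed.

Let nrm_sum (I : Type) (s : seq I) (F : I -> 'M[C R]_n) : nrm (\sum_(i <- s) F i) <= \sum_(i <- s) nrm (F i).
Proof.
elim: s => [|i s IH]; last by rewrite !big_cons; exact: le_trans (nrmD _ _) (lerD _ _).
by rewrite !big_nil -(scale0r (0 : 'M[C R]_n)) nrmZ rnorm0 mul0r.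
Qed.

Let T := ('I_n * 'I_n * bool)%type.

(* Real coordinates of a complex matrix, in a space where spheres are compact. *)
Let mat (x : 'rV[R]_(#|{: T}|)) : 'M[C R]_n :=
  \matrix_(i, j) (x 0 (enum_rank (i, j, false)) +i* x 0 (enum_rank (i, j, true))).

Let matB x y : mat (x - y) = mat x - mat y.
Proof. by apply/matrixP => i j; rewrite !mxE; apply/eqP; rewrite eq_complex /= !eqxx. Qed.

Let matZ (s : R) x : mat (s *: x) = s%:C *: mat x.
Proof. by apply/matrixP => i j; rewrite !mxE; apply/eqP; rewrite eq_complex /= !mul0r subr0 addr0 !eqxx. Qed.

Let entry_le (x : 'rV[R]_(#|{: T}|)) k : `|x 0 k| <= `|x|.
Proof.
rewrite [leRHS]/Num.norm /= mx_normrE.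
exact: (le_bigmax _ (fun ij : 'I_1 * 'I_(#|{: T}|) => `|x ij.1 ij.2|) (0, k)).
Qed.

Let mat_bound : exists2 L : R, 0 <= L & forall x, nrm (mat x) <= L * `|x|.
Proof.
exists (\sum_i \sum_j 2 * nrm (delta_mx i j)) => [|x].
  by apply: sumr_ge0 => i _; apply: sumr_ge0 => j _; rewrite mulr_ge0.
rewrite [mat x]matrix_sum_delta; apply: le_trans (nrm_sum _ _) _.
rewrite mulr_suml; apply: ler_sum => i _; apply: le_trans (nrm_sum _ _) _.
rewrite mulr_suml; apply: ler_sum => j _; rewrite nrmZ mulrAC; apply: ler_wpM2r => //.
rewrite mxE; apply: le_trans (rnorm_le_ReIm _) _ => /=.
by rewrite mulr2n mulrDl mul1r; apply: lerD.
Qed.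

(** On the compact unit sphere of the real coordinate space [nrm] attains its minimum, which is
    positive because only the zero matrix has norm 0; homogeneity does the rest. The 2 in the
    constant covers real and imaginary part. *)
Lemma norm_entry : exists2 K : R, 0 <= K & forall (A : 'M[C R]_n) i j, rnorm (A i j) <= K * nrm A.
Proof.
(* For [n = 0] there is no entry, and the sphere would be empty. *)
have [n0|n0] := posnP n.
  exists 0 => // A i; exfalso.
  by have := leq_ltn_trans (leq0n i) (ltn_ord i); rewrite [X in (_ < X)%N]n0.
have [L L0 HL] := mat_bound.
pose S : set 'rV[R]_(#|{: T}|) := [set x | `|x| = 1].
pose one : 'rV[R]_(#|{: T}|) := const_mx 1.
pose k0 : 'I_(#|{: T}|) := enum_rank (Ordinal n0, Ordinal n0, false).
have one0 : 0 < `|one|.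
  by apply: lt_le_trans (entry_le one k0); rewrite mxE normr1.
have S0 : S !=set0.
  exists (`|one|^-1 *: one); rewrite /S /= normrZ ger0_norm ?invr_ge0 //.
  by rewrite mulVf // gt_eqF.
have cS : compact S.
  apply: bounded_closed_compact.
    by exists 1; split=> // M M1 x /= ->; exact: ltW.
  have -> : S = (fun x : 'rV[R]_(#|{: T}|) => `|x|) @^-1` [set 1] by [].
  by apply: preimage_closed; [move=> x _; exact: norm_continuous|exact: closed_eq].
have cf : {within S, continuous (fun x => nrm (mat x))}.
  apply: continuous_subspaceT => x.
  suff H : (fun y : 'rV[R]_(#|{: T}|) => nrm (mat y)) @ nbhs x --> nrm (mat x) by exact: H.
  apply/(@cvgrPdist_lt _ R^o) => e e0.
  apply/nbhs_ballP; exists (e / (L + 1)) => [|y]; first by rewrite /= divr_gt0 // ltr_wpDl.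
  rewrite -ball_normE /= ltr_pdivlMr ?ltr_wpDl // => xy.
  apply: le_lt_trans xy; apply: le_trans (_ : L * `|x - y| <= _); last first.
    by rewrite mulrC; apply: ler_wpM2l => //; rewrite lerDl.
  apply: le_trans (HL (x - y)); rewrite matB ler_norml lerBlDr.
  have i1 := nrmD (mat x - mat y) (mat y); rewrite subrK in i1.
  have i2 := nrmD (mat x) (- (mat x - mat y)); rewrite nrmN opprB addrC subrK in i2.
  by rewrite i1 andbT; lra.
have [c cS1 Hc] := EVT_min_rV S0 cS cf.
rewrite inE in cS1.
have c0 : 0 < nrm (mat c).
  rewrite lt_def nrm_ge0 andbT; apply/eqP => /nrm0 mc.
  have : c = 0.
    apply/rowP => k; rewrite mxE -(enum_valK k); case: (enum_val k) => [[i j] b].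
    have := congr1 (fun M : 'M[C R]_n => M i j) mc; rewrite !mxE => -[E1 E2].
    by case: b.
  by move=> cz; move: cS1; rewrite /S /= cz normr0 => /esym/eqP; rewrite oner_eq0.
exists (2 / nrm (mat c)) => [|A i j]; first by rewrite divr_ge0 // ltW.
pose x : 'rV[R]_(#|{: T}|) := \row_k (let: (i, j, b) := enum_val k in if b then complex.Im (A i j) else complex.Re (A i j)).
have mx : mat x = A.
  apply/matrixP => u v; rewrite !mxE !enum_rankK.
  by case: (A u v).
have [x0|x0] := eqVneq `|x| 0.
  have xz : x = 0 by apply/eqP; rewrite -normr_eq0 x0.
  rewrite -mx xz; have -> : mat 0 i j = 0 by rewrite !mxE.
  by rewrite rnorm0 mulr_ge0 // divr_ge0 // ltW.
have xp : 0 < `|x| by rewrite lt_def x0 normr_ge0.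
have : nrm (mat c) <= nrm (mat (`|x|^-1 *: x)).
  apply: Hc; rewrite inE /S /= normrZ ger0_norm ?invr_ge0 //.
  by rewrite mulVf.
rewrite matZ nrmZ rnorm_nneg ?invr_ge0 // mx mulrC ler_pdivlMr // => le.
apply: le_trans (_ : 2 * `|x| <= _).
  rewrite -{1}mx mxE; apply: le_trans (rnorm_le_ReIm _) _ => /=.
  by rewrite mulr2n mulrDl mul1r; apply: lerD.
by rewrite -mulrA; apply: ler_wpM2l => //; rewrite mulrC ler_pdivlMr // mulrC.
Qed.

End NormEquivalence.

(** * The equation in the coordinate ln z *)

Section FirstDerivative.
Variable R : realType.
Local Notation E := (C R * C R)%type.
Implicit Types (f g : E -> C R) (x : E) (a b : C R).

Definition has_D1 f x a := differentiable f x /\ D1 f x = a.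

Lemma has_D1_eq f x a b : has_D1 f x a -> a = b -> has_D1 f x b.
Proof. by move=> ? <-. Qed.

Lemma has_D1D f g x a b : has_D1 f x a -> has_D1 g x b -> has_D1 (fun u => f u + g u) x (a + b).
Proof.
move=> [df Ef] [dg Eg]; split; first exact: differentiableD.
by apply: etrans (diffD_apply ((1, 0) : E) df dg) _; exact: (congr2 (fun s t => s + t) Ef Eg).
Qed.

Lemma has_D1M f g x a b : has_D1 f x a -> has_D1 g x b ->
  has_D1 (fun u => f u * g u) x (f x * b + g x * a).
Proof.
move=> [df Ef] [dg Eg]; split; first exact: differentiableM.
apply: etrans (diffM_apply ((1, 0) : E) df dg) _.
exact: (congr2 (fun s t => f x * s + g x * t) Eg Ef).
Qed.

Lemma has_D1_cexp f x a : has_D1 f x a -> has_D1 (fun u => cexp (f u)) x (cexp (f x) * a).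
Proof.
move=> [df Ef]; split; first exact: differentiable_cexp.
by apply: etrans (diff_cexp_comp ((1, 0) : E) df) _; exact: (congr1 (fun s => cexp (f x) * s) Ef).
Qed.

Lemma has_D1_sum (n : nat) (f : 'I_n -> E -> C R) x (a : 'I_n -> C R) :
  (forall k, has_D1 (f k) x (a k)) -> has_D1 (fun u => \sum_k f k u) x (\sum_k a k).
Proof.
move=> H; have df k : differentiable (f k) x by have [] := H k.
have [ds Es] := diff_sum_apply (index_enum 'I_n) ((1, 0) : E) df.
split; first exact: ds.
by apply: etrans Es _; apply: eq_bigr => k _; have [] := H k.
Qed.

Lemma has_D1_fst x : has_D1 (fun u : E => u.1) x 1.
Proof.
split; first exact: differentiable_fst.
have l1 : 'd (fst : {linear E -> C R}) x = (fst : {linear E -> C R}) :> (E -> C R).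
  by apply: diff_lin => y; exact: cvg_fst.
exact: (congr1 (fun F => F ((1, 0) : E)) l1).
Qed.

Lemma has_D1_snd (h : C R -> C R) x : differentiable h x.2 -> has_D1 (fun u : E => h u.2) x 0.
Proof.
move=> dh; have d2 : differentiable (fun u : E => u.2) x by exact: differentiable_snd.
split; first exact: (differentiable_comp d2 dh).
have l1 : 'd (snd : {linear E -> C R}) x = (snd : {linear E -> C R}) :> (E -> C R).
  by apply: diff_lin => y; exact: cvg_snd.
have E2 : 'd (fun u : E => u.2) x ((1, 0) : E) = 0 by exact: (congr1 (fun F => F ((1, 0) : E)) l1).
apply: etrans (diff_comp_apply ((1, 0) : E) d2 dh) _.
by apply: etrans (congr1 ('d h (x.2)) E2) _; exact: linear0.
Qed.

Lemma has_D1_pow (s : R) x : has_D1 (fun u => cexp (s%:C * u.1)) x (s%:C * cexp (s%:C * x.1)).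
Proof.
have H1 := has_D1_snd (@differentiable_cst _ _ _ (s%:C : C R) x.2 : differentiable (fun=> s%:C : C R) x.2).
apply: has_D1_eq (has_D1_cexp (has_D1M H1 (has_D1_fst x))) _.
by rewrite mulr1 mulr0 addr0 mulrC.
Qed.

Lemma has_D1_cst a x : has_D1 (fun=> a) x 0.
Proof. exact: (has_D1_snd (@differentiable_cst _ _ _ a x.2)). Qed.

End FirstDerivative.

(** * The phase function and its derivative *)

Section Coefficients.
Variables (R : realType) (Omega : set (C R)) (H : nat) (beta : nat -> R) (c : nat -> C R -> C R).
Local Notation E := (C R * C R)%type.
Implicit Types (x : E).
Hypothesis hH : (0 < H)%N.
Hypothesis hbeta : forall k, (k < H)%N -> beta k.+1 < beta k.
Hypothesis hbetaH : beta H = -1.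
Hypothesis hc : forall k, (1 <= k <= H)%N -> forall omega, Omega omega -> differentiable (c k) omega.
Hypothesis hcb : forall k, (1 <= k <= H)%N -> exists B : R, forall omega, Omega omega -> rnorm (c k omega) <= B.

Local Notation kappa := (beta 0%N + 1).

Lemma beta_mono j k : (j <= k <= H)%N -> beta k <= beta j.
Proof.
elim: k => [|k IH]; first by case: j.
rewrite leq_eqVlt => /andP[/orP[/eqP->|]] => // jk kH.
by apply: le_trans (ltW (hbeta kH)) (IH _); rewrite -ltnS jk ltnW.
Qed.

Lemma beta_gtN1 k : (k < H)%N -> 0 < beta k + 1.
Proof.
move=> kH; have := hbeta kH; have := @beta_mono k.+1 H; rewrite kH leqnn hbetaH => /(_ isT); lra.
Qed.

Lemma upow_uexp (w : C R) (s : R) : upow (uexp w) s = cexp (s%:C * w).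
Proof.
rewrite /upow /uexp [X in cexp X]complexRI cexp_complex /= ReZ ImZ.
by rewrite /powR gt_eqF ?expR_gt0 // expRK.
Qed.

Definition Pw x : C R := Pfun H beta c (uexp x.1) x.2.
(** The factor [cexp x.1] is [dz / dw], so this is the derivative of [Pw] in [w = ln z]. *)
Definition pw x : C R := cexp x.1 * pfun H beta c (uexp x.1) x.2.

(** The factor [exp w] raises every exponent by 1; as [beta H = -1], the last term no longer depends
    on [w]. *)
Lemma pwE x : pw x = cexp (kappa%:C * x.1) +
  (\sum_(k < H.-1) c k.+1 x.2 * cexp ((beta k.+1 + 1)%:C * x.1) + c H x.2).
Proof.
have step (s : R) : cexp x.1 * cexp (s%:C * x.1) = cexp ((s + 1)%:C * x.1).
  by rewrite -cexpD rmorphD rmorph1; congr cexp; ring.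
rewrite /pw /pfun mulrDr upow_uexp step big_nat_recr //= mulrDr; congr (_ + (_ + _)).
  rewrite big_add1 big_mkord mulr_sumr; apply: eq_bigr => k _.
  by rewrite upow_uexp mulrCA step.
by rewrite upow_uexp hbetaH mulrCA step addNr mul0r cexp0 mulr1.
Qed.

Lemma has_D1_Pw x : Omega x.2 -> has_D1 Pw x (pw x).
Proof.
move=> Ox; have kn k : (k < H)%N -> (beta k + 1)%:C != 0 :> C R.
  by move=> /beta_gtN1 b; rewrite -[_ == _](rnorm_eq0 ((beta k + 1)%:C : C R)) rnorm_real normr_eq0 gt_eqF.
have term (s : R) : s%:C != 0 :> C R -> has_D1 (fun u : E => cexp (s%:C * u.1) / s%:C) x (cexp (s%:C * x.1)).
  move=> s0; apply: has_D1_eq (has_D1M (has_D1_pow s x) (has_D1_cst (s%:C)^-1 x)) _.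
  by rewrite mulr0 add0r mulKf.
have H1 := term _ (kn 0%N hH).
have hk (k : 'I_H.-1) : (k.+1 < H)%N by rewrite -ltn_predRL.
have H2 : has_D1 (fun u : E => \sum_(k < H.-1) c k.+1 u.2 * (cexp ((beta k.+1 + 1)%:C * u.1) / (beta k.+1 + 1)%:C)) x
    (\sum_(k < H.-1) c k.+1 x.2 * cexp ((beta k.+1 + 1)%:C * x.1)).
  apply: has_D1_sum => k.
  have dk : differentiable (c k.+1) x.2 by apply: (hc _ Ox); rewrite ltn0Sn ltnW ?hk.
  apply: has_D1_eq (has_D1M (has_D1_snd dk) (term _ (kn _ (hk k)))) _.
  by rewrite mulr0 addr0.
have dH : differentiable (c H) x.2 by apply: (hc _ Ox); rewrite hH leqnn.
have H3 := has_D1M (has_D1_snd dH) (has_D1_fst x).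
have -> : Pw = fun u : E => cexp (kappa%:C * u.1) / kappa%:C +
    \sum_(k < H.-1) c k.+1 u.2 * (cexp ((beta k.+1 + 1)%:C * u.1) / (beta k.+1 + 1)%:C) + c H u.2 * u.1.
  apply/funext => u; rewrite /Pw /Pfun upow_uexp uexpK; congr (_ + _ + _).
  by rewrite big_add1 big_mkord; apply: eq_bigr => k _; rewrite upow_uexp.
apply: has_D1_eq (has_D1D (has_D1D H1 H2) H3) _.
by rewrite pwE mulr1 mulr0 addr0 addrA.
Qed.

Lemma differentiable_pw x : Omega x.2 -> differentiable pw x.
Proof.
move=> Ox.
have -> : pw = fun u : E => cexp (kappa%:C * u.1) +
  (\sum_(k < H.-1) c k.+1 u.2 * cexp ((beta k.+1 + 1)%:C * u.1) + c H u.2).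
  by apply/funext => u; exact: pwE.
have dc k : (0 < k <= H)%N -> differentiable (fun u : E => c k u.2) x.
  by move=> kH; have [] := has_D1_snd (hc kH Ox).
apply: differentiableD; first by have [] := has_D1_pow kappa x.
apply: differentiableD; last by apply: dc; rewrite hH leqnn.
have df (k : 'I_H.-1) : differentiable (fun u : E => c k.+1 u.2 * cexp ((beta k.+1 + 1)%:C * u.1)) x.
  apply: differentiableM; last by have [] := has_D1_pow (beta k.+1 + 1) x.
  by apply: dc; rewrite ltn0Sn ltnW // -ltn_predRL.
by have [] := diff_sum_apply (index_enum 'I_H.-1) ((1, 0) : E) df.
Qed.

(** The remaining exponents lie below the leading one by at least the gap [g], and the coefficients
    are bounded in [omega], so for [Re w > 0] the remainder is at most
    [SB exp ((kappa - g) Re w)]. *)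
Lemma pw_lim (e : R) : 0 < e -> exists X : R, forall x, Omega x.2 -> X < complex.Re x.1 ->
  rnorm (pw x - cexp (kappa%:C * x.1)) <= e * expR (kappa * complex.Re x.1).
Proof.
move=> e0; pose g := beta 0%N - beta 1%N.
have g0 : 0 < g by rewrite subr_gt0; exact: hbeta.
have /choice[B HB] : forall k, exists B : R, (1 <= k <= H)%N -> forall omega, Omega omega -> rnorm (c k omega) <= B.
  by move=> k; have [kH|kH] := boolP (1 <= k <= H)%N; [have [B ?] := hcb kH; exists B|exists 0].
pose SB := \sum_(k < H.-1) `|B k.+1| + `|B H|.
have SB0 : 0 <= SB by rewrite addr_ge0 // sumr_ge0.
exists (Num.max 0 (ln ((SB + 1) / e) / g)) => x Ox; rewrite gt_max => /andP[s0 sX].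
set s := complex.Re x.1 in s0 sX *.
have tail k : (1 <= k <= H)%N -> expR ((beta k + 1) * s) <= expR ((kappa - g) * s).
  move=> kH; rewrite ler_expR ler_wpM2r ?(ltW s0) //.
  by have := @beta_mono 1 k kH; rewrite /g; lra.
rewrite pwE addrAC subrr add0r.
apply: le_trans (_ : SB * expR ((kappa - g) * s) <= _).
  apply: le_trans (rnormD _ _) _; rewrite mulrDl; apply: lerD.
    apply: le_trans (rnorm_sum _ _ _) _; rewrite mulr_suml; apply: ler_sum => k _.
    have kH : (1 <= k.+1 <= H)%N by rewrite ltn0Sn ltnW // -ltn_predRL.
    rewrite rnormM; apply: ler_pM; [exact: rnorm_ge0|exact: rnorm_ge0| |].
      exact: le_trans (HB _ kH _ Ox) (ler_norm _).
    by rewrite rnorm_cexp ReZ; exact: tail.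
  have HH : (1 <= H <= H)%N by rewrite hH leqnn.
  rewrite -[leLHS]mulr1; apply: ler_pM => //; first exact: rnorm_ge0.
    exact: le_trans (HB _ HH _ Ox) (ler_norm _).
  by apply: le_trans (tail H HH); rewrite hbetaH addNr mul0r expR0.
rewrite mulrBl expRD mulrCA mulrC ler_wpM2r ?expR_ge0 //.
rewrite expRN ler_pdivrMr ?expR_gt0 //.
move: sX; rewrite ltr_pdivrMr // [s * g]mulrC -ltr_expR lnK ?posrE ?divr_gt0 ?ltr_wpDl // ltr_pdivrMr // [_ * e]mulrC.
by move=> h; apply: le_trans (ltW h); rewrite lerDl.
Qed.

End Coefficients.

Lemma diff_slice (R : realType) (f : C R * C R -> C R) (w omega : C R) (a : C R) :
  has_D1 f (w, omega) a -> differentiable (fun u => f (u, omega)) w /\ 'd (fun u => f (u, omega)) w 1 = a.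
Proof.
move=> [df Ef].
have di : differentiable (fun u : C R => u) w by exact: ex_diff.
have dc : differentiable (fun=> omega : C R) w by exact: differentiable_cst.
have dp : differentiable (fun u : C R => (u, omega)) w by exact: differentiable_pair.
split; first exact: (differentiable_comp dp df).
apply: etrans (diff_comp_apply (1 : C R) dp df) _.
have E1 := diff_id1 w.
have E2 : 'd (fun=> omega : C R) w 1 = 0 by exact: (congr1 (fun F => F (1 : C R)) (diff_cst _ w)).
have E3 : 'd (fun u : C R => (u, omega)) w 1 = (1, 0).
  apply: etrans (congr1 (fun F => F (1 : C R)) (diff_pair di dc)) _.
  exact: (congr2 pair E1 E2).
by apply: etrans (congr1 ('d f ((w, omega) : C R * C R)) E3) _.
Qed.

(** * Reduction to a perturbed diagonal system *)

Section Reduction.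
Variables (R : realType) (n : nat) (nrm : 'M[C R]_n -> R) (M : R) (Omega : set (C R)).
Variables (A : 'M[C R]_n) (psi : 'I_n -> 'cV[C R]_n) (nu : 'I_n -> C R).
Variables (H : nat) (beta : nat -> R) (c : nat -> C R -> C R) (Rm : ucover R -> C R -> 'M[C R]_n) (delta : R).
Hypothesis hnrm : is_norm nrm.
Hypothesis hM : 0 < M.
Hypothesis oO : open Omega.
Hypothesis hpsi : basis_of fullv [tuple psi j | j < n].
Hypothesis hA : forall j, A *m psi j = nu j *: psi j.
Hypothesis hH : (0 < H)%N.
Hypothesis hbeta : forall k, (k < H)%N -> beta k.+1 < beta k.
Hypothesis hbetaH : beta H = -1.
Hypothesis hc : forall k, (1 <= k <= H)%N -> forall omega, Omega omega -> differentiable (c k) omega.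
Hypothesis hcb : forall k, (1 <= k <= H)%N -> exists B : R, forall omega, Omega omega -> rnorm (c k omega) <= B.
Hypothesis hdelta : 0 < delta.
Hypothesis hRm : uholomorphic M Omega Rm.
Hypothesis hRmO : forall theta1 theta2 : R, theta1 <= theta2 ->
  uniform_bigO Omega theta1 theta2 (fun z omega => nrm (Rm z omega)) (-1 - delta).

Local Notation E := (C R * C R)%type.
Local Notation kappa := (beta 0%N + 1).
Local Notation U := (half_plane (ln M) Omega).
Local Notation P := (Pw H beta c).
Local Notation p := (pw H beta c).
Implicit Types (x : E) (w : C R) (i j k : 'I_n) (z : ucover R).

Definition system_mx (omega : C R) (z : ucover R) : 'M[C R]_n := - (pfun H beta c z omega *: A) + Rm z omega.
Definition Eexp (j : 'I_n) (z : ucover R) (omega : C R) : C R := cexp (- (nu j * Pfun H beta c z omega)).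

Definition eigenmx : 'M[C R]_n := \matrix_(i, j) psi j i 0.
Local Notation Q := eigenmx.

Lemma mulmx_eigen (v : 'cV[C R]_n) : Q *m v = \sum_j v j 0 *: psi j.
Proof.
apply/colP => i; rewrite !mxE summxE; apply: eq_bigr => j _.
by rewrite !mxE mulrC.
Qed.

Lemma eigenmx_unit : Q \in unitmx.
Proof.
have /andP[_ fr] := hpsi.
rewrite -unitmx_tr -row_free_unit; apply: inj_row_free => v vQ.
have E0 : Q *m v^T = 0 by rewrite -[LHS]trmxK trmx_mul trmxK vQ trmx0.
move: E0; rewrite mulmx_eigen => E0.
apply/rowP => j; rewrite mxE.
have /freeP/(_ (fun j => v 0 j)) := fr; apply.
by rewrite -[RHS]E0; apply: eq_bigr => k _; rewrite mxE -tnth_nth tnth_mktuple.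
Qed.

(** The perturbation in the basis of eigenvectors. The factor [dz / dw = exp w] uses up one power of
    [z] in the decay of [Rm] and leaves [|z|^(- delta)]. *)
Definition coefB i k x : C R := cexp x.1 * (invmx Q *m Rm (uexp x.1) x.2 *m Q) i k.

Local Notation coef := (perturbed (fun i => - nu i) p coefB).

Lemma uexp_gt w : ln M < complex.Re w -> M < umod (uexp w).
Proof. by move=> mw /=; rewrite -[ltLHS]lnK ?posrE // ltr_expR. Qed.

Lemma uln_gt z : M < umod z -> ln M < complex.Re (uln z).
Proof. by move=> Mz /=; rewrite ltr_ln ?posrE // umod_gt0. Qed.

Lemma kappa_gt0 : 0 < kappa.
Proof. exact: (beta_gtN1 hbeta hbetaH hH). Qed.

Lemma dPw x : U x -> differentiable P x /\ D1 P x = p x.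
Proof. by move=> [_ Ox]; exact: (has_D1_Pw hH hbeta hbetaH hc Ox). Qed.

Lemma dpw x : U x -> differentiable p x.
Proof. by move=> [_ Ox]; exact: (differentiable_pw hH hbetaH hc Ox). Qed.

Lemma coefB_diff i k x : U x -> differentiable (coefB i k) x.
Proof.
case: x => [w o] [mw Oo]; have dR := hRm (uexp_gt mw) Oo; rewrite uexpK in dR.
apply: differentiableM; first by apply: differentiable_cexp; exact: differentiable_fst.
have de l h : differentiable (fun x : E => Rm (uexp x.1) x.2 l h) (w, o).
  exact: (differentiable_comp dR (@differentiable_entry R n n l h (Rm (uexp w) o))).
have -> : (fun x : E => (invmx Q *m Rm (uexp x.1) x.2 *m Q) i k) =
    fun x : E => \sum_l (\sum_h invmx Q i h * Rm (uexp x.1) x.2 h l) * Q l k.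
  by apply/funext => x; rewrite mxE; apply: eq_bigr => l _; rewrite mxE.
have d1 l : differentiable (fun x : E => (\sum_h invmx Q i h * Rm (uexp x.1) x.2 h l) * Q l k) (w, o).
  apply: differentiableM; last exact: differentiable_cst.
  have d2 h : differentiable (fun x : E => invmx Q i h * Rm (uexp x.1) x.2 h l) (w, o).
    by apply: differentiableM; [exact: differentiable_cst|exact: de].
  by have [] := diff_sum_apply (index_enum 'I_n) ((1, 0) : E) d2.
by have [] := diff_sum_apply (index_enum 'I_n) ((1, 0) : E) d1.
Qed.

Lemma coefB_bound (t1 t2 : R) : exists K X : R, forall i k x, Omega x.2 ->
  t1 <= complex.Im x.1 <= t2 -> X < complex.Re x.1 -> rnorm (coefB i k x) <= K * expR (- (delta * complex.Re x.1)).
Proof.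
have [t12|t12] := leP t1 t2; last first.
  exists 0, 0 => i k x _ /andP[x1 x2]; have : t1 <= t2 by exact: le_trans x2.
  by rewrite leNgt t12.
have [K [r0 HK]] := hRmO t12; have [L L0 HL] := norm_entry hnrm.
pose S i k := \sum_l (\sum_h rnorm (invmx Q i h)) * rnorm (Q l k).
have S0 i k : 0 <= S i k.
  by apply: sumr_ge0 => l _; rewrite mulr_ge0 ?rnorm_ge0 // sumr_ge0 // => h _; exact: rnorm_ge0.
pose SS := \sum_i \sum_k S i k.
exists (SS * (L * `|K|)), (ln (Num.max r0 1)) => i k [w o] /= Oo tw Xw.
have rw : r0 < umod (uexp w).
  have m1 : 0 < Num.max r0 1 by rewrite lt_max ltr01 orbT.
  rewrite /=; apply: le_lt_trans (_ : Num.max r0 1 < _); first by rewrite le_max lexx.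
  by rewrite -[ltLHS]lnK ?posrE // ltr_expR.
have b := HK (uexp w) o Oo tw rw.
have pE : umod (uexp w) `^ (-1 - delta) = expR (- complex.Re w) * expR (- (delta * complex.Re w)).
  by rewrite /powR gt_eqF ?umod_gt0 //= expRK -expRD; congr expR; ring.
rewrite pE in b.
have bR h l : rnorm (Rm (uexp w) o h l) <= L * `|K| * (expR (- complex.Re w) * expR (- (delta * complex.Re w))).
  apply: le_trans (HL _ h l) _; rewrite -mulrA; apply: ler_wpM2l => //.
  by apply: le_trans b _; rewrite ler_wpM2r ?mulr_ge0 ?expR_ge0 // ler_norm.
set X := L * `|K| * _ in bR.
have X0 : 0 <= X by rewrite !mulr_ge0 ?expR_ge0.
have bM : rnorm ((invmx Q *m Rm (uexp w) o *m Q) i k) <= S i k * X.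
  rewrite mxE; apply: le_trans (rnorm_sum _ _ _) _; rewrite /S mulr_suml; apply: ler_sum => l _.
  rewrite rnormM mulrAC; apply: ler_wpM2r; first exact: rnorm_ge0.
  rewrite mxE; apply: le_trans (rnorm_sum _ _ _) _; rewrite mulr_suml; apply: ler_sum => h _.
  by rewrite rnormM; apply: ler_wpM2l; [exact: rnorm_ge0|exact: bR].
have SL : S i k <= SS.
  rewrite /SS (bigD1 i) //= (bigD1 k) //= -addrA lerDl addr_ge0 //.
    by apply: sumr_ge0.
  by apply: sumr_ge0 => l _; apply: sumr_ge0.
rewrite /coefB rnormM rnorm_cexp /=.
apply: le_trans (ler_wpM2l (expR_ge0 _) bM) _.
apply: le_trans (_ : expR (complex.Re w) * (SS * X) <= _).
  by apply: ler_wpM2l; [exact: expR_ge0|exact: ler_wpM2r].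
have e1 : expR (complex.Re w) * expR (- complex.Re w) = 1 by rewrite -expRD subrr expR0.
apply: eq_le_of; rewrite /X.
have -> : expR (complex.Re w) * (SS * (L * `|K| * (expR (- complex.Re w) * expR (- (delta * complex.Re w))))) =
  SS * (L * `|K|) * expR (- (delta * complex.Re w)) * (expR (complex.Re w) * expR (- complex.Re w)) by ring.
by rewrite e1 mulr1.
Qed.

Lemma row_app_system (y : 'I_n -> E -> C R) i w omega :
  row_app coef y i (w, omega) =
  cexp w * (invmx Q *m (system_mx omega (uexp w) *m \sum_j y j (w, omega) *: psi j)) i 0.
Proof.
pose v : 'cV[C R]_n := \col_j y j (w, omega).
have vE : \sum_j y j (w, omega) *: psi j = Q *m v.
  by rewrite mulmx_eigen; apply: eq_bigr => j _; rewrite mxE.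
have AQ : invmx Q *m (A *m (Q *m v)) = \col_j (nu j * y j (w, omega)).
  rewrite mulmx_eigen mulmx_sumr.
  rewrite (eq_bigr (fun j => (nu j * v j 0) *: psi j)); last first.
    by move=> j _; rewrite -scalemxAr hA scalerA mulrC.
  pose v' : 'cV[C R]_n := \col_j (nu j * y j (w, omega)).
  have -> : \sum_j (nu j * v j 0) *: psi j = Q *m v'.
    by rewrite mulmx_eigen; apply: eq_bigr => j _; rewrite !mxE.
  by rewrite mulKmx // eigenmx_unit.
rewrite vE /system_mx mulmxDl mulNmx -scalemxAl mulmxDr mulmxN -scalemxAr AQ.
rewrite row_app_perturbed !mulmxA mxE mulrDr; congr (_ + _).
  by rewrite !mxE /pw /=; ring.
rewrite mxE mulr_sumr; apply: eq_bigr => k _.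
by rewrite /coefB [v k 0]mxE mulrA.
Qed.

Definition assemble (y : 'I_n -> E -> C R) (z : ucover R) (omega : C R) : 'cV[C R]_n :=
  \sum_i y i (uln z, omega) *: psi i.

Lemma assemble_solution (y : 'I_n -> E -> C R) (omega : C R) : Omega omega ->
  (forall x, U x -> ode coef y x) -> solution M (system_mx omega) (fun z => assemble y z omega).
Proof.
move=> Oo Hy z Mz; rewrite -[z]ulnK; set w := uln z.
have Ux : U (w, omega) by split=> //; exact: uln_gt.
apply/is_uderiveP => k.
have HY i := diff_slice (Hy _ Ux i).
have fE : (fun u => assemble y (uexp u) omega k 0) = fun u : C R => \sum_i psi i k 0 * y i (u, omega).
  by apply/funext => u; rewrite /assemble summxE uexpK; apply: eq_bigr => i _; rewrite mxE mulrC.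
have dt i : differentiable (fun u : C R => psi i k 0 * y i (u, omega)) w.
  by apply: differentiableM; [exact: differentiable_cst|have [] := HY i].
have [ds Es] := diff_sum_apply (index_enum 'I_n) (1 : C R) dt.
rewrite fE; split; first exact: ds.
apply: etrans Es _.
have -> : system_mx omega (uexp w) *m assemble y (uexp w) omega =
    Q *m (invmx Q *m (system_mx omega (uexp w) *m \sum_j y j (w, omega) *: psi j)).
  by rewrite mulKVmx ?eigenmx_unit // /assemble uexpK.
rewrite [in RHS]mxE mulr_sumr; apply: eq_bigr => i _.
have [d1 E1] := HY i.
apply: etrans (diff_mull (psi i k 0) (1 : C R) d1) _.
apply: etrans (congr1 (fun s => psi i k 0 * s) E1) _.
by rewrite [Q k i]mxE row_app_system; ring.
Qed.

(** Here [f] carries no parameter: this serves the statements on a frozen equation, in which the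
    second variable is a dummy. *)
Definition coord (f : ucover R -> 'cV[C R]_n) i x : C R := (invmx Q *m f (uexp x.1)) i 0.

Lemma coordE f z omega : \sum_i coord f i (uln z, omega) *: psi i = f z.
Proof.
by rewrite /coord /= ulnK -mulmx_eigen mulKVmx // eigenmx_unit.
Qed.

Lemma coord_ode (f : ucover R -> 'cV[C R]_n) : (forall omega, Omega omega -> solution M (system_mx omega) f) ->
  forall x, U x -> ode coef (coord f) x.
Proof.
move=> Hf [w omega] Ux i; have [mw Oo] := Ux.
have /is_uderiveP Hk := Hf omega Oo (uexp w) (uexp_gt mw).
have fk k : has_D1 (fun u : E => f (uexp u.1) k 0) (w, omega) (cexp w * (system_mx omega (uexp w) *m f (uexp w)) k 0).
  have [dk Ek] := Hk k; have [df Ef] := has_D1_fst ((f (uexp w) k 0, omega) : E).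
  have [d1 E1] := @D1_comp_fst R (fun u => f (uexp u) k 0) (fun v : E => v.1) (w, omega) _ dk Ek df.
  by split; [exact: d1|apply: etrans E1 _; rewrite Ef mulr1].
have Hs := has_D1_sum (fun k => has_D1M (has_D1_cst (invmx Q i k) (w, omega)) (fk k)).
have -> : coord f i = fun u : E => \sum_k invmx Q i k * f (uexp u.1) k 0.
  by apply/funext => u; rewrite /coord mxE.
apply: has_D1_eq Hs _; rewrite row_app_system.
have -> : \sum_j coord f j (w, omega) *: psi j = f (uexp w).
  by rewrite -[w in LHS]uexpK coordE.
rewrite mxE mulr_sumr; apply: eq_bigr => k _.
by rewrite mulr0 addr0; ring.
Qed.

Lemma near_delta_asymptotic (t1 t2 : R) (phi : 'I_n -> E -> C R) j :
  near_delta Omega delta t1 t2 phi j ->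
  asymptotic M Omega t1 t2 delta (assemble (fun i x => cexp (- (nu j * P x)) * phi i x)) (psi j) (Eexp j).
Proof.
move=> [K [X HK]].
exists (fun z omega => \sum_i (phi i (uln z, omega) - (i == j)%:R) *: psi i); split.
  exists (\sum_i `|K| * rnorm (psi i)), (expR X) => z omega Oo tz rz.
  have Xz : X < complex.Re (uln z) by rewrite /= -ltr_expR lnK // posrE umod_gt0.
  have b i := HK (uln z, omega) Oo tz Xz i.
  have -> : umod z `^ (- delta) = expR (- (delta * complex.Re (uln z))).
    by rewrite /powR gt_eqF ?umod_gt0 //= mulNr.
  apply: le_trans (rnorm_sum _ _ _) _; rewrite mulr_suml; apply: ler_sum => i _.
  rewrite rnormZ mulrAC; apply: ler_wpM2r; first exact: rnorm_ge0.
  by apply: le_trans (b i) _; rewrite ler_wpM2r ?expR_ge0 // ler_norm.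
move=> z omega Mz Oo tz.
have -> : psi j + \sum_i (phi i (uln z, omega) - (i == j)%:R) *: psi i = \sum_i phi i (uln z, omega) *: psi i.
  under eq_bigr do rewrite scalerBl; rewrite sumrB.
  have -> : \sum_i (i == j)%:R *: psi i = psi j.
    by rewrite (bigD1 j) //= eqxx scale1r big1 ?addr0 // => i ij; rewrite (negbTE ij) scale0r.
  by rewrite addrCA subrr addr0.
rewrite scaler_sumr; apply: eq_bigr => i _.
by rewrite scalerA /Eexp /Pw /= ulnK.
Qed.

Lemma asymptotic_near_delta (t1 t2 : R) (f : ucover R -> 'cV[C R]_n) j :
  asymptotic M Omega t1 t2 delta (fun z _ => f z) (psi j) (Eexp j) ->
  near_delta Omega delta t1 t2 (fun i x => cexp (- (- nu j * P x)) * coord f i x) j.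
Proof.
move=> [eps [[K [r0 HK]] Hf]]; have [L L0 HL] := entry_bound R n 1.
pose S := \sum_i \sum_k rnorm (invmx Q i k).
have S0 : 0 <= S by apply: sumr_ge0 => i _; apply: sumr_ge0 => k _; exact: rnorm_ge0.
exists (S * (L * `|K|)), (Num.max (ln M) (ln (Num.max r0 1))) => -[w omega] /= Oo tw.
rewrite gt_max => /andP[mw rw] i.
have r0w : r0 < umod (uexp w).
  have m1 : 0 < Num.max r0 1 by rewrite lt_max ltr01 orbT.
  rewrite /=; apply: le_lt_trans (_ : Num.max r0 1 < _); first by rewrite le_max lexx.
  by rewrite -[ltLHS]lnK ?posrE // ltr_expR.
have := HK (uexp w) omega Oo tw r0w.
have -> : umod (uexp w) `^ (- delta) = expR (- (delta * complex.Re w)).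
  by rewrite /powR gt_eqF ?umod_gt0 //= expRK mulNr.
move=> b; have fE := Hf (uexp w) omega (uexp_gt mw) Oo tw.
have -> : cexp (- (- nu j * P (w, omega))) * coord f i (w, omega) - (i == j)%:R = (invmx Q *m eps (uexp w) omega) i 0.
  have qj : (invmx Q *m psi j) i 0 = (i == j)%:R.
    have -> : psi j = Q *m delta_mx j 0.
      rewrite mulmx_eigen (bigD1 j) //= mxE !eqxx scale1r big1 ?addr0 // => k kj.
      by rewrite mxE (negbTE kj) scale0r.
    by rewrite mulKmx ?eigenmx_unit // mxE eqxx andbT.
  rewrite /coord /= fE -scalemxAr mulmxDr !mxE -[X in X + _ = _]mulr1.
  rewrite -{1}qj /Eexp /Pw /= mulNr opprK.
  have e1 : cexp (nu j * Pfun H beta c (uexp w) omega) * cexp (- (nu j * Pfun H beta c (uexp w) omega)) = 1.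
    by rewrite -cexpD subrr cexp0.
  by rewrite mulr1 mulrA e1 mul1r !mxE addrAC subrr add0r.
have i1 k : rnorm (eps (uexp w) omega k 0) <= L * `|K| * expR (- (delta * complex.Re w)).
  apply: le_trans (HL k 0 _) _; rewrite -mulrA; apply: ler_wpM2l => //.
  by apply: le_trans b _; rewrite ler_wpM2r ?expR_ge0 // ler_norm.
rewrite mxE; apply: le_trans (rnorm_sum _ _ _) _.
apply: le_trans (_ : \sum_k rnorm (invmx Q i k) * (L * `|K| * expR (- (delta * complex.Re w))) <= _).
  by apply: ler_sum => k _; rewrite rnormM; apply: ler_wpM2l; [exact: rnorm_ge0|exact: i1].
rewrite -mulr_suml -[leRHS]mulrA; apply: ler_wpM2r; first by rewrite !mulr_ge0 ?expR_ge0.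
rewrite /S [leRHS](bigD1 i) //= lerDl; apply: sumr_ge0 => l _; apply: sumr_ge0 => k _; exact: rnorm_ge0.
Qed.

Lemma assemble_holomorphic (y : 'I_n -> E -> C R) : (forall i x, U x -> differentiable (y i) x) ->
  uholomorphic M Omega (assemble y).
Proof.
move=> dy z omega Mz Oo.
have Ux : U (uln z, omega) by split=> //; exact: uln_gt.
have -> : (fun x : C R * C R => assemble y (uexp x.1) x.2) = \sum_i (fun x : E => y i x *: psi i).
  by apply/funext => x; rewrite /assemble fct_sumE uexpK -surjective_pairing.
by apply: differentiable_sum => i; apply: differentiableZl; exact: dy.
Qed.

Lemma coord_twist (f : ucover R -> 'cV[C R]_n) j x : (forall omega, Omega omega -> solution M (system_mx omega) f) ->
  U x -> ode (perturbed (fun i => nu j - nu i) p coefB) (fun i x => cexp (- (- nu j * P x)) * coord f i x) x.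
Proof.
move=> Hf Ux; have := ode_twist dPw (- nu j) Ux (coord_ode Hf Ux).
by have -> : (fun i => - nu i - - nu j) = (fun i => nu j - nu i) by apply/funext => i; ring.
Qed.

Lemma coord_inj (f f' : ucover R -> 'cV[C R]_n) j (omega : C R) :
  (forall w, ln M < complex.Re w -> forall i,
     cexp (- (- nu j * P (w, omega))) * coord f i (w, omega) - cexp (- (- nu j * P (w, omega))) * coord f' i (w, omega) = 0) ->
  forall z, M < umod z -> f z = f' z.
Proof.
move=> Z z Mz; rewrite -(coordE f z omega) -(coordE f' z omega); apply: eq_bigr => i _; congr (_ *: _).
have := Z (uln z) (uln_gt Mz) i; rewrite -mulrBr => /eqP.
by rewrite mulf_eq0 (negbTE (cexp_neq0 _)) /= subr_eq0 => /eqP.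
Qed.

(** That [system_mx] is constant in the parameter expresses that the equation is frozen.
    Independence and span are read off along the ray at the end [a] of the sector, where real parts
    separate distinct eigenvalues. *)
Lemma solutions_basis (a b : R) (f : 'I_n -> ucover R -> 'cV[C R]_n) (omega : C R) : Omega omega -> a <= b ->
  (forall omega', system_mx omega' = system_mx omega) ->
  (forall j j', complex.Re ((nu j - nu j') * expi a) = 0 -> nu j = nu j') ->
  (forall j, solution M (system_mx omega) (f j)) ->
  (forall j, asymptotic M Omega (a / kappa) ((b + pi) / kappa) delta (fun z _ => f j z) (psi j) (Eexp j)) ->
  solution_basis M (system_mx omega) f.
Proof.
move=> Oo ab Eo sep Hf Af.
have Hf' j omega' : Omega omega' -> solution M (system_mx omega') (f j) by rewrite Eo.
pose phi j i x := cexp (- (- nu j * P x)) * coord (f j) i x.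
have abp : a <= b + pi by have := pi_gt0 R; lra.
have Nphi j := asymptotic_near_delta (Af j).
have tw j i x : twisted P nu phi j i x = coord (f j) i x.
  by rewrite /twisted /phi mulrA -cexpD mulNr opprK addNr cexp0 mul1r.
have plim := pw_lim hH hbeta hbetaH hcb.
split=> [j|a' a0|g Hg]; first exact: Hf.
  apply: (@twisted_independent _ _ _ _ _ _ _ _ kappa_gt0 hdelta dPw plim nu phi a (b + pi) omega Oo abp sep Nphi) => w mw i.
  under eq_bigr do rewrite tw.
  have := a0 (uexp w) (uexp_gt mw) => /(congr1 (fun v => (invmx Q *m v) i 0)).
  rewrite mulmx0 mulmx_sumr summxE [RHS]mxE => a0w; apply: etrans a0w.
  by apply: eq_bigr => j _; rewrite -scalemxAr mxE.
have Hg' omega' : Omega omega' -> solution M (system_mx omega') g by rewrite Eo.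
have [a' Ha'] := @twisted_span _ _ _ _ _ _ _ _ _ kappa_gt0 hdelta dPw dpw plim coefB_diff nu phi a (b + pi) omega Oo abp sep
  (fun j x Ux => coord_twist j (Hf' j) Ux) Nphi (coord g) (coord_ode Hg').
exists a' => z Mz; rewrite -(coordE g z omega).
under eq_bigr do rewrite (Ha' _ (uln_gt Mz)) scaler_suml.
rewrite exchange_big /=; apply: eq_bigr => j _.
rewrite -[in RHS](coordE (f j) z omega) scaler_sumr; apply: eq_bigr => i _.
by rewrite scalerA tw.
Qed.

Lemma sector_unique (a b : R) (f f' : ucover R -> 'cV[C R]_n) j (omega : C R) : Omega omega -> a <= b ->
  (forall i, signed a b (nu j - nu i)) -> (forall omega', system_mx omega' = system_mx omega) ->
  solution M (system_mx omega) f -> solution M (system_mx omega) f' ->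
  asymptotic M Omega (a / kappa) ((b + pi) / kappa) delta (fun z _ => f z) (psi j) (Eexp j) ->
  asymptotic M Omega (a / kappa) ((b + pi) / kappa) delta (fun z _ => f' z) (psi j) (Eexp j) ->
  forall z, M < umod z -> f z = f' z.
Proof.
move=> Oo ab sgn Eo Hf Hf' Af Af'.
have {}Hf omega' : Omega omega' -> solution M (system_mx omega') f by rewrite Eo.
have {}Hf' omega' : Omega omega' -> solution M (system_mx omega') f' by rewrite Eo.
have sm := near_deltaB (lexx _) (lexx _) (lexx _) (lexx _) (asymptotic_near_delta Af) (asymptotic_near_delta Af').
apply: (@coord_inj f f' j omega) => w mw i.
exact: (sector_solution_unique oO kappa_gt0 hdelta dPw dpw (pw_lim hH hbeta hbetaH hcb) coefB_diff coefB_bound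
  Oo ab sgn (fun x Ux => odeB (coord_twist j Hf Ux) (coord_twist j Hf' Ux)) sm mw i).
Qed.

Lemma subdominant_unique (a b : R) (f f' : ucover R -> 'cV[C R]_n) j (omega : C R) : Omega omega -> a <= b ->
  (forall i, nu j - nu i = 0 \/ 0 < complex.Re ((nu j - nu i) * expi a)) -> (forall omega', system_mx omega' = system_mx omega) ->
  solution M (system_mx omega) f -> solution M (system_mx omega) f' ->
  asymptotic M Omega ((a - pi) / kappa) ((b + pi) / kappa) delta (fun z _ => f z) (psi j) (Eexp j) ->
  asymptotic M Omega ((a - pi) / kappa) ((b + pi) / kappa) delta (fun z _ => f' z) (psi j) (Eexp j) ->
  forall z, M < umod z -> f z = f' z.
Proof.
move=> Oo ab pos Eo Hf Hf' Af Af'; have pi0 := pi_gt0 R.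
have {}Hf omega' : Omega omega' -> solution M (system_mx omega') f by rewrite Eo.
have {}Hf' omega' : Omega omega' -> solution M (system_mx omega') f' by rewrite Eo.
(* The sector contains [[a - pi, a + pi]], so [narrow_solution_unique] applies about the ray [a]
   with [e = pi]. *)
have hi : (a + pi) / kappa <= (b + pi) / kappa by rewrite ler_pM2r ?invr_gt0 ?kappa_gt0 // lerD2r.
have sm := near_deltaB (lexx _) (lexx _) hi hi (asymptotic_near_delta Af) (asymptotic_near_delta Af').
apply: (@coord_inj f f' j omega) => w mw i.
exact: (narrow_solution_unique oO kappa_gt0 hdelta dPw dpw (pw_lim hH hbeta hbetaH hcb) coefB_diff coefB_bound
  Oo pi0 pos (fun x Ux => odeB (coord_twist j Hf Ux) (coord_twist j Hf' Ux)) sm mw i).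
Qed.

Lemma assembled_solution (t1 t2 : R) (phi : 'I_n -> E -> C R) j :
  (forall x, U x -> ode (perturbed (fun i => nu j - nu i) p coefB) phi x) ->
  near_delta Omega delta t1 t2 phi j ->
  exists f : ucover R -> C R -> 'cV[C R]_n,
    [/\ forall omega, Omega omega -> solution M (system_mx omega) (fun z => f z omega),
        asymptotic M Omega t1 t2 delta f (psi j) (Eexp j) & uholomorphic M Omega f].
Proof.
move=> Hphi Nphi; pose y i x := cexp (- (nu j * P x)) * phi i x.
have Hy x : U x -> ode coef y x.
  move=> Ux; have := ode_twist dPw (nu j) Ux (Hphi x Ux).
  by have -> : (fun i => nu j - nu i - nu j) = (fun i => - nu i) by apply/funext => i; ring.
exists (assemble y); split.
- by move=> omega Oo; exact: assemble_solution.
- exact: near_delta_asymptotic.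
- by apply: assemble_holomorphic => i x Ux; have [] := Hy x Ux i.
Qed.

Lemma sector_exists (a b : R) j : a <= b -> (forall i, signed a b (nu j - nu i)) ->
  exists f : ucover R -> C R -> 'cV[C R]_n,
    [/\ forall omega, Omega omega -> solution M (system_mx omega) (fun z => f z omega),
        asymptotic M Omega (a / kappa) ((b + pi) / kappa) delta f (psi j) (Eexp j) & uholomorphic M Omega f].
Proof.
move=> ab sgn; have [eps eps0 [phi Hphi [K [X HK]]]] := sector_solution_exists oO kappa_gt0 hdelta dPw dpw
  (pw_lim hH hbeta hbetaH hcb) coefB_diff coefB_bound ab (subrr (nu j)) sgn.
apply: (assembled_solution Hphi); exists K, X => x Ox /andP[x1 x2]; apply: HK => //.
have ki : 0 < kappa^-1 by rewrite invr_gt0 kappa_gt0.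
apply/andP; split; [apply: le_trans x1|apply: le_trans x2 _]; rewrite ler_pM2r //; lra.
Qed.

Lemma subdominant_exists (a b : R) j : a <= b ->
  (forall i, nu j - nu i = 0 \/ forall t, a <= t <= b -> 0 < complex.Re ((nu j - nu i) * expi t)) ->
  exists f : ucover R -> C R -> 'cV[C R]_n,
    [/\ forall omega, Omega omega -> solution M (system_mx omega) (fun z => f z omega),
        asymptotic M Omega ((a - pi) / kappa) ((b + pi) / kappa) delta f (psi j) (Eexp j) & uholomorphic M Omega f].
Proof.
move=> ab pos; have [phi Hphi Nphi] := subdominant_solution_exists oO kappa_gt0 hdelta dPw dpw
  (pw_lim hH hbeta hbetaH hcb) coefB_diff coefB_bound ab (subrr (nu j)) pos.
exact: (assembled_solution Hphi).
Qed.

End Reduction.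

(** By the intermediate value theorem a continuous real function without zeros keeps the sign it has
    at [a]. This turns the hypothesis of (1), which speaks of zeros, into one on signs. *)
Lemma signed_of_nonzero (R : realType) (l : C R) (a b : R) : a <= b ->
  (forall t, a <= t <= b -> complex.Re (l * expi t) = 0 -> l = 0) -> signed a b l.
Proof.
move=> ab H; have [->|l0] := eqVneq l 0; first by apply: Or31.
have ne t : a <= t <= b -> complex.Re (l * expi t) != 0.
  by move=> tab; apply/eqP => /(H t tab)/eqP; rewrite (negbTE l0).
have cf (t : R) : {within `[a, t], continuous (fun s : R => complex.Re (l * expi s))}.
  by apply: continuous_subspaceT; exact: continuous_Re_mul_expi.
have aab : a <= a <= b by rewrite lexx ab.
have cross t : a <= t <= b ->
    Num.min (complex.Re (l * expi a)) (complex.Re (l * expi t)) <= 0 <= Num.max (complex.Re (l * expi a)) (complex.Re (l * expi t)) -> False.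
  move=> /andP[a_t tb] m0; have [s sab s0] := IVT a_t (cf t) m0.
  move: sab; rewrite in_itv /= => /andP[as_ st].
  by have := ne s; rewrite s0 eqxx as_ (le_trans st tb) => /(_ isT).
have := ne a aab; rewrite neq_lt => /orP[fa|fa].
  apply: Or33 => t tab; rewrite ltNge; apply/negP => ft; apply: (cross t tab).
  by rewrite ge_min le_max (ltW fa) ft orbT.
apply: Or32 => t tab; rewrite ltNge; apply/negP => ft; apply: (cross t tab).
by rewrite ge_min le_max (ltW fa) ft orbT.
Qed.

Lemma asymptotic_slice (R : realType) (n : nat) (M : R) (Omega : set (C R)) (t1 t2 delta : R)
    (f : ucover R -> C R -> 'cV[C R]_n) (v : 'cV[C R]_n) (e : ucover R -> C R -> C R) (omega : C R) :
  Omega omega -> asymptotic M Omega t1 t2 delta f v e ->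
  asymptotic M setT t1 t2 delta (fun z _ => f z omega) v (fun z _ => e z omega).
Proof.
move=> Oo [eps [[K [r0 HK]] Hf]]; exists (fun z _ => eps z omega); split.
  by exists K, r0 => z _ _ tz rz; exact: HK.
by move=> z _ Mz _ tz; exact: Hf.
Qed.

Lemma uholomorphic_slice (R : realType) (n : nat) (M : R) (Omega : set (C R))
    (f : ucover R -> C R -> 'M[C R]_n) (omega : C R) :
  Omega omega -> uholomorphic M Omega f -> uholomorphic M setT (fun z _ => f z omega).
Proof.
move=> Oo Hf z o Mz _.
have d1 : differentiable (fun x : C R * C R => x.1) (uln z, o) by exact: differentiable_fst.
have d2 : differentiable (fun=> omega : C R) ((uln z, o) : C R * C R) by exact: differentiable_cst.
have dp : differentiable (fun x : C R * C R => (x.1, omega)) (uln z, o) by exact: differentiable_pair.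
exact: (differentiable_comp dp (Hf z omega Mz Oo)).
Qed.

Theorem theorem3p26 (R : realType) (n : nat) (nrm : 'M[C R]_n -> R)
  (M : R) (Omega : set (C R))
  (A : 'M[C R]_n) (psi : 'I_n -> 'cV[C R]_n) (nu : 'I_n -> C R)
  (H : nat) (beta : nat -> R) (c : nat -> C R -> C R)
  (Rm : ucover R -> C R -> 'M[C R]_n) (delta : R)
  (hnrm : is_norm nrm)
  (hM : 0 < M)
  (hOmega : is_domain Omega)
  (hpsi : basis_of fullv [tuple psi j | j < n])
  (hA : forall j, A *m psi j = nu j *: psi j)
  (hH : (0 < H)%N)
  (hbeta : forall k, (k < H)%N -> beta k.+1 < beta k)
  (hbetaH : beta H = -1)
  (hc : forall k, (1 <= k <= H)%N ->
     forall omega, Omega omega -> differentiable (c k) omega)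
  (hcb : forall k, (1 <= k <= H)%N ->
     exists B : R, forall omega, Omega omega -> rnorm (c k omega) <= B)
  (hdelta : 0 < delta)
  (hRm : uholomorphic M Omega Rm)
  (hRmO : forall theta1 theta2 : R, theta1 <= theta2 ->
     uniform_bigO Omega theta1 theta2
       (fun z omega => nrm (Rm z omega)) (-1 - delta)) :
  let eqn (omega : C R) (z : ucover R) : 'M[C R]_n :=
    - (pfun H beta c z omega *: A) + Rm z omega in
  let E (j : 'I_n) (z : ucover R) (omega : C R) : C R :=
    cexp (- (nu j * Pfun H beta c z omega)) in
  (forall a b : R, a <= b ->
     (forall tau, a <= tau <= b -> forall j j',
        complex.Re ((nu j - nu j') * expi tau) = 0 <-> nu j = nu j') ->
     let good (Psi : 'I_n -> ucover R -> C R -> 'cV[C R]_n) :=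
       (forall omega, Omega omega ->
          solution_basis M (eqn omega) (fun j z => Psi j z omega)) /\
       (forall j, asymptotic M Omega
          (a / (beta 0%N + 1)) ((b + pi) / (beta 0%N + 1)) delta
          (Psi j) (psi j) (E j)) in
     exists Psi,
       [/\ good Psi,
           forall j, uholomorphic M Omega (Psi j)
         & forall Psi', good Psi' -> forall j z omega,
             M < umod z -> Omega omega -> Psi' j z omega = Psi j z omega])
  /\
  (forall (a b : R) (j0 : 'I_n), a <= b ->
     (forall tau, a <= tau <= b -> forall j, j != j0 ->
        0 < complex.Re ((nu j0 - nu j) * expi tau)) ->
     let good (Psi : ucover R -> C R -> 'cV[C R]_n) :=
       (forall omega, Omega omega ->
          solution M (eqn omega) (fun z => Psi z omega)) /\
       asymptotic M Omega
         ((a - pi) / (beta 0%N + 1)) ((b + pi) / (beta 0%N + 1)) delta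
         Psi (psi j0) (E j0) in
     exists Psi,
       [/\ good Psi,
           forall Psi', good Psi' -> forall z omega,
             M < umod z -> Omega omega -> Psi' z omega = Psi z omega
         & uholomorphic M Omega Psi]).
Proof.
move=> eqn0 E0; have [_ oO _] := hOmega.
have oT : open (setT : set (C R)) by exact: openT.
(* The coefficients at a frozen [omega], as constant functions of a dummy parameter. The basis
   property and uniqueness concern each [omega] separately, and a competitor [Psi'] may depend on
   [omega] in any way. *)
pose cs omega k (_ : C R) := c k omega.
pose Rs omega z (_ : C R) := Rm z omega.
have hcs omega k : (1 <= k <= H)%N -> forall o, [set: C R] o -> differentiable (cs omega k) o.
  by move=> _ o _; exact: differentiable_cst.
have hcbs omega : Omega omega -> forall k, (1 <= k <= H)%N ->
    exists B : R, forall o, [set: C R] o -> rnorm (cs omega k o) <= B.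
  by move=> Oo k kH; have [B HB] := hcb k kH; exists B => o _; exact: HB.
have hRs omega : Omega omega -> uholomorphic M setT (Rs omega).
  by move=> Oo; exact: uholomorphic_slice Oo hRm.
have hRsO omega : Omega omega -> forall theta1 theta2 : R, theta1 <= theta2 ->
    uniform_bigO setT theta1 theta2 (fun z o => nrm (Rs omega z o)) (-1 - delta).
  move=> Oo t1 t2 t12; have [K [r0 HK]] := hRmO t1 t2 t12.
  by exists K, r0 => z o _ tz rz; exact: HK.
split=> [a b ab Hab good|a b j0 ab Hab good].
  have sgn j i : signed a b (nu j - nu i).
    apply: signed_of_nonzero => // t tab t0.
    by have [/(_ t0) -> _] := Hab t tab j i; rewrite subrr.
  have sep j j' : complex.Re ((nu j - nu j') * expi a) = 0 -> nu j = nu j'.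
    by move=> z; apply/(Hab a _ j j'); rewrite ?lexx.
  have /choice[Psi HPsi] : forall j, exists f : ucover R -> C R -> 'cV[C R]_n,
      [/\ forall omega, Omega omega -> solution M (eqn0 omega) (fun z => f z omega),
          asymptotic M Omega (a / (beta 0%N + 1)) ((b + pi) / (beta 0%N + 1)) delta f (psi j) (E0 j) &
          uholomorphic M Omega f].
    by move=> j; exact: (sector_exists hnrm hM oO hpsi hA hH hbeta hbetaH hc hcb hdelta hRm hRmO ab (sgn j)).
  exists Psi; split; last 2 first.
  - by move=> j; have [] := HPsi j.
  - move=> Psi' [Hs' Ha'] j z omega Mz Oo.
    have [s a1 _] := HPsi j; have [s' _ _] := Hs' omega Oo.
    apply: (@sector_unique R n nrm M setT A psi nu H beta (cs omega) (Rs omega) delta hnrm hM oT hpsi hA hH hbeta hbetaH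
      (hcs omega) (hcbs omega Oo) hdelta (hRs omega Oo) (hRsO omega Oo) a b
      (fun z => Psi' j z omega) (fun z => Psi j z omega) j omega I ab (sgn j) (fun=> erefl)).
    + exact: (s' j).
    + exact: (s omega Oo).
    + exact: (asymptotic_slice Oo (Ha' j)).
    + exact: (asymptotic_slice Oo a1).
    + exact: Mz.
  split=> [omega Oo|j]; last by have [] := HPsi j.
  apply: (@solutions_basis R n M setT A psi nu H beta (cs omega) (Rs omega) delta hM hpsi hA hH hbeta hbetaH
    (hcs omega) (hcbs omega Oo) hdelta (hRs omega Oo) a b (fun j z => Psi j z omega) omega I ab (fun=> erefl) sep) => j.
    by have [s _ _] := HPsi j; exact: (s omega Oo).
  by have [_ a1 _] := HPsi j; exact: (asymptotic_slice Oo a1).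
have pos i : nu j0 - nu i = 0 \/ forall t, a <= t <= b -> 0 < complex.Re ((nu j0 - nu i) * expi t).
  have [->|ij] := eqVneq i j0; first by left; rewrite subrr.
  by right=> t tab; exact: Hab.
have [Psi [Hs Ha Hh]] := subdominant_exists hnrm hM oO hpsi hA hH hbeta hbetaH hc hcb hdelta hRm hRmO ab pos.
exists Psi; split; [by split| |exact: Hh].
move=> Psi' [Hs' Ha'] z omega Mz Oo.
have posa i : nu j0 - nu i = 0 \/ 0 < complex.Re ((nu j0 - nu i) * expi a).
  by have [?|p] := pos i; [left|right; apply: p; rewrite lexx].
apply: (@subdominant_unique R n nrm M setT A psi nu H beta (cs omega) (Rs omega) delta hnrm hM oT hpsi hA hH hbeta hbetaH
  (hcs omega) (hcbs omega Oo) hdelta (hRs omega Oo) (hRsO omega Oo) a b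
  (fun z => Psi' z omega) (fun z => Psi z omega) j0 omega I ab posa (fun=> erefl)).
- exact: (Hs' omega Oo).
- exact: (Hs omega Oo).
- exact: (asymptotic_slice Oo Ha').
- exact: (asymptotic_slice Oo Ha).
- exact: Mz.
Qed.
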